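(* Assume that the kernel $K$ on $\mathbb R$ is non-negative, integrates to $1$ and has the form $K(t)=\Phi(t^2)$ for some real twice boundedly differentiable even function $\Phi$ with support contained in $[-T,T]$, $T<\infty$. Assume that $G$ is a fourth order kernel on $\mathbb R$ supported by $[-T_G,T_G]$ for some $T_G<\infty$, twice continuously differentiable, symmetric about zero and integrating to $1$. Let $c>0$ and $t_0\ge1$ be constants, let $p:\mathbb R\to\mathbb R$ be a nondecreasing function with $p(s)\ge1$ for all $s$ and $p(s)=s$ for all $s\ge t_0$, having seven bounded and uniformly continuous derivatives, and let $\alpha(x)=c\,p^{1/2}(c^{-2}x)$. Set $h_{1,n}=((\log n)/n)^{1/5}$, $h_{2,n}=h_{4,n}=((\log n)/n)^{1/13}$ and $h_{3,n}=((\log n)/n)^{1/11}$, $n\in\mathbb N$. Let $\hat f(t;h_{1,n},h_{2,n},h_{3,n},h_{4,n})$ be the variable bandwidth density estimator defined in the context from these kernels, bandwidths and function $\alpha$. For $r>0$ put $$\mathcal D_r(f)=\{t\in\mathbb R: f(t)>r>t_0c^2,\ |t|<1/r\},\qquad \hat{\mathcal D}_r^n=\{t\in\mathbb R:\hat f(t;h_{1,n})>2r>t_0c^2,\ |t|<1/r\}.$$ Then, for every $r>0$ and every $C<\infty$, $$\sup_{t\in\mathcal D_r(f)}\left|\hat f(t;h_{1,n},h_{2,n},h_{3,n},h_{4,n})-f(t)\right|=O_{\rm a.s.}\left(\left(\frac{\log n}{n}\right)^{6/13}\right)\quad\text{uniformly in } f\in\mathcal P_{C,6},$$ and $$\sup_{t\in\hat{\mathcal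 D}_r^n}\left|\hat f(t;h_{1,n},h_{2,n},h_{3,n},h_{4,n})-f(t)\right|=O_{\rm a.s.}\left(\left(\frac{\log n}{n}\right)^{6/13}\right)\quad\text{uniformly in } f\in\mathcal P_{C,6}.$$
   Context: $X_1,X_2,\dots$ are i.i.d. real random variables with density $f$, realized as the coordinate functions of $\mathbb R^{\mathbb N}$ under $\Pr_f=(P_f)^{\mathbb N}$, where $dP_f(x)=f(x)dx$. $G$ being a fourth order kernel means $\int G(z)dz=1$, $\int z^jG(z)dz=0$ for $1\le j\le3$, and $\int z^4G(z)dz=a\ne0$. Estimator. Put $\tau_r=\int K(x)|x|^rdx$ for $r>0$, and $$\hat f(x;h_{1,n})=\frac1{nh_{1,n}}\sum_{i=1}^nK\left(\frac{x-X_i}{h_{1,n}}\right),\quad f_{G_1}(x;h_{3,n})=\frac1{nh_{3,n}^2}\sum_{i=1}^nG'\left(\frac{x-X_i}{h_{3,n}}\right),\quad f_{G_2}(x;h_{4,n})=\frac1{nh_{4,n}^3}\sum_{i=1}^nG''\left(\frac{x-X_i}{h_{4,n}}\right).$$ Let $\hat\alpha(x;h_{1,n})=\alpha(\hat f(x;h_{1,n}))$, $$\hat\beta(x;h_{1,n},h_{3,n},h_{4,n})=\frac{\tau_4\left[f_{G_2}(x;h_{4,n})\hat f(x;h_{1,n})-2(f_{G_1}(x;h_{3,n}))^2\right]}{24\,\tau_2\,\hat\alpha^6(x;h_{1,n})},$$ $$\hat\gamma(x)=\hat\gamma(x;h_{1,n},h_{2,n},h_{3,n},h_{4,n})=\frac{\hat\alpha(x;h_{1,n})}{1+h_{2,n}^2\hat\beta(x;h_{1,n},h_{3,n},h_{4,n})}.$$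 Then $$\hat f(t;h_{1,n},h_{2,n},h_{3,n},h_{4,n})=\frac1{nh_{2,n}}\sum_{i=1}^nK\left(\frac{t-X_i}{h_{2,n}}\hat\gamma(X_i)\right)\hat\gamma(X_i).$$ $\mathcal P_{C,k}$ denotes the set of probability densities on $\mathbb R$ such that the density itself and all its derivatives of order $k$ or lower are bounded by $C$ and are uniformly continuous. Uniform almost sure order: given a collection $\mathcal D$ of densities and measurable functions $Z_{n,f}(X_1,\dots,X_n)$, $f\in\mathcal D$, ''$Z_{n,f}=O_{\rm a.s.}(a_n)$ uniformly in $f\in\mathcal D$'' means that there exists a finite constant $M$ such that $$\lim_{k\to\infty}\sup_{f\in\mathcal D}\Pr_f\left\{\sup_{n\ge k}\frac1{a_n}|Z_{n,f}(X_1,\dots,X_n)|>M\right\}=0 .$$ A supremum over an empty set is taken to be $0$. Only large $n$ matter. *)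

(* Defs.v *)
From HB Require Import structures.
From mathcomp Require Import all_boot all_order all_algebra.
From mathcomp Require Import all_classical all_reals all_analysis.
From mathcomp Require Import measurable_realfun.

Set Implicit Arguments.
Unset Strict Implicit.
Unset Printing Implicit Defensive.

Import Order.TTheory GRing.Theory Num.Theory.
Import numFieldNormedType.Exports.

Local Open Scope ring_scope.
Local Open Scope classical_set_scope.

(* Supremum of a set of nonnegative extended reals; the supremum of the empty
   set is 0 (ereal_sup would give -oo). *)
Definition esup0 (R : realType) (A : set (\bar R)) : \bar R :=
  if A == set0 then 0%E else ereal_sup A.

Definition cylinders (R : realType) : set (set (nat -> R)) :=
  [set A | exists i (B : set R), measurable B /\ A = [set X | B (X i)]].

(* R^N with the product sigma-algebra; the coordinate X i stands for the
   observation X_(i+1). *)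
Definition sampleSpace (R : realType) := g_sigma_algebraType (@cylinders R).

Definition sample (R : realType) (n : nat) (X : sampleSpace R) : n.-tuple R :=
  [tuple (X : nat -> R) i | i < n].

Definition is_density (R : realType) (f : R -> R) : Prop :=
  [/\ measurable_fun setT f, forall x, 0 <= f x &
      (\int[lebesgue_measure]_x (f x)%:E = 1)%E].

Definition density_law (R : realType) (f : R -> R) (A : set R) : \bar R :=
  (\int[lebesgue_measure]_(x in A) (f x)%:E)%E.

(* P is the product measure (P_f)^N: by the pi-lambda theorem, its values on the
   finite-dimensional boxes determine it on the product sigma-algebra. *)
Definition is_product_law (R : realType) (f : R -> R)
    (P : probability (sampleSpace R) R) : Prop :=
  forall (n : nat) (A : nat -> set R), (forall i, measurable (A i)) ->
    P [set X | forall i, (i < n)%N -> A i ((X : nat -> R) i)] =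
    (\prod_(i < n) density_law f (A i))%E.

(* f^`(j) is total: it is the j-th derivative only where the lower-order
   derivatives are derivable. *)
Definition differentiable_upto (R : realType) (k : nat) (f : R -> R) : Prop :=
  forall j, (j < k)%N -> forall x, derivable (f^`(j)) x 1.

(* The class P_{C,k}; j = 0 is f itself. *)
Definition smooth_densities (R : realType) (C : R) (k : nat) : set (R -> R) :=
  [set f | [/\ is_density f, differentiable_upto k f &
     forall j, (j <= k)%N ->
       (forall x, `|(f^`(j)) x| <= C) /\ unif_continuous (f^`(j))]].

(* Z n f is a function of (X_1, ..., X_n); its measurability is part of the
   notion. *)
Definition uniform_Oas (R : realType)
    (Pr : (R -> R) -> probability (sampleSpace R) R) (D : set (R -> R))
    (Z : forall n : nat, (R -> R) -> n.-tuple R -> \bar R) (a : nat -> R) : Prop :=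
  (forall n f, D f -> measurable_fun setT (Z n f)) /\
  exists M : R,
    (fun k : nat =>
       esup0 [set Pr f [set X | (M%:E < esup0
                [set ((a n)^-1)%:E * `|Z n f (sample n X)|
                | n in [set n | (k <= n)%N]])%E]
            | f in D]) @ \oo --> 0%E.

Definition is_K_kernel (R : realType) (K Phi : R -> R) (T : R) : Prop :=
  [/\ (forall t, 0 <= K t),
      (\int[lebesgue_measure]_t (K t)%:E = 1)%E,
      (forall t, K t = Phi (t ^+ 2)) &
  [/\ differentiable_upto 2 Phi,
      (forall j, (j <= 2)%N -> exists B : R, forall t, `|(Phi^`(j)) t| <= B),
      (forall t, Phi (- t) = Phi t) &
      closure [set t | Phi t != 0] `<=` `[- T, T] ]].

Definition fourth_order (R : realType) (G : R -> R) : Prop :=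
  [/\ (\int[lebesgue_measure]_z (G z)%:E = 1)%E,
      (forall j, (1 <= j <= 3)%N ->
         (\int[lebesgue_measure]_z (z ^+ j * G z)%:E = 0)%E) &
      exists2 a : R, a != 0 &
        (\int[lebesgue_measure]_z (z ^+ 4 * G z)%:E = a%:E)%E].

Definition is_G_kernel (R : realType) (G : R -> R) (TG : R) : Prop :=
  [/\ fourth_order G,
      closure [set t | G t != 0] `<=` `[- TG, TG],
      differentiable_upto 2 G,
      continuous (G^`(2)) &
      forall t, G (- t) = G t].

Definition is_clipping (R : realType) (t0 : R) (p : R -> R) : Prop :=
  [/\ {homo p : s t / s <= t},
      (forall s, 1 <= p s),
      (forall s, t0 <= s -> p s = s),
      differentiable_upto 7 p &
      forall j, (1 <= j <= 7)%N ->
        (exists B : R, forall s, `|(p^`(j)) s| <= B) /\ unif_continuous (p^`(j))].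

Definition alpha (R : realType) (c : R) (p : R -> R) (x : R) : R :=
  c * Num.sqrt (p (c ^- 2 * x)).

Definition tau (R : realType) (K : R -> R) (r : R) : R :=
  \int[lebesgue_measure]_x (K x * `|x| `^ r).

(* 1 / (n h^m) sum_i L ((x - X_i) / h) *)
Definition kernel_sum (R : realType) (L : R -> R) (m n : nat) (h : R)
    (X : n.-tuple R) (x : R) : R :=
  (n%:R * h ^+ m)^-1 * \sum_(i < n) L ((x - tnth X i) / h).

Definition fhat (R : realType) (K : R -> R) n (h1 : R) (X : n.-tuple R) : R -> R :=
  kernel_sum K 1 h1 X.

Definition fG1 (R : realType) (G : R -> R) n (h3 : R) (X : n.-tuple R) : R -> R :=
  kernel_sum (G^`()) 2 h3 X.

Definition fG2 (R : realType) (G : R -> R) n (h4 : R) (X : n.-tuple R) : R -> R :=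
  kernel_sum (G^`(2)) 3 h4 X.

Definition alpha_hat (R : realType) (K : R -> R) (c : R) (p : R -> R) n
    (h1 : R) (X : n.-tuple R) (x : R) : R :=
  alpha c p (fhat K h1 X x).

Definition beta_hat (R : realType) (K G : R -> R) (c : R) (p : R -> R) n
    (h1 h3 h4 : R) (X : n.-tuple R) (x : R) : R :=
  tau K 4 * (fG2 G h4 X x * fhat K h1 X x - 2 * fG1 G h3 X x ^+ 2)
  / (24 * tau K 2 * alpha_hat K c p h1 X x ^+ 6).

Definition gamma_hat (R : realType) (K G : R -> R) (c : R) (p : R -> R) n
    (h1 h2 h3 h4 : R) (X : n.-tuple R) (x : R) : R :=
  alpha_hat K c p h1 X x / (1 + h2 ^+ 2 * beta_hat K G c p h1 h3 h4 X x).

(* Variable bandwidth estimator: the i-th summand uses gamma_hat at the i-th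
   observation, computed from the same sample.  Here and above x / 0 = 0. *)
Definition fhat_var (R : realType) (K G : R -> R) (c : R) (p : R -> R) n
    (h1 h2 h3 h4 : R) (X : n.-tuple R) (t : R) : R :=
  let g i := gamma_hat K G c p h1 h2 h3 h4 X (tnth X i) in
  (n%:R * h2)^-1 * \sum_(i < n) K ((t - tnth X i) / h2 * g i) * g i.

(* ((log n) / n)^e; it is 0 for n <= 1. *)
Definition log_rate (R : realType) (e : R) (n : nat) : R :=
  (ln (n%:R : R) / n%:R) `^ e.

Definition region (R : realType) (t0 c r : R) (f : R -> R) : set R :=
  [set t | [/\ r < f t, t0 * c ^+ 2 < r & `|t| < r^-1]].

Definition region_hat (R : realType) (K : R -> R) (t0 c r : R) n (h1 : R)
    (X : n.-tuple R) : set R :=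
  [set t | [/\ 2 * r < fhat K h1 X t, t0 * c ^+ 2 < 2 * r & `|t| < r^-1]].

(* Main.v *)
From Pilot Require Import Defs.
From HB Require Import structures.
From mathcomp Require Import all_boot all_order all_algebra.
From mathcomp Require Import all_classical all_reals all_analysis.
From mathcomp Require Import measurable_realfun.
From mathcomp Require Import ring lra zify.

Set Implicit Arguments.
Unset Strict Implicit.
Unset Printing Implicit Defensive.

Import Order.TTheory GRing.Theory Num.Theory.
Import numFieldNormedType.Exports.

Local Open Scope ring_scope.
Local Open Scope classical_set_scope.

(* With h = h_2 = (log n / n)^(1/13), every error has to be O(h^6).

   Off an event of probability O(n^-2), Bernstein's inequality controls two
   families of deviations.  First, at each observation X_i, and conditionally on
   X_i (which is resampled), those of the three pilot kernel sums; the pilot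
   estimators are only ever evaluated at observations, so that no supremum over
   the real line is needed.  Second, those of the empirical distribution on the
   intervals of length O(h) of a grid of mesh 1/n; by Abel summation this bounds
   the deviation of a function of Lipschitz constant Lam supported in a window
   of length O(h) by O(Lam h^8).

   On the complement the argument is deterministic.  With gamma the clipped
   theoretical bandwidth function, sigma = sqrt (f t) and L(z) = (z K(z))',
   gamma_hat - gamma = (f_hat - f) / (2 sigma) + O(h^6) at the observations in the
   window around t, hence the estimator is, up to O(h^6), the sum of the ideal
   estimator built from gamma and of P_n (w (f_hat - f)) / (2 sigma), where
   w(x) = L((t - x) sigma / h) / h.  The deviations of both are handled by Abel
   summation, by Fubini for the expectation of w (f_hat - E f_hat); the
   expectation of w (E f_hat - f) is small because L has integral 0.

   The bias of the ideal estimator is O(h^6): substituting x = t + Z(h u), where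
   Z is given by Lagrange inversion from 1 / gamma, turns it into the integral
   of K(u) B(h u), and the choice of beta cancels the terms of order h^2 and h^4
   of B. *)

(** The rate is one factor h beyond what pointwise bounds give. With eps = log n / n = h^13, the
    pilot error at an observation has bias h_1^2 = h^5.2 and fluctuation sqrt(eps / h_1) = h^5.2. A
    perturbed summand carries 1/h and a fraction O(h) of the observations lies in the window, so
    absolute values would stop at h^5.2: the rest is gained by averaging f_hat - f against w. Terms
    quadratic in f_hat - f are O(h^10), and the derivative estimators, with error O(h^4), only enter
    through h^2 beta. The bound O(Lam h^8) combines O(n h) grid cells, increments Lam / n and
    deviations sqrt(h eps) = h^7 of indicators; it is applied with Lam = O(h^-2). The bias cancels
    because beta = - kappa (1/f)'' with kappa = tau_4 / (24 tau_2). For phi = 1 / gamma, the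
    coefficient of x^2 in f phi^2 = (1 + h^2 beta)^2 is 2 h^2 times that of beta, up to O(h^4), and
    the coefficient of x^4 in f phi^4 is that of 1/f, up to O(h^2); weighted by tau_2 h^2 and tau_4
    h^4, they cancel. *)

Definition box (R : realType) (n : nat) (A : nat -> set R) :
    set (sampleSpace R) :=
  [set X | forall i, (i < n)%N -> A i ((X : nat -> R) i)].

(** A pi-system containing the whole space, on which [is_product_law] prescribes the measure. *)
Definition boxes (R : realType) : set (set (sampleSpace R)) :=
  [set B | exists n (A : nat -> set R),
     (forall i, measurable (A i)) /\ B = box n A].

Definition obs (R : realType) (i : nat) (X : sampleSpace R) : R :=
  (X : nat -> R) i.

(** * Resampling one coordinate *)

Section product_space.
Context (R : realType).
Local Notation S := (sampleSpace R).

Lemma measurable_obs i : measurable_fun setT (@obs R i).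
Proof.
move=> _ B mB; rewrite setTI; apply: sub_sigma_algebra.
by exists i, B.
Qed.

HB.instance Definition _ i :=
  isMeasurableFun.Build _ _ _ _ (@obs R i) (@measurable_obs i).

Lemma measurable_box n (A : nat -> set R) :
  (forall i, measurable (A i)) -> measurable (box n A).
Proof.
move=> mA.
rewrite (_ : box n A = \bigcap_(i in [set i | (i < n)%N]) (@obs R i @^-1` A i)).
  apply: bigcap_measurableType => i _.
  by rewrite -[X in measurable X]setTI; exact: measurable_obs.
by apply/seteqP; split => X.
Qed.

Lemma boxes_generate : (@measurable _ S) = <<s @boxes R >>.
Proof.
apply/seteqP; split.
  apply: smallest_sub; first exact: smallest_sigma_algebra.
  move=> _ [i [B [mB ->]]]; apply: sub_sigma_algebra.
  exists i.+1, (fun j => if j == i then B else setT); split.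
    by move=> j; case: ifP.
  apply/seteqP; split => X /=.
    by move=> BX j _; case: eqP => [->|].
  by move=> /(_ i (ltnSn i)); rewrite eqxx.
apply: smallest_sub; first exact: sigma_algebra_measurable.
by move=> _ [n [A [mA ->]]]; exact: measurable_box.
Qed.

Lemma boxes_setI : setI_closed (@boxes R).
Proof.
move=> _ _ [n [A [mA ->]]] [m [B [mB ->]]].
(* Both boxes are padded with [setT] up to the larger number of coordinates. *)
exists (maxn n m), (fun i => (if (i < n)%N then A i else setT) `&`
  (if (i < m)%N then B i else setT)); split.
  by move=> i; apply: measurableI; case: ifP.
apply/seteqP; split => X /=.
  by move=> [XA XB] i _; split; case: ifP => // /[dup] ? /[dup] *; auto.
move=> h; split => i im.
  by have := h i; rewrite leq_max im => /(_ isT)[].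
by have := h i; rewrite leq_max im orbT => /(_ isT)[_].
Qed.

Definition upd i (x : R) (X : S) : S :=
  (fun j => if j == i then x else (X : nat -> R) j).

Definition resample i (z : R * S) : S := upd i z.1 z.2.

Lemma measurable_resample i : measurable_fun setT (@resample i).
Proof.
apply: (@measurability _ _ _ S setT (@resample i) (@cylinders R)) => //.
move=> _ [_ [j [B [mB ->]]] <-]; rewrite setTI.
have [->|ji] := eqVneq j i.
  rewrite (_ : _ @^-1` _ = fst @^-1` B); last first.
    by apply/seteqP; split => z; rewrite /= /resample/upd eqxx.
  by rewrite -[X in measurable X]setTI; exact: measurable_fst.
rewrite (_ : _ @^-1` _ = snd @^-1` (@obs R j @^-1` B)); last first.
  by apply/seteqP; split => z; rewrite /= /resample/upd/obs (negbTE ji).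
rewrite -[X in measurable X]setTI; apply: measurable_snd => //.
by rewrite -[X in measurable X]setTI; exact: measurable_obs.
Qed.

HB.instance Definition _ i :=
  isMeasurableFun.Build _ _ _ _ (@resample i) (measurable_resample i).


Definition law (P : probability S R) := distribution P (@obs R 0).

HB.instance Definition _ (P : probability S R) :=
  Probability.on (law P).

Context (f : R -> R) (P : probability S R) (fP : is_product_law f P).

Lemma lawE A : measurable A -> law P A = density_law f A.
Proof.
move=> mA; have := fP 1%N (fun=> mA); rewrite big_ord1 => <-.
rewrite /law /distribution /pushforward; congr (P _); apply/seteqP; split => X /=.
  by move=> ? [|].
exact.
Qed.

Lemma law_box n (A : nat -> set R) : (forall i, measurable (A i)) ->
  P (box n A) = (\prod_(i < n) law P (A i))%E.
Proof.
by move=> mA; rewrite fP//; apply: eq_bigr => i _; rewrite lawE.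
Qed.

(** Replacing X_i by an independent copy does not change the law, since both measures agree on
    boxes. Conditioning on X_i thereby becomes an iterated integral, without conditional
    expectations. *)
Lemma resample_law i (A : set S) : measurable A ->
  P A = pushforward (law P \x P)%E (@resample i) A.
Proof.
move: A; apply: (measure_unique (@boxes R) (fun=> setT)).
- exact: boxes_generate.
- exact: boxes_setI.
- move=> _; exists 0%N, (fun=> setT); split => //.
  by apply/seteqP; split => // X _ j.
- by rewrite bigcup_const.
- move=> _ [n [A [mA ->]]].
  rewrite [LHS](law_box n mA) /pushforward.
  (* The constraint on coordinate [i] is now carried by the fresh value, through [B], and the old
     coordinate is free. A box with [n <= i] does not see the coordinate, and [B] is [setT]. *)
  pose A' j := if j == i then setT else A j.
  have mA' j : measurable (A' j) by rewrite /A'; case: ifP.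
  pose B := if (i < n)%N then A i else setT.
  have mB : measurable B by rewrite /B; case: ifP.
  have e : @resample i @^-1` box n A = B `*` box n A'.
    apply/seteqP; split => -[x X] /=.
      move=> h; split; first by rewrite /B; case: ifPn => // /h /=; rewrite /resample/upd/= eqxx.
      move=> j jn; rewrite /A'; have [//|ji] := eqVneq j i.
      by have := h j jn; rewrite /resample/upd/= (negbTE ji).
    move=> [Bx h] j jn; rewrite /resample/upd/=.
    have [ji|ji] := eqVneq j i; first by move: Bx; rewrite /B -ji jn.
    by have := h j jn; rewrite /A' (negbTE ji).
  transitivity ((law P \x P)%E (B `*` box n A')); last first.
    exact: (congr1 (law P \x P)%E (esym e)).
  rewrite [RHS]product_measure1E//; last exact: measurable_box.
  rewrite [X in (_ * X)%E](law_box n mA').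
  have [ilt|ige] := ltnP i n.
    rewrite (bigD1 (Ordinal ilt))//= [in RHS](bigD1 (Ordinal ilt))//=.
    rewrite /B ilt {1}/A' eqxx probability_setT mul1e; congr (_ * _)%E.
    by apply: eq_bigr => j ji; rewrite /A' ifN.
  rewrite /B ltnNge ige/= probability_setT mul1e; apply: eq_bigr => j _.
  by rewrite /A' ifN// ltn_eqF// (leq_trans (ltn_ord j)).
- by move=> _; rewrite [ltLHS](_ : _ = 1%E) ?ltry//; exact: probability_setT.
Qed.

Lemma resample_integral i (g : S -> \bar R) : measurable_fun setT g ->
  (forall X, 0 <= g X)%E ->
  (\int[P]_X g X = \int[law P]_x \int[P]_X g (resample i (x, X)))%E.
Proof.
move=> mg g0; rewrite (eq_measure_integral (pushforward (law P \x P)%E (@resample i))); last first.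
  by move=> A mA _; apply: resample_law.
rewrite ge0_integral_pushforward// preimage_setT.
rewrite fubini_tonelli1//; last by move=> z; exact: g0.
by apply: measurableT_comp => //; exact: measurable_resample.
Qed.

End product_space.

(** * Expectations of bounded measurable functions *)

Definition bounded_measurable d (T : measurableType d) (R : realType)
    (g : T -> R) : Prop :=
  measurable_fun setT g /\ exists M, forall x, `|g x| <= M.

Section measurable_filtered.
Context d (T : measurableType d) (R : realType).

Lemma measurable_sum_cond (I : Type) (r : seq I) (J : pred I) (h : I -> T -> R) :
  (forall i, measurable_fun setT (h i)) ->
  measurable_fun setT (fun x => \sum_(i <- r | J i) h i x).
Proof.
move=> mh; under eq_fun do rewrite big_mkcond.
by apply: measurable_sum => i; case: (J i).
Qed.

Lemma measurable_prod_cond (I : eqType) (r : seq I) (J : pred I) (h : I -> T -> R) :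
  (forall i, measurable_fun setT (h i)) ->
  measurable_fun setT (fun x => \prod_(i <- r | J i) h i x).
Proof.
move=> mh; under eq_fun do rewrite big_mkcond.
by apply: measurable_prod => i _; case: (J i).
Qed.

End measurable_filtered.

Section expectation.
Context d (T : measurableType d) (R : realType) (mu : probability T R).
Local Notation bm := (@bounded_measurable _ T R).
Local Notation E g := (\int[mu]_x g x)%R.

Lemma bm_integrable (g : T -> R) : bm g -> mu.-integrable setT (EFin \o g).
Proof.
move=> [mg [M gM]]; apply: measurable_bounded_integrable => //.
  by rewrite [ltLHS](_ : _ = 1%E) ?ltry//; exact: probability_setT.
by exists M; split; rewrite ?num_real // => y My x _; exact: le_trans (gM x) (ltW My).
Qed.

Lemma bm_cst (c : R) : bm (cst c).
Proof. by split => //; exists `|c|. Qed.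

Lemma bmD g1 g2 : bm g1 -> bm g2 -> bm (fun x => g1 x + g2 x).
Proof.
move=> [m1 [M1 b1]] [m2 [M2 b2]]; split; first exact: measurable_funD.
by exists (M1 + M2) => x; rewrite (le_trans (ler_normD _ _))// lerD.
Qed.

Lemma bmB g1 g2 : bm g1 -> bm g2 -> bm (fun x => g1 x - g2 x).
Proof.
move=> [m1 [M1 b1]] [m2 [M2 b2]]; split; first exact: measurable_funB.
by exists (M1 + M2) => x; rewrite (le_trans (ler_normB _ _))// lerD.
Qed.

Lemma bmM g1 g2 : bm g1 -> bm g2 -> bm (fun x => g1 x * g2 x).
Proof.
move=> [m1 [M1 b1]] [m2 [M2 b2]]; split; first exact: measurable_funM.
by exists (M1 * M2) => x; rewrite normrM ler_pM.
Qed.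

Lemma bmZ (c : R) g : bm g -> bm (fun x => c * g x).
Proof. exact: bmM (bm_cst c). Qed.

Lemma bm_sum (I : Type) (r : seq I) (Q : pred I) (F : I -> T -> R) :
  (forall i, bm (F i)) -> bm (fun x => \sum_(i <- r | Q i) F i x).
Proof.
move=> bF; elim: r => [|a r ih].
  by under eq_fun do rewrite big_nil; exact: bm_cst.
under eq_fun do rewrite big_cons.
by case: (Q a) => //; exact: bmD.
Qed.

Lemma expect_cst (c : R) : E (cst c) = c.
Proof.
rewrite Rintegral_cst// [X in fine X](_ : _ = 1%E) ?mulr1//.
exact: probability_setT.
Qed.

Lemma expectD g1 g2 : bm g1 -> bm g2 ->
  \int[mu]_x (g1 x + g2 x) = E g1 + E g2.
Proof. by move=> b1 b2; rewrite RintegralD//; exact: bm_integrable. Qed.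

Lemma expectB g1 g2 : bm g1 -> bm g2 ->
  \int[mu]_x (g1 x - g2 x) = E g1 - E g2.
Proof. by move=> b1 b2; rewrite RintegralB//; exact: bm_integrable. Qed.

Lemma expectZ (c : R) g : bm g -> \int[mu]_x (c * g x) = c * E g.
Proof. by move=> b; rewrite RintegralZl//; exact: bm_integrable. Qed.

Lemma expect_sum (I : Type) (r : seq I) (F : I -> T -> R) :
  (forall i, bm (F i)) ->
  \int[mu]_x (\sum_(i <- r) F i x) = \sum_(i <- r) E (F i).
Proof.
move=> bF; elim: r => [|a r ih].
  under eq_Rintegral do rewrite big_nil.
  by rewrite big_nil; exact: expect_cst.
under eq_Rintegral do rewrite big_cons.
by rewrite expectD// ?ih ?big_cons//; exact: bm_sum.
Qed.

Lemma expect_le g1 g2 : bm g1 -> bm g2 -> (forall x, g1 x <= g2 x) ->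
  E g1 <= E g2.
Proof. by move=> b1 b2 h; apply: le_Rintegral => //; exact: bm_integrable. Qed.

Lemma expect_norm g (h : T -> R) : bm g -> bm h -> (forall x, `|g x| <= h x) ->
  `|E g| <= E h.
Proof.
move=> bg bh gh; rewrite ler_norml -mulN1r -expectZ//; apply/andP; split.
  apply: expect_le => //; first exact: bmZ.
  by move=> x; rewrite mulN1r; have := gh x; rewrite ler_norml => /andP[].
by apply: expect_le => // x; exact: le_trans (ler_norm _) (gh x).
Qed.

Lemma expect_bound g (M : R) : bm g -> (forall x, `|g x| <= M) -> `|E g| <= M.
Proof.
by move=> bg gM; rewrite -[leRHS]expect_cst; apply: expect_norm => //; exact: bm_cst.
Qed.

Lemma expect_EFin g : bm g -> (\int[mu]_x (g x)%:E)%E = (E g)%:E.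
Proof.
move=> bg; rewrite /Rintegral fineK//.
exact: integrable_fin_num (bm_integrable bg).
Qed.

Lemma bm_indic (A : set T) : measurable A -> bm (\1_A : T -> R).
Proof.
move=> mA; split; first exact: measurable_indic.
by exists 1 => x; rewrite indicE; case: (_ \in _); rewrite ?normr1 ?normr0.
Qed.

Lemma expect_indic (A : set T) : measurable A -> E (\1_A : T -> R) = fine (mu A).
Proof. by move=> mA; rewrite /Rintegral integral_indic// setIT. Qed.

End expectation.

(** Since exp(-y) >= 1 - y, it suffices that (1 + y + 2 y^2)(1 - y) = 1 + y^2 (1 - 2 y) be at least
    1. *)
Lemma expR_le_quadratic (R : realType) (y : R) :
  `|y| <= 2^-1 -> expR y <= 1 + y + 2 * y ^+ 2.
Proof.
rewrite ler_norml => /andP[y1 y2].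
have h := expR_ge1Dx (- y).
have e : expR y * expR (- y) = 1 by rewrite -expRD subrr expR0.
have y2' : y <= 1/2 by lra.
have hp : 0 < expR y by exact: expR_gt0.
rewrite -(ler_pM2r (expR_gt0 (- y))) e.
have h2 : 0 <= 1 + y + 2 * y ^+ 2 by nra.
apply: le_trans (ler_wpM2l h2 h).
have h3 : 0 <= y ^+ 2 * (1 - 2 * y) by rewrite mulr_ge0 ?sqr_ge0//; lra.
by nra.
Qed.

(** * Bernstein's inequality *)

Section bernstein.
Context (R : realType).
Local Notation S := (sampleSpace R).
Context (f : R -> R) (P : probability S R) (fP : is_product_law f P).
Local Notation bm := (@bounded_measurable _ _ _).

Lemma measurable_sum_obs n (J : pred nat) (phi : R -> R) :
  measurable_fun setT phi ->
  measurable_fun setT (fun X : S => \sum_(j < n | J j) phi (obs j X)).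
Proof.
move=> mphi; apply: measurable_sum_cond => j.
by apply: measurableT_comp => //; exact: measurable_obs.
Qed.

(** Induction on [n]: resampling coordinate [n] factors the integral. An index outside [J]
    contributes a factor 1, which [1 <= a] bounds by [a]. *)
Lemma product_expectation_le n (J : pred nat) (psi : R -> R) (a : R) :
  measurable_fun setT psi -> (forall x, 0 <= psi x) -> 1 <= a ->
  (\int[law P]_x (psi x)%:E <= a%:E)%E ->
  (\int[P]_X (\prod_(j < n | J j) psi (obs j X))%:E <= (a ^+ n)%:E)%E.
Proof.
move=> mpsi psi0 a1 psia; elim: n => [|n ih].
  under eq_integral do rewrite big_ord0.
  rewrite integral_cst// expr0 mul1e [leLHS](_ : _ = 1%E)//.
  exact: probability_setT.
have mprod m : measurable_fun setT (fun X : S => \prod_(j < m | J j) psi (obs j X)).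
  by apply: measurable_prod_cond => j; apply: measurableT_comp => //; exact: measurable_obs.
have prod0 m (X : S) : 0 <= \prod_(j < m | J j) psi (obs j X).
  by apply: prodr_ge0 => j _.
pose psi' x := if J n then psi x else 1.
have mpsi' : measurable_fun setT psi' by rewrite /psi'; case: (J n).
have psi'0 x : 0 <= psi' x by rewrite /psi'; case: (J n).
rewrite (resample_integral fP n); last 2 first.
  exact/measurable_EFinP.
  by move=> X; rewrite lee_fin.
have e x : (\int[P]_X (\prod_(j < n.+1 | J j) psi (obs j (resample n (x, X))))%:E =
    (psi' x)%:E * \int[P]_X (\prod_(j < n | J j) psi (obs j X))%:E)%E.
  rewrite -ge0_integralZl//; last 3 first.
    exact/measurable_EFinP.
    by move=> X _; rewrite lee_fin.
    by rewrite lee_fin.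
  apply: eq_integral => X _; rewrite -EFinM; congr (_%:E).
  rewrite big_mkcond big_ord_recr/= mulrC; congr (_ * _).
    by rewrite /psi' /obs /resample /upd/= eqxx.
  rewrite [RHS]big_mkcond/=; apply: eq_bigr => j _.
  by rewrite /obs /resample /upd/= ltn_eqF.
under eq_integral do rewrite e.
rewrite ge0_integralZr//; last 3 first.
  exact/measurable_EFinP.
  by move=> x _; rewrite lee_fin.
  by apply: integral_ge0 => X _; rewrite lee_fin.
rewrite exprS EFinM; apply: lee_pmul => //.
- by apply: integral_ge0 => x _; rewrite lee_fin.
- by apply: integral_ge0 => X _; rewrite lee_fin.
rewrite /psi'; case: (J n) => //.
rewrite integral_cst// mul1e [leLHS](_ : _ = 1%E)//.
exact: probability_setT.
Qed.

Lemma mgf_le (phi : R -> R) (b v lam : R) :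
  measurable_fun setT phi -> (forall x, `|phi x| <= b) ->
  \int[law P]_x phi x = 0 -> \int[law P]_x (phi x ^+ 2) <= v ->
  0 <= lam -> lam * b <= 2^-1 ->
  (\int[law P]_x (expR (lam * phi x))%:E <= (expR (2 * lam ^+ 2 * v))%:E)%E.
Proof.
move=> mphi phib phi0 phiv lam0 lamb.
have bphi : bm phi by split => //; exists b.
have bphi2 : bm (fun x => phi x ^+ 2).
  by under eq_fun do rewrite expr2; exact: bmM.
have bexp : bm (fun x => expR (lam * phi x)).
  split; first by apply: measurableT_comp => //; exact: measurable_funM.
  exists (expR (lam * b)) => x; rewrite ger0_norm ?expR_ge0// ler_expR.
  by rewrite ler_wpM2l// (le_trans (ler_norm _)).
rewrite (expect_EFin _ bexp) lee_fin.
apply: (@le_trans _ _ (\int[law P]_x ((1 + lam * phi x) + (2 * lam ^+ 2) * phi x ^+ 2))).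
  apply: expect_le => //.
    apply: bmD; last exact: bmZ.
    by apply: bmD; [exact: bm_cst|exact: bmZ].
  move=> x; have := @expR_le_quadratic _ (lam * phi x).
  rewrite exprMn mulrA; apply.
  by rewrite normrM ger0_norm// (le_trans _ lamb)// ler_wpM2l.
rewrite expectD; last 2 first.
- by apply: bmD; [exact: bm_cst|exact: bmZ].
- exact: bmZ.
rewrite expectD; last 2 first.
- exact: bm_cst.
- exact: bmZ.
rewrite !expectZ// phi0 mulr0 addr0 expect_cst.
apply: le_trans (expR_ge1Dx _); rewrite lerD2l ler_wpM2l//.
by rewrite mulr_ge0// sqr_ge0.
Qed.

(** [lam] stays free: it will be sqrt(eps / h) rather than the optimal value, which turns both terms
    of the exponent into multiples of log n. *)
Lemma chernoff n (J : pred nat) (phi : R -> R) (b v lam u : R) :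
  measurable_fun setT phi -> (forall x, `|phi x| <= b) ->
  \int[law P]_x phi x = 0 -> \int[law P]_x (phi x ^+ 2) <= v -> 0 <= v ->
  0 <= lam -> lam * b <= 2^-1 ->
  (P [set X | (u <= \sum_(j < n | J j) phi (obs j X))%R] <=
   (expR (2 * n%:R * lam ^+ 2 * v - lam * u))%:E)%E.
Proof.
move=> mphi phib phi0 phiv v0 lam0 lamb.
set A := [set X | _].
have mA : measurable A.
  rewrite (_ : A = (fun X : S => \sum_(j < n | J j) phi (obs j X)) @^-1` `[u, +oo[).
    rewrite -[X in measurable X]setTI; apply: measurable_sum_obs => //.
  by apply/seteqP; split => X /=; rewrite in_itv/= andbT.
have h1 : ((expR (lam * u))%:E * P A <= (expR (2 * lam ^+ 2 * v) ^+ n)%:E)%E.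
  have mexp : measurable_fun setT (fun x => expR (lam * phi x)).
    by apply: measurableT_comp => //; exact: measurable_funM.
  have a1 : 1 <= expR (2 * lam ^+ 2 * v).
    by rewrite -expR0 ler_expR !mulr_ge0// sqr_ge0.
  apply: le_trans (product_expectation_le n J mexp (fun=> expR_ge0 _) a1
    (mgf_le mphi phib phi0 phiv lam0 lamb)).
  have mprod : measurable_fun setT
     (fun X : S => (\prod_(j < n | J j) expR (lam * phi (obs j X)))%:E).
    apply/measurable_EFinP; apply: measurable_prod_cond => j.
    by apply: (measurableT_comp mexp); exact: measurable_obs.
  rewrite -integral_cst//.
  apply: (@le_trans _ _ (\int[P]_(X in A) (\prod_(j < n | J j) expR (lam * phi (obs j X)))%:E)%E).
    apply: ge0_le_integral => //.
    - by move=> X _; rewrite lee_fin expR_ge0.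
    - exact: measurable_funTS.
    - by move=> X AX; rewrite lee_fin -expR_sum ler_expR -mulr_sumr ler_wpM2l.
  apply: ge0_subset_integral => //.
  by move=> X _; rewrite lee_fin prodr_ge0// => j _; exact: expR_ge0.
rewrite -(lee_pmul2l (x := (expR (lam * u))%:E)) ?lte_fin ?expR_gt0//.
rewrite -EFinM -expRD addrC subrK (le_trans h1)// lee_fin.
rewrite -expRM_natl ler_expR le_eqVlt; apply/orP; left; apply/eqP.
by rewrite -mulr_natl; ring.
Qed.

Lemma bernstein n (J : pred nat) (phi : R -> R) (b v lam u : R) :
  measurable_fun setT phi -> (forall x, `|phi x| <= b) ->
  \int[law P]_x phi x = 0 -> \int[law P]_x (phi x ^+ 2) <= v -> 0 <= v ->
  0 <= lam -> lam * b <= 2^-1 ->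
  (P [set X | (u <= `|\sum_(j < n | J j) phi (obs j X)|)%R] <=
   (2 * expR (2 * n%:R * lam ^+ 2 * v - lam * u))%:E)%E.
Proof.
move=> mphi phib phi0 phiv v0 lam0 lamb.
pose A (s : R) := [set X : S | u <= \sum_(j < n | J j) (s * phi (obs j X))].
have mA s : measurable (A s).
  rewrite (_ : A s = (fun X : S => \sum_(j < n | J j) (fun x => s * phi x) (obs j X)) @^-1` `[u, +oo[).
    rewrite -[X in measurable X]setTI; apply: (@measurable_sum_obs n J (fun x => s * phi x)) => //.
    exact: measurable_funM.
  by apply/seteqP; split => X /=; rewrite in_itv/= andbT.
have -> : [set X : S | u <= `|\sum_(j < n | J j) phi (obs j X)|] = A 1 `|` A (-1).
  apply/seteqP; split => X; rewrite /A /= -!mulr_sumr mul1r mulN1r.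
    by rewrite ler_normr => /orP[]; [left|right].
  by rewrite ler_normr => -[->|->//]; rewrite ?orbT.
apply: (le_trans (measureU2 _ (mA _) (mA _))).
rewrite mulr_natl mulr2n EFinD; apply: leeD.
- rewrite (_ : A 1 = [set X : S | u <= \sum_(j < n | J j) phi (obs j X)]).
    exact: chernoff.
  by apply/seteqP; split => X; rewrite /A /= -!mulr_sumr mul1r.
- apply: (@chernoff n J (fun x => -1 * phi x) b) => //.
  + exact: measurable_funM.
  + by move=> x; rewrite mulN1r normrN.
  + by rewrite expectZ ?phi0 ?mulr0//; split => //; exists b.
  + by under eq_Rintegral do rewrite mulN1r sqrrN.
Qed.

(** Once X_i = x is fixed, the other terms are independent and centred functions [q x] of the X_j,
    so that Bernstein's bound holds with the same constants for every x and survives integration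
    over x. The term j = i is a function of X_i alone and has to be left out. *)
Lemma bernstein_resampled n i (q : R -> R -> R) (b v lam u : R) :
  measurable_fun setT (fun z : R * R => q z.1 z.2) ->
  (forall x y, `|q x y| <= b) ->
  (forall x, \int[law P]_y q x y = 0) ->
  (forall x, \int[law P]_y (q x y ^+ 2) <= v) -> 0 <= v ->
  0 <= lam -> lam * b <= 2^-1 ->
  measurable [set X : S | u <= `|\sum_(j < n | j != i :> nat) q (obs i X) (obs j X)|] /\
  (P [set X | (u <= `|\sum_(j < n | j != i :> nat) q (obs i X) (obs j X)|)%R] <=
   (2 * expR (2 * n%:R * lam ^+ 2 * v - lam * u))%:E)%E.
Proof.
move=> mq qb q0 qv v0 lam0 lamb.
set A := [set X | _].
have mA : measurable A.
  rewrite (_ : A = (fun X : S => `|\sum_(j < n | j != i :> nat) q (obs i X) (obs j X)|) @^-1` `[u, +oo[).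
    rewrite -[X in measurable X]setTI.
    apply: (measurableT_comp (@normr_measurable _ _)) => //.
    apply: measurable_sum_cond => j.
    have mp : measurable_fun setT (fun X : S => (obs i X, obs j X)).
      by apply: measurable_fun_pair; exact: measurable_obs.
    exact: (measurableT_comp mq mp).
  by apply/seteqP; split => X /=; rewrite in_itv/= andbT.
split => //.
have h x : (\int[P]_X (\1_A (resample i (x, X)))%:E <=
    (2 * expR (2 * n%:R * lam ^+ 2 * v - lam * u))%:E)%E.
  pose Ax := [set X : S | u <= `|\sum_(j < n | j != i :> nat) q x (obs j X)|].
  have mqx : measurable_fun setT (q x).
    have mp : measurable_fun setT (fun y : R => (x, y)) by exact: measurable_fun_pair.
    exact: (measurableT_comp mq mp).
  have mAx : measurable Ax.
    rewrite (_ : Ax = (fun X : S => `|\sum_(j < n | j != i :> nat) q x (obs j X)|) @^-1` `[u, +oo[).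
      rewrite -[X in measurable X]setTI.
      apply: (measurableT_comp (@normr_measurable _ _)) => //.
      exact: (@measurable_sum_obs n (fun j => j != i)).
    by apply/seteqP; split => X /=; rewrite in_itv/= andbT.
  have e X : \1_A (resample i (x, X)) = \1_Ax X :> R.
    rewrite !indicE.
    have es : \sum_(j < n | j != i :> nat) q x (obs j (resample i (x, X))) =
              \sum_(j < n | j != i :> nat) q x (obs j X).
      by apply: eq_bigr => j /negbTE ji; rewrite /obs /resample /upd/= ji.
    have ei : obs i (resample i (x, X)) = x by rewrite /obs /resample /upd/= eqxx.
    have -> : resample i (x, X) \in A = (X \in Ax) :> bool.
      by apply/idP/idP; rewrite !inE /A /Ax /= ei es.
    by [].
  under eq_integral do rewrite e.
  rewrite integral_indic// setIT.
  exact: (@bernstein n (fun j => j != i) (q x) b).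
rewrite -(setIT A) -integral_indic//.
rewrite (resample_integral fP i); last 2 first.
  apply/measurable_EFinP; exact: measurable_indic.
  by move=> X; rewrite lee_fin indicE ler0n.
apply: (@le_trans _ _ (\int[law P]_x (2 * expR (2 * n%:R * lam ^+ 2 * v - lam * u))%:E)%E).
  apply: ge0_le_integral => //.
  - by move=> x _; apply: integral_ge0 => X _; rewrite lee_fin indicE ler0n.
  - apply: (@measurable_fun_fubini_tonelli_F _ _ _ _ _ P
      (fun z => (\1_A (resample i z))%:E)) => //.
      apply/measurable_EFinP; apply: measurableT_comp; first exact: measurable_indic.
      exact: measurable_resample.
rewrite integral_cst// [X in (_ * X)%E](_ : _ = 1%E) ?mule1//.
exact: probability_setT.
Qed.

End bernstein.

(** * Calculus on segments *)

Section is_derive_lambda.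
Context (R : realType).
Implicit Types (f g : R -> R) (a b c x : R).

Lemma isd_cst c x : is_derive x 1 (fun=> c) 0.
Proof. exact: is_derive_cst. Qed.

Lemma isd_id x : is_derive x 1 (fun y : R => y) 1.
Proof. exact: is_derive_id. Qed.

Lemma isdD f g a b x : is_derive x 1 f a -> is_derive x 1 g b ->
  is_derive x 1 (fun y => f y + g y) (a + b).
Proof. by move=> ? ?; exact: is_deriveD. Qed.

Lemma isdB f g a b x : is_derive x 1 f a -> is_derive x 1 g b ->
  is_derive x 1 (fun y => f y - g y) (a - b).
Proof. by move=> ? ?; exact: is_deriveB. Qed.

Lemma isdM f g a b x : is_derive x 1 f a -> is_derive x 1 g b ->
  is_derive x 1 (fun y => f y * g y) (a * g x + f x * b).
Proof.
move=> df dg; have h := @is_deriveM _ _ f g x 1 _ _ df dg.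
apply: (is_derive_eq h).
by rewrite addrC /GRing.scale/= [g x * a]mulrC.
Qed.

Lemma isd_comp f g a b x : is_derive (g x) 1 f a -> is_derive x 1 g b ->
  is_derive x 1 (fun y => f (g y)) (a * b).
Proof. by move=> df dg; exact: (@is_derive1_comp _ f g). Qed.

Lemma isd_eq f a b x : is_derive x 1 f a -> a = b -> is_derive x 1 f b.
Proof. by move=> ? <-. Qed.

End is_derive_lambda.

Section segment_integral.
Context (R : realType).
Local Notation leb := (@lebesgue_measure R).
Implicit Types (a b c M : R) (g : R -> R).

Definition segint a b g : R := \int[leb]_(x in `[a, b]) g x.

Lemma segment_integrable a b g : continuous g ->
  leb.-integrable `[a, b] (EFin \o g).
Proof.
move=> cg; apply: continuous_compact_integrable; first exact: segment_compact.
exact: continuous_subspaceT.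
Qed.

Lemma segint_EFin a b g : continuous g ->
  (\int[leb]_(x in `[a, b]) (g x)%:E)%E = (segint a b g)%:E.
Proof.
move=> cg; rewrite /segint /Rintegral fineK//.
by apply: integrable_fin_num => //; exact: segment_integrable.
Qed.

Lemma eq_segint a b g1 g2 : (forall x, a <= x <= b -> g1 x = g2 x) ->
  segint a b g1 = segint a b g2.
Proof. by move=> h; apply: eq_Rintegral => x; rewrite inE/= in_itv/= => /h. Qed.

Lemma segintD a b g1 g2 : continuous g1 -> continuous g2 ->
  segint a b (fun x => g1 x + g2 x) = segint a b g1 + segint a b g2.
Proof. by move=> c1 c2; rewrite /segint RintegralD//; exact: segment_integrable. Qed.

Lemma segintB a b g1 g2 : continuous g1 -> continuous g2 ->
  segint a b (fun x => g1 x - g2 x) = segint a b g1 - segint a b g2.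
Proof. by move=> c1 c2; rewrite /segint RintegralB//; exact: segment_integrable. Qed.

Lemma segintZ a b k g : continuous g ->
  segint a b (fun x => k * g x) = k * segint a b g.
Proof. by move=> cg; rewrite /segint RintegralZl//; exact: segment_integrable. Qed.

Lemma segint_cst a b k : a <= b -> segint a b (fun=> k) = k * (b - a).
Proof.
move=> ab; rewrite /segint Rintegral_cst//= lebesgue_measure_itv/= lte_fin.
case: ltP => //= ba.
have -> : a = b by apply/eqP; rewrite eq_le ab.
by rewrite subrr.
Qed.

Lemma segint_le a b g1 g2 : continuous g1 -> continuous g2 ->
  (forall x, a <= x <= b -> g1 x <= g2 x) -> segint a b g1 <= segint a b g2.
Proof.
move=> c1 c2 h; apply: le_Rintegral => //; try exact: segment_integrable.
Qed.

Lemma segint_norm a b g1 g2 : continuous g1 -> continuous g2 ->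
  (forall x, a <= x <= b -> `|g1 x| <= g2 x) ->
  `|segint a b g1| <= segint a b g2.
Proof.
move=> c1 c2 h; rewrite ler_norml -mulN1r -segintZ//; apply/andP; split.
  apply: segint_le => //; first by move=> x; apply: cvgM; [exact: cvg_cst|exact: c2].
  by move=> x /h; rewrite mulN1r ler_norml => /andP[].
by apply: segint_le => // x /h; exact: le_trans (ler_norm _).
Qed.

Lemma segint_bound a b g M : a <= b -> continuous g ->
  (forall x, a <= x <= b -> `|g x| <= M) -> `|segint a b g| <= M * (b - a).
Proof.
move=> ab cg h; rewrite -segint_cst//; apply: segint_norm => //.
by move=> x; exact: cvg_cst.
Qed.

Lemma segint_widen a b a' b' g : a' <= a -> b <= b' ->
  (forall x, ~~ (a <= x <= b) -> g x = 0) -> segint a' b' g = segint a b g.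
Proof.
move=> aa bb g0; rewrite /segint Rintegral_mkcond [RHS]Rintegral_mkcond.
apply: eq_Rintegral => x _; rewrite !patchE.
have e1 : (x \in `[a', b']%classic) = (a' <= x <= b') by rewrite mem_setE in_itv.
have e2 : (x \in `[a, b]%classic) = (a <= x <= b) by rewrite mem_setE in_itv.
rewrite e1 e2; have [h|h] := boolP (a <= x <= b).
  by case/andP: h => h1 h2; rewrite (le_trans aa)//= (le_trans h2).
by case: ifP => // _; exact: g0.
Qed.

Lemma integral_segint a b g : continuous g ->
  (forall x, ~~ (a <= x <= b) -> g x = 0) ->
  (\int[leb]_x (g x)%:E)%E = (segint a b g)%:E.
Proof.
move=> cg g0; rewrite -segint_EFin// [RHS]integral_mkcond.
apply: eq_integral => x _; rewrite patchE.
have e2 : (x \in `[a, b]%classic) = (a <= x <= b) by rewrite mem_setE in_itv.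
by rewrite e2; case: ifPn => // /g0 ->.
Qed.

Lemma is_derive_continuous (F F' : R -> R) :
  (forall x : R, is_derive x 1 F (F' x)) -> continuous F.
Proof.
move=> dF x; apply: differentiable_continuous; apply/derivable1_diffP.
by have [] := dF x.
Qed.

Lemma derive1_eq (F F' : R -> R) : (forall x : R, is_derive x 1 F (F' x)) -> F^`() = F'.
Proof.
by move=> dF; apply/funext => x; rewrite derive1E; have [_] := dF x.
Qed.

Lemma derivable_LR (F F' : R -> R) a b : (forall x : R, is_derive x 1 F (F' x)) ->
  derivable_oo_LRcontinuous F a b.
Proof.
move=> dF; have cF := is_derive_continuous dF; split.
- by move=> x _; have [] := dF x.
- by apply: cvg_at_right_filter; exact: cF.
- by apply: cvg_at_left_filter; exact: cF.
Qed.

Lemma segint_FTC a b (F F' : R -> R) : a <= b ->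
  (forall x : R, is_derive x 1 F (F' x)) -> continuous F' ->
  segint a b F' = F b - F a.
Proof.
rewrite le_eqVlt => /predU1P[->|ab] dF cF'.
  by rewrite /segint set_itv1 Rintegral_set1 subrr.
apply/EFin_inj; rewrite -segint_EFin// EFinB; apply: continuous_FTC2 => //.
- exact: continuous_subspaceT.
- exact: derivable_LR.
- by move=> x _; rewrite (derive1_eq dF).
Qed.

Lemma segint_substitution a b (F F' g : R -> R) : a <= b ->
  (forall x : R, is_derive x 1 F (F' x)) -> continuous F' -> continuous g ->
  (forall x y, a <= x <= b -> a <= y <= b -> x < y -> F x < F y) ->
  segint (F a) (F b) g = segint a b (fun x => g (F x) * F' x).
Proof.
move=> ab dF cF' cg incr.
have cF := is_derive_continuous dF.
apply/EFin_inj; rewrite -!segint_EFin//; last first.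
  move=> x; apply: cvgM; last exact: cF'.
  by apply: (@continuous_comp _ _ _ F g); [exact: cF|exact: cg].
rewrite (integration_by_substitution_increasing (F := F))//.
- by apply: eq_integral => x _; rewrite (derive1_eq dF).
- by rewrite (derive1_eq dF) => x _; exact: cF'.
- rewrite (derive1_eq dF); apply/cvg_ex; exists (F' a).
  by apply: cvg_at_right_filter; exact: cF'.
- rewrite (derive1_eq dF); apply/cvg_ex; exists (F' b).
  by apply: cvg_at_left_filter; exact: cF'.
- exact: derivable_LR.
- exact: continuous_subspaceT.
Qed.

Lemma is_derive_affine (t h x : R) : is_derive x 1 (fun z => t + h * z) h.
Proof.
apply: (isd_eq (isdD (isd_cst t x) (isdM (isd_cst h x) (isd_id x)))).
by rewrite add0r mul0r add0r mulr1.
Qed.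

Lemma segint_affine a b t h g : a <= b -> 0 < h -> continuous g ->
  segint (t + h * a) (t + h * b) g = h * segint a b (fun z => g (t + h * z)).
Proof.
move=> ab h0 cg.
have caf : continuous (fun z : R => g (t + h * z)).
  move=> x; apply: (@continuous_comp _ _ _ (fun z => t + h * z) g); last exact: cg.
  exact: (is_derive_continuous (is_derive_affine t h)).
rewrite (segint_substitution ab (is_derive_affine t h))//.
- by rewrite -segintZ//; apply: eq_segint => x _; rewrite mulrC.
- by move=> x; exact: cvg_cst.
- by move=> x y _ _ xy; rewrite ltrD2l ltr_pM2l.
Qed.

Lemma segint_opp a b g : a <= b -> continuous g ->
  segint (- b) (- a) g = segint a b (fun z => g (- z)).
Proof.
move=> ab cg; apply/EFin_inj; rewrite -!segint_EFin//; last first.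
  move=> x; apply: (@continuous_comp _ _ _ -%R g); last exact: cg.
  exact: opp_continuous.
rewrite integration_by_substitution_oppr//.
exact: continuous_subspaceT.
Qed.

Lemma continuous_measurable g : continuous g -> measurable_fun setT g.
Proof. exact: continuous_measurable_fun. Qed.

Lemma continuous_bm g a b : continuous g ->
  (forall x, ~~ (a <= x <= b) -> g x = 0) -> bounded_measurable g.
Proof.
move=> cg g0; split; first exact: continuous_measurable.
have /compact_bounded[M [_ hM]] : compact (g @` `[a, b]).
  by apply: continuous_compact; [exact: continuous_subspaceT|exact: segment_compact].
exists (`|M| + 1) => x; have [h|h] := boolP (a <= x <= b).
  apply: hM; first by rewrite ltr_pwDr// ler_norm.
  by exists x => //=; rewrite in_itv.
by rewrite g0// normr0 addr_ge0.
Qed.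

End segment_integral.

(** * The law of one observation and its density *)

Section law_density.
Context (R : realType).
Local Notation S := (sampleSpace R).
Local Notation leb := (@lebesgue_measure R).
Context (f : R -> R) (P : probability S R) (fP : is_product_law f P).
Hypothesis fd : is_density f.

(* [R] and [measurableTypeR R] carry the same sigma-algebra under different
   displays; the Lebesgue measure lives on the latter. *)
Let toR (x : R) : measurableTypeR R := x.

Let measurable_toR : measurable_fun setT toR.
Proof. by move=> _ A mA; rewrite setTI. Qed.

#[local] HB.instance Definition _ :=
  isMeasurableFun.Build _ _ _ _ toR measurable_toR.

Let nu := distribution (law P) toR.

Let nu_dominated : nu `<< leb.
Proof.
have [mf f0 _] := fd.
move=> B B0 A mA AB; have A0 := B0 A mA AB.
rewrite [LHS](lawE fP mA); apply: null_set_integral => //.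
exact/measurable_EFinP/measurable_funTS.
Qed.

(** [is_product_law] only gives measures of sets. The Radon-Nikodym derivative of the law has the
    same integral as [f] over every measurable set, hence equals [f] almost everywhere, and the
    formula for functions follows. *)
Lemma law_expect (g : R -> R) : bounded_measurable g ->
  (\int[law P]_x (g x)%:E)%E = (\int[leb]_x (g x * f x)%:E)%E.
Proof.
move=> bg; have [mf f0 f1] := fd; have [mg [M gM]] := bg.
transitivity (\int[nu]_x (g x)%:E)%E.
  rewrite [RHS]integral_distribution//; first exact/measurable_EFinP.
  exact: (bm_integrable (law P) bg).
have ig : nu.-integrable setT (EFin \o g).
  by apply: bm_integrable; split => //; exists M.
rewrite -(Radon_Nikodym_change_of_variables nu_dominated)//.
have nuD : charge_of_finite_measure nu `<< leb := nu_dominated.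
apply: ae_eq_integral => //.
- apply: emeasurable_funM; first exact/measurable_EFinP.
  by apply: measurable_int; exact: (Radon_Nikodym_integrable nuD).
- by apply/measurable_EFinP; exact: measurable_funM.
have -> : (fun x => (g x * f x)%:E) = (fun x => (g x)%:E * (f x)%:E)%E.
  by apply/funext => x; rewrite EFinM.
apply: ae_eqe_mul2l.
apply: integral_ae_eq => //.
- by exact: (Radon_Nikodym_integrable nuD).
- exact/measurable_EFinP.
- move=> A _ mA; rewrite -Radon_Nikodym_integral//.
  exact: (lawE fP mA).
Qed.

Lemma law_segint (g : R -> R) a b : continuous g -> continuous f ->
  (forall x, ~~ (a <= x <= b) -> g x = 0) ->
  \int[law P]_x g x = segint a b (fun x => g x * f x).
Proof.
move=> cg cf g0; rewrite /Rintegral law_expect; last exact: (continuous_bm cg g0).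
rewrite (@integral_segint _ a b)//.
- by move=> x; apply: cvgM; [exact: cg|exact: cf].
- by move=> x /g0 ->; rewrite mul0r.
Qed.

Lemma law_segment_le a b C : a <= b -> continuous f -> (forall x, f x <= C) ->
  fine (law P `[a, b]) <= C * (b - a).
Proof.
move=> ab cf fC; rewrite [law P _](lawE fP)// /density_law.
have [mf f0 f1] := fd.
rewrite segint_EFin//= -segint_cst//; apply: segint_le => //.
by move=> x; exact: cvg_cst.
Qed.

End law_density.

(** * Lipschitz functions, functions of bounded support, Taylor's bound *)

Definition lip (R : realType) (M : R) (g : R -> R) : Prop :=
  forall x y, `|g x - g y| <= M * `|x - y|.

Definition vanishes (R : realType) (A : R) (g : R -> R) : Prop :=
  forall z, A <= `|z| -> g z = 0.

Section calculus.
Context (R : realType).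
Implicit Types (f g F : R -> R) (a b t x y z A M : R).

Lemma mvt F (F' : R -> R) x y : (forall z : R, is_derive z 1 F (F' z)) ->
  exists2 xi, (Num.min x y <= xi <= Num.max x y) & F y - F x = F' xi * (y - x).
Proof.
move=> dF; have cF a b : {within `[a, b], continuous F}.
  exact: continuous_subspaceT (is_derive_continuous dF).
have [xy|yx] := leP x y.
  have [c] := @MVT_segment _ F F' x y xy (fun z _ => dF z) (cF x y).
  by rewrite in_itv/= => h e; exists c.
have [c] := @MVT_segment _ F F' y x (ltW yx) (fun z _ => dF z) (cF y x).
by rewrite in_itv/= => h e; exists c => //; rewrite -[F y - _]opprB e -mulrN opprB.
Qed.

Lemma lip_on_deriv F (F' : R -> R) a b M : (forall z : R, is_derive z 1 F (F' z)) ->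
  (forall z, a <= z <= b -> `|F' z| <= M) ->
  forall x y, a <= x <= b -> a <= y <= b -> `|F x - F y| <= M * `|x - y|.
Proof.
move=> dF bF x y /andP[ax xb] /andP[ay yb].
have [xi /andP[h1 h2] ->] := mvt y x dF.
rewrite normrM ler_wpM2r// bF//; apply/andP; split.
  by apply: le_trans h1; rewrite le_min ax ay.
by apply: (le_trans h2); rewrite ge_max xb yb.
Qed.

Lemma lip_deriv F (F' : R -> R) M : (forall z : R, is_derive z 1 F (F' z)) ->
  (forall z, `|F' z| <= M) -> lip M F.
Proof.
move=> dF bF x y; have [xi _ ->] := mvt y x dF.
by rewrite normrM ler_wpM2r.
Qed.

Lemma lip_continuous M g : lip M g -> continuous g.
Proof.
move=> lg x; apply/cvgrPdist_lt => e e0.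
have M1 : 0 < `|M| + 1 by rewrite ltr_pwDr.
near=> y; rewrite (le_lt_trans (lg x y))//.
apply: (@le_lt_trans _ _ ((`|M| + 1) * `|x - y|)).
  by rewrite ler_wpM2r// (le_trans (ler_norm M))// lerDl.
rewrite mulrC -ltr_pdivlMr//; near: y; apply/nbhs_ballP.
by exists (e / (`|M| + 1)); rewrite /= ?divr_gt0.
Unshelve. all: by end_near. Qed.

Lemma lip_ge0 M g : lip M g -> 0 <= M.
Proof.
move=> /(_ 1 0); rewrite subr0 normr1 mulr1; exact: le_trans.
Qed.

Definition clamp A z : R := if z < - A then - A else if A < z then A else z.

Lemma clamp_lip A x y : 0 <= A -> `|clamp A x - clamp A y| <= `|x - y|.
Proof.
move=> A0; rewrite ler_norml /clamp.
have := ler_norm (x - y); have := ler_norm (- (x - y)); rewrite normrN.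
case: (ltP x (- A)) => ?; case: (ltP y (- A)) => ?; try (case: (ltP A x) => ?);
  try (case: (ltP A y) => ?); move=> ? ?; apply/andP; split; lra.
Qed.

(** [clamp A] is a 1-Lipschitz retraction onto [-A, A], and [g] factors through it because it
    vanishes at the end points as well as outside. *)
Lemma lip_glue A M g : 0 <= A -> vanishes A g ->
  (forall x y, - A <= x <= A -> - A <= y <= A -> `|g x - g y| <= M * `|x - y|) ->
  0 <= M -> lip M g.
Proof.
move=> A0 gA lg M0 x y.
have clA z : - A <= clamp A z <= A.
  by rewrite /clamp; case: (ltP z (- A)) => ?; [|case: (ltP A z) => ?];
    apply/andP; split; lra.
have gcl z : g z = g (clamp A z).
  rewrite /clamp; case: (ltP z (- A)) => h1.
    rewrite gA; last by rewrite ltr0_norm; lra.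
    by rewrite gA// normrN ger0_norm.
  case: (ltP A z) => h2 //.
  rewrite gA; last by rewrite ger0_norm; lra.
  by rewrite gA// ger0_norm.
rewrite (gcl x) (gcl y); apply: le_trans (lg _ _ (clA x) (clA y)) _.
by rewrite ler_wpM2l// clamp_lip.
Qed.

(** The margin 1 provides a neighbourhood of [z] on which [F] is constant. *)
Lemma vanishes_deriv F (F' : R -> R) A : (forall z : R, is_derive z 1 F (F' z)) ->
  vanishes A F -> vanishes (A + 1) F'.
Proof.
move=> dF vF z zA.
have [dz <-] := dF z.
have h : \near z, F z = cst 0 z.
  near=> y; rewrite vF//.
  have : `|z - y| < 1 by near: y; apply/nbhs_ballP; exists 1 => //=.
  have := ler_normD (z - y) y; rewrite subrK; lra.
by rewrite (near_eq_derive _ h)// ?derive_cst// oner_eq0.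
Unshelve. all: by end_near. Qed.

Lemma vanishes_out A g z : vanishes A g -> ~~ (- A <= z <= A) -> g z = 0.
Proof. by move=> vg; rewrite -ler_norml -ltNge => /ltW; exact: vg. Qed.

Lemma vanishes_bounded A g : continuous g -> vanishes A g ->
  exists2 M, 0 <= M & forall z, `|g z| <= M.
Proof.
move=> cg vg.
have [_ [M h]] := continuous_bm cg (fun x => @vanishes_out A g x vg).
by exists M => //; exact: le_trans (h 0).
Qed.

(** Induction on [k]: the derivative in z of the remainder of order k + 1 is the remainder of order
    k of the shifted family, and the mean value theorem supplies one more factor |z|. The factor 1 /
    k! of the sharp bound is given up. *)
Lemma taylor_bound k (g : nat -> R -> R) C t z :
  (forall j, (j < k)%N -> forall x : R, is_derive x 1 (g j) (g j.+1 x)) ->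
  (forall x, `|g k x| <= C) ->
  `|g 0%N (t + z) - \sum_(j < k) g j t / j`!%:R * z ^+ j| <= C * `|z| ^+ k.
Proof.
elim: k g z => [|k ih] g z dg gC.
  by rewrite big_ord0 subr0 expr0 mulr1.
pose F y := g 0%N (t + y) - \sum_(j < k.+1) g j t / j`!%:R * y ^+ j.
pose F' y := g 1%N (t + y) - \sum_(j < k) g j.+1 t / j`!%:R * y ^+ j.
have F'C y : `|F' y| <= C * `|y| ^+ k.
  by apply: (ih (fun j => g j.+1)) => // j jk; exact: dg.
have dS : forall y : R, is_derive y 1
    (fun y => \sum_(j < k.+1) g j t / j`!%:R * y ^+ j)
    (\sum_(j < k) g j.+1 t / j`!%:R * y ^+ j).
  elim: k {ih gC F F' F'C} dg => [|k ih] dg y.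
    rewrite big_ord0 (_ : (fun y => _) = fun=> g 0%N t); first exact: isd_cst.
    by apply/funext => u; rewrite big_ord_recl big_ord0/= fact0 divr1 expr0 mulr1 addr0.
  under eq_fun do rewrite big_ord_recr/=.
  rewrite big_ord_recr/=; apply: isdD; first by apply: ih => j jk; apply: dg; rewrite ltnW.
  have dX : is_derive y 1 (fun y : R => y ^+ k.+1) (k.+1%:R * y ^+ k).
    rewrite (_ : (fun y => _) = (id : R -> R) ^+ k.+1); last first.
      by apply/funext => u; rewrite exprfctE.
    apply: (isd_eq (@is_deriveX _ _ id k.+1 y 1 1 (isd_id y))).
    by rewrite /GRing.scale/= mulr1.
  apply: (isd_eq (isdM (isd_cst _ _) dX)).
  rewrite mul0r add0r mulrA; congr (_ * _).
  rewrite -mulrA; congr (_ * _); rewrite factS natrM invfM mulrAC mulVf ?mul1r//.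
have dF y : is_derive y 1 F (F' y).
  have d1 : is_derive y 1 (fun y : R => t + y) 1.
    by apply: (isd_eq (isdD (isd_cst t y) (isd_id y))); rewrite add0r.
  have d0 : is_derive y 1 (fun y : R => g 0%N (t + y)) (g 1%N (t + y)).
    by apply: (isd_eq (isd_comp (dg 0%N isT (t + y)) d1)); rewrite mulr1.
  exact: isdB d0 (dS y).
have F0 : F 0 = 0.
  rewrite /F addr0 big_ord_recl/= fact0 divr1 expr0 mulr1 big1 ?addr0 ?subrr//.
  by move=> i _; rewrite exprS mul0r mulr0.
have [xi hxi] := mvt 0 z dF.
rewrite F0 !subr0 -/(F z) => ->.
rewrite normrM exprS mulrCA mulrC ler_wpM2l//.
apply: (le_trans (F'C xi)).
have C0 : 0 <= C by exact: le_trans (gC 0).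
rewrite ler_wpM2l// lerXn2r ?nnegrE//.
case/andP: hxi.
by case: (leP 0 z) => ? ? ?; rewrite ler_norml; apply/andP; split;
  have := ler_norm z; have := ler_norm (- z); rewrite normrN; lra.
Qed.

End calculus.

Lemma continuousM_fun (R : realType) (f g : R -> R) :
  continuous f -> continuous g -> continuous (fun x => f x * g x).
Proof. by move=> cf cg x; apply: cvgM; [exact: cf|exact: cg]. Qed.

Lemma continuousB_fun (R : realType) (f g : R -> R) :
  continuous f -> continuous g -> continuous (fun x => f x - g x).
Proof. by move=> cf cg x; apply: cvgB; [exact: cf|exact: cg]. Qed.

Lemma continuousD_fun (R : realType) (f g : R -> R) :
  continuous f -> continuous g -> continuous (fun x => f x + g x).
Proof. by move=> cf cg x; apply: cvgD; [exact: cf|exact: cg]. Qed.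

Lemma continuous_cst (R : realType) (c : R) : continuous (fun _ : R => c).
Proof. by move=> x; exact: cvg_cst. Qed.

Lemma continuous_id (R : realType) : continuous (fun x : R => x).
Proof. by move=> x; exact: cvg_id. Qed.

Lemma continuous_pow (R : realType) k : continuous (fun x : R => x ^+ k).
Proof. by move=> x; exact: exprn_continuous. Qed.

Lemma continuous_compose (R : realType) (f g : R -> R) :
  continuous f -> continuous g -> continuous (fun x => f (g x)).
Proof. by move=> cf cg x; apply: (@continuous_comp _ _ _ g f); [exact: cg|exact: cf]. Qed.

Lemma continuous_affine (R : realType) (t h : R) : continuous (fun z => t + h * z).
Proof. by exact: (is_derive_continuous (is_derive_affine t h)). Qed.

Lemma continuousN_fun (R : realType) (f : R -> R) :
  continuous f -> continuous (fun x => - f x).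
Proof. by move=> cf x; apply: cvgN; exact: cf. Qed.

Ltac cont := repeat first [ assumption | exact: continuous_cst | exact: continuous_id
  | exact: continuous_pow | exact: continuous_affine
  | exact: opp_continuous | apply: continuousN_fun
  | apply: continuousB_fun | apply: continuousD_fun | apply: continuousM_fun ].

(** Besides being (z K(z))', [L] gives the derivative of g -> K(z g) g, namely L(z g): it governs
    the effect of a small change of the bandwidth function. All bounds share one radius and one
    constant. *)
Record kernel_bounds (R : realType) (K K1 L : R -> R) (A M : R) : Prop := {
  kb_A : 1 <= A;
  kb_M : 0 <= M;
  kb_vanishes : vanishes A K;
  kb_ge0 : forall z, 0 <= K z;
  kb_even : forall z, K (- z) = K z;
  kb_mass : segint (- A) A K = 1;
  kb_bound : forall z, `|K z| <= M;
  kb_derive : forall z : R, is_derive z 1 K (K1 z);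
  kb_lip : lip M K;
  kb_lip1 : lip M K1;
  kb_Lderive : forall z : R, is_derive z 1 (fun y : R => y * K y) (L z);
  kb_Lvanishes : vanishes A L;
  kb_Lbound : forall z, `|L z| <= M;
  kb_Llip : lip M L;
  kb_Lmass : segint (- A) A L = 0 }.

Record kernel4_bounds (R : realType) (G : R -> R) (A M : R) : Prop := {
  gb_A : 1 <= A;
  gb_M : 0 <= M;
  gb_vanishes : forall j, (j <= 2)%N -> vanishes A (G^`(j));
  gb_bound : forall j, (j <= 2)%N -> forall z, `|G^`(j) z| <= M;
  gb_continuous : forall j, (j <= 2)%N -> continuous (G^`(j));
  gb_derive : forall j, (j < 2)%N -> forall z : R, is_derive z 1 (G^`(j)) (G^`(j.+1) z);
  gb_moment0 : segint (- A) A G = 1;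
  gb_moment : forall j, (1 <= j <= 3)%N -> segint (- A) A (fun z => z ^+ j * G z) = 0 }.

(** * Kernels and smoothing *)

Section kernels.
Context (R : realType).
Implicit Types (A M C h x z : R).

Lemma is_derive_derive1n (k j : nat) (f : R -> R) : differentiable_upto k f -> (j < k)%N ->
  forall x : R, is_derive x 1 (f^`(j)) (f^`(j.+1) x).
Proof.
move=> df jk x; split; first exact: df.
by rewrite derive1nS derive1E.
Qed.

Lemma vanishes_le A B (g : R -> R) : A <= B -> vanishes A g -> vanishes B g.
Proof. by move=> AB vg z Bz; apply: vg; exact: le_trans Bz. Qed.

Lemma support_vanishes (g : R -> R) (T : R) :
  closure [set t | g t != 0] `<=` `[- T, T] -> vanishes (`|T| + 1) g.
Proof.
move=> h z zT; apply: contrapT => /eqP gz.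
have /h : closure [set t | g t != 0] z by apply: subset_closure.
rewrite /= in_itv/= -ler_norml => h2.
have := ler_norm T; lra.
Qed.

Lemma kernel4_boundsP (G : R -> R) (TG : R) : is_G_kernel G TG ->
  exists A M, kernel4_bounds G A M.
Proof.
move=> [[m0 m13 _] sG dG cG2 _].
have v0 := support_vanishes sG.
set B := `|TG| + 1 in v0.
have B1 : 1 <= B by rewrite lerDr.
have d0 : forall z : R, is_derive z 1 G (G^`() z).
  by move=> z; have := is_derive_derive1n dG (isT : (0 < 2)%N) z.
have d1 : forall z : R, is_derive z 1 (G^`()) (G^`(2) z).
  by move=> z; have := is_derive_derive1n dG (isT : (1 < 2)%N) z.
have v1 := vanishes_deriv d0 v0.
have v2 := vanishes_deriv d1 v1.
have c0 : continuous G := is_derive_continuous d0.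
have c1 : continuous (G^`()) := is_derive_continuous d1.
have [M0 M00 b0] := vanishes_bounded c0 v0.
have [M1 M10 b1] := vanishes_bounded c1 v1.
have [M2 M20 b2] := vanishes_bounded cG2 v2.
have mom j : (\int[lebesgue_measure]_z (z ^+ j * G z)%:E =
    (segint (- (B + 1 + 1)) (B + 1 + 1) (fun z => z ^+ j * G z))%:E)%E.
  apply: integral_segint; first by cont.
  move=> z hz; rewrite (@vanishes_out _ (B + 1 + 1) G)//; first exact: mulr0.
  by apply: vanishes_le v0; lra.
exists (B + 1 + 1), (M0 + M1 + M2); split.
- lra.
- by rewrite !addr_ge0.
- case=> [|[|[|j]]] j2; last by case: (notF j2).
  + by apply: vanishes_le v0; lra.
  + by apply: vanishes_le v1; lra.
  + exact: v2.
- case=> [|[|[|j]]] j2 z; last by case: (notF j2).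
  + by apply: (le_trans (b0 z)); lra.
  + by apply: (le_trans (b1 z)); lra.
  + by apply: (le_trans (b2 z)); lra.
- case=> [|[|[|j]]] j2; last (by case: (notF j2)); [rewrite derive1n0; exact: c0|rewrite derive1n1; exact: c1|exact: cG2].
- by move=> j j2; exact: is_derive_derive1n dG j2.
- apply/EFin_inj; rewrite -m0.
  rewrite -(@integral_segint _ _ _ G)// => z hz; apply: (@vanishes_out _ (B + 1 + 1)) => //.
  by apply: vanishes_le v0; lra.
- by move=> j j13; apply/EFin_inj; rewrite -mom; exact: m13.
Qed.

(** The second derivative of [Phi] is bounded but need not be continuous. The Lipschitz bounds of
    [K1] and [L] therefore come from explicit bounds of their derivatives on [-A, A], extended by
    [lip_glue]; compactness serves for the continuous [K], [K1] and [L]. *)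
Lemma kernel_boundsP (K Phi : R -> R) (T : R) : is_K_kernel K Phi T ->
  exists K1 L A M, kernel_bounds K K1 L A M.
Proof.
move=> [K0 Kint KPhi [dPhi bPhi _ sPhi]].
have dP0 := is_derive_derive1n dPhi (isT : (0 < 2)%N).
have dP1 := is_derive_derive1n dPhi (isT : (1 < 2)%N).
have [B0 hB0] := bPhi 0%N isT.
have [B1 hB1] := bPhi 1%N isT.
have [B2 hB2] := bPhi 2%N isT.
have {}KPhi : K = (fun t => Phi (t ^+ 2)) by apply/funext.
have dsq z : is_derive z 1 (fun t : R => t ^+ 2) (2 * z).
  rewrite (_ : (fun t : R => t ^+ 2) = fun t => t * t); last by apply/funext => t; rewrite expr2.
  by apply: (isd_eq (isdM (isd_id z) (isd_id z))); ring.
pose P1 := Phi^`(1); pose P2 := Phi^`(2).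
have {}dP0 z : is_derive z 1 Phi (P1 z) by have := dP0 z; rewrite derive1n0.
have {}dP1 z : is_derive z 1 P1 (P2 z) by exact: dP1.
pose K1 z := P1 (z ^+ 2) * (2 * z).
have dK z : is_derive z 1 K (K1 z).
  by rewrite KPhi; exact: (@isd_comp _ Phi (fun t => t ^+ 2) _ _ z (dP0 _) (dsq z)).
pose K2 z := (P2 (z ^+ 2) * (2 * z)) * (2 * z) + P1 (z ^+ 2) * 2.
have d2z z : is_derive z 1 (fun t : R => 2 * t) 2.
  by apply: (isd_eq (isdM (isd_cst 2 z) (isd_id z))); ring.
have dK1 z : is_derive z 1 K1 (K2 z).
  exact: (isdM (@isd_comp _ P1 (fun t => t ^+ 2) _ _ z (dP1 _) (dsq z)) (d2z z)).
pose L z := 1 * K z + z * K1 z.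
have dL z : is_derive z 1 (fun y : R => y * K y) (L z) by exact: (isdM (isd_id z) (dK z)).
pose L1 z := (0 * K z + 1 * K1 z) + (1 * K1 z + z * K2 z).
have dL' z : is_derive z 1 L (L1 z).
  apply: isdD; first by exact: (isdM (isd_cst 1 z) (dK z)).
  by exact: (isdM (isd_id z) (dK1 z)).
have v0 : vanishes (`|T| + 1) K.
  move=> z hz; rewrite KPhi; apply: (support_vanishes sPhi).
  (* As |z| >= 1, z^2 >= |z| >= |T| + 1 lies outside the support of [Phi]. *)
  have z1 : 1 <= `|z| by apply: le_trans hz; rewrite lerDr.
  rewrite normrX expr2 (le_trans hz)// ler_peMr//.
set A0 := `|T| + 1 in v0.
have A01 : 1 <= A0 by rewrite lerDr.
have v1 := vanishes_deriv dK v0.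
set A := A0 + 1 in v1.
have vL : vanishes A L.
  move=> z hz; rewrite /L (v1 z hz) (v0 z) ?mulr0 ?addr0//.
  by apply: le_trans hz; rewrite /A; lra.
have A1 : 1 <= A by rewrite /A; lra.
have cK : continuous K := is_derive_continuous dK.
have cK1 : continuous K1 := is_derive_continuous dK1.
have cL : continuous L := is_derive_continuous dL'.
have B10 : 0 <= B1 by exact: le_trans (hB1 0).
have B20 : 0 <= B2 by exact: le_trans (hB2 0).
have vA : vanishes A K by apply: vanishes_le v0; rewrite /A; lra.
have [MK MK0 bK] := vanishes_bounded cK v0.
have [MK1 MK10 bK1] := vanishes_bounded cK1 v1.
have [ML ML0 bL] := vanishes_bounded cL vL.
pose D2 := B2 * (2 * A) * (2 * A) + B1 * 2.
have D20 : 0 <= D2 by rewrite /D2 addr_ge0// !mulr_ge0//; lra.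
have bK2 z : - A <= z <= A -> `|K2 z| <= D2.
  rewrite -ler_norml => zA; rewrite /K2 /D2 (le_trans (ler_normD _ _))// lerD//.
    rewrite !normrM [`|2|]ger0_norm//.
    by rewrite !ler_pM ?mulr_ge0//; try (by apply: hB2); rewrite ?ler_pM2l.
  by rewrite normrM [`|2|]ger0_norm// ler_wpM2r//; exact: hB1.
have lK1 : lip D2 K1.
  apply: (@lip_glue _ A) => //; first lra.
  exact: lip_on_deriv dK1 bK2.
pose D3 := MK1 + MK1 + A * D2.
have D30 : 0 <= D3 by rewrite /D3 !addr_ge0// mulr_ge0//; lra.
have lL : lip D3 L.
  apply: (@lip_glue _ A) => //; first lra.
  apply: (lip_on_deriv dL') => z hz.
  rewrite /L1 mul0r add0r !mul1r addrA /D3.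
  rewrite (le_trans (ler_normD _ _))// lerD//.
    by rewrite (le_trans (ler_normD _ _))// lerD.
  by rewrite normrM ler_pM// ?bK2// ler_norml.
exists K1, L, A, (MK + MK1 + ML + D2 + D3); split => //.
- by do ![apply: addr_ge0 => //].
- by move=> z; rewrite KPhi sqrrN.
- apply/EFin_inj; rewrite -(@integral_segint _ (- A) A K)//.
  by move=> z; exact: vanishes_out.
- by move=> z; apply: (le_trans (bK z)); lra.
- by apply: (lip_deriv dK) => z; apply: (le_trans (bK1 z)); lra.
- by move=> x y; apply: (le_trans (lK1 x y)); rewrite ler_wpM2r//; lra.
- by move=> z; apply: (le_trans (bL z)); lra.
- by move=> x y; apply: (le_trans (lL x y)); rewrite ler_wpM2r//; lra.
- rewrite (segint_FTC _ dL)//; last lra.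
  by rewrite (vA A) ?(vA (- A)) ?mulr0 ?subrr// ?normrN ger0_norm//; lra.
Qed.

End kernels.

Section density_facts.
Context (R : realType).
Implicit Types (f : R -> R) (C : R).

Lemma sd_density f C k : smooth_densities C k f -> is_density f.
Proof. by case. Qed.

Lemma sd_derive f C k j : smooth_densities C k f -> (j < k)%N ->
  forall x : R, is_derive x 1 (f^`(j)) (f^`(j.+1) x).
Proof. by case=> _ df _; exact: is_derive_derive1n. Qed.

Lemma sd_bound f C k j : smooth_densities C k f -> (j <= k)%N ->
  forall x, `|f^`(j) x| <= C.
Proof. by case=> _ _ bf /bf[]. Qed.

Lemma sd_continuous f C k : smooth_densities C k.+1 f -> continuous f.
Proof.
move=> sf; have := is_derive_continuous (sd_derive sf (ltn0Sn k)).
by rewrite derive1n0.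
Qed.

Lemma sd_le f C k : smooth_densities C k f -> forall x, f x <= C.
Proof.
move=> sf x; have := sd_bound sf (leq0n k) x; rewrite derive1n0.
exact: le_trans (ler_norm _).
Qed.

Lemma sd_lip f C k j : smooth_densities C k f -> (j < k)%N -> lip C (f^`(j)).
Proof. by move=> sf jk; exact: lip_deriv (sd_derive sf jk) (sd_bound sf jk). Qed.

End density_facts.

Section smoothing.
Context (R : realType).
Implicit Types (A M C h x z : R) (Q phi : R -> R).

Lemma continuous_subst x h phi : continuous phi -> continuous (fun z => phi (x - h * z)).
Proof.
move=> cphi; apply: continuous_compose => //.
by apply: continuousB_fun; [cont|apply: continuousM_fun; cont].
Qed.

Lemma continuous_scaled x h Q : continuous Q -> continuous (fun y => Q ((x - y) / h)).
Proof.
move=> cQ; apply: continuous_compose => //.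
by apply: continuousM_fun; cont.
Qed.

Lemma segint_kernel_subst Q phi A x h : continuous Q -> continuous phi ->
  0 <= A -> 0 < h ->
  segint (x - h * A) (x + h * A) (fun y => Q ((x - y) / h) * phi y) =
  h * segint (- A) A (fun z => Q z * phi (x - h * z)).
Proof.
move=> cQ cphi A0 h0.
have cp := continuous_subst (x := x) (h := h) cphi.
have AA : - A <= A by lra.
rewrite -mulrN segint_affine//; last first.
  by apply: continuousM_fun => //; exact: continuous_scaled.
congr (_ * _).
have := @segint_opp _ (- A) A (fun z => Q z * phi (x - h * z)) AA (continuousM_fun cQ cp).
rewrite opprK => ->.
apply: eq_segint => z _; rewrite mulrN opprK; congr (Q _ * _).
by rewrite opprD addrA subrr add0r mulNr mulrAC divff ?mul1r// gt_eqF.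
Qed.

Lemma scaled_vanishes Q A x h y : vanishes A Q -> 0 < h ->
  ~~ (x - h * A <= y <= x + h * A) -> Q ((x - y) / h) = 0.
Proof.
move=> vQ h0 hy; apply: vQ; rewrite normrM normfV (gtr0_norm h0) ler_pdivlMr//.
move: hy; rewrite negb_and -!ltNge => /orP[hy|hy].
  by rewrite (le_trans _ (ler_norm _))//; lra.
by rewrite distrC (le_trans _ (ler_norm _))//; lra.
Qed.

Lemma law_kernel (f : R -> R) (P : probability (sampleSpace R) R) Q A x h :
  is_product_law f P -> is_density f -> continuous f -> continuous Q ->
  vanishes A Q -> 0 <= A -> 0 < h ->
  \int[law P]_y Q ((x - y) / h) = h * segint (- A) A (fun z => Q z * f (x - h * z)).
Proof.
move=> fP fd cf cQ vQ A0 h0.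
rewrite (law_segint fP fd (a := x - h * A) (b := x + h * A))//.
- exact: segint_kernel_subst.
- exact: continuous_scaled.
- by move=> y; exact: scaled_vanishes.
Qed.

(** With mass 1 and, by evenness, first moment 0, the kernel reproduces the affine Taylor polynomial
    of [phi 0]. The family [phi] is arbitrary because the estimate is also applied to the difference
    of a density and its translate. *)
Lemma kernel_smoothing K K1 L A M (phi : nat -> R -> R) C x h :
  kernel_bounds K K1 L A M ->
  (forall j, (j < 2)%N -> forall x : R, is_derive x 1 (phi j) (phi j.+1 x)) ->
  (forall x, `|phi 2%N x| <= C) ->
  `|segint (- A) A (fun z => K z * phi 0%N (x - h * z)) - phi 0%N x| <= C * A ^+ 2 * h ^+ 2.
Proof.
move=> kb dphi phiC.
have A1 := kb_A kb.
have AA : - A <= A by lra.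
have cK := is_derive_continuous (kb_derive kb).
have cphi := is_derive_continuous (dphi 0%N isT).
have cs := continuous_subst (x := x) (h := h) cphi.
have C0 : 0 <= C by exact: le_trans (phiC 0).
have odd0 : segint (- A) A (fun z => z * K z) = 0.
  have czK : continuous (fun z => z * K z) by apply: continuousM_fun; cont.
  have : segint (- A) A (fun z => z * K z) = - segint (- A) A (fun z => z * K z).
    have := @segint_opp _ (- A) A (fun z => z * K z) AA czK.
    rewrite opprK => {1}->; rewrite -[RHS]mulN1r -segintZ//.
    by apply: eq_segint => z _; rewrite (kb_even kb); ring.
  lra.
have czK : continuous (fun z => z * K z) by apply: continuousM_fun; cont.
have cphix : continuous (fun z => phi 0%N x * K z) by apply: continuousM_fun; cont.
have cphi1 : continuous (fun z => (- (h * phi 1%N x)) * (z * K z)) by apply: continuousM_fun; cont.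
have cKp : continuous (fun z => K z * phi 0%N (x - h * z)) by apply: continuousM_fun.
have -> : segint (- A) A (fun z => K z * phi 0%N (x - h * z)) - phi 0%N x =
    segint (- A) A (fun z => K z * phi 0%N (x - h * z) - phi 0%N x * K z
      - (- (h * phi 1%N x)) * (z * K z)).
  rewrite segintB//; last exact: continuousB_fun.
  by rewrite segintB// !segintZ// odd0 (kb_mass kb); ring.
apply: (@le_trans _ _ (segint (- A) A (fun z => (C * A ^+ 2 * h ^+ 2) * K z))).
  apply: segint_norm.
  - by apply: continuousB_fun => //; exact: continuousB_fun.
  - by apply: continuousM_fun; cont.
  move=> z; rewrite -ler_norml => zA.
  have -> : K z * phi 0%N (x - h * z) - phi 0%N x * K z - - (h * phi 1%N x) * (z * K z) =
    K z * (phi 0%N (x + - (h * z)) - \sum_(j < 2) phi j x / j`!%:R * (- (h * z)) ^+ j).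
    by rewrite !big_ord_recl big_ord0/= /bump/= !factS fact0; field.
  rewrite normrM (ger0_norm (kb_ge0 kb z)) mulrC ler_wpM2r ?(kb_ge0 kb)//.
  apply: (le_trans (taylor_bound _ _ dphi phiC)).
  have h2 : `|h| ^+ 2 = h ^+ 2 by rewrite real_normK ?num_real.
  rewrite normrN normrM exprMn h2 -mulrA ler_wpM2l// mulrC ler_wpM2r ?sqr_ge0//.
  by rewrite lerXn2r ?nnegrE//; lra.
by rewrite segintZ// (kb_mass kb) mulr1.
Qed.

(** The vanishing moments reproduce the cubic Taylor polynomial. As [G] may change sign, the
    integral of |G| is bounded by [M] times the length 2 A. *)
Lemma kernel4_smoothing G A M (phi : nat -> R -> R) C x h :
  kernel4_bounds G A M ->
  (forall j, (j < 4)%N -> forall x : R, is_derive x 1 (phi j) (phi j.+1 x)) ->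
  (forall x, `|phi 4%N x| <= C) ->
  `|segint (- A) A (fun z => G z * phi 0%N (x - h * z)) - phi 0%N x| <=
  M * C * A ^+ 4 * (2 * A) * h ^+ 4.
Proof.
move=> kb dphi phiC.
have A1 := gb_A kb.
have AA : - A <= A by lra.
have cG : continuous G by have := gb_continuous kb (isT : (0 <= 2)%N); rewrite derive1n0.
have bG : forall z, `|G z| <= M by have := gb_bound kb (isT : (0 <= 2)%N); rewrite derive1n0.
have cphi := is_derive_continuous (dphi 0%N isT).
have cs := continuous_subst (x := x) (h := h) cphi.
have C0 : 0 <= C by exact: le_trans (phiC 0).
pose c1 := - (h * phi 1%N x); pose c2 := h ^+ 2 * phi 2%N x / 2.
pose c3 := - (h ^+ 3 * phi 3%N x / 6).
have cz j : continuous (fun z => z ^+ j * G z) by apply: continuousM_fun; cont.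
have cc (c : R) j : continuous (fun z => c * (z ^+ j * G z)) by apply: continuousM_fun; cont.
have cGp : continuous (fun z => G z * phi 0%N (x - h * z)) by apply: continuousM_fun.
have cp0 : continuous (fun z => phi 0%N x * G z) by apply: continuousM_fun; cont.
have e : segint (- A) A (fun z => G z * phi 0%N (x - h * z)) - phi 0%N x =
    segint (- A) A (fun z => G z * phi 0%N (x - h * z) - phi 0%N x * G z
      - c1 * (z ^+ 1 * G z) - c2 * (z ^+ 2 * G z) - c3 * (z ^+ 3 * G z)).
  rewrite !segintB//; do ?apply: continuousB_fun => //.
  by rewrite !segintZ// !(gb_moment kb)// (gb_moment0 kb); ring.
rewrite e.
apply: (@le_trans _ _ (M * C * A ^+ 4 * h ^+ 4 * (A - - A))); last first.
  by rewrite le_eqVlt; apply/orP; left; apply/eqP; ring.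
apply: segint_bound => //; first by do ?apply: continuousB_fun => //.
move=> z; rewrite -ler_norml => zA.
have -> : G z * phi 0%N (x - h * z) - phi 0%N x * G z
      - c1 * (z ^+ 1 * G z) - c2 * (z ^+ 2 * G z) - c3 * (z ^+ 3 * G z) =
    G z * (phi 0%N (x + - (h * z)) - \sum_(j < 4) phi j x / j`!%:R * (- (h * z)) ^+ j).
  by rewrite !big_ord_recl big_ord0/= /bump/= !factS fact0 /c1 /c2 /c3; field.
have -> : M * C * A ^+ 4 * h ^+ 4 = M * (C * (A ^+ 4 * h ^+ 4)) by ring.
rewrite normrM ler_pM//.
apply: (le_trans (taylor_bound _ _ dphi phiC)).
have h4 : `|h| ^+ 4 = h ^+ 4 by rewrite -normrX ger0_norm// exprn_even_ge0.
rewrite normrN normrM exprMn h4 ler_wpM2l// mulrC ler_wpM2r ?exprn_even_ge0//.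
by rewrite lerXn2r ?nnegrE//; lra.
Qed.

(** Each integration by parts moves a derivative from the kernel to the density and yields one
    factor [h], which cancels one power in the normalization of the derivative estimators. *)
Lemma segint_parts (Q Q1 phi phi1 : R -> R) A x h :
  (forall z : R, is_derive z 1 Q (Q1 z)) -> (forall z : R, is_derive z 1 phi (phi1 z)) ->
  continuous Q1 -> continuous phi1 -> vanishes A Q -> 0 <= A ->
  segint (- A) A (fun z => Q1 z * phi (x - h * z)) =
  h * segint (- A) A (fun z => Q z * phi1 (x - h * z)).
Proof.
move=> dQ dphi cQ1 cphi1 vQ A0.
have cQ := is_derive_continuous dQ.
have cphi := is_derive_continuous dphi.
have cs := continuous_subst (x := x) (h := h) cphi.
have cs1 := continuous_subst (x := x) (h := h) cphi1.
have daff z : is_derive z 1 (fun z => x - h * z) (- h).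
  by apply: (isd_eq (isdB (isd_cst x z) (isdM (isd_cst h z) (isd_id z)))); ring.
have dp z := isdM (dQ z) (@isd_comp _ phi (fun z => x - h * z) _ _ z (dphi _) (daff z)).
have ci1 : continuous (fun z => Q1 z * phi (x - h * z)) by apply: continuousM_fun.
have ci2 : continuous (fun z => Q z * phi1 (x - h * z)) by apply: continuousM_fun.
have AA : - A <= A by lra.
have := segint_FTC AA dp.
rewrite (vQ A) ?(vQ (- A)) ?normrN ?ger0_norm// !mul0r subrr => H.
apply/eqP; rewrite -subr_eq0 -segintZ// -segintB//; last by apply: continuousM_fun; cont.
rewrite -[X in _ == X]H; last first.
  apply: continuousD_fun => //; apply: continuousM_fun => //; apply: continuousM_fun => //.
  exact: continuous_cst.
by apply/eqP; apply: eq_segint => z _; ring.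
Qed.

End smoothing.

(** * Uniform expansions *)

(** The index [s] gathers every parameter (density, point, bandwidth, sample), so that a single
    constant expresses uniformity. *)
Definition bigOh (R : realType) (T : Type) (D : T -> Prop) (h : T -> R) (k : nat)
    (u : T -> R) : Prop :=
  exists2 M, 0 <= M & forall s, D s -> `|u s| <= M * h s ^+ k.

Section bigOh_theory.
Context (R : realType) (T : Type) (D : T -> Prop) (h : T -> R).
Hypothesis h01 : forall s, D s -> 0 <= h s <= 1.
Implicit Types (u w : T -> R) (k : nat).
Local Notation Oh := (bigOh D h).

Let h0 s : D s -> 0 <= h s. Proof. by move=> /h01/andP[]. Qed.

Lemma Oh_ext k u w : (forall s, D s -> u s = w s) -> Oh k u -> Oh k w.
Proof. by move=> uw [M M0 uM]; exists M => // s Ds; rewrite -uw//; exact: uM. Qed.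

Lemma Oh_le j k u : (j <= k)%N -> Oh k u -> Oh j u.
Proof.
move=> jk [M M0 uM]; exists M => // s Ds; apply: (le_trans (uM s Ds)).
rewrite ler_wpM2l//; apply: ler_wiXn2l => //; first exact: h0.
by case/andP: (h01 Ds).
Qed.

Lemma Oh0 k : Oh k (fun=> 0).
Proof. by exists 0 => // s Ds; rewrite normr0 mul0r. Qed.

Lemma OhD k u w : Oh k u -> Oh k w -> Oh k (fun s => u s + w s).
Proof.
move=> [M M0 uM] [N N0 wN]; exists (M + N); first exact: addr_ge0.
move=> s Ds; rewrite mulrDl (le_trans (ler_normD _ _))// lerD//; [exact: uM|exact: wN].
Qed.

Lemma OhN k u : Oh k u -> Oh k (fun s => - u s).
Proof. by move=> [M M0 uM]; exists M => // s Ds; rewrite normrN; exact: uM. Qed.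

Lemma OhB k u w : Oh k u -> Oh k w -> Oh k (fun s => u s - w s).
Proof. by move=> Ou Ow; apply: OhD => //; exact: OhN. Qed.

Lemma OhM j k u w : Oh j u -> Oh k w -> Oh (j + k) (fun s => u s * w s).
Proof.
move=> [M M0 uM] [N N0 wN]; exists (M * N); first exact: mulr_ge0.
move=> s Ds; rewrite normrM exprD mulrACA ler_pM//; [exact: uM|exact: wN].
Qed.

Lemma OhMl k u w : Oh 0 u -> Oh k w -> Oh k (fun s => u s * w s).
Proof. exact: OhM. Qed.

Lemma OhMr k u w : Oh k u -> Oh 0 w -> Oh k (fun s => u s * w s).
Proof. by move=> Ou Ow; have := OhM Ou Ow; rewrite addn0. Qed.

Lemma Oh_cst (c : R) : Oh 0 (fun=> c).
Proof. by exists `|c| => // s _; rewrite expr0 mulr1. Qed.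

Lemma Oh_h k : Oh k (fun s => h s ^+ k).
Proof.
by exists 1 => // s Ds; rewrite mul1r ger0_norm// exprn_ge0// h0.
Qed.

Lemma OhX0 k u : Oh 0 u -> Oh 0 (fun s => u s ^+ k).
Proof.
move=> Ou; elim: k => [|k ih]; first exact: Oh_ext (Oh_cst 1).
by apply: Oh_ext (OhMl Ou ih) => s _; rewrite exprS.
Qed.

Lemma OhX k u : Oh 1 u -> Oh k (fun s => u s ^+ k).
Proof.
move=> Ou; elim: k => [|k ih]; first exact: Oh_ext (Oh_cst 1).
by apply: Oh_ext (OhM Ou ih) => s _; rewrite exprS.
Qed.

End bigOh_theory.

Ltac Ohbounded := repeat first [ assumption | exact: Oh_cst | apply: OhD | apply: OhB
  | apply: OhN | apply: OhMl | apply: OhX0 ].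

Definition pol6 (R : realType) (a0 a1 a2 a3 a4 a5 v : R) : R :=
  a0 + v * (a1 + v * (a2 + v * (a3 + v * (a4 + v * a5)))).

(* [v] is a small quantity (usually O(h)), and the O(h^k) is uniform over [D]. *)
Record jet (R : realType) (T : Type) (D : T -> Prop) (h : T -> R) (k : nat)
    (v U a0 a1 a2 a3 a4 a5 : T -> R) : Prop := {
  jet0 : bigOh D h 0 a0; jet1 : bigOh D h 0 a1; jet2 : bigOh D h 0 a2;
  jet3 : bigOh D h 0 a3; jet4 : bigOh D h 0 a4; jet5 : bigOh D h 0 a5;
  jet_rem : bigOh D h k (fun s =>
    U s - pol6 (a0 s) (a1 s) (a2 s) (a3 s) (a4 s) (a5 s) (v s)) }.

Section jets.
Context (R : realType) (T : Type) (D : T -> Prop) (h : T -> R).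
Hypothesis h01 : forall s, D s -> 0 <= h s <= 1.
Local Notation Oh := (bigOh D h).
Local Notation jet := (jet D h).
Implicit Types (k : nat) (u v w U W : T -> R).

Lemma Oh_pol6 (a0 a1 a2 a3 a4 a5 v : T -> R) : Oh 0 a0 -> Oh 0 a1 -> Oh 0 a2 ->
  Oh 0 a3 -> Oh 0 a4 -> Oh 0 a5 -> Oh 0 v ->
  Oh 0 (fun s => pol6 (a0 s) (a1 s) (a2 s) (a3 s) (a4 s) (a5 s) (v s)).
Proof. by move=> *; rewrite /pol6; Ohbounded. Qed.

Lemma jet_ext k v U U' a0 a1 a2 a3 a4 a5 b0 b1 b2 b3 b4 b5 :
  (forall s, D s -> [/\ U s = U' s, a0 s = b0 s, a1 s = b1 s & a2 s = b2 s] /\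
     [/\ a3 s = b3 s, a4 s = b4 s & a5 s = b5 s]) ->
  jet k v U a0 a1 a2 a3 a4 a5 -> jet k v U' b0 b1 b2 b3 b4 b5.
Proof.
move=> e [ja0 ja1 ja2 ja3 ja4 ja5 jr]; split.
- by apply: Oh_ext ja0 => s /e[[]].
- by apply: Oh_ext ja1 => s /e[[]].
- by apply: Oh_ext ja2 => s /e[[]].
- by apply: Oh_ext ja3 => s /e[_ []].
- by apply: Oh_ext ja4 => s /e[_ []].
- by apply: Oh_ext ja5 => s /e[_ []].
- by apply: Oh_ext jr => s /e[[-> -> -> ->] [-> -> ->]].
Qed.

Lemma jet_bounded k v U a0 a1 a2 a3 a4 a5 : Oh 0 v ->
  jet k v U a0 a1 a2 a3 a4 a5 -> Oh 0 U.
Proof.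
move=> Ov [ja0 ja1 ja2 ja3 ja4 ja5 jr].
apply: Oh_ext (OhD (Oh_pol6 ja0 ja1 ja2 ja3 ja4 ja5 Ov) (Oh_le h01 (leq0n k) jr)) => s _.
by rewrite addrC subrK.
Qed.

Lemma jet_le j k v U a0 a1 a2 a3 a4 a5 : (j <= k)%N ->
  jet k v U a0 a1 a2 a3 a4 a5 -> jet j v U a0 a1 a2 a3 a4 a5.
Proof. by move=> jk [ja0 ja1 ja2 ja3 ja4 ja5 jr]; split => //; exact: Oh_le jr. Qed.

Lemma jet_mul k v U W a0 a1 a2 a3 a4 a5 b0 b1 b2 b3 b4 b5 : (k <= 6)%N -> Oh 1 v ->
  jet k v U a0 a1 a2 a3 a4 a5 -> jet k v W b0 b1 b2 b3 b4 b5 ->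
  jet k v (fun s => U s * W s)
    (fun s => a0 s * b0 s)
    (fun s => a0 s * b1 s + a1 s * b0 s)
    (fun s => a0 s * b2 s + a1 s * b1 s + a2 s * b0 s)
    (fun s => a0 s * b3 s + a1 s * b2 s + a2 s * b1 s + a3 s * b0 s)
    (fun s => a0 s * b4 s + a1 s * b3 s + a2 s * b2 s + a3 s * b1 s + a4 s * b0 s)
    (fun s => a0 s * b5 s + a1 s * b4 s + a2 s * b3 s + a3 s * b2 s + a4 s * b1 s
              + a5 s * b0 s).
Proof.
move=> k6 Ov jU jW; have Ov0 := Oh_le h01 (leq0n 1) Ov.
have OW := jet_bounded Ov0 jW.
case: jU => ja0 ja1 ja2 ja3 ja4 ja5 jra; case: jW => jb0 jb1 jb2 jb3 jb4 jb5 jrb.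
split; try by Ohbounded.
have Oa := Oh_pol6 ja0 ja1 ja2 ja3 ja4 ja5 Ov0.
(* The part of degree 6 to 10 of the product, divided by v^6; it is absorbed because v^6 =
   O(h^6). *)
pose rem s := pol6
  (a1 s * b5 s + a2 s * b4 s + a3 s * b3 s + a4 s * b2 s + a5 s * b1 s)
  (a2 s * b5 s + a3 s * b4 s + a4 s * b3 s + a5 s * b2 s)
  (a3 s * b5 s + a4 s * b4 s + a5 s * b3 s)
  (a4 s * b5 s + a5 s * b4 s) (a5 s * b5 s) 0 (v s).
have Orem : Oh 0 rem by apply: Oh_pol6; Ohbounded.
have O6 := Oh_le h01 k6 (OhMr (OhX 6 Ov) Orem).
apply: Oh_ext (OhD (OhD (OhMr jra OW) (OhMl Oa jrb)) O6) => s _.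
rewrite /rem /pol6; ring.
Qed.

Lemma jet_add k v U W a0 a1 a2 a3 a4 a5 b0 b1 b2 b3 b4 b5 :
  jet k v U a0 a1 a2 a3 a4 a5 -> jet k v W b0 b1 b2 b3 b4 b5 ->
  jet k v (fun s => U s + W s)
    (fun s => a0 s + b0 s) (fun s => a1 s + b1 s) (fun s => a2 s + b2 s)
    (fun s => a3 s + b3 s) (fun s => a4 s + b4 s) (fun s => a5 s + b5 s).
Proof.
move=> [ja0 ja1 ja2 ja3 ja4 ja5 jra] [jb0 jb1 jb2 jb3 jb4 jb5 jrb].
split; try by Ohbounded.
by apply: Oh_ext (OhD jra jrb) => s _; rewrite /pol6; ring.
Qed.

Lemma jet_scale j k v c U a0 a1 a2 a3 a4 a5 : Oh j c ->
  jet k v U a0 a1 a2 a3 a4 a5 ->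
  jet (j + k) v (fun s => c s * U s) (fun s => c s * a0 s) (fun s => c s * a1 s)
    (fun s => c s * a2 s) (fun s => c s * a3 s) (fun s => c s * a4 s)
    (fun s => c s * a5 s).
Proof.
move=> Oc [ja0 ja1 ja2 ja3 ja4 ja5 jra].
have Oc0 := Oh_le h01 (leq0n j) Oc.
split; try by Ohbounded.
by apply: Oh_ext (OhM Oc jra) => s _; rewrite /pol6; ring.
Qed.

Lemma jet_cst k v (c : T -> R) : Oh 0 c ->
  jet k v c c (fun=> 0) (fun=> 0) (fun=> 0) (fun=> 0) (fun=> 0).
Proof.
move=> Oc; split => //; try exact: Oh_cst.
by apply: Oh_ext (Oh0 D h k) => s _; rewrite /pol6; ring.
Qed.

Lemma jet_near k v U W a0 a1 a2 a3 a4 a5 : jet k v W a0 a1 a2 a3 a4 a5 ->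
  Oh k (fun s => U s - W s) -> jet k v U a0 a1 a2 a3 a4 a5.
Proof.
move=> [ja0 ja1 ja2 ja3 ja4 ja5 jra] UW; split => //.
by apply: Oh_ext (OhD UW jra) => s _; rewrite addrA subrK.
Qed.

Lemma jet_trunc4 k v U a0 a1 a2 a3 a4 a5 : (k <= 4)%N -> Oh 1 v ->
  jet k v U a0 a1 a2 a3 a4 a5 -> jet k v U a0 a1 a2 a3 (fun=> 0) (fun=> 0).
Proof.
move=> k4 Ov [ja0 ja1 ja2 ja3 ja4 ja5 jra]; have Ov0 := Oh_le h01 (leq0n 1) Ov.
split => //; try exact: Oh_cst.
have O4 : Oh 4 (fun s => v s ^+ 4 * (a4 s + v s * a5 s)).
  by apply: OhMr; [exact: OhX|Ohbounded].
by apply: Oh_ext (OhD jra (Oh_le h01 k4 O4)) => s _; rewrite /pol6; ring.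
Qed.

Lemma jet_comp v y U a0 a1 a2 a3 a4 a5 A0 A1 A2 A3 A4 : Oh 1 y ->
  jet 6 y v (fun=> 0) A0 A1 A2 A3 A4 -> jet 6 v U a0 a1 a2 a3 a4 a5 ->
  jet 6 y U a0 (fun s => a1 s * A0 s)
    (fun s => a1 s * A1 s + a2 s * A0 s ^+ 2)
    (fun s => a1 s * A2 s + a2 s * (2 * A0 s * A1 s) + a3 s * A0 s ^+ 3)
    (fun s => a1 s * A3 s + a2 s * (2 * A0 s * A2 s + A1 s ^+ 2)
      + a3 s * (3 * A0 s ^+ 2 * A1 s) + a4 s * A0 s ^+ 4)
    (fun s => a1 s * A4 s + a2 s * (2 * A0 s * A3 s + 2 * A1 s * A2 s)
      + a3 s * (3 * A0 s ^+ 2 * A2 s + 3 * A0 s * A1 s ^+ 2)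
      + a4 s * (4 * A0 s ^+ 3 * A1 s) + a5 s * A0 s ^+ 5).
Proof.
move=> Oy jv [ja0 ja1 ja2 ja3 ja4 ja5 jra].
have H c (Oc : Oh 0 c) := jet_cst 6 y Oc.
(* One Horner step: the composition iterates W -> c + v W, starting from the top coefficient of the
   jet of [U]. *)
have lift W b0 b1 b2 b3 b4 b5 c : Oh 0 c -> jet 6 y W b0 b1 b2 b3 b4 b5 ->
   jet 6 y (fun s => c s + v s * W s) _ _ _ _ _ _ :=
   fun Oc jW => jet_add (H c Oc) (jet_mul (leqnn 6) Oy jv jW).
have := lift _ _ _ _ _ _ _ a0 ja0 (lift _ _ _ _ _ _ _ a1 ja1 (lift _ _ _ _ _ _ _ a2 ja2
  (lift _ _ _ _ _ _ _ a3 ja3 (lift _ _ _ _ _ _ _ a4 ja4 (H a5 ja5))))).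
set V := (fun s => a0 s + _) => jV.
by apply: jet_ext (jet_near jV jra) => s Ds; split; split => //; ring.
Qed.

(** 1/U - B = (1 - U B) / U, where the identities between coefficients say that U B = 1 + O(h^k),
    and [U] is bounded away from 0. *)
Lemma jet_inv k v U c a0 a1 a2 a3 a4 a5 b0 b1 b2 b3 b4 b5 : (k <= 6)%N -> Oh 1 v ->
  0 < c -> (forall s, D s -> c <= U s) ->
  jet k v U a0 a1 a2 a3 a4 a5 ->
  [/\ Oh 0 b0, Oh 0 b1, Oh 0 b2, Oh 0 b3 & Oh 0 b4] -> Oh 0 b5 ->
  (forall s, D s -> [/\ a0 s * b0 s = 1, a0 s * b1 s + a1 s * b0 s = 0 &
     a0 s * b2 s + a1 s * b1 s + a2 s * b0 s = 0]
   /\ [/\ a0 s * b3 s + a1 s * b2 s + a2 s * b1 s + a3 s * b0 s = 0,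
    a0 s * b4 s + a1 s * b3 s + a2 s * b2 s + a3 s * b1 s + a4 s * b0 s = 0 &
    a0 s * b5 s + a1 s * b4 s + a2 s * b3 s + a3 s * b2 s + a4 s * b1 s
              + a5 s * b0 s = 0]) ->
  jet k v (fun s => (U s)^-1) b0 b1 b2 b3 b4 b5.
Proof.
move=> k6 Ov c0 cU jU [ob0 ob1 ob2 ob3 ob4] ob5 e; split => //.
pose B s := pol6 (b0 s) (b1 s) (b2 s) (b3 s) (b4 s) (b5 s) (v s).
have jB : jet k v B b0 b1 b2 b3 b4 b5.
  by split => //; apply: Oh_ext (Oh0 D h k) => s _; rewrite /B subrr.
have [_ _ _ _ _ _ jr] := jet_mul k6 Ov jU jB.
have OiU : Oh 0 (fun s => (U s)^-1).
  exists c^-1; first by rewrite invr_ge0 ltW.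
  move=> s Ds; have U0 : 0 < U s by exact: lt_le_trans (cU s Ds).
  by rewrite expr0 mulr1 normfV gtr0_norm// lef_pV2// ?posrE// cU.
apply: Oh_ext (OhMl OiU (OhN jr)) => s Ds.
have U0 : U s != 0 by rewrite gt_eqF// (lt_le_trans c0)// cU.
have [[-> -> ->] [-> -> ->]] := e s Ds.
by rewrite -/(B s) /pol6; field.
Qed.

(** S - B = (U - B^2) / (S + B). The sign condition on the polynomial selects the right root and
    keeps S + B at least [c]. *)
Lemma jet_sqrt v U S c a0 a1 a2 a3 a4 a5 b0 b1 b2 b3 b4 b5 : Oh 1 v -> 0 < c ->
  (forall s, D s -> c <= S s) -> (forall s, D s -> S s ^+ 2 = U s) ->
  (forall s, D s -> 0 <= pol6 (b0 s) (b1 s) (b2 s) (b3 s) (b4 s) (b5 s) (v s)) ->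
  jet 6 v U a0 a1 a2 a3 a4 a5 ->
  [/\ Oh 0 b0, Oh 0 b1, Oh 0 b2, Oh 0 b3 & Oh 0 b4] -> Oh 0 b5 ->
  (forall s, D s -> [/\ b0 s * b0 s = a0 s, b0 s * b1 s + b1 s * b0 s = a1 s &
     b0 s * b2 s + b1 s * b1 s + b2 s * b0 s = a2 s]
   /\ [/\ b0 s * b3 s + b1 s * b2 s + b2 s * b1 s + b3 s * b0 s = a3 s,
    b0 s * b4 s + b1 s * b3 s + b2 s * b2 s + b3 s * b1 s + b4 s * b0 s = a4 s &
    b0 s * b5 s + b1 s * b4 s + b2 s * b3 s + b3 s * b2 s + b4 s * b1 s
              + b5 s * b0 s = a5 s]) ->
  jet 6 v S b0 b1 b2 b3 b4 b5.
Proof.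
move=> Ov c0 cS SU B0 jU [ob0 ob1 ob2 ob3 ob4] ob5 e; split => //.
pose B s := pol6 (b0 s) (b1 s) (b2 s) (b3 s) (b4 s) (b5 s) (v s).
have jB : jet 6 v B b0 b1 b2 b3 b4 b5.
  by split => //; apply: Oh_ext (Oh0 D h 6) => s _; rewrite /B subrr.
have [_ _ _ _ _ _ jr] := jet_mul (leqnn 6) Ov jB jB.
have [_ _ _ _ _ _ jrU] := jU.
have OiU : Oh 0 (fun s => (S s + B s)^-1).
  exists c^-1; first by rewrite invr_ge0 ltW.
  move=> s Ds; have S0 : c <= S s + B s by rewrite ler_wpDr// ?B0// cS.
  have SB0 : 0 < S s + B s by exact: lt_le_trans S0.
  by rewrite expr0 mulr1 normfV gtr0_norm// lef_pV2.
apply: Oh_ext (OhMl OiU (OhB jrU jr)) => s Ds.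
have S0 : S s + B s != 0 by rewrite gt_eqF// (lt_le_trans c0)// ler_wpDr// ?B0// cS.
have [[-> -> ->] [-> -> ->]] := e s Ds.
by rewrite -SU// -/(B s); field.
Qed.

End jets.

Section bigOh_congruence.
Context (R : realType) (T : Type) (D : T -> Prop) (h : T -> R).
Hypothesis h01 : forall s, D s -> 0 <= h s <= 1.
Local Notation Oh := (bigOh D h).
Implicit Types (u w : T -> R).

Lemma Oh_congD k u w u' w' : Oh k (fun s => u s - w s) ->
  Oh k (fun s => u' s - w' s) -> Oh k (fun s => (u s + u' s) - (w s + w' s)).
Proof. by move=> O1 O2; apply: Oh_ext (OhD O1 O2) => s _; ring. Qed.

Lemma Oh_congM k u w u' w' : Oh 0 u' -> Oh 0 w -> Oh k (fun s => u s - w s) ->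
  Oh k (fun s => u' s - w' s) -> Oh k (fun s => (u s * u' s) - (w s * w' s)).
Proof.
move=> bu' bw O1 O2.
by apply: Oh_ext (OhD (OhMr O1 bu') (OhMl bw O2)) => s _; ring.
Qed.

Lemma Oh_congX k u w n : Oh 0 u -> Oh 0 w -> Oh k (fun s => u s - w s) ->
  Oh k (fun s => u s ^+ n - w s ^+ n).
Proof.
move=> bu bw O1; elim: n => [|n ih].
  by apply: Oh_ext (Oh0 D h k) => s _; rewrite !expr0 subrr.
by apply: Oh_ext (Oh_congM (OhX0 n bu) bw O1 ih) => s _; rewrite !exprS.
Qed.

Lemma Oh_cong_refl k u : Oh k (fun s => u s - u s).
Proof. by apply: Oh_ext (Oh0 D h k) => s _; rewrite subrr. Qed.

End bigOh_congruence.

(* With [phi = sum phi_k x^k] and [f = sum f_k x^k], let [Z = y A(y)] solve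
   [Z = y phi(Z)] modulo y^7 (Lagrange inversion); then
   [A B = f(Z) Z'] modulo y^6 where the coefficient [B_k] is that of [x^k] in
   [f phi^k]. *)
(** * Lagrange inversion *)

Section lagrange.
Context (R : realType).
Implicit Types (a f x : R).

Definition lagr1 x0 x1 : R := x1 * x0.
Definition lagr2 x0 x1 x2 : R := x1 * lagr1 x0 x1 + x2 * x0 ^+ 2.
Definition lagr3 x0 x1 x2 x3 : R :=
  x1 * lagr2 x0 x1 x2 + x2 * (2 * x0 * lagr1 x0 x1) + x3 * x0 ^+ 3.
Definition lagr4 x0 x1 x2 x3 x4 : R :=
  x1 * lagr3 x0 x1 x2 x3 + x2 * (2 * x0 * lagr2 x0 x1 x2 + lagr1 x0 x1 ^+ 2)
  + x3 * (3 * x0 ^+ 2 * lagr1 x0 x1) + x4 * x0 ^+ 4.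
Definition lagr5 x0 x1 x2 x3 x4 x5 : R :=
  x1 * lagr4 x0 x1 x2 x3 x4
  + x2 * (2 * x0 * lagr3 x0 x1 x2 x3 + 2 * lagr1 x0 x1 * lagr2 x0 x1 x2)
  + x3 * (3 * x0 ^+ 2 * lagr2 x0 x1 x2 + 3 * x0 * lagr1 x0 x1 ^+ 2)
  + x4 * (4 * x0 ^+ 3 * lagr1 x0 x1) + x5 * x0 ^+ 5.

Definition burm1 f0 f1 x0 x1 : R := f0 * x1 + f1 * x0.
Definition burm2 f0 f1 f2 x0 x1 x2 : R :=
  f0 * (2 * x0 * x2 + x1 ^+ 2) + f1 * (2 * x0 * x1) + f2 * x0 ^+ 2.
Definition burm3 f0 f1 f2 f3 x0 x1 x2 x3 : R :=
  f0 * (3 * x0 ^+ 2 * x3 + 6 * x0 * x1 * x2 + x1 ^+ 3)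
  + f1 * (3 * x0 ^+ 2 * x2 + 3 * x0 * x1 ^+ 2) + f2 * (3 * x0 ^+ 2 * x1)
  + f3 * x0 ^+ 3.
Definition burm4 f0 f1 f2 f3 f4 x0 x1 x2 x3 x4 : R :=
  f0 * (4 * x0 ^+ 3 * x4 + 12 * x0 ^+ 2 * x1 * x3 + 6 * x0 ^+ 2 * x2 ^+ 2
        + 12 * x0 * x1 ^+ 2 * x2 + x1 ^+ 4)
  + f1 * (4 * x0 ^+ 3 * x3 + 12 * x0 ^+ 2 * x1 * x2 + 4 * x0 * x1 ^+ 3)
  + f2 * (4 * x0 ^+ 3 * x2 + 6 * x0 ^+ 2 * x1 ^+ 2)
  + f3 * (4 * x0 ^+ 3 * x1) + f4 * x0 ^+ 4.
Definition burm5 f0 f1 f2 f3 f4 f5 x0 x1 x2 x3 x4 x5 : R :=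
  f0 * (5 * x0 ^+ 4 * x5 + 20 * x0 ^+ 3 * x1 * x4 + 20 * x0 ^+ 3 * x2 * x3
        + 30 * x0 ^+ 2 * x1 ^+ 2 * x3 + 30 * x0 ^+ 2 * x1 * x2 ^+ 2
        + 20 * x0 * x1 ^+ 3 * x2 + x1 ^+ 5)
  + f1 * (5 * x0 ^+ 4 * x4 + 20 * x0 ^+ 3 * x1 * x3 + 10 * x0 ^+ 3 * x2 ^+ 2
          + 30 * x0 ^+ 2 * x1 ^+ 2 * x2 + 5 * x0 * x1 ^+ 4)
  + f2 * (5 * x0 ^+ 4 * x3 + 20 * x0 ^+ 3 * x1 * x2 + 10 * x0 ^+ 2 * x1 ^+ 3)
  + f3 * (5 * x0 ^+ 4 * x2 + 10 * x0 ^+ 3 * x1 ^+ 2)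
  + f4 * (5 * x0 ^+ 4 * x1) + f5 * x0 ^+ 5.

(** The coefficients of degree 0 to 5 of f(Z) Z' = A B, where the [g_k] are those of f(Z) and the (k
    + 1) A_k those of Z'. When phi = 1 / gamma, A is 1 / gamma(t + Z), so that B is the factor gamma
    f Z' which the substitution leaves beside the kernel. *)
Lemma burmann f0 f1 f2 f3 f4 f5 x0 x1 x2 x3 x4 x5
  (A0 := x0) (A1 := lagr1 x0 x1) (A2 := lagr2 x0 x1 x2) (A3 := lagr3 x0 x1 x2 x3)
  (A4 := lagr4 x0 x1 x2 x3 x4) (A5 := lagr5 x0 x1 x2 x3 x4 x5)
  (g0 := f0) (g1 := f1 * A0) (g2 := f1 * A1 + f2 * A0 ^+ 2)
  (g3 := f1 * A2 + f2 * (2 * A0 * A1) + f3 * A0 ^+ 3)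
  (g4 := f1 * A3 + f2 * (2 * A0 * A2 + A1 ^+ 2) + f3 * (3 * A0 ^+ 2 * A1) + f4 * A0 ^+ 4)
  (g5 := f1 * A4 + f2 * (2 * A0 * A3 + 2 * A1 * A2)
      + f3 * (3 * A0 ^+ 2 * A2 + 3 * A0 * A1 ^+ 2) + f4 * (4 * A0 ^+ 3 * A1) + f5 * A0 ^+ 5)
  (B0 := f0) (B1 := burm1 f0 f1 x0 x1) (B2 := burm2 f0 f1 f2 x0 x1 x2)
  (B3 := burm3 f0 f1 f2 f3 x0 x1 x2 x3) (B4 := burm4 f0 f1 f2 f3 f4 x0 x1 x2 x3 x4)
  (B5 := burm5 f0 f1 f2 f3 f4 f5 x0 x1 x2 x3 x4 x5) :
  [/\ g0 * A0 = A0 * B0,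
      g0 * (2 * A1) + g1 * A0 = A0 * B1 + A1 * B0 &
      g0 * (3 * A2) + g1 * (2 * A1) + g2 * A0 = A0 * B2 + A1 * B1 + A2 * B0] /\
  [/\ g0 * (4 * A3) + g1 * (3 * A2) + g2 * (2 * A1) + g3 * A0 =
      A0 * B3 + A1 * B2 + A2 * B1 + A3 * B0,
      g0 * (5 * A4) + g1 * (4 * A3) + g2 * (3 * A2) + g3 * (2 * A1) + g4 * A0 =
      A0 * B4 + A1 * B3 + A2 * B2 + A3 * B1 + A4 * B0 &
      g0 * (6 * A5) + g1 * (5 * A4) + g2 * (4 * A3) + g3 * (3 * A2) + g4 * (2 * A1) + g5 * A0 =
      A0 * B5 + A1 * B4 + A2 * B3 + A3 * B2 + A4 * B1 + A5 * B0].
Proof.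
rewrite /B5 /B4 /B3 /B2 /B1 /B0 /g5 /g4 /g3 /g2 /g1 /g0 /A5 /A4 /A3 /A2 /A1 /A0.
rewrite /burm5 /burm4 /burm3 /burm2 /burm1 /lagr5 /lagr4 /lagr3 /lagr2 /lagr1.
by split; split; ring.
Qed.

End lagrange.

(* Coefficients of [1 / (1 + p1 x + ... + p5 x^5)] and of its square root. *)
Section inverse_coefficients.
Context (R : realType).
Implicit Types p : R.

Definition winv1 p1 : R := - p1.
Definition winv2 p1 p2 : R := - (p1 * winv1 p1 + p2).
Definition winv3 p1 p2 p3 : R := - (p1 * winv2 p1 p2 + p2 * winv1 p1 + p3).
Definition winv4 p1 p2 p3 p4 : R :=
  - (p1 * winv3 p1 p2 p3 + p2 * winv2 p1 p2 + p3 * winv1 p1 + p4).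
Definition winv5 p1 p2 p3 p4 p5 : R :=
  - (p1 * winv4 p1 p2 p3 p4 + p2 * winv3 p1 p2 p3 + p3 * winv2 p1 p2
     + p4 * winv1 p1 + p5).

Definition wsqrt1 p1 : R := 2^-1 * winv1 p1.
Definition wsqrt2 p1 p2 : R := 2^-1 * (winv2 p1 p2 - wsqrt1 p1 ^+ 2).
Definition wsqrt3 p1 p2 p3 : R :=
  2^-1 * (winv3 p1 p2 p3 - 2 * wsqrt1 p1 * wsqrt2 p1 p2).
Definition wsqrt4 p1 p2 p3 p4 : R :=
  2^-1 * (winv4 p1 p2 p3 p4 - 2 * wsqrt1 p1 * wsqrt3 p1 p2 p3 - wsqrt2 p1 p2 ^+ 2).
Definition wsqrt5 p1 p2 p3 p4 p5 : R :=
  2^-1 * (winv5 p1 p2 p3 p4 p5 - 2 * wsqrt1 p1 * wsqrt4 p1 p2 p3 p4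
          - 2 * wsqrt2 p1 p2 * wsqrt3 p1 p2 p3).

End inverse_coefficients.

(** * The bias integrand as a polynomial in y = h u *)

Section bias_jets.
Context (R : realType) (T : Type) (D : T -> Prop) (h : T -> R).
Hypothesis h01 : forall s, D s -> 0 <= h s <= 1.
Local Notation Oh := (bigOh D h).
Local Notation jet := (jet D h).
Context (p1 p2 p3 p4 p5 e0 y : T -> R) (kap c : R).
Hypotheses (Op1 : Oh 0 p1) (Op2 : Oh 0 p2) (Op3 : Oh 0 p3) (Op4 : Oh 0 p4)
  (Op5 : Oh 0 p5) (Oe0 : Oh 0 e0) (Oy : Oh 1 y).
Hypotheses (c0 : 0 < c) (ce0 : forall s, D s -> c <= e0 s).

(** When p_k is the k-th Taylor coefficient of f at t divided by f(t), the [bw] and [bq] are the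
    Taylor coefficients of f(t)/f and of its square root. *)
Definition bw1 s := winv1 (p1 s).
Definition bw2 s := winv2 (p1 s) (p2 s).
Definition bw3 s := winv3 (p1 s) (p2 s) (p3 s).
Definition bw4 s := winv4 (p1 s) (p2 s) (p3 s) (p4 s).
Definition bw5 s := winv5 (p1 s) (p2 s) (p3 s) (p4 s) (p5 s).
Definition bq1 s := wsqrt1 (p1 s).
Definition bq2 s := wsqrt2 (p1 s) (p2 s).
Definition bq3 s := wsqrt3 (p1 s) (p2 s) (p3 s).
Definition bq4 s := wsqrt4 (p1 s) (p2 s) (p3 s) (p4 s).
Definition bq5 s := wsqrt5 (p1 s) (p2 s) (p3 s) (p4 s) (p5 s).

Definition bf0 s := (e0 s ^+ 2)^-1.
(** Taylor coefficients of beta = - kap (1/f)'': the factor (k + 1)(k + 2) comes from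
    differentiating e0^2 bw_(k+2) x^(k+2) twice. *)
Definition bb0 s := - (kap * 2) * e0 s ^+ 2 * bw2 s.
Definition bb1 s := - (kap * 6) * e0 s ^+ 2 * bw3 s.
Definition bb2 s := - (kap * 12) * e0 s ^+ 2 * bw4 s.
Definition bb3 s := - (kap * 20) * e0 s ^+ 2 * bw5 s.

(** Taylor coefficients of 1 / gamma = (1 + h^2 beta) / sqrt f, with beta cut after degree 3. *)
Definition bx0 s := e0 s * (1 + h s ^+ 2 * bb0 s).
Definition bx1 s := e0 s * (h s ^+ 2 * bb1 s + bq1 s * (1 + h s ^+ 2 * bb0 s)).
Definition bx2 s := e0 s * (h s ^+ 2 * bb2 s + bq1 s * (h s ^+ 2 * bb1 s)
  + bq2 s * (1 + h s ^+ 2 * bb0 s)).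
Definition bx3 s := e0 s * (h s ^+ 2 * bb3 s + bq1 s * (h s ^+ 2 * bb2 s)
  + bq2 s * (h s ^+ 2 * bb1 s) + bq3 s * (1 + h s ^+ 2 * bb0 s)).
Definition bx4 s := e0 s * (bq1 s * (h s ^+ 2 * bb3 s) + bq2 s * (h s ^+ 2 * bb2 s)
  + bq3 s * (h s ^+ 2 * bb1 s) + bq4 s * (1 + h s ^+ 2 * bb0 s)).
Definition bx5 s := e0 s * (bq2 s * (h s ^+ 2 * bb3 s) + bq3 s * (h s ^+ 2 * bb2 s)
  + bq4 s * (h s ^+ 2 * bb1 s) + bq5 s * (1 + h s ^+ 2 * bb0 s)).

Definition bA1 s := lagr1 (bx0 s) (bx1 s).
Definition bA2 s := lagr2 (bx0 s) (bx1 s) (bx2 s).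
Definition bA3 s := lagr3 (bx0 s) (bx1 s) (bx2 s) (bx3 s).
Definition bA4 s := lagr4 (bx0 s) (bx1 s) (bx2 s) (bx3 s) (bx4 s).
Definition bA5 s := lagr5 (bx0 s) (bx1 s) (bx2 s) (bx3 s) (bx4 s) (bx5 s).

Definition bB1 s := burm1 (bf0 s) (bf0 s * p1 s) (bx0 s) (bx1 s).
Definition bB2 s := burm2 (bf0 s) (bf0 s * p1 s) (bf0 s * p2 s) (bx0 s) (bx1 s) (bx2 s).
Definition bB3 s := burm3 (bf0 s) (bf0 s * p1 s) (bf0 s * p2 s) (bf0 s * p3 s)
  (bx0 s) (bx1 s) (bx2 s) (bx3 s).
Definition bB4 s := burm4 (bf0 s) (bf0 s * p1 s) (bf0 s * p2 s) (bf0 s * p3 s)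
  (bf0 s * p4 s) (bx0 s) (bx1 s) (bx2 s) (bx3 s) (bx4 s).
Definition bB5 s := burm5 (bf0 s) (bf0 s * p1 s) (bf0 s * p2 s) (bf0 s * p3 s)
  (bf0 s * p4 s) (bf0 s * p5 s) (bx0 s) (bx1 s) (bx2 s) (bx3 s) (bx4 s) (bx5 s).

(** With Z = y A(y) from Lagrange inversion, [bzeta] is Z and [bdzeta] is dZ/dy; [bepol] is the
    Taylor polynomial of f^(-1/2) at t. *)
Definition bApol s := pol6 (bx0 s) (bA1 s) (bA2 s) (bA3 s) (bA4 s) (bA5 s).
Definition bBpol s := pol6 (bf0 s) (bB1 s) (bB2 s) (bB3 s) (bB4 s) (bB5 s).
Definition bzeta s := y s * bApol s (y s).
Definition bepol s v := pol6 (e0 s) (e0 s * bq1 s) (e0 s * bq2 s) (e0 s * bq3 s)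
  (e0 s * bq4 s) (e0 s * bq5 s) v.
Definition bdzeta s v := pol6 (bx0 s) (2 * bA1 s) (3 * bA2 s) (4 * bA3 s)
  (5 * bA4 s) (6 * bA5 s) v.

Lemma Obw : [/\ Oh 0 bw1, Oh 0 bw2, Oh 0 bw3, Oh 0 bw4 & Oh 0 bw5].
Proof.
have O1 : Oh 0 bw1 by rewrite /bw1 /winv1; Ohbounded.
have O2 : Oh 0 bw2 by rewrite /bw2 /winv2; Ohbounded.
have O3 : Oh 0 bw3 by rewrite /bw3 /winv3; Ohbounded.
have O4 : Oh 0 bw4 by rewrite /bw4 /winv4; Ohbounded.
by split => //; rewrite /bw5 /winv5; Ohbounded.
Qed.

Lemma Obq : [/\ Oh 0 bq1, Oh 0 bq2, Oh 0 bq3, Oh 0 bq4 & Oh 0 bq5].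
Proof.
have [Ow1 Ow2 Ow3 Ow4 Ow5] := Obw.
have O1 : Oh 0 bq1 by rewrite /bq1 /wsqrt1; Ohbounded.
have O2 : Oh 0 bq2 by rewrite /bq2 /wsqrt2; Ohbounded.
have O3 : Oh 0 bq3 by rewrite /bq3 /wsqrt3; Ohbounded.
have O4 : Oh 0 bq4 by rewrite /bq4 /wsqrt4; Ohbounded.
by split => //; rewrite /bq5 /wsqrt5; Ohbounded.
Qed.

Lemma Obf0 : Oh 0 bf0.
Proof.
exists (c ^- 2); first by rewrite invr_ge0 exprn_ge0// ltW.
move=> s Ds; have e00 : 0 < e0 s by exact: lt_le_trans (ce0 Ds).
have e2 : 0 < e0 s ^+ 2 by rewrite exprn_gt0.
rewrite expr0 mulr1 /bf0 gtr0_norm ?invr_gt0//.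
by rewrite lef_pV2 ?posrE ?exprn_gt0// lerXn2r ?nnegrE ?ce0// ltW.
Qed.

Lemma Obb : [/\ Oh 0 bb0, Oh 0 bb1, Oh 0 bb2 & Oh 0 bb3].
Proof.
have [Ow1 Ow2 Ow3 Ow4 Ow5] := Obw.
by rewrite /bb0 /bb1 /bb2 /bb3; split; Ohbounded.
Qed.

Lemma Ohsq : Oh 0 (fun s => h s ^+ 2).
Proof. exact: Oh_le (Oh_h h01 2). Qed.

Lemma Obx : [/\ Oh 0 bx0, Oh 0 bx1 & Oh 0 bx2] /\ [/\ Oh 0 bx3, Oh 0 bx4 & Oh 0 bx5].
Proof.
have [Ob0 Ob1 Ob2 Ob3] := Obb; have [Oq1 Oq2 Oq3 Oq4 Oq5] := Obq.
have Oh2 := Ohsq.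
by rewrite /bx0 /bx1 /bx2 /bx3 /bx4 /bx5; split; split; Ohbounded.
Qed.

Lemma ObA : [/\ Oh 0 bA1, Oh 0 bA2, Oh 0 bA3, Oh 0 bA4 & Oh 0 bA5].
Proof.
have [[Ox0 Ox1 Ox2] [Ox3 Ox4 Ox5]] := Obx.
have O1 : Oh 0 bA1 by rewrite /bA1 /lagr1; Ohbounded.
have O2 : Oh 0 bA2 by rewrite /bA2 /lagr2; Ohbounded.
have O3 : Oh 0 bA3 by rewrite /bA3 /lagr3; Ohbounded.
have O4 : Oh 0 bA4 by rewrite /bA4 /lagr4; Ohbounded.
by split => //; rewrite /bA5 /lagr5; Ohbounded.
Qed.

Lemma ObB : [/\ Oh 0 bB1, Oh 0 bB2, Oh 0 bB3, Oh 0 bB4 & Oh 0 bB5].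
Proof.
have [[Ox0 Ox1 Ox2] [Ox3 Ox4 Ox5]] := Obx; have Of0 := Obf0.
rewrite /bB1 /bB2 /bB3 /bB4 /bB5 /burm1 /burm2 /burm3 /burm4 /burm5.
by split; Ohbounded.
Qed.

Lemma Ozeta : Oh 1 bzeta.
Proof.
have [Ox _] := Obx; have [OA1 OA2 OA3 OA4 OA5] := ObA; case: Ox => Ox0 _ _.
apply: OhMr => //; apply: Oh_pol6 => //.
exact: Oh_le Oy.
Qed.

Lemma jet_zeta : jet 6 y bzeta (fun=> 0) bx0 bA1 bA2 bA3 bA4.
Proof.
have [[Ox0 _ _] _] := Obx; have [OA1 OA2 OA3 OA4 OA5] := ObA.
split => //; first exact: Oh_cst.
have O6 : Oh 6 (fun s => y s ^+ 6 * bA5 s) by apply: OhMr => //; exact: OhX.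
by apply: Oh_ext O6 => s _; rewrite /bzeta /bApol /pol6; ring.
Qed.

Context (F F1 F2 S : T -> R).
Hypotheses (cF : forall s, D s -> c <= F s) (cS : forall s, D s -> c <= S s)
  (SF : forall s, D s -> S s ^+ 2 = (F s)^-1)
  (epol0 : forall s, D s -> 0 <= bepol s (bzeta s)).
Hypothesis jF : jet 6 bzeta F bf0 (fun s => bf0 s * p1 s) (fun s => bf0 s * p2 s)
  (fun s => bf0 s * p3 s) (fun s => bf0 s * p4 s) (fun s => bf0 s * p5 s).
Hypothesis jF1 : jet 4 bzeta F1 (fun s => bf0 s * p1 s) (fun s => 2 * (bf0 s * p2 s))
  (fun s => 3 * (bf0 s * p3 s)) (fun s => 4 * (bf0 s * p4 s)) (fun=> 0) (fun=> 0).
Hypothesis jF2 : jet 4 bzeta F2 (fun s => 2 * (bf0 s * p2 s))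
  (fun s => 6 * (bf0 s * p3 s)) (fun s => 12 * (bf0 s * p4 s))
  (fun s => 20 * (bf0 s * p5 s)) (fun=> 0) (fun=> 0).

Definition bbeta s := kap * (F2 s * F s - 2 * F1 s ^+ 2) / F s ^+ 3.
Definition bphi s := (1 + h s ^+ 2 * bbeta s) * S s.

Let e0_neq0 s : D s -> e0 s != 0.
Proof. by move=> Ds; rewrite gt_eqF// (lt_le_trans c0)// ce0. Qed.

Let F_neq0 s : D s -> F s != 0.
Proof. by move=> Ds; rewrite gt_eqF// (lt_le_trans c0)// cF. Qed.

Lemma jet_Finv : jet 6 bzeta (fun s => (F s)^-1) (fun s => e0 s ^+ 2)
  (fun s => e0 s ^+ 2 * bw1 s) (fun s => e0 s ^+ 2 * bw2 s)
  (fun s => e0 s ^+ 2 * bw3 s) (fun s => e0 s ^+ 2 * bw4 s)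
  (fun s => e0 s ^+ 2 * bw5 s).
Proof.
have [Ow1 Ow2 Ow3 Ow4 Ow5] := Obw.
apply: (jet_inv h01 (leqnn 6) Ozeta c0 cF jF); first by split; Ohbounded.
  by Ohbounded.
move=> s Ds; have e00 := e0_neq0 Ds.
rewrite /bw5 /winv5 -!/(bw4 _) /bw4 /winv4 /bw3 /winv3 /bw2 /winv2 /bw1 /winv1 /bf0.
by split; split; field.
Qed.

Lemma jet_S : jet 6 bzeta S e0 (fun s => e0 s * bq1 s) (fun s => e0 s * bq2 s)
  (fun s => e0 s * bq3 s) (fun s => e0 s * bq4 s) (fun s => e0 s * bq5 s).
Proof.
have [Oq1 Oq2 Oq3 Oq4 Oq5] := Obq.
apply: (jet_sqrt h01 Ozeta c0 cS SF epol0 jet_Finv); first by split; Ohbounded.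
  by Ohbounded.
move=> s Ds.
rewrite /bq5 /wsqrt5 /bq4 /wsqrt4 /bq3 /wsqrt3 /bq2 /wsqrt2 /bq1 /wsqrt1.
rewrite /bw5 /bw4 /bw3 /bw2 /bw1.
by split; split; field.
Qed.

(** Order 4 is what six derivatives of f leave for f'', and it suffices because beta is multiplied
    by h^2. *)
Lemma jet_beta : jet 4 bzeta bbeta bb0 bb1 bb2 bb3 (fun=> 0) (fun=> 0).
Proof.
have Oz := Ozeta.
have jI := jet_le h01 (isT : (4 <= 6)%N) jet_Finv.
have k6 : (4 <= 6)%N by [].
have jI2 := jet_mul h01 k6 Oz jI jI.
have jI3 := jet_mul h01 k6 Oz jI jI2.
have j1 := jet_mul h01 k6 Oz jF2 jI2.
have j2 := jet_mul h01 k6 Oz (jet_mul h01 k6 Oz jF1 jF1) jI3.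
have j3 := jet_add (jet_scale h01 (Oh_cst D h kap) j1) (jet_scale h01 (Oh_cst D h (- (kap * 2))) j2).
have [Ob0 Ob1 Ob2 Ob3] := Obb.
apply: jet_ext (jet_trunc4 h01 (leqnn 4) Oz j3) => s Ds.
have e00 := e0_neq0 Ds; have F0 := F_neq0 Ds.
rewrite /bbeta /bb0 /bb1 /bb2 /bb3 /bw5 /bw4 /bw3 /bw2 /bw1 /winv5 /winv4 /winv3 /winv2 /winv1 /bf0.
by split; split => //; field; rewrite ?e00 ?F0.
Qed.

Lemma jet_phi : jet 6 bzeta bphi bx0 bx1 bx2 bx3 bx4 bx5.
Proof.
have Oz := Ozeta.
have jb := jet_scale h01 (Oh_h h01 2) jet_beta.
have j1 := jet_add (jet_cst 6 bzeta (Oh_cst D h 1)) jb.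
apply: jet_ext (jet_mul h01 (leqnn 6) Oz j1 jet_S) => s Ds.
rewrite /bphi /bx0 /bx1 /bx2 /bx3 /bx4 /bx5.
by split; split => //; ring.
Qed.

(** Substituting Z into the jet of 1 / gamma, [jet_comp] produces exactly the recursion that defines
    the [lagr] coefficients, so that 1 / gamma(t + Z) is A up to O(h^6). *)
Lemma phi_expansion : Oh 6 (fun s => bphi s - bApol s (y s)).
Proof.
have j := jet_comp h01 Oy jet_zeta jet_phi.
have [_ _ _ _ _ _ jr] := j.
by apply: Oh_ext jr => s _.
Qed.

Lemma density_expansion :
  Oh 6 (fun s => F s * bdzeta s (y s) - bApol s (y s) * bBpol s (y s)).
Proof.
have Oy0 := Oh_le h01 (leq0n 1) Oy.
have [[Ox0 _ _] _] := Obx; have [OA1 OA2 OA3 OA4 OA5] := ObA.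
have [OB1 OB2 OB3 OB4 OB5] := ObB; have Of0 := Obf0.
have jFy := jet_comp h01 Oy jet_zeta jF.
have jd : jet 6 y (fun s => bdzeta s (y s)) bx0 (fun s => 2 * bA1 s)
    (fun s => 3 * bA2 s) (fun s => 4 * bA3 s) (fun s => 5 * bA4 s) (fun s => 6 * bA5 s).
  split; [done|by Ohbounded|by Ohbounded|by Ohbounded|by Ohbounded|by Ohbounded|].
  by apply: Oh_ext (Oh0 D h 6) => s _; rewrite /bdzeta subrr.
have jA : jet 6 y (fun s => bApol s (y s)) bx0 bA1 bA2 bA3 bA4 bA5.
  by split => //; apply: Oh_ext (Oh0 D h 6) => s _; rewrite /bApol subrr.
have jB : jet 6 y (fun s => bBpol s (y s)) bf0 bB1 bB2 bB3 bB4 bB5.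
  by split => //; apply: Oh_ext (Oh0 D h 6) => s _; rewrite /bBpol subrr.
have [_ _ _ _ _ _ r1] := jet_mul h01 (leqnn 6) Oy jFy jd.
have [_ _ _ _ _ _ r2] := jet_mul h01 (leqnn 6) Oy jA jB.
apply: Oh_ext (OhB r1 r2) => s _.
have [[e1 e2 e3] [e4 e5 e6]] := burmann (bf0 s) (bf0 s * p1 s) (bf0 s * p2 s)
  (bf0 s * p3 s) (bf0 s * p4 s) (bf0 s * p5 s) (bx0 s) (bx1 s) (bx2 s) (bx3 s) (bx4 s) (bx5 s).
rewrite -/(bA1 s) -/(bA2 s) -/(bA3 s) -/(bA4 s) -/(bA5 s) -/(bB1 s) -/(bB2 s)
  -/(bB3 s) -/(bB4 s) -/(bB5 s) in e1 e2 e3 e4 e5 e6.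
rewrite e1 e2 e3 e4 e5 e6; ring.
Qed.

(** B_2 is the coefficient of x^2 in f phi^2 = (1 + h^2 beta)^2: f cancels, and no term of order 0
    in h survives. *)
Lemma bB2_expansion : Oh 4 (fun s => bB2 s - 2 * h s ^+ 2 * bb2 s).
Proof.
have [Ob0 Ob1 Ob2 Ob3] := Obb.
have O4 : Oh 4 (fun s => h s ^+ 4 * (2 * bb0 s * bb2 s + bb1 s ^+ 2)).
  by apply: OhMr; [exact: Oh_h|Ohbounded].
apply: Oh_ext O4 => s Ds; have e00 := e0_neq0 Ds.
rewrite /bB2 /burm2 /bx0 /bx1 /bx2 /bf0 /bq1 /bq2 /wsqrt2 /wsqrt1 /winv2 /winv1.
by field.
Qed.

(** B_4 is the coefficient of x^4 in f phi^4 = (1 + h^2 beta)^4 / f, which is that of 1/f up to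
    O(h^2). *)
Lemma bB4_expansion : Oh 2 (fun s => bB4 s - e0 s ^+ 2 * bw4 s).
Proof.
have [Ob0 Ob1 Ob2 Ob3] := Obb; have [Oq1 Oq2 Oq3 Oq4 Oq5] := Obq.
have [[Ox0 Ox1 Ox2] [Ox3 Ox4 Ox5]] := Obx; have Of0 := Obf0.
(* The coefficients of f^(-1/2), to which those of phi reduce at h = 0: [bB4] is compared with its
   value there, by congruences modulo O(h^2). *)
pose d0 s := e0 s; pose d1 s := e0 s * bq1 s; pose d2 s := e0 s * bq2 s.
pose d3 s := e0 s * bq3 s; pose d4 s := e0 s * bq4 s.
have [Od0 Od1 Od2] : [/\ Oh 0 d0, Oh 0 d1 & Oh 0 d2] by split; rewrite /d0 /d1 /d2; Ohbounded.
have [Od3 Od4] : Oh 0 d3 /\ Oh 0 d4 by split; rewrite /d3 /d4; Ohbounded.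
have Oh2 W : Oh 0 W -> Oh 2 (fun s => h s ^+ 2 * W s) by move=> OW; apply: OhMr; [exact: Oh_h|].
have c0' : Oh 2 (fun s => bx0 s - d0 s).
  have O : Oh 0 (fun s => e0 s * bb0 s) by Ohbounded.
  by apply: Oh_ext (Oh2 _ O) => s _; rewrite /bx0 /d0; ring.
have c1' : Oh 2 (fun s => bx1 s - d1 s).
  have O : Oh 0 (fun s => e0 s * (bb1 s + bq1 s * bb0 s)) by Ohbounded.
  by apply: Oh_ext (Oh2 _ O) => s _; rewrite /bx1 /d1; ring.
have c2' : Oh 2 (fun s => bx2 s - d2 s).
  have O : Oh 0 (fun s => e0 s * (bb2 s + bq1 s * bb1 s + bq2 s * bb0 s)) by Ohbounded.
  by apply: Oh_ext (Oh2 _ O) => s _; rewrite /bx2 /d2; ring.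
have c3' : Oh 2 (fun s => bx3 s - d3 s).
  have O : Oh 0 (fun s => e0 s * (bb3 s + bq1 s * bb2 s + bq2 s * bb1 s + bq3 s * bb0 s)) by Ohbounded.
  by apply: Oh_ext (Oh2 _ O) => s _; rewrite /bx3 /d3; ring.
have c4' : Oh 2 (fun s => bx4 s - d4 s).
  have O : Oh 0 (fun s => e0 s * (bq1 s * bb3 s + bq2 s * bb2 s + bq3 s * bb1 s + bq4 s * bb0 s)) by Ohbounded.
  by apply: Oh_ext (Oh2 _ O) => s _; rewrite /bx4 /d4; ring.
have Oe : Oh 2 (fun s => bB4 s - burm4 (bf0 s) (bf0 s * p1 s) (bf0 s * p2 s) (bf0 s * p3 s)
    (bf0 s * p4 s) (d0 s) (d1 s) (d2 s) (d3 s) (d4 s)).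
  rewrite /bB4 /burm4.
  by repeat first [ assumption | exact: Oh_cong_refl | apply: Oh_congD
    | apply: Oh_congM | apply: Oh_congX | apply: Oh_cst | apply: OhD | apply: OhMl | apply: OhX0].
apply: Oh_ext Oe => s Ds; have e00 := e0_neq0 Ds; congr (_ - _).
rewrite /burm4 /d0 /d1 /d2 /d3 /d4 /bf0 /bq1 /bq2 /bq3 /bq4 /bw4.
rewrite /wsqrt4 /wsqrt3 /wsqrt2 /wsqrt1 /winv4 /winv3 /winv2 /winv1.
by field.
Qed.

End bias_jets.

(** * Bias of the ideal estimator *)

Definition ubl (R : realType) (I : Type) (D : I -> Prop) (g : I -> R -> R) : Prop :=
  exists2 M, 0 <= M & forall i, D i -> (forall x, `|g i x| <= M) /\ lip M (g i).

Section uniformly_bounded_lipschitz.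
Context (R : realType) (I : Type) (D : I -> Prop).
Implicit Types (g : I -> R -> R).
Local Notation ubl := (@ubl R I D).

Lemma ubl_ext g1 g2 : (forall i, D i -> g1 i =1 g2 i) -> ubl g1 -> ubl g2.
Proof.
move=> e [M M0 h]; exists M => // i Di; have [b l] := h i Di.
by split=> [x|x y]; rewrite -!e //.
Qed.

Lemma ubl_cst (c : I -> R) M : (forall i, D i -> `|c i| <= M) -> ubl (fun i _ => c i).
Proof.
move=> cM; exists `|M| => // i Di; split=> [_|x y]; first by rewrite (le_trans (cM i Di))// ler_norm.
by rewrite subrr normr0 mulr_ge0.
Qed.

Lemma ubl_add g1 g2 : ubl g1 -> ubl g2 -> ubl (fun i x => g1 i x + g2 i x).
Proof.
move=> [M M0 h1] [N N0 h2]; exists (M + N); first exact: addr_ge0.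
move=> i Di; have [b1 l1] := h1 i Di; have [b2 l2] := h2 i Di; split=> [x|x y].
  by rewrite (le_trans (ler_normD _ _))// lerD.
rewrite opprD addrACA mulrDl (le_trans (ler_normD _ _))// lerD//.
Qed.

Lemma ubl_mul g1 g2 : ubl g1 -> ubl g2 -> ubl (fun i x => g1 i x * g2 i x).
Proof.
move=> [M M0 h1] [N N0 h2]; exists (2 * M * N + M * N); first by rewrite addr_ge0// !mulr_ge0.
move=> i Di; have [b1 l1] := h1 i Di; have [b2 l2] := h2 i Di.
have MN : 0 <= M * N by rewrite mulr_ge0.
split=> [x|x y].
  apply: (@le_trans _ _ (M * N)); first by rewrite normrM ler_pM.
  by rewrite lerDr -mulrA mulr_ge0.
have -> : g1 i x * g2 i x - g1 i y * g2 i y =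
  (g1 i x - g1 i y) * g2 i x + g1 i y * (g2 i x - g2 i y) by ring.
rewrite (le_trans (ler_normD _ _))// !normrM.
apply: (@le_trans _ _ ((M * `|x - y|) * N + M * (N * `|x - y|))).
  by rewrite lerD// ler_pM//.
have -> : (M * `|x - y|) * N + M * (N * `|x - y|) = (2 * M * N) * `|x - y| by ring.
by rewrite ler_wpM2r// lerDl.
Qed.

Lemma ubl_opp g : ubl g -> ubl (fun i x => - g i x).
Proof.
move=> [M M0 h]; exists M => // i Di; have [b l] := h i Di.
by split=> [x|x y]; rewrite ?normrN// -opprD normrN; exact: l.
Qed.

Lemma ubl_inv g c : 0 < c -> (forall i, D i -> forall x, c <= g i x) ->
  ubl g -> ubl (fun i x => (g i x)^-1).
Proof.
move=> c0 cg [M M0 h]; exists (c^-1 + c^-1 * c^-1 * M).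
  by rewrite addr_ge0// ?mulr_ge0// invr_ge0 ltW.
move=> i Di; have [b l] := h i Di.
have g0 x : 0 < g i x by exact: lt_le_trans (cg i Di x).
have gi x : `|(g i x)^-1| <= c^-1 by rewrite gtr0_norm ?invr_gt0// lef_pV2 ?posrE ?cg//.
have ci : 0 <= c^-1 by rewrite invr_ge0 ltW.
split=> [x|x y].
  by apply: (le_trans (gi x)); rewrite lerDl !mulr_ge0.
have -> : (g i x)^-1 - (g i y)^-1 = (g i x)^-1 * (g i y)^-1 * (g i y - g i x).
  by field; rewrite !gt_eqF.
rewrite !normrM [`|g i y - _|]distrC.
apply: (@le_trans _ _ (c^-1 * c^-1 * (M * `|x - y|))).
  by rewrite ler_pM ?mulr_ge0// ler_pM//.
by rewrite mulrA ler_wpM2r// lerDr.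
Qed.

Lemma ubl_sqrt g c : 0 < c -> (forall i, D i -> forall x, c <= g i x) ->
  ubl g -> ubl (fun i x => Num.sqrt (g i x)).
Proof.
move=> c0 cg [M M0 h]; exists (Num.sqrt M + (Num.sqrt c)^-1 * M).
  by rewrite addr_ge0 ?sqrtr_ge0// mulr_ge0// invr_ge0 sqrtr_ge0.
move=> i Di; have [b l] := h i Di.
have g0 x : 0 < g i x by exact: lt_le_trans (cg i Di x).
have sc : 0 < Num.sqrt c by rewrite sqrtr_gt0.
have sg x : Num.sqrt c <= Num.sqrt (g i x) by apply: ler_wsqrtr; exact: cg.
split=> [x|x y].
  rewrite ger0_norm ?sqrtr_ge0//.
  apply: (@le_trans _ _ (Num.sqrt M)).
    by apply: ler_wsqrtr; exact: le_trans (ler_norm _) (b x).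
  by rewrite lerDl mulr_ge0// invr_ge0 sqrtr_ge0.
have s0 : 0 < Num.sqrt (g i x) + Num.sqrt (g i y).
  by rewrite addr_gt0// sqrtr_gt0.
have -> : Num.sqrt (g i x) - Num.sqrt (g i y) =
    (Num.sqrt (g i x) + Num.sqrt (g i y))^-1 * (g i x - g i y).
  apply: (mulfI (lt0r_neq0 s0)); rewrite mulrA mulfV ?gt_eqF// mul1r.
  by rewrite mulrC -subr_sqr !sqr_sqrtr// ltW.
rewrite normrM gtr0_norm ?invr_gt0//.
apply: (@le_trans _ _ ((Num.sqrt c)^-1 * (M * `|x - y|))).
  apply: ler_pM; [by rewrite invr_ge0 ltW|exact: normr_ge0| |exact: l].
  rewrite lef_pV2 ?posrE//; apply: (le_trans (sg x)).
  by rewrite lerDl sqrtr_ge0.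
by rewrite mulrA ler_wpM2r// lerDr sqrtr_ge0.
Qed.

Lemma ubl_max g (c : R) : ubl g -> ubl (fun i x => Num.max (g i x) c).
Proof.
move=> [M M0 h]; exists (M + `|c|); first by rewrite addr_ge0.
move=> i Di; have [b l] := h i Di; split=> [x|x y].
  case: (leP (g i x) c) => _; first by rewrite lerDr.
  by rewrite (le_trans (b x))// lerDl.
apply: (@le_trans _ _ `|g i x - g i y|).
  have := ler_norm (g i x - g i y); have := ler_norm (- (g i x - g i y)).
  rewrite normrN ler_norml.
  by case: (leP (g i x) c); case: (leP (g i y) c) => *; apply/andP; split; lra.
by apply: (le_trans (l x y)); rewrite ler_wpM2r// lerDl.
Qed.

Lemma ubl_exp g k : ubl g -> ubl (fun i x => g i x ^+ k).
Proof.
move=> ug; elim: k => [|k ih].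
  by apply: ubl_ext (@ubl_cst (fun=> 1) 1 _) => // i _; rewrite normr1.
by apply: ubl_ext (ubl_mul ug ih) => i _ x; rewrite exprS.
Qed.

End uniformly_bounded_lipschitz.

(** * The clipped theoretical bandwidth function *)

Section pilot_bandwidth.
Context (R : realType).
Implicit Types (f : R -> R) (kap r h x : R).

(** Clipping by a maximum instead of [p]: the result is bounded below on the whole line, Lipschitz
    when [f] is, and equal to [f] wherever f >= r, which will hold in the window around the point of
    interest. *)
Definition flr r f x : R := Num.max (f x) r.

Definition beta_cut kap r f x : R :=
  kap * (derive1n 2 f x * flr r f x - 2 * derive1n 1 f x ^+ 2) / flr r f x ^+ 3.

Definition gamma_cut kap r h f x : R :=
  Num.sqrt (flr r f x) / (1 + h ^+ 2 * beta_cut kap r f x).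

Lemma flr_ge r f x : r <= flr r f x.
Proof. by rewrite /flr le_max lexx orbT. Qed.

Lemma flrE r f x : r <= f x -> flr r f x = f x.
Proof. by move=> h; apply/max_idPl. Qed.

Lemma ubl_cut C k r (D : R * (R -> R) -> Prop) :
  (forall i, D i -> smooth_densities C k.+1 i.2) -> ubl D (fun i => flr r i.2).
Proof.
move=> DC; apply: ubl_max; exists `|C| => // i /DC sf; split=> [x|].
  have := sd_bound sf (leq0n _) x; rewrite derive1n0 => h.
  exact: le_trans (ler_norm _).
have := sd_lip sf (ltn0Sn k); rewrite derive1n0 => l x y.
by apply: (le_trans (l x y)); rewrite ler_wpM2r// ler_norm.
Qed.

Lemma ubl_derive C k j (D : R * (R -> R) -> Prop) : (j < k)%N ->
  (forall i, D i -> smooth_densities C k i.2) -> ubl D (fun i => derive1n j i.2).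
Proof.
move=> jk DC; exists `|C| => // i /DC sf; split=> [x|x y].
  by apply: (le_trans (sd_bound sf (ltnW jk) x)); exact: ler_norm.
by apply: (le_trans (sd_lip sf jk x y)); rewrite ler_wpM2r// ler_norm.
Qed.

Lemma ubl_beta_cut C kap r (D : R * (R -> R) -> Prop) : 0 < r ->
  (forall i, D i -> smooth_densities C 6 i.2) ->
  ubl D (fun i => beta_cut kap r i.2).
Proof.
move=> r0 DC.
have uc := ubl_cut r DC.
have u1 := ubl_derive (isT : (1 < 6)%N) DC.
have u2 := ubl_derive (isT : (2 < 6)%N) DC.
have cc (a : R) : ubl D (fun _ _ => a) by exact: (@ubl_cst _ _ _ _ `|a|).
have u3 : ubl D (fun i x => (flr r i.2 x ^+ 3)^-1).
  apply: (@ubl_inv _ _ _ _ (r ^+ 3)) (ubl_exp 3 uc); first exact: exprn_gt0.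
  move=> i Di x; have c0 := lt_le_trans r0 (flr_ge r i.2 x).
  by rewrite lerXn2r ?nnegrE ?(ltW r0) ?(ltW c0) ?flr_ge.
rewrite /beta_cut; apply: ubl_mul u3; apply: ubl_mul => //.
by apply: ubl_add; [exact: ubl_mul|apply: ubl_opp; apply: ubl_mul => //; exact: ubl_exp].
Qed.

Lemma gamma_cut_bounds C kap r : 0 < r ->
  exists h0 g0 G, [/\ 0 < h0 <= 1, 0 < g0, 0 < G &
  forall f h, smooth_densities C 6 f -> 0 <= h <= h0 ->
   [/\ forall x, g0 <= gamma_cut kap r h f x <= G,
       forall x, 2^-1 <= 1 + h ^+ 2 * beta_cut kap r f x,
       forall x, `|gamma_cut kap r h f x - Num.sqrt (flr r f x)| <= G * h ^+ 2 &
       lip G (gamma_cut kap r h f)]].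
Proof.
move=> r0.
pose D0 (i : R * (R -> R)) := smooth_densities C 6 i.2.
have [B B0 hB] : ubl D0 (fun i => beta_cut kap r i.2) by exact: (@ubl_beta_cut C).
(* Makes h^2 |beta| at most 1/2, so that the denominator of gamma stays in [1/2, 3/2]. *)
pose h0 : R := (2 * (B + 1))^-1.
have h00 : 0 < h0 by rewrite invr_gt0; lra.
have h01 : h0 <= 1 by rewrite invf_le1; lra.
have small h : 0 <= h <= h0 -> h ^+ 2 * B <= 2^-1.
  move=> /andP[hh0 hh1]; have hh2 : h ^+ 2 <= h0.
    rewrite expr2 -[leRHS]mulr1 ler_pM// (le_trans hh1)//.
  apply: (@le_trans _ _ (h0 * (B + 1))); first by rewrite ler_pM ?sqr_ge0// lerDl.
  by rewrite /h0 invfM mulrVK// unitfE gt_eqF//; lra.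
pose D (i : R * (R -> R)) := smooth_densities C 6 i.2 /\ 0 <= i.1 <= h0.
have DC i : D i -> smooth_densities C 6 i.2 by case.
have ub := @ubl_beta_cut C kap r D r0 DC.
have uc := @ubl_cut C 5 r D DC.
have us : ubl D (fun i x => Num.sqrt (flr r i.2 x)).
  by apply: (ubl_sqrt r0) => // i _ x; exact: flr_ge.
have den i x : D i -> 2^-1 <= 1 + i.1 ^+ 2 * beta_cut kap r i.2 x.
  move=> [sf hi]; have [b _] := hB (i.1, i.2) sf.
  have := small _ hi; have := b x; rewrite ler_norml => /andP[b1 b2].
  have : 0 <= i.1 ^+ 2 by exact: sqr_ge0.
  rewrite /= in b1 b2 *; nra.
have hbound i : D i -> `|i.1 ^+ 2| <= 1.
  move=> [_ /andP[i0 i1]]; rewrite normrX ger0_norm// exprn_ile1//.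
  exact: le_trans h01.
have cc (a : R) : ubl D (fun _ _ => a) by exact: (@ubl_cst _ _ _ _ `|a|).
have uden : ubl D (fun i x => 1 + i.1 ^+ 2 * beta_cut kap r i.2 x).
  by apply: ubl_add => //; apply: ubl_mul => //; exact: (ubl_cst hbound).
have ui : ubl D (fun i x => (1 + i.1 ^+ 2 * beta_cut kap r i.2 x)^-1).
  have h2 : (0 : R) < 2^-1 by lra.
  by apply: (ubl_inv h2 _ uden) => i Di x; exact: den.
have [G G0 hG] := ubl_mul us ui.
have [S S0 hS] := us.
exists h0, (Num.sqrt r * (2/3)), (G + 1 + S * 2 * B); split.
- by rewrite h00.
- by rewrite mulr_gt0 ?sqrtr_gt0//; lra.
- by have := mulr_ge0 S0 B0; lra.
move=> f h sf hh.
have Di : D (h, f) by split.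
have [bG lG] := hG (h, f) Di.
have [bS _] := hS (h, f) Di.
have SB : 0 <= S * 2 * B by rewrite !mulr_ge0.
split.
- move=> x; apply/andP; split; last first.
    by apply: le_trans (ler_norm _) (le_trans (bG x) _); lra.
  have dx := den _ x Di.
  apply: ler_pM; [exact: sqrtr_ge0|lra|by apply: ler_wsqrtr; exact: flr_ge|].
  have -> : (2 / 3 : R) = (3 / 2)^-1 by field.
  have d0 : 0 < 1 + h ^+ 2 * beta_cut kap r f x by apply: lt_le_trans dx; lra.
  have e0 : (0 : R) < 3 / 2 by lra.
  rewrite lef_pV2 ?posrE//.
  have [b _] := hB (h, f) sf.
  have := small _ hh; have := b x; rewrite ler_norml => /andP[b1 b2].
  have : 0 <= h ^+ 2 by exact: sqr_ge0.
  rewrite /= in b1 b2 *; nra.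
- by move=> x; exact: (den _ x Di).
- move=> x; have dx := den _ x Di.
  have d0 : 0 < 1 + h ^+ 2 * beta_cut kap r f x by apply: lt_le_trans dx; lra.
  have -> : gamma_cut kap r h f x - Num.sqrt (flr r f x) =
      Num.sqrt (flr r f x) * (1 + h ^+ 2 * beta_cut kap r f x)^-1 * (- beta_cut kap r f x) * h ^+ 2.
    by rewrite /gamma_cut; field; rewrite gt_eqF.
  rewrite normrM [`|h ^+ 2|]ger0_norm ?sqr_ge0// ler_wpM2r ?sqr_ge0//.
  rewrite 2!normrM normrN.
  apply: (@le_trans _ _ (S * 2 * B)); last lra.
  have h2 : (0 : R) < 2^-1 by lra.
  apply: ler_pM; [by rewrite mulr_ge0|exact: normr_ge0| |].
    apply: ler_pM; [exact: normr_ge0|exact: normr_ge0|exact: bS|].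
    by rewrite gtr0_norm ?invr_gt0// -[leRHS]invrK lef_pV2 ?posrE.
  by have [b _] := hB (h, f) sf; exact: b.
- by move=> x y; apply: (le_trans (lG x y)); rewrite ler_wpM2r//; lra.
Qed.

End pilot_bandwidth.

(** * Expansions uniform in the density, the point, the bandwidth and u *)

Local Arguments derive1n : simpl never.

Record bias_param (R : realType) := BiasParam {
  bp_f : R -> R; bp_t : R; bp_h : R; bp_u : R }.

Section bias_families.
Context (R : realType) (C r0 U kap : R).
Hypotheses (r00 : 0 < r0) (U0 : 0 <= U).
Local Notation T := (bias_param R).
Implicit Types (s : T) (hm : R).

Definition bp_dom hm s : Prop :=
  [/\ smooth_densities C 6 (bp_f s), r0 <= bp_f s (bp_t s), 0 < bp_h s <= hm &
      `|bp_u s| <= U].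

Definition bp_p k s : R :=
  derive1n k (bp_f s) (bp_t s) / (k`!)%:R / bp_f s (bp_t s).
Definition bp_e0 s : R := (Num.sqrt (bp_f s (bp_t s)))^-1.
Definition bp_y s : R := bp_h s * bp_u s.

Definition bp_zeta : T -> R := bzeta (@bp_h R) (bp_p 1) (bp_p 2) (bp_p 3) (bp_p 4)
  (bp_p 5) bp_e0 bp_y kap.
Definition bp_A : T -> R -> R := bApol (@bp_h R) (bp_p 1) (bp_p 2) (bp_p 3) (bp_p 4)
  (bp_p 5) bp_e0 kap.
Definition bp_B : T -> R -> R := bBpol (@bp_h R) (bp_p 1) (bp_p 2) (bp_p 3) (bp_p 4)
  (bp_p 5) bp_e0 kap.
Definition bp_dzeta : T -> R -> R := bdzeta (@bp_h R) (bp_p 1) (bp_p 2) (bp_p 3)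
  (bp_p 4) (bp_p 5) bp_e0 kap.
Definition bp_epol : T -> R -> R := bepol (bp_p 1) (bp_p 2) (bp_p 3)
  (bp_p 4) (bp_p 5) bp_e0.

(** A lower bound of f^(-1/2) common to the densities bounded by [C]. *)
Definition bp_emin : R := (Num.sqrt (`|C| + 1))^-1.

Lemma bp_emin_gt0 : 0 < bp_emin.
Proof. by rewrite invr_gt0 sqrtr_gt0 ltr_wpDl. Qed.

Section domain.
Context (hm : R) (hm1 : hm <= 1).
Local Notation D := (bp_dom hm).
Local Notation Oh := (bigOh D (@bp_h R)).

Lemma bp_h01 s : D s -> 0 <= bp_h s <= 1.
Proof. by move=> [_ _ /andP[h0 h1] _]; rewrite ltW// (le_trans h1). Qed.

Lemma bp_le s x : D s -> bp_f s x <= `|C| + 1.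
Proof.
by move=> [sf _ _ _]; have := sd_le sf x; have := ler_norm C; lra.
Qed.

Lemma bp_f0 s : D s -> 0 < bp_f s (bp_t s).
Proof. by move=> [_ fr _ _]; exact: lt_le_trans fr. Qed.

Lemma bp_isqrt s x : D s -> 0 < bp_f s x -> bp_emin <= (Num.sqrt (bp_f s x))^-1.
Proof.
move=> Ds fx; rewrite /bp_emin lef_pV2 ?posrE ?sqrtr_gt0//.
  by apply: ler_wsqrtr; exact: bp_le.
Qed.

Lemma bp_e0_ge s : D s -> bp_emin <= bp_e0 s.
Proof. by move=> Ds; apply: bp_isqrt => //; exact: bp_f0. Qed.

Lemma Oh_bp_p k : (k <= 6)%N -> Oh 0 (bp_p k).
Proof.
move=> k6; exists (`|C| / r0); first by rewrite divr_ge0// ltW.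
move=> s Ds; have [sf fr _ _] := Ds; rewrite expr0 mulr1 /bp_p normrM.
have f0 := bp_f0 Ds.
apply: ler_pM; [exact: normr_ge0|exact: normr_ge0| |].
  rewrite normrM normfV normr_nat ler_pdivrMr ?ltr0n ?fact_gt0//.
  apply: (le_trans (sd_bound sf k6 _)).
  apply: (le_trans (ler_norm C)); rewrite ler_peMr//.
  by rewrite ler1n fact_gt0.
by rewrite normfV gtr0_norm// lef_pV2 ?posrE.
Qed.

Lemma Oh_bp_e0 : Oh 0 bp_e0.
Proof.
exists (Num.sqrt r0)^-1; first by rewrite invr_ge0 sqrtr_ge0.
move=> s Ds; have [sf fr _ _] := Ds; have f0 := bp_f0 Ds.
rewrite expr0 mulr1 /bp_e0 gtr0_norm ?invr_gt0 ?sqrtr_gt0//.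
rewrite lef_pV2 ?posrE ?sqrtr_gt0//; exact: ler_wsqrtr.
Qed.

Lemma Oh_bp_y : Oh 1 bp_y.
Proof.
exists U => // s Ds; have [_ _ /andP[h0 _] uU] := Ds.
by rewrite /bp_y normrM expr1 mulrC [`|bp_h s|]gtr0_norm// ler_wpM2r// ltW.
Qed.

Let P1 := Oh_bp_p (isT : (1 <= 6)%N).
Let P2 := Oh_bp_p (isT : (2 <= 6)%N).
Let P3 := Oh_bp_p (isT : (3 <= 6)%N).
Let P4 := Oh_bp_p (isT : (4 <= 6)%N).
Let P5 := Oh_bp_p (isT : (5 <= 6)%N).

Lemma Oh_bp_zeta : Oh 1 bp_zeta.
Proof.
exact: (Ozeta bp_h01 kap P1 P2 P3 P4 P5 Oh_bp_e0 Oh_bp_y).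
Qed.

Lemma Oh_bp_epol : Oh 1 (fun s => bp_epol s (bp_zeta s) - bp_e0 s).
Proof.
have [ O1 O2 O3 O4 O5] := Obq P1 P2 P3 P4 P5.
have Oe := Oh_bp_e0; have Oz := Oh_bp_zeta.
have Oz0 := Oh_le bp_h01 (leq0n 1) Oz.
set q1 := bq1 _ in O1; set q2 := bq2 _ _ in O2; set q3 := bq3 _ _ _ in O3.
set q4 := bq4 _ _ _ _ in O4; set q5 := bq5 _ _ _ _ _ in O5.
have O : Oh 0 (fun s => pol6 (bp_e0 s * q1 s) (bp_e0 s * q2 s) (bp_e0 s * q3 s)
   (bp_e0 s * q4 s) (bp_e0 s * q5 s) 0 (bp_zeta s)).
  by apply: Oh_pol6; Ohbounded.
apply: Oh_ext (OhMr Oz O) => s _.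
by rewrite /bp_epol /bepol /pol6 -/(q1 s) -/(q2 s) -/(q3 s) -/(q4 s) -/(q5 s); ring.
Qed.

Let Ax := Obx bp_h01 kap P1 P2 P3 P4 P5 Oh_bp_e0.
Let AA := ObA bp_h01 kap P1 P2 P3 P4 P5 Oh_bp_e0.
Let Ab := Obb kap P1 P2 P3 P4 P5 Oh_bp_e0.

Let x0_e0 : Oh 1 (fun s => bx0 (@bp_h R) (bp_p 1) (bp_p 2) bp_e0 kap s - bp_e0 s).
Proof.
have [ O0 _ _ _] := Ab; have Oe := Oh_bp_e0.
have O : Oh 0 (fun s => bp_e0 s * bb0 (bp_p 1) (bp_p 2) bp_e0 kap s) by Ohbounded.
apply: (Oh_le bp_h01 (isT : (1 <= 2)%N)).
by apply: Oh_ext (OhMr (Oh_h bp_h01 2) O) => s _; rewrite /bx0; ring.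
Qed.

Lemma Oh_bp_A : Oh 1 (fun s => bp_A s (bp_y s) - bp_e0 s).
Proof.
have [ O1 O2 O3 O4 O5] := AA.
have Oy := Oh_bp_y; have Oy0 := Oh_le bp_h01 (leq0n 1) Oy.
have O : Oh 0 (fun s => pol6 (bA1 (@bp_h R) (bp_p 1) (bp_p 2) (bp_p 3) bp_e0 kap s)
   (bA2 (@bp_h R) (bp_p 1) (bp_p 2) (bp_p 3) (bp_p 4) bp_e0 kap s)
   (bA3 (@bp_h R) (bp_p 1) (bp_p 2) (bp_p 3) (bp_p 4) (bp_p 5) bp_e0 kap s)
   (bA4 (@bp_h R) (bp_p 1) (bp_p 2) (bp_p 3) (bp_p 4) (bp_p 5) bp_e0 kap s)
   (bA5 (@bp_h R) (bp_p 1) (bp_p 2) (bp_p 3) (bp_p 4) (bp_p 5) bp_e0 kap s)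
   0 (bp_y s)).
  by apply: Oh_pol6; Ohbounded.
by apply: Oh_ext (OhD x0_e0 (OhMr Oy O)) => s _; rewrite /bp_A /bApol /pol6; ring.
Qed.

Lemma Oh_bp_dzeta : Oh 1 (fun s => bp_dzeta s (bp_y s) - bp_e0 s).
Proof.
have [ O1 O2 O3 O4 O5] := AA.
have Oy := Oh_bp_y; have Oy0 := Oh_le bp_h01 (leq0n 1) Oy.
have O : Oh 0 (fun s => pol6 (2 * bA1 (@bp_h R) (bp_p 1) (bp_p 2) (bp_p 3) bp_e0 kap s)
   (3 * bA2 (@bp_h R) (bp_p 1) (bp_p 2) (bp_p 3) (bp_p 4) bp_e0 kap s)
   (4 * bA3 (@bp_h R) (bp_p 1) (bp_p 2) (bp_p 3) (bp_p 4) (bp_p 5) bp_e0 kap s)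
   (5 * bA4 (@bp_h R) (bp_p 1) (bp_p 2) (bp_p 3) (bp_p 4) (bp_p 5) bp_e0 kap s)
   (6 * bA5 (@bp_h R) (bp_p 1) (bp_p 2) (bp_p 3) (bp_p 4) (bp_p 5) bp_e0 kap s)
   0 (bp_y s)).
  by apply: Oh_pol6; Ohbounded.
by apply: Oh_ext (OhD x0_e0 (OhMr Oy O)) => s _; rewrite /bp_dzeta /bdzeta /pol6; ring.
Qed.

Lemma bp_bf0 s : D s -> bf0 bp_e0 s = bp_f s (bp_t s).
Proof.
move=> Ds; have f0 := bp_f0 Ds.
by rewrite /bf0 /bp_e0 exprVn sqr_sqrtr ?ltW// invrK.
Qed.

Lemma Oh_bp_B : Oh 0 (fun s => bp_B s (bp_y s)).
Proof.
have [ O1 O2 O3 O4 O5] := ObB bp_h01 kap P1 P2 P3 P4 P5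
  Oh_bp_e0 bp_emin_gt0 bp_e0_ge.
have Oy0 := Oh_le bp_h01 (leq0n 1) Oh_bp_y.
by apply: Oh_pol6 => //; exact: (Obf0 _ bp_emin_gt0 bp_e0_ge).
Qed.

Let Otaylor (a j : nat) (F : T -> R) : (a <= 6)%N -> (j + a <= 6)%N ->
  (forall s, D s -> F s = derive1n j (bp_f s) (bp_t s + bp_zeta s)) ->
  Oh a (fun s => F s - \sum_(i < a) derive1n (j + i) (bp_f s) (bp_t s) / (i`!)%:R
     * bp_zeta s ^+ i).
Proof.
move=> a6 ja HF; have [Z Z0 hZ] := OhX a Oh_bp_zeta.
exists (`|C| * Z); first by rewrite mulr_ge0.
move=> s Ds; have [sf _ _ _] := Ds; rewrite HF//.
apply: (@le_trans _ _ (`|C| * `|bp_zeta s| ^+ a)).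
  have := @taylor_bound R a (fun i => derive1n (j + i) (bp_f s)) `|C| (bp_t s) (bp_zeta s).
  rewrite addn0; apply.
    move=> i ia x; rewrite addnS; apply: (sd_derive sf).
    by apply: leq_trans ja; rewrite ltn_add2l.
  by move=> x; apply: (le_trans (sd_bound sf ja x)); exact: ler_norm.
by rewrite -mulrA ler_wpM2l// -normrX hZ.
Qed.

Let coefE k s : D s -> bf0 bp_e0 s * bp_p k s = derive1n k (bp_f s) (bp_t s) / (k`!)%:R.
Proof.
by move=> Ds; rewrite bp_bf0// /bp_p mulrC divfK// gt_eqF// bp_f0.
Qed.

Lemma bp_jF : jet D (@bp_h R) 6 bp_zeta (fun s => bp_f s (bp_t s + bp_zeta s))
  (bf0 bp_e0) (fun s => bf0 bp_e0 s * bp_p 1 s) (fun s => bf0 bp_e0 s * bp_p 2 s)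
  (fun s => bf0 bp_e0 s * bp_p 3 s) (fun s => bf0 bp_e0 s * bp_p 4 s)
  (fun s => bf0 bp_e0 s * bp_p 5 s).
Proof.
have Of0 := Obf0 (@bp_h R) bp_emin_gt0 bp_e0_ge.
split; [exact: Of0|exact: OhMl Of0 P1|exact: OhMl Of0 P2|
  exact: OhMl Of0 P3|exact: OhMl Of0 P4|exact: OhMl Of0 P5|].
have O := @Otaylor 6 0 (fun s => bp_f s (bp_t s + bp_zeta s)) isT isT.
have {}O := O (fun s _ => congr1 (fun g => g _) (esym (derive1n0 (bp_f s)))).
apply: Oh_ext O => s Ds; rewrite !(coefE _ Ds) (bp_bf0 Ds) /pol6.
rewrite !big_ord_recl big_ord0/= /bump/= ?addn0 ?add0n ?add1n ?addn1 derive1n0 fact0.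
set z := bp_zeta s; set t := bp_t s.
move: (derive1n 1 (bp_f s) t) (derive1n 2 (bp_f s) t) (derive1n 3 (bp_f s) t)
  (derive1n 4 (bp_f s) t) (derive1n 5 (bp_f s) t) => c1 c2 c3 c4 c5.
move: (bp_f s t) (bp_f s (t + z)) => c0 c6.
by rewrite !factS !fact0; field.
Qed.

Lemma bp_jF1 : jet D (@bp_h R) 4 bp_zeta
  (fun s => derive1n 1 (bp_f s) (bp_t s + bp_zeta s))
  (fun s => bf0 bp_e0 s * bp_p 1 s) (fun s => 2 * (bf0 bp_e0 s * bp_p 2 s))
  (fun s => 3 * (bf0 bp_e0 s * bp_p 3 s)) (fun s => 4 * (bf0 bp_e0 s * bp_p 4 s))
  (fun=> 0) (fun=> 0).
Proof.
have Of0 := Obf0 (@bp_h R) bp_emin_gt0 bp_e0_ge.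
have := (P1, P2, P3, P4, P5) => -[[[[P1' P2'] P3'] P4'] P5'].
split; [by Ohbounded|by Ohbounded|by Ohbounded|by Ohbounded|by Ohbounded|by Ohbounded|].
have O := @Otaylor 4 1 (fun s => derive1n 1 (bp_f s) (bp_t s + bp_zeta s)) isT isT.
apply: Oh_ext (O (fun _ _ => erefl)) => s Ds; rewrite !(coefE _ Ds) /pol6.
rewrite !big_ord_recl big_ord0/= /bump/= ?addn0 ?add0n ?add1n ?addn1.
set z := bp_zeta s; set t := bp_t s.
move: (derive1n 1 (bp_f s) t) (derive1n 2 (bp_f s) t) (derive1n 3 (bp_f s) t)
  (derive1n 4 (bp_f s) t) (derive1n 5 (bp_f s) t) => c1 c2 c3 c4 c5.
move: (derive1n _ (bp_f s) (t + z)) => c6.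
by rewrite !factS !fact0; field.
Qed.

Lemma bp_jF2 : jet D (@bp_h R) 4 bp_zeta
  (fun s => derive1n 2 (bp_f s) (bp_t s + bp_zeta s))
  (fun s => 2 * (bf0 bp_e0 s * bp_p 2 s))
  (fun s => 6 * (bf0 bp_e0 s * bp_p 3 s)) (fun s => 12 * (bf0 bp_e0 s * bp_p 4 s))
  (fun s => 20 * (bf0 bp_e0 s * bp_p 5 s)) (fun=> 0) (fun=> 0).
Proof.
have Of0 := Obf0 (@bp_h R) bp_emin_gt0 bp_e0_ge.
have := (P1, P2, P3, P4, P5) => -[[[[P1' P2'] P3'] P4'] P5'].
split; [by Ohbounded|by Ohbounded|by Ohbounded|by Ohbounded|by Ohbounded|by Ohbounded|].
have O := @Otaylor 4 2 (fun s => derive1n 2 (bp_f s) (bp_t s + bp_zeta s)) isT isT.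
apply: Oh_ext (O (fun _ _ => erefl)) => s Ds; rewrite !(coefE _ Ds) /pol6.
rewrite !big_ord_recl big_ord0/= /bump/= ?addn0 ?add0n ?add1n ?addn1.
set z := bp_zeta s; set t := bp_t s.
move: (derive1n 1 (bp_f s) t) (derive1n 2 (bp_f s) t) (derive1n 3 (bp_f s) t)
  (derive1n 4 (bp_f s) t) (derive1n 5 (bp_f s) t) => c1 c2 c3 c4 c5.
move: (derive1n _ (bp_f s) (t + z)) => c6.
by rewrite !factS !fact0; field.
Qed.

End domain.

End bias_families.

Section bias.
Context (R : realType) (K K1 L : R -> R) (A M : R).
Hypothesis kb : kernel_bounds K K1 L A M.

Let cK : continuous K := is_derive_continuous (kb_derive kb).
Let A1 := kb_A kb.
Let AA : - A <= A. Proof. by have := A1; lra. Qed.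

Lemma odd_moment j : odd j -> segint (- A) A (fun z : R => z ^+ j * K z) = 0.
Proof.
move=> oj; have cz : continuous (fun z : R => z ^+ j * K z) by apply: continuousM_fun; cont.
have := @segint_opp _ (- A) A (fun z : R => z ^+ j * K z) AA cz.
rewrite opprK => e.
have : segint (- A) A (fun z : R => z ^+ j * K z) = - segint (- A) A (fun z : R => z ^+ j * K z).
  rewrite {1}e -[RHS]mulN1r -segintZ//.
  apply: eq_segint => z _; rewrite (kb_even kb) exprNn -signr_odd oj expr1.
  by rewrite mulrA.
lra.
Qed.

Lemma moment_expansion (b0 b1 b2 b3 b4 b5 h U : R) : A <= U ->
  segint (- U) U (fun u => K u * pol6 b0 b1 b2 b3 b4 b5 (h * u)) =
  b0 + b2 * h ^+ 2 * segint (- A) A (fun z : R => z ^+ 2 * K z)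
     + b4 * h ^+ 4 * segint (- A) A (fun z : R => z ^+ 4 * K z).
Proof.
move=> AU; rewrite (@segint_widen _ (- A) A); [|lra|exact: AU|]; last first.
  by move=> x hx; rewrite (vanishes_out (kb_vanishes kb) hx) mul0r.
have cz j : continuous (fun z : R => z ^+ j * K z) by apply: continuousM_fun; cont.
have cc (c : R) j : continuous (fun z : R => c * (z ^+ j * K z)) by apply: continuousM_fun; cont.
rewrite (@eq_segint _ _ _ _ (fun z : R => b0 * (z ^+ 0 * K z) + (b1 * h) * (z ^+ 1 * K z)
  + (b2 * h ^+ 2) * (z ^+ 2 * K z) + (b3 * h ^+ 3) * (z ^+ 3 * K z)
  + (b4 * h ^+ 4) * (z ^+ 4 * K z) + (b5 * h ^+ 5) * (z ^+ 5 * K z))); last first.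
  by move=> x _; rewrite /pol6; ring.
rewrite !segintD//; do ?apply: continuousD_fun => //.
rewrite !segintZ// !(@odd_moment 1) ?(@odd_moment 3) ?(@odd_moment 5)//.
by rewrite (kb_mass kb); ring.
Qed.

Lemma is_derive_pol6 (a0 a1 a2 a3 a4 a5 y : R) :
  is_derive y 1 (fun y : R => y * pol6 a0 a1 a2 a3 a4 a5 y)
    (pol6 a0 (2 * a1) (3 * a2) (4 * a3) (5 * a4) (6 * a5) y).
Proof.
have step (g : R -> R) (dg a x : R) : is_derive x 1 g dg ->
    is_derive x 1 (fun y => a + y * g y) (g x + x * dg).
  move=> hg; apply: (isd_eq (isdD (isd_cst a x) (isdM (isd_id x) hg))).
  by ring.
have d5 := step (fun=> a5) 0 a4 y (isd_cst a5 y).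
have d4 := step _ _ a3 y d5.
have d3 := step _ _ a2 y d4.
have d2 := step _ _ a1 y d3.
have d1 := step _ _ a0 y d2.
apply: (isd_eq (isdM (isd_id y) d1)); rewrite /pol6; ring.
Qed.

Lemma continuous_pol6 (a0 a1 a2 a3 a4 a5 h : R) :
  continuous (fun u => pol6 a0 a1 a2 a3 a4 a5 (h * u)).
Proof.
have step (g : R -> R) a : continuous g -> continuous (fun u => a + h * u * g u).
  move=> cg; apply: (continuousD_fun (@continuous_cst R a)).
  exact: (continuousM_fun (continuousM_fun (@continuous_cst R h) (@continuous_id R)) cg).
exact: (step _ _ (step _ _ (step _ _ (step _ _ (step _ _ (@continuous_cst R a5)))))).
Qed.

Context (C r0 r1 rho : R).
Hypotheses (r10 : 0 < r1) (r1r0 : r1 < r0) (rho0 : 0 < rho).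
Let m2 := segint (- A) A (fun z : R => z ^+ 2 * K z).
Let m4 := segint (- A) A (fun z : R => z ^+ 4 * K z).
Hypothesis m20 : m2 != 0.
Let kap := m4 / (24 * m2).
(** Range of the substituted variable u. As A(h u) >= [bp_emin C] / 2, the first summand makes Z(h
    U) at least rho h, so that the image of [-U, U] covers the window; the second makes [-U, U]
    contain the support of [K]. *)
Let U := 2 * rho / bp_emin C + A.
Local Notation T := (bias_param R).
Local Notation zeta := (bp_zeta kap).

Let r00 : 0 < r0. Proof. exact: lt_trans r1r0. Qed.
Let em0 : 0 < bp_emin C := bp_emin_gt0 C.
Let U0 : 0 <= U.
Proof. by rewrite addr_ge0 ?divr_ge0 ?mulr_ge0 ?ltW//; have := A1; lra. Qed.
Let AU : A <= U. Proof. by rewrite lerDr divr_ge0 ?mulr_ge0 ?ltW. Qed.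

Let small : exists2 h0, 0 < h0 <= 1 & forall s, bp_dom C r0 U h0 s ->
  [/\ r1 <= bp_f s (bp_t s + zeta s),
      0 <= bp_epol s (zeta s),
      bp_emin C / 2 <= bp_A kap s (bp_y s) &
      bp_emin C / 2 <= bp_dzeta kap s (bp_y s)].
Proof.
have [Z Z0 hZ] := Oh_bp_zeta C kap r00 U0 (lexx 1).
have [Me Me0 hMe] := Oh_bp_epol C kap r00 U0 (lexx 1).
have [MA MA0 hMA] := Oh_bp_A C kap r00 U0 (lexx 1).
have [Md Md0 hMd] := Oh_bp_dzeta C kap r00 U0 (lexx 1).
have q1 : 0 < `|C| * Z + 1 by rewrite ltr_wpDl// mulr_ge0.
have q2 : 0 < Me + MA + Md + 1 by rewrite ltr_wpDl// !addr_ge0.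
(* The three terms ensure h <= 1, then f(t + Z) >= r1, then a distance at most [bp_emin C] / 2 from
   [bp_e0] for each of the three other quantities. *)
pose h0 := Num.min 1 (Num.min ((r0 - r1) / (`|C| * Z + 1)) (bp_emin C / 2 / (Me + MA + Md + 1))).
have h00 : 0 < h0.
  rewrite !lt_min ltr01 /=; apply/andP; split; first by rewrite divr_gt0 ?subr_gt0.
  by rewrite divr_gt0// divr_gt0.
have h01 : h0 <= 1 by rewrite ge_min lexx.
have h02 : (`|C| * Z + 1) * h0 <= r0 - r1.
  by rewrite mulrC -ler_pdivlMr// !ge_min lexx orbT.
have h03 : (Me + MA + Md + 1) * h0 <= bp_emin C / 2.
  by rewrite mulrC -ler_pdivlMr// !ge_min lexx !orbT.
exists h0; first by rewrite h00.
move=> s Ds; have [sf fr /andP[hs0 hs1] us] := Ds.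
have D1 : bp_dom C r0 U 1 s by split => //; rewrite hs0 (le_trans hs1).
have eA := bp_e0_ge r00 D1.
have bound (Mx e : R) : 0 <= Mx -> Mx <= Me + MA + Md ->
    `|e - bp_e0 s| <= Mx * bp_h s ^+ 1 -> bp_emin C / 2 <= e.
  move=> Mx0 Mxle; rewrite expr1 => he.
  have : Mx * bp_h s <= bp_emin C / 2.
    by apply: le_trans h03; rewrite ler_pM// ?(ltW hs0)//; lra.
  move: he; rewrite ler_norml => /andP[] *; lra.
split.
- have lf := sd_lip sf (isT : (0 < 6)%N); rewrite derive1n0 in lf.
  have := lf (bp_t s) (bp_t s + zeta s).
  have -> : `|bp_t s - (bp_t s + zeta s)| = `|zeta s| by rewrite opprD addNKr normrN.
  have := hZ s D1; rewrite expr1 => hz hf.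
  have h5 : C * `|zeta s| <= r0 - r1.
    apply: le_trans h02.
    apply: (@le_trans _ _ (`|C| * (Z * bp_h s))).
      by apply: ler_pM; rewrite ?normr_ge0 ?ler_norm//; exact: (lip_ge0 lf).
    rewrite mulrA; apply: ler_pM => //; [by rewrite mulr_ge0|exact: ltW|by rewrite lerDl].
  by have := ler_norm (bp_f s (bp_t s) - bp_f s (bp_t s + zeta s)); lra.
- have := bound Me (bp_epol s (zeta s)) Me0 _ (hMe s D1) => h4.
  by apply: le_trans (h4 _); [rewrite divr_ge0// ltW|lra].
- by apply: (bound MA) => //; [lra|exact: hMA].
- by apply: (bound Md) => //; [lra|exact: hMd].
Qed.

(** With x = t + Z(h u), the argument of [K] is, up to sign, u A gamma, and A gamma = 1 + O(h^6) by
    [phi_expansion]; the remaining factor gamma f Z' is then B + O(h^6) by [density_expansion]. *)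
Lemma bias_pointwise : exists2 h0, 0 < h0 <= 1 & 
  (forall s, bp_dom C r0 U h0 s ->
     bp_emin C / 2 <= bp_A kap s (bp_y s) /\ bp_emin C / 2 <= bp_dzeta kap s (bp_y s)) /\
  exists2 B, 0 <= B & forall s, bp_dom C r0 U h0 s ->
   `|K (bp_u s * bp_A kap s (bp_y s) * gamma_cut kap r1 (bp_h s) (bp_f s) (bp_t s + zeta s))
     * gamma_cut kap r1 (bp_h s) (bp_f s) (bp_t s + zeta s)
     * bp_f s (bp_t s + zeta s) * bp_dzeta kap s (bp_y s)
     - K (bp_u s) * bp_B kap s (bp_y s)| <= B * bp_h s ^+ 6.
Proof.
have [h1 /andP[h10 h11] hs1] := small.
have [h2 [g0 [G [/andP[h20 h21] g00 G0 hg]]]] := gamma_cut_bounds C kap r10.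
pose h0 := Num.min h1 h2.
have h00 : 0 < h0 by rewrite lt_min h10.
have h01 : h0 <= 1 by rewrite ge_min h11.
have sub s : bp_dom C r0 U h0 s -> bp_dom C r0 U h1 s.
  move=> [sf fr /andP[hs0 hs] us]; split => //; rewrite hs0 (le_trans hs)//.
  by rewrite ge_min lexx.
exists h0; first by rewrite h00.
split; first by move=> s /sub/hs1[].
pose D := bp_dom C r0 U h0.
pose F s := bp_f s (bp_t s + zeta s).
pose F1 s := derive1n 1 (bp_f s) (bp_t s + zeta s).
pose F2 s := derive1n 2 (bp_f s) (bp_t s + zeta s).
pose S s := (Num.sqrt (F s))^-1.
pose c := Num.min (bp_emin C) r1.
have c0 : 0 < c by rewrite lt_min em0.
have Fr s : D s -> r1 <= F s by move=> /sub/hs1[].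
have F0 s : D s -> 0 < F s by move=> Ds; exact: lt_le_trans (Fr s Ds).
have ce0 s : D s -> c <= bp_e0 s by move=> Ds; rewrite ge_min (bp_e0_ge r00 Ds).
have cF s : D s -> c <= F s by move=> Ds; rewrite ge_min Fr ?orbT.
have cS s : D s -> c <= S s by move=> Ds; rewrite ge_min (bp_isqrt Ds (F0 s Ds)).
have SF s : D s -> S s ^+ 2 = (F s)^-1.
  by move=> Ds; rewrite /S exprVn sqr_sqrtr// ltW// F0.
have ep0 s : D s -> 0 <= bp_epol s (zeta s) by move=> /sub/hs1[].
have hD := @bp_h01 _ C r0 U h0 h01.
have P1 := Oh_bp_p C U r00 h0 (isT : (1 <= 6)%N).
have P2 := Oh_bp_p C U r00 h0 (isT : (2 <= 6)%N).
have P3 := Oh_bp_p C U r00 h0 (isT : (3 <= 6)%N).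
have P4 := Oh_bp_p C U r00 h0 (isT : (4 <= 6)%N).
have P5 := Oh_bp_p C U r00 h0 (isT : (5 <= 6)%N).
have Oe := Oh_bp_e0 C U r00 h0.
have Oy := Oh_bp_y C r0 U0 h0.
have jF := bp_jF C kap r00 U0 h01.
have jF1 := bp_jF1 C kap r00 U0 h01.
have jF2 := bp_jF2 C kap r00 U0 h01.
have e1 := phi_expansion hD P1 P2 P3 P4 P5 Oe Oy c0 ce0 cF cS SF ep0 jF jF1 jF2.
have e2 := density_expansion hD P1 P2 P3 P4 P5 Oe Oy c0 ce0 jF.
have OB := Oh_bp_B C kap r00 U0 h01.
pose gam s := gamma_cut kap r1 (bp_h s) (bp_f s) (bp_t s + zeta s).
have gG s : D s -> g0 <= gam s <= G /\ 2^-1 <= 1 + bp_h s ^+ 2 * beta_cut kap r1 (bp_f s) (bp_t s + zeta s).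
  move=> [sf fr /andP[hs0 hs] us].
  have hh : 0 <= bp_h s <= h2 by rewrite ltW//= (le_trans hs)// ge_min lexx orbT.
  by have [h3 h4 _ _] := hg _ _ sf hh; split; [exact: h3|exact: h4].
have Ogam : bigOh D (@bp_h R) 0 gam.
  exists G; first exact: ltW.
  move=> s /gG[/andP[g1 g2] _]; rewrite expr0 mulr1 ger0_norm//.
  by apply: le_trans g1; exact: ltW.
(* An exact identity: f(t + Z) >= r1 makes the clipping inactive. *)
have gphi s : D s -> gam s * bphi (@bp_h R) kap F F1 F2 S s = 1.
  move=> Ds; have [_ d1] := gG s Ds.
  have d0 : 0 < 1 + bp_h s ^+ 2 * beta_cut kap r1 (bp_f s) (bp_t s + zeta s).
    by apply: lt_le_trans d1; lra.
  have ec : flr r1 (bp_f s) (bp_t s + zeta s) = F s by exact: flrE (Fr s Ds).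
  have eb : beta_cut kap r1 (bp_f s) (bp_t s + zeta s) = bbeta kap F F1 F2 s.
    by rewrite /beta_cut ec.
  rewrite /gam /gamma_cut /bphi ec eb /S in d0 *.
  by field; rewrite gt_eqF ?sqrtr_gt0 ?F0// gt_eqF.
have E2 : bigOh D (@bp_h R) 6 (fun s => bp_A kap s (bp_y s) * gam s - 1).
  apply: Oh_ext (OhMl Ogam (OhN e1)) => s Ds.
  have e := gphi s Ds.
  rewrite -[LHS]/(gam s * - (bphi (@bp_h R) kap F F1 F2 S s - bp_A kap s (bp_y s))).
  by rewrite opprB mulrBr e mulrC.
have E1 : bigOh D (@bp_h R) 6 (fun s => gam s * F s * bp_dzeta kap s (bp_y s) - bp_B kap s (bp_y s)).
  apply: Oh_ext (OhD (OhMl Ogam e2) (OhMr E2 OB)) => s Ds.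
  rewrite -[LHS]/(gam s * (F s * bp_dzeta kap s (bp_y s)
     - bp_A kap s (bp_y s) * bp_B kap s (bp_y s))
     + (bp_A kap s (bp_y s) * gam s - 1) * bp_B kap s (bp_y s)).
  by ring.
have OK : bigOh D (@bp_h R) 0 (fun s => K (bp_u s * bp_A kap s (bp_y s) * gam s)).
  exists M; first exact: (kb_M kb).
  by move=> s _; rewrite expr0 mulr1; exact: (kb_bound kb).
have OuE : bigOh D (@bp_h R) 6 (fun s => K (bp_u s * bp_A kap s (bp_y s) * gam s) - K (bp_u s)).
  have [N N0 hN] := E2; exists (M * (U * N)).
    by rewrite !mulr_ge0// (kb_M kb).
  move=> s Ds; have [_ _ _ us] := Ds.
  apply: (le_trans (kb_lip kb _ _)); rewrite -!mulrA ler_wpM2l ?(kb_M kb)//.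
  have -> : bp_u s * (bp_A kap s (bp_y s) * gam s) - bp_u s =
     bp_u s * (bp_A kap s (bp_y s) * gam s - 1) by ring.
  rewrite normrM ler_pM//; exact: hN.
have [B B0 hB] := OhD (OhMl OK E1) (OhMr OuE OB).
exists B => // s Ds; apply: le_trans (hB s Ds).
rewrite le_eqVlt; apply/orP; left; apply/eqP; congr (`|_|).
by rewrite /gam /F; ring.
Qed.

Lemma bias_bound : exists2 h0, 0 < h0 <= 1 & exists2 B, 0 <= B &
  forall f t h, smooth_densities C 6 f -> r0 <= f t -> 0 < h <= h0 ->
  (forall x, rho * h <= `|x - t| -> K ((t - x) / h * gamma_cut kap r1 h f x) = 0) ->
  `|h^-1 * segint (t - rho * h) (t + rho * h) (fun x =>
      K ((t - x) / h * gamma_cut kap r1 h f x) * gamma_cut kap r1 h f x * f x)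
    - f t| <= B * h ^+ 6.
Proof.
have [h1 /andP[h10 h11] [hA [B B0 hB]]] := bias_pointwise.
have [h2 [g0 [G [/andP[h20 h21] g00 G0 hg]]]] := gamma_cut_bounds C kap r10.
pose h0 := Num.min h1 h2.
have h00 : 0 < h0 by rewrite lt_min h10.
have h01 : h0 <= 1 by rewrite ge_min h11.
have D1 := @bp_h01 _ C r0 U h1 h11.
have P1 := Oh_bp_p C U r00 h1 (isT : (1 <= 6)%N).
have P2 := Oh_bp_p C U r00 h1 (isT : (2 <= 6)%N).
have P3 := Oh_bp_p C U r00 h1 (isT : (3 <= 6)%N).
have P4 := Oh_bp_p C U r00 h1 (isT : (4 <= 6)%N).
have P5 := Oh_bp_p C U r00 h1 (isT : (5 <= 6)%N).
have Oe := Oh_bp_e0 C U r00 h1.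
have [B2 B20 hB2] := bB2_expansion D1 kap P1 P2 P3 P4 P5 Oe em0 (fun s ds => bp_e0_ge r00 ds).
have [B4 B40 hB4] := bB4_expansion D1 kap P1 P2 P3 P4 P5 Oe em0 (fun s ds => bp_e0_ge r00 ds).
exists h0; first by rewrite h00.
exists (B * (U - - U) + (B2 * `|m2| + B4 * `|m4|)).
  by rewrite !addr_ge0 ?mulr_ge0// opprK addr_ge0.
move=> f t h sf ft /andP[hp hh0] Kvan.
have hh1 : h <= h1 by apply: (le_trans hh0); rewrite ge_min lexx.
have hh2 : h <= h2 by apply: (le_trans hh0); rewrite ge_min lexx orbT.
have hh : 0 <= h <= h2 by rewrite ltW.
have [_ _ _ lg] := hg _ _ sf hh.
have cg := lip_continuous lg.
have cf := sd_continuous sf.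
pose s u := BiasParam f t h u.
have Ds u : `|u| <= U -> bp_dom C r0 U h1 (s u) by move=> uU; split => //=; rewrite hp.
have DsU u : - U <= u <= U -> bp_dom C r0 U h1 (s u) by rewrite -ler_norml; exact: Ds.
pose Psi x := K ((t - x) / h * gamma_cut kap r1 h f x) * gamma_cut kap r1 h f x * f x.
have cPsi : continuous Psi.
  rewrite /Psi; apply: continuousM_fun => //; apply: continuousM_fun => //.
  apply: continuous_compose => //; apply: continuousM_fun => //.
  by apply: continuousM_fun; cont.
have zE u : zeta (s u) = (h * u) * bp_A kap (s 0) (h * u) by [].
pose X u := t + zeta (s u).
pose X' (u : R) : R := h * bp_dzeta kap (s 0) (h * u).
have dX (u : R) : is_derive u 1 X (X' u).
  have daff : is_derive u 1 (fun u : R => h * u) h.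
    by apply: (isd_eq (isdM (isd_cst h u) (isd_id u))); ring.
  have d1 := @is_derive_pol6 (bx0 (@bp_h R) (bp_p 1) (bp_p 2) (@bp_e0 R) kap (s 0))
    (bA1 (@bp_h R) (bp_p 1) (bp_p 2) (bp_p 3) (@bp_e0 R) kap (s 0))
    (bA2 (@bp_h R) (bp_p 1) (bp_p 2) (bp_p 3) (bp_p 4) (@bp_e0 R) kap (s 0))
    (bA3 (@bp_h R) (bp_p 1) (bp_p 2) (bp_p 3) (bp_p 4) (bp_p 5) (@bp_e0 R) kap (s 0))
    (bA4 (@bp_h R) (bp_p 1) (bp_p 2) (bp_p 3) (bp_p 4) (bp_p 5) (@bp_e0 R) kap (s 0))
    (bA5 (@bp_h R) (bp_p 1) (bp_p 2) (bp_p 3) (bp_p 4) (bp_p 5) (@bp_e0 R) kap (s 0))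
    (h * u).
  apply: (isd_eq (isdD (isd_cst t u) (@isd_comp _ _ (fun u => h * u) _ _ u d1 daff))).
  by rewrite add0r mulrC.
have cX' : continuous X'.
  by apply: continuousM_fun; [exact: continuous_cst|exact: continuous_pol6].
have X'0 u : - U <= u <= U -> 0 < X' u.
  move=> /DsU/hA[_ hd]; rewrite mulr_gt0// (lt_le_trans _ hd)// divr_gt0//.
have incr x y : - U <= x <= U -> - U <= y <= U -> x < y -> X x < X y.
  move=> /andP[x1 x2] /andP[y1 y2] xy; have [xi /andP[]] := mvt x y dX.
  rewrite min_l ?max_r ?(ltW xy)// => k1 k2 e.
  by rewrite -subr_gt0 e mulr_gt0 ?subr_gt0// X'0// (le_trans x1 k1) (le_trans k2 y2).
have UU : - U <= U by have := U0; lra.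
have key u : - U <= u <= U -> h * (bp_emin C / 2) <= h * bp_A kap (s u) (h * u).
  by move=> /DsU/hA[ha _]; rewrite ler_wpM2l// ltW.
have Uem : rho <= U * (bp_emin C / 2).
  rewrite /U mulrDl; have -> : 2 * rho / bp_emin C * (bp_emin C / 2) = rho.
    by field; rewrite gt_eqF.
  by rewrite lerDl mulr_ge0 ?divr_ge0 ?ltW//; have := A1; lra.
(* The window lies in [X(-U), X(U)] and the integrand vanishes outside it, so that the integral may
   be extended to that segment before substituting. *)
have XU : t + rho * h <= X U.
  rewrite lerD2l zE.
  have hu : - U <= U <= U by rewrite UU lexx.
  have k := key U hu.
  have -> : h * U * bp_A kap (s 0) (h * U) = U * (h * bp_A kap (s U) (h * U)).
    by rewrite mulrA [U * h]mulrC.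
  apply: le_trans (ler_wpM2l U0 k); rewrite mulrCA mulrC ler_wpM2l// ltW//.
have XNU : X (- U) <= t - rho * h.
  rewrite lerD2l zE.
  have hu : - U <= - U <= U by rewrite UU lexx.
  have k := key (- U) hu.
  have -> : h * - U * bp_A kap (s 0) (h * - U) = - (U * (h * bp_A kap (s (- U)) (h * - U))).
    by rewrite mulrN mulNr mulrA [U * h]mulrC.
  rewrite lerN2; apply: le_trans (ler_wpM2l U0 k); rewrite mulrCA mulrC ler_wpM2l// ltW//.
have PsiV x : ~~ (t - rho * h <= x <= t + rho * h) -> Psi x = 0.
  move=> hx; rewrite /Psi Kvan ?mul0r//.
  move: hx; rewrite negb_and -!ltNge => /orP[hx|hx].
    by have := ler_norm (- (x - t)); rewrite normrN; lra.
  by have := ler_norm (x - t); lra.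
rewrite -/Psi -(segint_widen XNU XU PsiV).
rewrite (segint_substitution UU dX cX' cPsi incr) -segintZ; last first.
  apply: continuousM_fun => //; apply: continuous_compose => //.
  exact: is_derive_continuous dX.
pose BK u := K u * bp_B kap (s 0) (h * u).
have cBK : continuous BK.
  by apply: continuousM_fun => //; exact: continuous_pol6.
have cPX : continuous (fun u => h^-1 * (Psi (X u) * X' u)).
  apply: continuousM_fun; first exact: continuous_cst.
  apply: continuousM_fun => //; apply: continuous_compose => //.
  exact: is_derive_continuous dX.
have step1 : `|segint (- U) U (fun u => h^-1 * (Psi (X u) * X' u)) - segint (- U) U BK|
    <= B * h ^+ 6 * (U - - U).
  rewrite -segintB//; apply: segint_bound => //; first exact: continuousB_fun.
  move=> u /DsU du; have := hB (s u) du; apply: le_trans.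
  rewrite le_eqVlt; apply/orP; left; apply/eqP; congr (`|_|); congr (_ - _).
  have harg : K ((t - X u) / h * gamma_cut kap r1 h f (X u)) =
     K (u * bp_A kap (s u) (h * u) * gamma_cut kap r1 h f (X u)).
    rewrite -(kb_even kb); congr K; rewrite /X zE -/(bp_A kap (s u) (h * u)).
    by rewrite -[bp_A kap (s 0) (h * u)]/(bp_A kap (s u) (h * u)); field; rewrite gt_eqF.
  rewrite /Psi harg /X' -[bp_dzeta kap (s 0) (h * u)]/(bp_dzeta kap (s u) (bp_y (s u))).
  rewrite /= -/(X u) -[bp_y (s u)]/(h * u); field; by rewrite gt_eqF.
have -> : segint (- U) U (fun u => h^-1 * (Psi (X u) * X' u)) - f t =
   (segint (- U) U (fun u => h^-1 * (Psi (X u) * X' u)) - segint (- U) U BK)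
   + (segint (- U) U BK - f t) by ring.
rewrite (le_trans (ler_normD _ _))// mulrDl lerD//.
  by rewrite mulrAC.
have d0 : bp_dom C r0 U h1 (s 0) by apply: Ds; rewrite normr0.
have := hB2 _ d0; have := hB4 _ d0.
rewrite /BK /bp_B /bBpol moment_expansion// -/m2 -/m4 (bp_bf0 r00 d0) /=.
set b2 := bB2 _ _ _ _ _ _ _ _; set b4 := bB4 _ _ _ _ _ _ _ _ _.
rewrite /bb2; set w4 := bw4 _ _ _ _ _; set e0 := bp_e0 _.
move=> k4 k2.
(* The main parts 2 bb2 m2 and e0^2 w4 m4 of the h^4 term cancel, because bb2 = - 12 kap e0^2 w4 and
   24 kap m2 = m4. *)
have -> : f t + b2 * h ^+ 2 * m2 + b4 * h ^+ 4 * m4 - f t =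
  (b2 - 2 * h ^+ 2 * (- (kap * 12) * e0 ^+ 2 * w4)) * h ^+ 2 * m2
   + (b4 - e0 ^+ 2 * w4) * h ^+ 4 * m4.
  by rewrite /kap; field; rewrite m20.
apply: (le_trans (ler_normD _ _)); rewrite [leRHS]mulrDl; apply: lerD.
  rewrite 2!normrM [`|h ^+ 2|]ger0_norm ?exprn_ge0 ?(ltW hp)//.
  apply: (@le_trans _ _ (B2 * h ^+ 4 * h ^+ 2 * `|m2|)).
    by rewrite ler_wpM2r// ler_wpM2r// exprn_ge0// ltW.
  by rewrite le_eqVlt; apply/orP; left; apply/eqP; ring.
rewrite 2!normrM [`|h ^+ 4|]ger0_norm ?exprn_ge0 ?(ltW hp)//.
apply: (@le_trans _ _ (B4 * h ^+ 2 * h ^+ 4 * `|m4|)).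
  by rewrite ler_wpM2r// ler_wpM2r// exprn_ge0// ltW.
by rewrite le_eqVlt; apply/orP; left; apply/eqP; ring.
Qed.

End bias.

(** * Uniform almost sure order *)

Section esup0_theory.
Context (R : realType).
Implicit Types (A : set (\bar R)).

Lemma esup0_ge0 A : (forall x, A x -> 0 <= x)%E -> (0 <= esup0 A)%E.
Proof.
move=> A0; rewrite /esup0; case: ifPn => // /set0P[x Ax].
by apply: ereal_sup_ge; exists x => //; exact: A0.
Qed.

Lemma esup0_le A (M : \bar R) : (0 <= M)%E -> (forall x, A x -> x <= M)%E ->
  (esup0 A <= M)%E.
Proof.
by move=> M0 AM; rewrite /esup0; case: ifPn => // _; apply: ge_ereal_sup => x; exact: AM.
Qed.

Lemma esup0_ub A x : A x -> (x <= esup0 A)%E.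
Proof.
move=> Ax; rewrite /esup0 ifF; first exact: ereal_sup_ubound.
by apply/negbTE/set0P; exists x.
Qed.

(** Since the functions are non-negative, extending the family by 0 outside [N] does not change the
    supremum, even for empty [N]; a supremum over all integers remains. *)
Lemma measurable_esup0 d (T : measurableType d) (N : set nat) (Y : nat -> T -> \bar R) :
  (forall n, measurable_fun setT (Y n)) -> (forall n x, 0 <= Y n x)%E ->
  measurable_fun setT (fun x => esup0 [set Y n x | n in N]).
Proof.
move=> mY Y0.
pose Z n x := if n \in N then Y n x else 0%E.
have mZ n : measurable_fun setT (Z n) by rewrite /Z; case: (n \in N).
have Z0 n x : (0 <= Z n x)%E by rewrite /Z; case: ifP.
have e x : esup0 [set Y n x | n in N] = esups (Z ^~ x) 0%N.
  rewrite /esups/=.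
  apply/eqP; rewrite eq_le; apply/andP; split.
    apply: esup0_le.
      by apply: ereal_sup_ge; exists (Z 0%N x) => //; exists 0%N.
    move=> _ [n Nn <-]; apply: ereal_sup_ubound; exists n => //.
    by rewrite /Z mem_set.
  apply: ge_ereal_sup => _ [n _ <-]; rewrite /Z; case: ifPn => [|_].
    by rewrite inE => Nn; apply: esup0_ub; exists n.
  by apply: esup0_ge0 => _ [m _ <-].
under eq_fun do rewrite e.
exact: measurable_fun_esups.
Qed.

End esup0_theory.

Section almost_sure_order.
Context (R : realType).
Local Notation S := (sampleSpace R).

Lemma measurable_sample n : measurable_fun setT (@sample R n).
Proof.
apply/measurable_fun_tnthP => i.
rewrite (_ : _ \o _ = @obs R i); first exact: measurable_obs.
by apply/funext => X; rewrite /= /sample tnth_mktuple.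
Qed.

Lemma union_tail_bound (P : probability S R) (Bad : nat -> set S) (c : R) k :
  0 <= c -> (0 < k)%N -> (forall n, measurable (Bad n)) ->
  (forall n, (k <= n)%N -> (P (Bad n) <= (c / n%:R ^+ 2)%:E)%E) ->
  (P (\bigcup_n Bad (k + n)%N) <= (2 * c / k%:R)%:E)%E.
Proof.
move=> c0 k0 mB PB.
apply: (@le_trans _ _ (\sum_(0 <= n <oo) P (Bad (k + n)%N))%E).
  apply: (@measure_sigma_subadditive _ _ _ P _ (fun n => Bad (k + n)%N)) => //.
  by apply: bigcupT_measurable => n; exact: mB.
apply: lime_le; first by apply: is_cvg_nneseries => n _ _; exact: measure_ge0.
apply: nearW => N.
(* c / x^2 <= 2c / x - 2c / (x + 1) for x >= 1, and the right-hand sides telescope. *)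
have h (n : nat) : (P (Bad (k + n)%N) <= (2 * c / (k + n)%:R - 2 * c / (k + n).+1%:R)%:E)%E.
  apply: (le_trans (PB _ (leq_addr _ _))); rewrite lee_fin.
  have kn0 : 0 < (k + n)%:R :> R by rewrite ltr0n addn_gt0 k0.
  have kn1 : 1 <= (k + n)%:R :> R by rewrite ler1n addn_gt0 k0.
  rewrite -[(k + n).+1%:R]natr1; set x := (k + n)%:R in kn0 kn1 *.
  have -> : 2 * c / x - 2 * c / (x + 1) = c / x ^+ 2 * (2 * x / (x + 1)).
    by field; rewrite !gt_eqF//; lra.
  rewrite ler_peMr ?divr_ge0 ?exprn_ge0 ?(ltW kn0)//.
  by rewrite ler_pdivlMr; lra.
apply: (@le_trans _ _ (\sum_(0 <= n < N) (2 * c / (k + n)%:R - 2 * c / (k + n).+1%:R)%:E)%E).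
  by apply: lee_sum => n _; exact: h.
rewrite sumEFin lee_fin.
have -> : \sum_(0 <= n < N) (2 * c / (k + n)%:R - 2 * c / (k + n).+1%:R) =
    2 * c / k%:R - 2 * c / (k + N)%:R :> R.
  elim: N => [|N ih]; first by rewrite big_geq// addn0 subrr.
  by rewrite big_nat_recr//= ih addnS; ring.
by rewrite lerBlDr lerDl !mulr_ge0// invr_ge0.
Qed.

(** The event that some bad event occurs at or after time k has probability O(1/k), uniformly in
    [f]; outside it the bound holds for all n >= k at once. *)
Lemma uniform_Oas_intro (Pr : (R -> R) -> probability S R) (D : set (R -> R))
    (Z : forall n, (R -> R) -> n.-tuple R -> \bar R) (a : nat -> R)
    (Bad : (R -> R) -> nat -> set S) (c M : R) (n0 : nat) :
  0 <= c -> 0 <= M ->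
  (forall n f, D f -> measurable_fun setT (Z n f)) ->
  (forall f n, D f -> measurable (Bad f n)) ->
  (forall f n, D f -> (n0 <= n)%N -> (Pr f (Bad f n) <= (c / n%:R ^+ 2)%:E)%E) ->
  (forall n, 0 <= a n) ->
  (forall f n X, D f -> (n0 <= n)%N -> ~ Bad f n X ->
     (`|Z n f (sample n X)| <= (M * a n)%:E)%E) ->
  uniform_Oas Pr D Z a.
Proof.
move=> c0 M0 mZ mB PB a0 ZM; split => //; exists M.
pose Y f n (X : S) := (((a n)^-1)%:E * `|Z n f (sample n X)|)%E.
have Y0 f n X : (0 <= Y f n X)%E.
  by rewrite mule_ge0// lee_fin invr_ge0.
have meas f k : D f -> measurable [set X | (M%:E < esup0
    [set Y f n X | n in [set n | (k <= n)%N]])%E].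
  move=> Df.
  have mY n : measurable_fun setT (Y f n).
    have mZs := measurableT_comp (mZ n f Df) (@measurable_sample n).
    apply: emeasurable_funM; first exact: measurable_cst.
    exact: (measurableT_comp (@abse_measurable _ setT) mZs).
  have me := @measurable_esup0 R _ S [set n | (k <= n)%N] (Y f) mY (Y0 f).
  pose g (x : S) := esup0 [set Y f n x | n in [set n | (k <= n)%N]].
  have {}me : measurable_fun setT g by exact: me.
  rewrite (_ : [set X | _] = g @^-1` `]M%:E, +oo[%classic); last first.
    by apply/seteqP; split => X /=; rewrite in_itv/= andbT.
  by rewrite -[X in measurable X]setTI; apply: me => //; exact: emeasurable_itv.
have bound f k : D f -> (maxn n0 1 <= k)%N ->
    (Pr f [set X | (M%:E < esup0 [set Y f n X | n in [set n | (k <= n)%N]])%E] <=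
     (2 * c / k%:R)%:E)%E.
  move=> Df; rewrite geq_max => /andP[nk k0].
  have hB n : measurable (Bad f n) by exact: mB.
  have hP n : (k <= n)%N -> (Pr f (Bad f n) <= (c / n%:R ^+ 2)%:E)%E.
    by move=> kn; apply: PB => //; exact: leq_trans kn.
  apply: le_trans (union_tail_bound c0 k0 hB hP).
  apply: le_measure; rewrite ?inE; first exact: meas.
    by apply: bigcupT_measurable => n; exact: mB.
  move=> X /= MX; apply: contrapT => nB.
  suff : (esup0 [set Y f n X | n in [set n | (k <= n)%N]] <= M%:E)%E.
    by rewrite leNgt MX.
  apply: esup0_le; first by rewrite lee_fin.
  move=> _ [n /= kn <-].
  have nBn : ~ Bad f n X.
    by move=> BX; apply: nB; exists (n - k)%N => //; rewrite subnKC.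
  have := ZM f n X Df (leq_trans nk kn) nBn.
  (* If a_n = 0, its inverse is 0 by convention and the normalized quantity vanishes. *)
  have := a0 n; rewrite le_eqVlt => /predU1P[an|an] h.
    by rewrite /Y -an invr0 mul0e lee_fin.
  rewrite /Y muleC lee_pdivrMr//.
pose u k := esup0 [set Pr f [set X | (M%:E < esup0
    [set Y f n X | n in [set n | (k <= n)%N]])%E] | f in D].
change (u @ \oo --> 0%E).
apply: (@squeeze_cvge _ _ _ _ (fun=> 0%E) _ (fun k => (4 * c * harmonic k)%:E)).
- near=> k; apply/andP; split.
    by apply: esup0_ge0 => _ [f _ <-]; exact: measure_ge0.
  have k1 : (maxn n0 1 <= k)%N by near: k; exact: nbhs_infty_ge.
  have k0 : (0 < k)%N by move: k1; rewrite geq_max => /andP[].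
  have kh : 0 <= @harmonic R k by rewrite /harmonic invr_ge0.
  apply: esup0_le; first by rewrite lee_fin !mulr_ge0.
  move=> _ [f Df <-]; apply: (le_trans (bound f k Df k1)); rewrite lee_fin.
  (* [harmonic k] is 1 / (k + 1), hence at least 1 / (2 k). *)
  have -> : 2 * c / k%:R = 4 * c * (2^-1 / k%:R) by field; rewrite pnatr_eq0 -lt0n.
  rewrite ler_wpM2l ?mulr_ge0// /harmonic -invfM lef_pV2 ?posrE ?mulr_gt0 ?ltr0n//.
  by rewrite -natrM ler_nat; lia.
- exact: cvg_cst.
- apply: cvg_EFin; first exact: nearW.
  rewrite (_ : fine \o _ = (fun k => 4 * c * @harmonic R k))//.
  rewrite -[X in _ --> X](mulr0 (4 * c)); apply: cvgMr; exact: cvg_harmonic.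
Unshelve. all: by end_near. Qed.

End almost_sure_order.

(** * Bad events *)

Section log_over_n.
Context (R : realType).

Definition eps (n : nat) : R := ln (n%:R : R) / n%:R.

Lemma ln_ge1 : exists n0 : nat, (0 < n0)%N /\ forall n, (n0 <= n)%N -> 1 <= ln (n%:R : R).
Proof.
exists (Num.truncn (expR 1 : R)).+1; split => // n hn.
have e0 : 0 < expR 1 :> R by exact: expR_gt0.
have h : expR 1 <= n%:R :> R.
  apply: le_trans (ltW (truncnS_gt _)) _.
  by rewrite ler_nat.
by rewrite -[leLHS](expRK 1) ler_ln ?posrE ?(lt_le_trans e0).
Qed.

(** ln n = 2 ln (sqrt n) <= 2 sqrt n gives eps n <= 2 / sqrt n. *)
Lemma eps_small (d : R) : 0 < d -> exists n0 : nat, forall n, (n0 <= n)%N -> eps n <= d.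
Proof.
move=> d0; exists (Num.truncn (4 / d ^+ 2)).+1 => n hn.
have n0 : 0 < n%:R :> R by rewrite ltr0n (leq_trans _ hn).
have h : 4 / d ^+ 2 <= n%:R.
  apply: le_trans (ltW (truncnS_gt _)) _.
  by rewrite ler_nat.
pose s := Num.sqrt (n%:R : R).
have s0 : 0 < s by rewrite sqrtr_gt0.
have sn : s ^+ 2 = n%:R by rewrite sqr_sqrtr// ltW.
have lns : ln s <= s.
  have := @ln_sublinear R s s0; exact: ltW.
rewrite /eps -sn expr2 lnM ?posrE// -expr2 ler_pdivrMr ?exprn_gt0//.
have sd : 2 <= d * s.
  have ds0 : 0 <= d * s by rewrite mulr_ge0 // ltW.
  rewrite -(@ler_pXn2r _ 2) ?nnegrE // exprMn sn mulrC.
  rewrite ler_pdivrMr ?exprn_gt0// in h.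
  by apply: le_trans h; rewrite -natrX.
by rewrite expr2; nra.
Qed.

Lemma eps_ge_inv n : 1 <= ln (n%:R : R) -> n%:R^-1 <= eps n.
Proof. by move=> h; rewrite /eps ler_peMl// invr_ge0. Qed.

Lemma log_rate_eps e n : log_rate e n = eps n `^ e.
Proof. by []. Qed.

End log_over_n.

Section deviations.
Context (R : realType).
Local Notation S := (sampleSpace R).
Implicit Types (P : probability S R).

Lemma finite_union_bound P (A : nat -> set S) (c : R) n :
  (forall i, measurable (A i)) -> (forall i, (i < n)%N -> (P (A i) <= c%:E)%E) ->
  (P (\bigcup_(i in [set i | (i < n)%N]) A i) <= (n%:R * c)%:E)%E.
Proof.
move=> mA; elim: n => [|n ih] PA.
  rewrite (_ : [set i | _] = set0) ?bigcup_set0 ?measure0 ?mul0r//.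
  by apply/seteqP; split.
have mU m : measurable (\bigcup_(i in [set i | (i < m)%N]) A i).
  exact: bigcup_measurable.
have -> : \bigcup_(i in [set i | (i < n.+1)%N]) A i =
    \bigcup_(i in [set i | (i < n)%N]) A i `|` A n.
  apply/seteqP; split => X.
    move=> [i /=]; rewrite ltnS leq_eqVlt => /orP[/eqP ->|ilt] AX; first by right.
    by left; exists i.
  move=> [[i /= ilt AX]|AX]; last by exists n => /=.
  by exists i => //=; rewrite ltnW.
apply: (le_trans (measureU2 _ (mU n) (mA n))).
rewrite -natr1 mulrDl mul1r EFinD; apply: leeD; last exact: PA.
by apply: ih => i ilt; apply: PA; rewrite ltnW.
Qed.

Definition kernel_mean P (Q : R -> R) (hh x : R) : R :=
  \int[law P]_y Q ((x - y) / hh).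

Definition kernel_dev P n (Q : R -> R) (hh : R) (X : S) (i : nat) : R :=
  \sum_(j < n | j != i :> nat)
     (Q ((obs i X - obs j X) / hh) - kernel_mean P Q hh (obs i X)).

(** The sum has variance O(n hh); the threshold is of order n sqrt(hh eps) = sqrt(n hh log n), the
    standard deviation enlarged by the factor sqrt(log n) that yields a power of n in the
    probability. *)
Definition bad_kernel P (A0 : R) n (Q : R -> R) (hh : R) : set S :=
  \bigcup_(i in [set i | (i < n)%N])
    [set X | n%:R * (A0 * Num.sqrt (hh * eps R n)) <= `|kernel_dev P n Q hh X i|].

Definition itvoc (a b : R) : set R := `]a, b]%classic.

Definition itv_dev P n (a b : R) (X : S) : R :=
  \sum_(j < n) (\1_(itvoc a b) (obs j X) - fine (law P (itvoc a b))).

Definition grid (B0 : R) n (k : nat) : R := - B0 + k%:R / n%:R.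

(** The distance of the grid points is limited to [w * h] so that the counts have variance O(n h),
    which sets the scale of the threshold. *)
Definition bad_itv P (A0 B0 w : R) n N (h : R) : set S :=
  \bigcup_(k in [set k | (k < N)%N]) \bigcup_(l in [set l | (l < N)%N])
    [set X | grid B0 n k <= grid B0 n l <= grid B0 n k + w * h /\
       n%:R * (A0 * Num.sqrt (h * eps R n)) <=
       `|itv_dev P n (grid B0 n k) (grid B0 n l) X|].

Lemma lip_smoothing (Q phi : R -> R) (A M B h : R) : continuous Q -> lip B phi ->
  (forall z, `|Q z| <= M) -> 0 <= A ->
  lip (M * B * (A - - A)) (fun x => segint (- A) A (fun z => Q z * phi (x - h * z))).
Proof.
move=> cQ lphi QM A0 x y.
have cphi := lip_continuous lphi.
have c1 t : continuous (fun z => Q z * phi (t - h * z)).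
  by apply: continuousM_fun => //; exact: continuous_subst.
rewrite -segintB// -mulrA [(A - - A) * _]mulrC mulrA.
apply: segint_bound; [lra|exact: continuousB_fun|move=> z _].
rewrite -mulrBr normrM -mulrA ler_pM//.
by apply: (le_trans (lphi _ _)); rewrite opprD opprK addrACA [- (h * z) + _]addrC subrr addr0.
Qed.

Context (C : R) (f : R -> R) (sf : smooth_densities C 6 f).
Context (P : probability S R) (fP : is_product_law f P).

Let fd := sd_density sf.
Let cf := sd_continuous sf.

Lemma bm_scaled (Q : R -> R) (M x hh : R) : continuous Q -> (forall z, `|Q z| <= M) ->
  bounded_measurable (fun y : R => Q ((x - y) / hh)).
Proof.
move=> cQ QM; split; last by exists M.
by apply: continuous_measurable; exact: continuous_scaled.
Qed.

Lemma law_scaled_le (Q : R -> R) (A M x hh : R) : continuous Q -> vanishes A Q ->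
  (forall z, `|Q z| <= M) -> 0 <= A -> 0 < hh ->
  \int[law P]_y (Q ((x - y) / hh) ^+ 2) <= (M ^+ 2 * C * (A - - A)) * hh.
Proof.
move=> cQ vQ QM A0 h0.
have cQ2 : continuous (fun z => Q z ^+ 2).
  by apply: (@continuous_compose R (fun z => z ^+ 2) Q) => //; exact: continuous_pow.
have vQ2 : vanishes A (fun z => Q z ^+ 2) by move=> z zA; rewrite vQ// expr0n.
rewrite (@law_kernel R f P (fun z => Q z ^+ 2) A x hh)// mulrC ler_wpM2r ?(ltW h0)//.
have cp := continuous_subst (x := x) (h := hh) cf.
apply: (le_trans (ler_norm _)); apply: segint_bound; [lra|exact: continuousM_fun|].
move=> z _; rewrite normrM ger0_norm ?sqr_ge0//.
apply: ler_pM; rewrite ?sqr_ge0 ?normr_ge0//.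
  by rewrite -real_normK ?num_real// lerXn2r ?nnegrE// (le_trans _ (QM 0)).
have := sd_bound sf (leq0n 6) (x - hh * z); by rewrite derive1n0.
Qed.

Lemma kernel_mean_lip (Q : R -> R) (A M hh : R) : continuous Q -> vanishes A Q ->
  (forall z, `|Q z| <= M) -> 0 <= A -> 0 < hh ->
  continuous (kernel_mean P Q hh).
Proof.
move=> cQ vQ QM A0 h0.
have e : kernel_mean P Q hh = fun x => hh * segint (- A) A (fun z => Q z * f (x - hh * z)).
  by apply/funext => x; rewrite /kernel_mean (@law_kernel R f P Q A).
have lf : lip C f by have := sd_lip sf (isT : (0 < 6)%N); rewrite derive1n0.
rewrite e; apply: continuousM_fun; first exact: continuous_cst.
exact: lip_continuous (lip_smoothing hh cQ lf QM A0).
Qed.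

(** With lam = sqrt(e / hh) the exponent is (2 V - A0) n e <= - 4 log n. The power 4 leaves n^-2
    after a union over O(n^2) pairs of grid points. *)
Lemma exp_bound (V A0 : R) n (e hh : R) : 0 < hh -> 0 <= e -> n%:R * e = ln (n%:R : R) ->
  1 <= ln (n%:R : R) -> 2 * V + 4 <= A0 -> (0 < n)%N ->
  2 * expR (2 * n%:R * (Num.sqrt (e / hh)) ^+ 2 * (V * hh)
     - Num.sqrt (e / hh) * (n%:R * (A0 * Num.sqrt (hh * e)))) <= 2 / n%:R ^+ 4 :> R.
Proof.
move=> h0 e0 ne ln1 VA n0.
rewrite ler_pM2l//.
have -> : 2 * n%:R * (Num.sqrt (e / hh)) ^+ 2 * (V * hh)
     - Num.sqrt (e / hh) * (n%:R * (A0 * Num.sqrt (hh * e))) = (2 * V - A0) * (n%:R * e).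
  rewrite sqr_sqrtr ?divr_ge0 ?(ltW h0)//.
  have -> : Num.sqrt (e / hh) * (n%:R * (A0 * Num.sqrt (hh * e))) =
      n%:R * A0 * (Num.sqrt (e / hh) * Num.sqrt (hh * e)) by ring.
  rewrite -sqrtrM ?divr_ge0 ?(ltW h0)//.
  have -> : e / hh * (hh * e) = e ^+ 2 by field; rewrite gt_eqF.
  by rewrite sqrtr_sqr ger0_norm//; field; rewrite gt_eqF.
rewrite ne; have -> : (n%:R ^+ 4)^-1 = expR (- (4%:R * ln (n%:R : R))) :> R.
  by rewrite expRN expRM_natl lnK// posrE ltr0n.
by rewrite ler_expR -mulNr ler_wpM2r//; lra.
Qed.

Lemma bad_kernel_prob (Q : R -> R) (A M A0 hh : R) n : continuous Q -> vanishes A Q ->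
  (forall z, `|Q z| <= M) -> 0 <= A -> 0 < hh -> 0 <= M ->
  1 <= ln (n%:R : R) -> (0 < n)%N ->
  Num.sqrt (eps R n / hh) * (M + M) <= 2^-1 ->
  2 * (M ^+ 2 * C * (A - - A)) + 4 <= A0 ->
  measurable (bad_kernel P A0 n Q hh) /\
  (P (bad_kernel P A0 n Q hh) <= (n%:R * (2 / n%:R ^+ 4))%:E)%E.
Proof.
move=> cQ vQ QM A00 h0 M0 ln1 n0 small VA.
have e0 : 0 <= eps R n by rewrite divr_ge0// (le_trans _ ln1).
have ne : n%:R * eps R n = ln (n%:R : R).
  by rewrite /eps mulrC divfK// pnatr_eq0 -lt0n.
have cm := kernel_mean_lip cQ vQ QM A00 h0.
pose q x y := Q ((x - y) / hh) - kernel_mean P Q hh x.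
have mq : measurable_fun setT (fun z : R * R => q z.1 z.2).
  apply: measurable_funB.
    apply: (measurableT_comp (continuous_measurable cQ)).
    apply: measurable_funM => //; apply: measurable_funB => //.
  exact: (measurableT_comp (continuous_measurable cm)).
have bmQ x := bm_scaled x hh cQ QM.
have mM x : `|kernel_mean P Q hh x| <= M by apply: expect_bound.
have qb x y : `|q x y| <= M + M by rewrite (le_trans (ler_normB _ _))// lerD.
have q0 x : \int[law P]_y q x y = 0.
  by rewrite /q expectB//; [rewrite expect_cst subrr|exact: bm_cst].
have C0 : 0 <= C by apply: (le_trans (normr_ge0 _)); exact: (sd_bound sf (leq0n 6) 0).
have v0 : 0 <= (M ^+ 2 * C * (A - - A)) * hh.
  by rewrite !mulr_ge0 ?sqr_ge0 ?(ltW h0)//; lra.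
have qv x : \int[law P]_y (q x y ^+ 2) <= (M ^+ 2 * C * (A - - A)) * hh.
  apply: le_trans (law_scaled_le x cQ vQ QM A00 h0).
  have b2 : bounded_measurable (fun y : R => Q ((x - y) / hh) ^+ 2).
    by under eq_fun do rewrite expr2; exact: bmM.
  have e y : q x y ^+ 2 = (Q ((x - y) / hh) ^+ 2 - (2 * kernel_mean P Q hh x) * Q ((x - y) / hh))
     + kernel_mean P Q hh x ^+ 2 by rewrite /q; ring.
  under eq_Rintegral do rewrite e.
  rewrite expectD; last 2 first.
  - by apply: bmB => //; exact: bmZ.
  - exact: bm_cst.
  rewrite expectB//; last exact: bmZ.
  rewrite expectZ// expect_cst -/(kernel_mean P Q hh x).
  (* The variance is at most the second moment. *)
  have h2 (I m : R) : I - 2 * m * m + m ^+ 2 <= I by have := sqr_ge0 m; nra.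
  exact: h2.
have key i := @bernstein_resampled R f P fP n i q (M + M) _ (Num.sqrt (eps R n / hh))
  (n%:R * (A0 * Num.sqrt (hh * eps R n))) mq qb q0 qv v0 (sqrtr_ge0 _) small.
split.
  by apply: bigcup_measurable => i _; have [] := key i.
apply: finite_union_bound => i; first by have [] := key i.
move=> _; have [_ h] := key i; apply: (le_trans h); rewrite lee_fin.
exact: exp_bound.
Qed.

Lemma law_itv_le (a b : R) : a <= b -> fine (law P (itvoc a b)) <= C * (b - a).
Proof.
move=> ab; apply: le_trans (law_segment_le fP fd ab cf (sd_le sf)).
apply: fine_le.
- by apply: fin_num_measure; exact: measurable_itv.
- by apply: fin_num_measure; exact: measurable_itv.
- apply: le_measure; rewrite ?inE; [exact: measurable_itv|exact: measurable_itv|].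
  by move=> x; rewrite /itvoc /= !in_itv/= => /andP[/ltW ax xb]; apply/andP.
Qed.

Lemma bad_itv_prob (A0 B0 w h : R) n N : 0 < h -> 0 <= w ->
  1 <= ln (n%:R : R) -> (0 < n)%N -> Num.sqrt (eps R n / h) * 2 <= 2^-1 ->
  2 * (C * w) + 4 <= A0 ->
  measurable (bad_itv P A0 B0 w n N h) /\
  (P (bad_itv P A0 B0 w n N h) <= (N%:R * (N%:R * (2 / n%:R ^+ 4)))%:E)%E.
Proof.
move=> h0 w0 ln1 n0 small VA.
have e0 : 0 <= eps R n by rewrite divr_ge0// (le_trans _ ln1).
have ne : n%:R * eps R n = ln (n%:R : R).
  by rewrite /eps mulrC divfK// pnatr_eq0 -lt0n.
have C0 : 0 <= C by apply: (le_trans (normr_ge0 _)); exact: (sd_bound sf (leq0n 6) 0).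
pose E k l := [set X : S | grid B0 n k <= grid B0 n l <= grid B0 n k + w * h /\
       n%:R * (A0 * Num.sqrt (h * eps R n)) <=
       `|itv_dev P n (grid B0 n k) (grid B0 n l) X|].
have key k l : measurable (E k l) /\ (P (E k l) <= (2 / n%:R ^+ 4)%:E)%E.
  (* Pairs that are too far apart, or in the wrong order, give the empty event. *)
  have [hkl|hkl] := boolP (grid B0 n k <= grid B0 n l <= grid B0 n k + w * h); last first.
    have -> : E k l = set0 by apply/seteqP; split => X //= [] h'; rewrite h' in hkl.
    by rewrite measure0 lee_fin divr_ge0// exprn_ge0.
  set a := grid B0 n k in hkl *; set b := grid B0 n l in hkl *.
  have -> : E k l = [set X : S | n%:R * (A0 * Num.sqrt (h * eps R n)) <= `|itv_dev P n a b X|].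
    by apply/seteqP; split => X /= => [[]|].
  pose p := fine (law P (itvoc a b)).
  pose phi x : R := \1_(itvoc a b) x - p.
  have mI : measurable (itvoc a b) by exact: measurable_itv.
  have bI : bounded_measurable (\1_(itvoc a b) : R -> R) by exact: bm_indic.
  have pE : \int[law P]_x (\1_(itvoc a b) x : R) = p by exact: expect_indic.
  have p0 : 0 <= p by rewrite /p fine_ge0.
  have p1 : p <= 1.
    rewrite -pE -[leRHS](expect_cst (law P) 1); apply: expect_le => //; first exact: bm_cst.
    by move=> x; rewrite indicE; case: (_ \in _).
  have bphi : bounded_measurable phi by apply: bmB => //; exact: bm_cst.
  have phib x : `|phi x| <= 2.
    by rewrite /phi indicE ler_norml; case: (_ \in _) => /=; apply/andP; split; lra.
  have phi0 : \int[law P]_x phi x = 0.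
    by rewrite expectB//; [rewrite pE expect_cst subrr|exact: bm_cst].
  have v0 : 0 <= (C * w) * h by rewrite !mulr_ge0// ltW.
  have phiv : \int[law P]_x (phi x ^+ 2) <= (C * w) * h.
    have e x : phi x ^+ 2 = (1 - 2 * p) * \1_(itvoc a b) x + p ^+ 2.
      by rewrite /phi indicE; case: (_ \in _) => /=; ring.
    under eq_Rintegral do rewrite e.
    rewrite expectD; last 2 first.
    - exact: bmZ.
    - exact: bm_cst.
    rewrite expectZ// expect_cst pE.
    case/andP: hkl => ab bw.
    have pC : p <= C * (b - a) by exact: law_itv_le.
    have : C * (b - a) <= C * w * h by rewrite -mulrA ler_wpM2l//; lra.
    have h2 : (1 - 2 * p) * p + p ^+ 2 <= p by have := sqr_ge0 p; nra.
    by move=> h3; apply: (le_trans h2); exact: le_trans pC h3.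
  split.
    rewrite (_ : [set X | _] = (fun X : S => `|\sum_(j < n | xpredT (j : nat)) phi (obs j X)|) @^-1` `[n%:R * (A0 * Num.sqrt (h * eps R n)), +oo[).
      have mF : measurable_fun setT (fun X : S => `|\sum_(j < n | xpredT (j : nat)) phi (obs j X)|).
        have m1 := @measurable_sum_obs R n xpredT phi bphi.1.
        exact: (measurableT_comp (@normr_measurable R setT) m1).
      by rewrite -[X in measurable X]setTI; exact: mF measurableT _ (measurable_itv _).
    by apply/seteqP; split => X /=; rewrite in_itv/= andbT.
  have := @bernstein R f P fP n xpredT phi 2 _ (Num.sqrt (eps R n / h))
   (n%:R * (A0 * Num.sqrt (h * eps R n))) bphi.1 phib phi0 phiv v0 (sqrtr_ge0 _) small.
  move=> hb; apply: (le_trans hb); rewrite lee_fin; exact: exp_bound.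
split.
  by apply: bigcup_measurable => k _; apply: bigcup_measurable => l _; case: (key k l).
apply: finite_union_bound => k.
  by apply: bigcup_measurable => l _; case: (key k l).
move=> _; apply: finite_union_bound => l; first by case: (key k l).
by move=> _; case: (key k l).
Qed.

End deviations.

(** * Deviations of Lipschitz functions *)

Section empirical_deviations.
Context (R : realType).
Local Notation S := (sampleSpace R).
Implicit Types (P : probability S R) (g : R -> R) (X : S).

Definition emp n X g : R := n%:R^-1 * \sum_(j < n) g (obs j X).

Definition dev P n X g : R := emp n X g - \int[law P]_y g y.

Lemma empD n X g1 g2 : emp n X (fun y => g1 y + g2 y) = emp n X g1 + emp n X g2.
Proof. by rewrite /emp big_split/= mulrDr. Qed.

Lemma empB n X g1 g2 : emp n X (fun y => g1 y - g2 y) = emp n X g1 - emp n X g2.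
Proof. by rewrite /emp sumrB mulrBr. Qed.

Lemma empZ n X (c : R) g : emp n X (fun y => c * g y) = c * emp n X g.
Proof. by rewrite /emp -mulr_sumr mulrCA. Qed.

Lemma emp_sum m n X (g : nat -> R -> R) :
  emp n X (fun y => \sum_(i < m) g i y) = \sum_(i < m) emp n X (g i).
Proof. by rewrite /emp exchange_big/= -mulr_sumr. Qed.

Lemma emp_le n X g1 g2 : (forall j, (j < n)%N -> g1 (obs j X) <= g2 (obs j X)) ->
  emp n X g1 <= emp n X g2.
Proof. by move=> g12; rewrite /emp ler_wpM2l// ler_sum// => j _; apply: g12. Qed.

Lemma emp_norm n X g : `|emp n X g| <= emp n X (fun y => `|g y|).
Proof.
rewrite /emp normrM ger0_norm ?invr_ge0// ler_wpM2l ?invr_ge0//.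
exact: ler_norm_sum.
Qed.

Lemma emp_cst n X (c : R) : (0 < n)%N -> emp n X (fun=> c) = c.
Proof.
move=> n0; rewrite /emp sumr_const card_ord -[c *+ n]mulr_natl mulKf//.
by rewrite pnatr_eq0 -lt0n.
Qed.

Lemma emp_bound n X g (M : R) : (0 < n)%N -> (forall y, `|g y| <= M) -> `|emp n X g| <= M.
Proof.
move=> n0 gM; rewrite (le_trans (emp_norm _ _ _))// -[leRHS](emp_cst X M n0).
exact: emp_le.
Qed.

Local Notation bm := (@bounded_measurable _ _ R).

Lemma devD P n X g1 g2 : bm g1 -> bm g2 ->
  dev P n X (fun y => g1 y + g2 y) = dev P n X g1 + dev P n X g2.
Proof. by move=> b1 b2; rewrite /dev empD expectD//; ring. Qed.

Lemma devB P n X g1 g2 : bm g1 -> bm g2 ->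
  dev P n X (fun y => g1 y - g2 y) = dev P n X g1 - dev P n X g2.
Proof. by move=> b1 b2; rewrite /dev empB expectB//; ring. Qed.

Lemma devZ P n X (c : R) g : bm g -> dev P n X (fun y => c * g y) = c * dev P n X g.
Proof. by move=> b; rewrite /dev empZ expectZ//; ring. Qed.

Lemma dev_sum P m n X (g : nat -> R -> R) : (forall i, bm (g i)) ->
  dev P n X (fun y => \sum_(i < m) g i y) = \sum_(i < m) dev P n X (g i).
Proof. by move=> b; rewrite /dev emp_sum expect_sum// sumrB. Qed.

Lemma dev_bound P n X g (M : R) : (0 < n)%N -> bm g -> (forall y, `|g y| <= M) ->
  `|dev P n X g| <= M + M.
Proof.
move=> n0 bg gM; rewrite (le_trans (ler_normB _ _))// lerD//; first exact: emp_bound.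
exact: expect_bound.
Qed.

(** On ]y_k, y_(k+1)] exactly the indicators with i >= k are 1, and the sum telescopes to g(y_k) -
    g(y_m), which is g(y_k) when [g] vanishes at y_m. *)
Definition step_sum (y : nat -> R) g m : R -> R := fun x =>
  \sum_(i < m) (g (y i) - g (y i.+1)) * \1_(itvoc (y 0%N) (y i.+1)) x.

Lemma step_sum_bm y g m : bm (step_sum y g m).
Proof.
rewrite /step_sum; apply: bm_sum => i.
by apply: bmZ; apply: bm_indic; exact: measurable_itv.
Qed.

Lemma step_sum_approx (y : nat -> R) g (Lam d : R) m : {homo y : i j / (i <= j)%N >-> i <= j} ->
  (forall i, y i.+1 - y i <= d) -> lip Lam g ->
  (forall x, x <= y 0%N -> g x = 0) -> (forall x, y m <= x -> g x = 0) ->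
  forall x, `|step_sum y g m x - g x| <= Lam * d.
Proof.
move=> ymon yd lg g0 gm x.
have Lam0 := lip_ge0 lg.
have d0 : 0 <= d by apply: le_trans (yd 0%N); rewrite subr_ge0 ymon.
have sum0 k : y k < x -> step_sum y g k x = 0.
  move=> kx; rewrite /step_sum big1// => i _; rewrite indicE memNset ?mulr0//.
  rewrite /itvoc /= in_itv/= => /andP[_ xi].
  by have := le_lt_trans (le_trans xi (ymon _ _ (ltn_ord i))) kx; rewrite ltxx.
have cell k : y 0%N < x <= y k -> `|step_sum y g k x + g (y k) - g x| <= Lam * d.
  elim: k => [|k ih] /andP[x0 xk]; first by have := lt_le_trans x0 xk; rewrite ltxx.
  rewrite /step_sum big_ord_recr/= -/(step_sum y g k x) indicE mem_set ?mulr1; last first.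
    by rewrite /itvoc /= in_itv/= x0 xk.
  have [xk'|xk'] := leP x (y k).
    have -> : step_sum y g k x + (g (y k) - g (y k.+1)) + g (y k.+1) - g x =
      step_sum y g k x + g (y k) - g x by ring.
    by apply: ih; rewrite x0.
  rewrite sum0// add0r subrK (le_trans (lg _ _))// ler_wpM2l//.
  by have := yd k; rewrite ltr0_norm ?subr_lt0//; lra.
have [x0|x0] := leP x (y 0%N).
  rewrite g0// subr0 /step_sum big1 ?normr0 ?mulr_ge0// => i _.
  rewrite indicE memNset ?mulr0// /itvoc /= in_itv/= => /andP[h _].
  by have := lt_le_trans h x0; rewrite ltxx.
have [xm|xm] := leP x (y m); last by rewrite sum0// gm ?(ltW xm)// subr0 normr0 mulr_ge0.
by have := @cell m; rewrite gm// addr0 x0 xm; apply.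
Qed.

Lemma dev_itv P n X (a b : R) : (0 < n)%N ->
  dev P n X (\1_(itvoc a b) : R -> R) = n%:R^-1 * itv_dev P n a b X.
Proof.
move=> n0; rewrite /dev /emp /itv_dev sumrB mulrBr; congr (_ - _).
rewrite expect_indic; last exact: measurable_itv.
rewrite sumr_const card_ord -[fine _ *+ n]mulr_natl mulKf//.
by rewrite pnatr_eq0 -lt0n.
Qed.

(* Summation by parts: the step function that interpolates [g] on the grid is a
   combination of indicators of intervals with a common left end point. *)
Lemma dev_lip P n N X (A0 B0 w h : R) g (Lam a b : R) : (0 < n)%N ->
  ~ bad_itv P A0 B0 w n N h X -> lip Lam g ->
  (forall y, y <= a -> g y = 0) -> (forall y, b <= y -> g y = 0) ->
  - B0 <= a -> a <= b -> (b + B0) * n%:R + 3 <= N%:R ->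
  b - a + 2 / n%:R <= w * h -> 0 <= A0 ->
  `|dev P n X g| <= Lam * ((b - a + 2 / n%:R) * (A0 * Num.sqrt (h * eps R n)) + 2 / n%:R).
Proof.
move=> n0 nbad lg ga gb Ba ab bN bw A00.
have Lam0 := lip_ge0 lg.
have nR : 0 < n%:R :> R by rewrite ltr0n.
have nV : 0 < n%:R^-1 :> R by rewrite invr_gt0.
(* Indices of grid points that bracket [a, b], at the cost of at most two extra cells. *)
pose k0 := Num.truncn ((a + B0) * n%:R).
pose l1 := (Num.truncn ((b + B0) * n%:R)).+1.
have aB : 0 <= (a + B0) * n%:R by rewrite mulr_ge0 ?(ltW nR)//; lra.
have bB : 0 <= (b + B0) * n%:R by rewrite mulr_ge0 ?(ltW nR)//; lra.
have k0a : k0%:R <= (a + B0) * n%:R by rewrite truncn_le.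
have k0b : (a + B0) * n%:R < k0%:R + 1 by rewrite natr1; exact: truncnS_gt.
have l1a : l1%:R <= (b + B0) * n%:R + 1 by rewrite -natr1 lerD2r truncn_le.
have l1b : (b + B0) * n%:R < l1%:R by exact: truncnS_gt.
have k0l1 : (k0 < l1)%N.
  rewrite ltnS; apply: le_truncn; rewrite ler_wpM2r// ?(ltW nR)//; lra.
pose m := (l1 - k0)%N.
have k0m : (k0 + m = l1)%N by rewrite subnKC// ltnW.
have mR : m%:R = l1%:R - k0%:R :> R by rewrite -k0m natrD; ring.
have mb : m%:R * n%:R^-1 <= b - a + 2 / n%:R.
  rewrite -(ler_pM2r nR) mulfVK ?gt_eqF// mulrDl divfK ?gt_eqF// mR; nra.
have l1N : (l1 < N)%N by rewrite -(ltr_nat R); lra.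
pose y i := grid B0 n (k0 + i)%N.
have yE i : y i = - B0 + (k0 + i)%:R / n%:R by [].
have ymon : {homo y : i j / (i <= j)%N >-> i <= j}.
  by move=> i j ij; rewrite !yE lerD2l ler_wpM2r ?(ltW nV)// ler_nat leq_add2l.
have yd i : y i.+1 - y i <= n%:R^-1.
  by rewrite !yE addnS -natr1; have -> : - B0 + ((k0 + i)%:R + 1) / n%:R -
    (- B0 + (k0 + i)%:R / n%:R) = n%:R^-1 by ring.
have y0 : y 0%N <= a by rewrite yE addn0 -lerBrDl opprK ler_pdivrMr.
have ym : b <= y m by rewrite yE k0m -lerBlDl opprK ler_pdivlMr// ltW.
have g0 x : x <= y 0%N -> g x = 0 by move=> h'; apply: ga; exact: le_trans y0.
have gm x : y m <= x -> g x = 0 by move=> h'; apply: gb; exact: le_trans h'.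
have approx := step_sum_approx ymon yd lg g0 gm.
set W := A0 * Num.sqrt (h * eps R n).
have W0 : 0 <= W by rewrite mulr_ge0// sqrtr_ge0.
have devI i : (i < m)%N -> `|dev P n X (\1_(itvoc (y 0%N) (y i.+1)) : R -> R)| <= W.
  move=> im; rewrite dev_itv// normrM gtr0_norm// mulrC ler_pdivrMr// leNgt; apply/negP => hW.
  apply: nbad; exists k0; first by rewrite /= (ltn_trans k0l1).
  have kl : (k0 + i.+1 < N)%N.
    by apply: leq_ltn_trans l1N; rewrite -k0m leq_add2l.
  exists (k0 + i.+1)%N => //=.
  have e0 : grid B0 n k0 = y 0%N by rewrite /y addn0.
  rewrite e0 -/(y i.+1) ymon//=; split; last by rewrite mulrC ltW.
  rewrite !yE addn0 natrD mulrDl addrA lerD2l.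
  apply: le_trans (le_trans mb bw); rewrite ler_wpM2r ?(ltW nV)// ler_nat//.
have bI i : bm (\1_(itvoc (y 0%N) (y i.+1)) : R -> R).
  by apply: bm_indic; exact: measurable_itv.
have devs : `|dev P n X (step_sum y g m)| <= m%:R * (Lam * n%:R^-1 * W).
  rewrite (@dev_sum P m n X (fun i x => (g (y i) - g (y i.+1)) * \1_(itvoc (y 0%N) (y i.+1)) x)); last first.
    by move=> i; exact: bmZ.
  apply: (le_trans (ler_norm_sum _ _ _)).
  have -> : m%:R * (Lam * n%:R^-1 * W) = \sum_(i < m) (Lam * n%:R^-1 * W).
    by rewrite sumr_const card_ord mulr_natl.
  apply: ler_sum => i _; rewrite devZ// normrM ler_pM ?devI//.
  rewrite (le_trans (lg _ _))// ler_wpM2l// distrC ger0_norm ?yd// subr_ge0 ymon//.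
have bg : bm g.
  have [Mg hg] : exists Mg, forall x, `|g x| <= Mg.
    exists (`|\sum_(i < m) `|g (y i) - g (y i.+1)| | + Lam * n%:R^-1) => x.
    have -> : g x = step_sum y g m x - (step_sum y g m x - g x) by ring.
    rewrite (le_trans (ler_normB _ _))// lerD//.
    apply: (le_trans (ler_norm_sum _ _ _)); apply: le_trans (ler_norm _).
    apply: ler_sum => i _; rewrite normrM ler_piMr// indicE.
    by case: (_ \in _); rewrite ?normr1 ?normr0.
  split; last by exists Mg.
  exact: continuous_measurable (lip_continuous lg).
have -> : dev P n X g = dev P n X (step_sum y g m) - dev P n X (fun x => step_sum y g m x - g x).
  by rewrite devB//; [ring|exact: step_sum_bm].
have bd : bm (fun x => step_sum y g m x - g x) by apply: bmB => //; exact: step_sum_bm.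
(* The interpolation error, at most Lam / n, counts twice: in the empirical mean and in the
   expectation. *)
have h2 := dev_bound P X n0 bd approx.
rewrite (le_trans (ler_normB _ _))//.
have -> : Lam * ((b - a + 2 / n%:R) * W + 2 / n%:R) =
   (b - a + 2 / n%:R) * (Lam * W) + (Lam / n%:R + Lam / n%:R) by ring.
apply: lerD => //; apply: (le_trans devs).
have -> : m%:R * (Lam / n%:R * W) = (m%:R * n%:R^-1) * (Lam * W) by ring.
by rewrite ler_wpM2r// mulr_ge0.
Qed.

End empirical_deviations.

(** * Pilot estimators at the observations *)

Record config (R : realType) := Config {
  size_of : nat; dens : R -> R; prob : probability (sampleSpace R) R;
  obsv : sampleSpace R; hh2 : R; hh1 : R; hh3 : R }.

(* The bandwidths are only constrained by the inequalities that the proof uses;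
   in terms of [hh2 = eps^(1/13)], [hh1] is the power 2.6 and [hh3] the power 13/11. *)
Record good (R : realType) (K G : R -> R) (C A0 B W : R) (s : config R) : Prop := {
  good_n : (0 < size_of s)%N;
  good_dens : smooth_densities C 6 (dens s);
  good_law : is_product_law (dens s) (prob s);
  good_h : 0 < hh2 s <= 1;
  good_eps : hh2 s ^+ 13 = eps R (size_of s);
  good_inv : (size_of s)%:R^-1 <= hh2 s ^+ 13;
  good_h1 : hh2 s ^+ 3 <= hh1 s;
  good_h1sq : hh1 s ^+ 2 <= hh2 s ^+ 5;
  good_h3 : 0 < hh3 s <= hh2 s;
  good_h3cube : hh2 s ^+ 5 <= hh3 s ^+ 3;
  good_itv : ~ bad_itv (prob s) A0 (B + W) (2 * W + 2) (size_of s)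
    (Num.truncn (2 * (B + W) * (size_of s)%:R)).+4 (hh2 s) (obsv s);
  good_K : ~ bad_kernel (prob s) A0 (size_of s) K (hh1 s) (obsv s);
  good_G1 : ~ bad_kernel (prob s) A0 (size_of s) (derive1n 1 G) (hh3 s) (obsv s);
  good_G2 : ~ bad_kernel (prob s) A0 (size_of s) (derive1n 2 G) (hh2 s) (obsv s) }.

Section kernel_at_observation.
Context (R : realType).
Local Notation S := (sampleSpace R).
Implicit Types (P : probability S R) (Q : R -> R) (X : S).

Lemma kernel_sumE Q m n (hh : R) X x :
  kernel_sum Q m hh (sample n X) x = hh ^- m * emp n X (fun y => Q ((x - y) / hh)).
Proof.
rewrite /kernel_sum /emp invfM mulrA [n%:R^-1 * _]mulrC; congr (_ * _).
by apply: eq_bigr => i _; rewrite tnth_mktuple.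
Qed.

(* The term [j = i] is not random given [X_i]; it costs [O(1/n)]. *)
Lemma kernel_at_observation P n Q (hh A0 M : R) X i : (i < n)%N ->
  (forall z, `|Q z| <= M) -> (forall x, `|kernel_mean P Q hh x| <= M) ->
  ~ bad_kernel P A0 n Q hh X ->
  `|emp n X (fun y => Q ((obs i X - y) / hh)) - kernel_mean P Q hh (obs i X)| <=
  A0 * Num.sqrt (hh * eps R n) + 2 * M / n%:R.
Proof.
move=> ilt QM kM nbad.
have n0 : (0 < n)%N by exact: leq_ltn_trans ilt.
have nR : 0 < n%:R :> R by rewrite ltr0n.
set mu := kernel_mean P Q hh (obs i X).
have -> : emp n X (fun y => Q ((obs i X - y) / hh)) - mu =
    n%:R^-1 * ((Q ((obs i X - obs i X) / hh) - mu) + kernel_dev P n Q hh X i).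
  rewrite -{1}(emp_cst X mu n0) -empB /emp (bigD1 (Ordinal ilt))//=; congr (_ * (_ + _)).
rewrite normrM gtr0_norm ?invr_gt0// mulrC ler_pdivrMr//; rewrite [leRHS]mulrDl divfK ?gt_eqF//.
rewrite (le_trans (ler_normD _ _))// addrC lerD//.
  rewrite leNgt; apply/negP => hlt; apply: nbad; exists i => //=.
  by rewrite [leLHS]mulrC ltW.
have -> : 2 * M = M + M by ring.
by apply: (le_trans (ler_normB _ _)); apply: lerD; [exact: QM|exact: kM].
Qed.

End kernel_at_observation.

Section good_configurations.
Context (R : realType) (K K1 L G : R -> R) (A M AG MG : R).
Context (kb : kernel_bounds K K1 L A M) (gb : kernel4_bounds G AG MG).
Context (C A0 B W : R) (A00 : 0 <= A0) (W0 : 0 <= W).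
Local Notation good := (good K G C A0 B W).
Implicit Types (s : config R) (t x y : R).

Let A1 := kb_A kb.
Let M0 := kb_M kb.
Let AG1 := gb_A gb.
Let MG0 := gb_M gb.
Let Age0 : 0 <= A. Proof. exact: le_trans ler01 A1. Qed.
Let AGge0 : 0 <= AG. Proof. exact: le_trans ler01 AG1. Qed.

Lemma good_C s : good s -> 0 <= C.
Proof.
by move=> gs; apply: le_trans (normr_ge0 _) (sd_bound (good_dens gs) (leq0n 6) 0).
Qed.

Lemma good_h0 s : good s -> 0 < hh2 s.
Proof. by move=> /good_h/andP[]. Qed.

Lemma good_hX s j k : good s -> (j <= k)%N -> hh2 s ^+ k <= hh2 s ^+ j.
Proof.
move=> gs jk; have /andP[h0 h1] := good_h gs.
by apply: ler_wiXn2l => //; exact: ltW.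
Qed.

Lemma good_hX1 s k : good s -> hh2 s ^+ k <= 1.
Proof. by move=> gs; have := good_hX gs (leq0n k); rewrite expr0. Qed.

Lemma good_h1_gt0 s : good s -> 0 < hh1 s.
Proof. by move=> gs; apply: lt_le_trans (good_h1 gs); rewrite exprn_gt0// good_h0. Qed.

Lemma good_h1_le s : good s -> hh1 s <= hh2 s.
Proof.
move=> gs; have h0 := good_h0 gs; have k0 := good_h1_gt0 gs.
rewrite -(@ler_pXn2r _ 2) ?nnegrE ?(ltW h0) ?(ltW k0)//.
by apply: le_trans (good_h1sq gs) _; exact: good_hX.
Qed.

Lemma sqrt_le_sq (a b : R) : 0 <= b -> a <= b ^+ 2 -> Num.sqrt a <= b.
Proof. by move=> b0 ab; rewrite -[leRHS]ger0_norm// -sqrtr_sqr ler_wsqrtr. Qed.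

Lemma good_dens_lip s j : good s -> (j < 6)%N -> lip C (derive1n j (dens s)).
Proof. by move=> gs; exact: sd_lip (good_dens gs). Qed.

Lemma good_f_lip s : good s -> lip C (dens s).
Proof. by move=> gs; have := good_dens_lip gs (isT : (0 < 6)%N); rewrite derive1n0. Qed.

Lemma good_f_cont s : good s -> continuous (dens s).
Proof. by move=> gs; exact: lip_continuous (good_f_lip gs). Qed.

Lemma good_f_bound s x : good s -> `|dens s x| <= C.
Proof. by move=> gs; have := sd_bound (good_dens gs) (leq0n 6) x; rewrite derive1n0. Qed.

(** As eps = h^13, the count on an interval of length O(h) deviates by sqrt(h eps) = h^7, and [g]
    varies by at most O(Lam h) over its window. The rounding terms, of order 1/n <= h^13, are
    absorbed. *)
Lemma good_dev_lip : exists2 D, 0 <= D & forall s t g (Lam : R), good s -> `|t| <= B ->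
  lip Lam g -> (forall y, W * hh2 s <= `|y - t| -> g y = 0) ->
  `|dev (prob s) (size_of s) (obsv s) g| <= D * Lam * hh2 s ^+ 8.
Proof.
exists ((2 * W + 2) * A0 + 2); first by rewrite !(addr_ge0, mulr_ge0).
move=> s t g Lam gs tB lg vg.
have Lam0 := lip_ge0 lg.
have h0 := good_h0 gs; have hle1 : hh2 s <= 1 by have /andP[] := good_h gs.
have n0 := good_n gs.
have nR : 0 < (size_of s)%:R :> R by rewrite ltr0n.
have ninv := good_inv gs.
have Wh : W * hh2 s <= W by rewrite ler_piMr.
have Wh0 : 0 <= W * hh2 s by rewrite mulr_ge0// ltW.
have := tB; rewrite ler_norml => /andP[Bt tB'].
have ni : (size_of s)%:R^-1 <= hh2 s by rewrite (le_trans ninv)//; exact: (good_hX gs (isT : (1 <= 13)%N)).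
have h := @dev_lip R (prob s) (size_of s) (Num.truncn (2 * (B + W) * (size_of s)%:R)).+4
  (obsv s) A0 (B + W) (2 * W + 2) (hh2 s) g Lam (t - W * hh2 s) (t + W * hh2 s)
  n0 (good_itv gs) lg.
apply: (le_trans (h _ _ _ _ _ _ A00)).
- by move=> y hy; apply: vg; rewrite -normrN opprB; apply: le_trans (ler_norm _); lra.
- by move=> y hy; apply: vg; apply: le_trans (ler_norm _); lra.
- lra.
- lra.
- set N := Num.truncn _.
  have hN : 2 * (B + W) * (size_of s)%:R < N.+1%:R by exact: truncnS_gt.
  have : (t + W * hh2 s + (B + W)) * (size_of s)%:R <= 2 * (B + W) * (size_of s)%:R.
    by rewrite ler_wpM2r ?(ltW nR)//; lra.
  have -> : N.+4%:R = N.+1%:R + 3 :> R by rewrite (_ : N.+4 = (N.+1 + 3)%N) ?natrD// addn3.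
  lra.
- by move: ni; set q := _^-1; lra.
rewrite -(good_eps gs) -exprS.
have -> : Num.sqrt (hh2 s ^+ 14) = hh2 s ^+ 7.
  by rewrite (exprM _ 7 2) sqrtr_sqr ger0_norm// exprn_ge0// ltW.
rewrite [_ * Lam]mulrC -mulrA ler_wpM2l//.
have h8 : hh2 s ^+ 8 = hh2 s * hh2 s ^+ 7 by rewrite exprS.
have n8 : (size_of s)%:R^-1 <= hh2 s ^+ 8 by rewrite (le_trans ninv)//; exact: good_hX.
have h70 : 0 <= A0 * hh2 s ^+ 7 by rewrite mulr_ge0// exprn_ge0// ltW.
have : (t + W * hh2 s - (t - W * hh2 s) + 2 / (size_of s)%:R) * (A0 * hh2 s ^+ 7) <=
    ((2 * W + 2) * hh2 s) * (A0 * hh2 s ^+ 7).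
  by rewrite ler_wpM2r//; move: ni; set q := _^-1; lra.
by rewrite mulrDl h8; move: n8; rewrite h8; lra.
Qed.

Lemma kernel_meanE s Q A' x (hh : R) : good s -> continuous Q -> vanishes A' Q -> 0 <= A' ->
  0 < hh -> kernel_mean (prob s) Q hh x = hh * segint (- A') A' (fun z => Q z * dens s (x - hh * z)).
Proof.
move=> gs cQ vQ A'0 hh0; rewrite /kernel_mean.
exact: law_kernel (good_law gs) (sd_density (good_dens gs)) (good_f_cont gs) cQ vQ A'0 hh0.
Qed.

Lemma kernel_mean_bound s Q (M' hh x : R) : continuous Q -> (forall z, `|Q z| <= M') ->
  `|kernel_mean (prob s) Q hh x| <= M'.
Proof. by move=> cQ QM; apply: expect_bound => //; exact: bm_scaled QM. Qed.

(** The bias is of order h1^2 <= h^5, the fluctuation of order sqrt(h1 eps) / h1 = sqrt(h^13 / h1)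
    <= h^5, because h1 >= h^3. *)
Lemma observation_density : exists2 D, 0 <= D & forall s i, good s -> (i < size_of s)%N ->
  `|fhat K (hh1 s) (sample (size_of s) (obsv s)) (obs i (obsv s)) - dens s (obs i (obsv s))|
    <= D * hh2 s ^+ 5.
Proof.
exists (A0 + 2 * M + `|C| * A ^+ 2); first by rewrite !(addr_ge0, mulr_ge0, exprn_ge0).
move=> s i gs ilt; set x := obs i (obsv s).
have h0 := good_h0 gs; have k0 := good_h1_gt0 gs.
have cK : continuous K by exact: lip_continuous (kb_lip kb).
have C0 := good_C gs.
rewrite /fhat kernel_sumE expr1.
have kobs := kernel_at_observation ilt (kb_bound kb)
  (fun x => kernel_mean_bound s (hh1 s) x cK (kb_bound kb)) (good_K gs).
rewrite -/x in kobs.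
have sm := @kernel_smoothing R K K1 L A M (fun j => derive1n j (dens s)) C x (hh1 s) kb
  (fun j j2 => sd_derive (good_dens gs) (leq_trans j2 (isT : (2 <= 6)%N)))
  (sd_bound (good_dens gs) (isT : (2 <= 6)%N)).
rewrite !derive1n0 in sm.
have mE : (hh1 s)^-1 * kernel_mean (prob s) K (hh1 s) x =
   segint (- A) A (fun z => K z * dens s (x - hh1 s * z)).
  by rewrite (kernel_meanE x gs cK (kb_vanishes kb))// ?mulKf ?gt_eqF.
set E := emp _ _ _ in kobs *.
have -> : (hh1 s)^-1 * E - dens s x = (hh1 s)^-1 * (E - kernel_mean (prob s) K (hh1 s) x) +
   (segint (- A) A (fun z => K z * dens s (x - hh1 s * z)) - dens s x).
  by rewrite -mE; ring.
rewrite mulrDl (le_trans (ler_normD _ _))// lerD//.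
  rewrite normrM gtr0_norm ?invr_gt0// mulrC ler_pdivrMr//; apply: (le_trans kobs).
  have s1 : Num.sqrt (hh1 s * eps R (size_of s)) <= hh2 s ^+ 5 * hh1 s.
    rewrite -(good_eps gs); apply: sqrt_le_sq; first by rewrite mulr_ge0 ?exprn_ge0 ?ltW.
    have -> : (hh2 s ^+ 5 * hh1 s) ^+ 2 = hh1 s * (hh2 s ^+ 10 * hh1 s) by ring.
    rewrite ler_pM2l// (_ : 13%N = (10 + 3)%N)// exprD ler_pM2l ?exprn_gt0//.
    exact: (good_h1 gs).
  have s2 : (size_of s)%:R^-1 <= hh2 s ^+ 5 * hh1 s.
    apply: (le_trans (good_inv gs)); rewrite (_ : 13%N = (5 + 8)%N)// exprD.
    rewrite ler_pM2l ?exprn_gt0//; apply: le_trans (good_h1 gs); exact: good_hX.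
  rewrite -[leRHS]mulrA [leRHS]mulrDl; apply: lerD; first by rewrite ler_wpM2l.
  by rewrite ler_wpM2l// mulr_ge0.
apply: (le_trans sm); rewrite ger0_norm// ler_wpM2l ?mulr_ge0 ?sqr_ge0//.
exact: (good_h1sq gs).
Qed.

(** After one integration by parts the bias is of order h3^4 <= h^4; the fluctuation is sqrt(h3 eps)
    / h3^2 = sqrt(h^13 / h3^3) <= h^4, because h3^3 >= h^5. *)
Lemma observation_derive1 : exists2 D, 0 <= D & forall s i, good s -> (i < size_of s)%N ->
  `|fG1 G (hh3 s) (sample (size_of s) (obsv s)) (obs i (obsv s)) -
    derive1n 1 (dens s) (obs i (obsv s))| <= D * hh2 s ^+ 4.
Proof.
exists (A0 + 2 * MG + MG * `|C| * AG ^+ 4 * (2 * AG)).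
  by rewrite !(addr_ge0, mulr_ge0, exprn_ge0).
move=> s i gs ilt; set x := obs i (obsv s).
have h0 := good_h0 gs; have /andP[k0 k1] := good_h3 gs.
have C0 := good_C gs.
rewrite /fG1 kernel_sumE.
have cG := gb_continuous gb (isT : (1 <= 2)%N).
have kobs := kernel_at_observation ilt (gb_bound gb (isT : (1 <= 2)%N))
  (fun x => kernel_mean_bound s (hh3 s) x cG (gb_bound gb (isT : (1 <= 2)%N))) (good_G1 gs).
rewrite -/x in kobs.
have dd j : (j < 4)%N -> forall x : R, is_derive x 1 (derive1n j.+1 (dens s)) (derive1n j.+2 (dens s) x).
  by move=> j4; apply: (sd_derive (good_dens gs)); rewrite ltnS (leq_trans j4).
have sm := @kernel4_smoothing R G AG MG (fun j => derive1n j.+1 (dens s)) C x (hh3 s) gb dd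
  (sd_bound (good_dens gs) (isT : (5 <= 6)%N)).
have dG := gb_derive gb (isT : (0 < 2)%N).
have df := sd_derive (good_dens gs) (isT : (0 < 6)%N).
have cf1 := lip_continuous (good_dens_lip gs (isT : (1 < 6)%N)).
have parts := @segint_parts R (derive1n 0 G) (derive1n 1 G) (derive1n 0 (dens s))
  (derive1n 1 (dens s)) AG x (hh3 s) dG df cG cf1 (gb_vanishes gb (leq0n 2)) AGge0.
rewrite !derive1n0 in parts.
have mE : hh3 s ^- 2 * kernel_mean (prob s) (derive1n 1 G) (hh3 s) x =
   segint (- AG) AG (fun z => G z * derive1n 1 (dens s) (x - hh3 s * z)).
  rewrite (kernel_meanE x gs cG (gb_vanishes gb (isT : (1 <= 2)%N)))// parts.
  by rewrite [hh3 s * (hh3 s * _)]mulrA -expr2 mulKf// expf_neq0// gt_eqF.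
set E := emp _ _ _ in kobs *.
have -> : hh3 s ^- 2 * E - derive1n 1 (dens s) x =
   hh3 s ^- 2 * (E - kernel_mean (prob s) (derive1n 1 G) (hh3 s) x) +
   (segint (- AG) AG (fun z => G z * derive1n 1 (dens s) (x - hh3 s * z)) - derive1n 1 (dens s) x).
  by rewrite -mE; ring.
have h3 : hh3 s ^+ 3 <= hh3 s ^+ 2.
  by apply: ler_wiXn2l => //; [exact: ltW|have /andP[_ le1] := good_h gs; exact: le_trans k1 le1].
rewrite mulrDl (le_trans (ler_normD _ _))// lerD//.
  rewrite normrM gtr0_norm ?invr_gt0 ?exprn_gt0// mulrC ler_pdivrMr ?exprn_gt0//.
  apply: (le_trans kobs).
  have s1 : Num.sqrt (hh3 s * eps R (size_of s)) <= hh2 s ^+ 4 * hh3 s ^+ 2.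
    rewrite -(good_eps gs); apply: sqrt_le_sq.
      by rewrite mulr_ge0 ?exprn_ge0 ?(ltW h0) ?(ltW k0).
    have -> : (hh2 s ^+ 4 * hh3 s ^+ 2) ^+ 2 = hh3 s * (hh2 s ^+ 8 * hh3 s ^+ 3) by ring.
    rewrite ler_pM2l// (_ : 13%N = (8 + 5)%N)// exprD ler_pM2l ?exprn_gt0//.
    exact: (good_h3cube gs).
  have s2 : (size_of s)%:R^-1 <= hh2 s ^+ 4 * hh3 s ^+ 2.
    apply: (le_trans (good_inv gs)); rewrite (_ : 13%N = (4 + 9)%N)// exprD.
    rewrite ler_pM2l ?exprn_gt0//; apply: le_trans h3; apply: le_trans (good_h3cube gs).
    exact: good_hX.
  rewrite -[leRHS]mulrA [leRHS]mulrDl; apply: lerD; first by rewrite ler_wpM2l.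
  by rewrite ler_wpM2l// mulr_ge0.
apply: (le_trans sm); rewrite ger0_norm// ler_wpM2l ?mulr_ge0 ?exprn_ge0//.
by rewrite lerXn2r ?nnegrE ?(ltW h0) ?(ltW k0).
Qed.

(** After two integrations by parts the bias is O(h^4), which takes all six derivatives of the
    density; the fluctuation is sqrt(h eps) / h^3 = h^4. *)
Lemma observation_derive2 : exists2 D, 0 <= D & forall s i, good s -> (i < size_of s)%N ->
  `|fG2 G (hh2 s) (sample (size_of s) (obsv s)) (obs i (obsv s)) -
    derive1n 2 (dens s) (obs i (obsv s))| <= D * hh2 s ^+ 4.
Proof.
exists (A0 + 2 * MG + MG * `|C| * AG ^+ 4 * (2 * AG)).
  by rewrite !(addr_ge0, mulr_ge0, exprn_ge0).
move=> s i gs ilt; set x := obs i (obsv s).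
have h0 := good_h0 gs.
have C0 := good_C gs.
rewrite /fG2 kernel_sumE.
have cG1 := gb_continuous gb (isT : (1 <= 2)%N).
have cG := gb_continuous gb (isT : (2 <= 2)%N).
have kobs := kernel_at_observation ilt (gb_bound gb (isT : (2 <= 2)%N))
  (fun x => kernel_mean_bound s (hh2 s) x cG (gb_bound gb (isT : (2 <= 2)%N))) (good_G2 gs).
rewrite -/x in kobs.
have dd j : (j < 4)%N -> forall x : R, is_derive x 1 (derive1n j.+2 (dens s)) (derive1n j.+3 (dens s) x).
  by move=> j4; apply: (sd_derive (good_dens gs)); rewrite !ltnS.
have sm := @kernel4_smoothing R G AG MG (fun j => derive1n j.+2 (dens s)) C x (hh2 s) gb dd
  (sd_bound (good_dens gs) (isT : (6 <= 6)%N)).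
have parts1 := @segint_parts R (derive1n 0 G) (derive1n 1 G) (derive1n 1 (dens s))
  (derive1n 2 (dens s)) AG x (hh2 s) (gb_derive gb (isT : (0 < 2)%N))
  (sd_derive (good_dens gs) (isT : (1 < 6)%N)) cG1
  (lip_continuous (good_dens_lip gs (isT : (2 < 6)%N))) (gb_vanishes gb (leq0n 2)) AGge0.
have parts2 := @segint_parts R (derive1n 1 G) (derive1n 2 G) (derive1n 0 (dens s))
  (derive1n 1 (dens s)) AG x (hh2 s) (gb_derive gb (isT : (1 < 2)%N))
  (sd_derive (good_dens gs) (isT : (0 < 6)%N)) cG
  (lip_continuous (good_dens_lip gs (isT : (1 < 6)%N))) (gb_vanishes gb (isT : (1 <= 2)%N)) AGge0.
rewrite !derive1n0 in parts1 parts2.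
have mE : hh2 s ^- 3 * kernel_mean (prob s) (derive1n 2 G) (hh2 s) x =
   segint (- AG) AG (fun z => G z * derive1n 2 (dens s) (x - hh2 s * z)).
  rewrite (kernel_meanE x gs cG (gb_vanishes gb (isT : (2 <= 2)%N)))// parts2 parts1.
  rewrite [hh2 s * (hh2 s * (hh2 s * _))]mulrA [hh2 s * hh2 s * _]mulrA -expr2 -exprSr.
  by rewrite mulKf// expf_neq0// gt_eqF.
set E := emp _ _ _ in kobs *.
have -> : hh2 s ^- 3 * E - derive1n 2 (dens s) x =
   hh2 s ^- 3 * (E - kernel_mean (prob s) (derive1n 2 G) (hh2 s) x) +
   (segint (- AG) AG (fun z => G z * derive1n 2 (dens s) (x - hh2 s * z)) - derive1n 2 (dens s) x).
  by rewrite -mE; ring.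
rewrite mulrDl (le_trans (ler_normD _ _))// lerD//.
  rewrite normrM gtr0_norm ?invr_gt0 ?exprn_gt0// mulrC ler_pdivrMr ?exprn_gt0//.
  apply: (le_trans kobs).
  have s1 : Num.sqrt (hh2 s * eps R (size_of s)) <= hh2 s ^+ 4 * hh2 s ^+ 3.
    rewrite -(good_eps gs); apply: sqrt_le_sq.
      by rewrite mulr_ge0 ?exprn_ge0 ?(ltW h0).
    by rewrite -exprS -exprD -exprM.
  have s2 : (size_of s)%:R^-1 <= hh2 s ^+ 4 * hh2 s ^+ 3.
    by apply: (le_trans (good_inv gs)); rewrite -exprD; exact: good_hX.
  rewrite -[leRHS]mulrA [leRHS]mulrDl; apply: lerD; first by rewrite ler_wpM2l.
  by rewrite ler_wpM2l// mulr_ge0.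
by apply: (le_trans sm); rewrite ger0_norm// ler_wpM2l ?mulr_ge0 ?exprn_ge0.
Qed.

End good_configurations.

(** * Errors throughout a window of length O(h) *)

Section tent.
Context (R : realType).
Implicit Types (r t x y : R).

(** A Lipschitz majorant of the indicator of |y - t| <= r, supported in |y - t| <= 2 r: the
    deviation bounds apply to Lipschitz functions only. *)
Definition tent r t y : R := Num.max 0 (Num.min 1 (2 - `|y - t| / r)).

Lemma max_lip (a x y : R) : `|Num.max a x - Num.max a y| <= `|x - y|.
Proof.
rewrite ler_norml; have := ler_norm (x - y); have := ler_norm (- (x - y)).
rewrite normrN; case: (leP a x) => ?; case: (leP a y) => ? ? ?;
  apply/andP; split; lra.
Qed.

Lemma min_lip (a x y : R) : `|Num.min a x - Num.min a y| <= `|x - y|.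
Proof.
rewrite ler_norml; have := ler_norm (x - y); have := ler_norm (- (x - y)).
rewrite normrN; case: (leP a x) => ?; case: (leP a y) => ? ? ?;
  apply/andP; split; lra.
Qed.

Lemma tent_lip r t : 0 < r -> lip r^-1 (tent r t).
Proof.
move=> r0 x y; rewrite (le_trans (max_lip _ _ _))// (le_trans (min_lip _ _ _))//.
have -> : 2 - `|x - t| / r - (2 - `|y - t| / r) = r^-1 * (`|y - t| - `|x - t|) by ring.
rewrite normrM gtr0_norm ?invr_gt0// ler_wpM2l ?invr_ge0 ?(ltW r0)//.
apply: (le_trans (ler_dist_dist _ _)).
have -> : y - t - (x - t) = y - x by ring.
by rewrite distrC.
Qed.

Lemma tent_le1 r t y : 0 <= tent r t y <= 1.
Proof.
by rewrite /tent le_max lexx/= ge_max ler01/= ge_min lexx.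
Qed.

Lemma tent_ge r t y : 0 < r -> (`|y - t| <= r)%R%:R <= tent r t y.
Proof.
move=> r0; case: (leP (`|y - t|) r) => h; last by case/andP: (tent_le1 r t y).
rewrite /tent le_max; apply/orP; right; rewrite le_min lexx/=.
have : `|y - t| / r <= 1 by rewrite ler_pdivrMr// mul1r.
lra.
Qed.

Lemma tent_out r t y : 0 < r -> 2 * r <= `|y - t| -> tent r t y = 0.
Proof.
move=> r0 h; rewrite /tent; apply/max_idPl; rewrite ge_min; apply/orP; right.
have : 2 <= `|y - t| / r by rewrite ler_pdivlMr.
lra.
Qed.

End tent.

Section good_windows.
Context (R : realType) (K K1 L G : R -> R) (A M : R).
Context (kb : kernel_bounds K K1 L A M).
Context (C A0 B W : R) (A00 : 0 <= A0) (W0 : 0 <= W).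
Local Notation good := (good K G C A0 B W).
Implicit Types (s : config R) (t x y rho : R).

Let A1 := kb_A kb.
Let M0 := kb_M kb.
Let Age0 : 0 <= A. Proof. exact: le_trans ler01 A1. Qed.

(** The tent that majorizes the indicator has Lipschitz constant 1 / (rho h), hence deviation
    O(h^7), and its expectation is O(h) because the density is bounded. *)
Lemma window_count rho : 0 < rho -> 2 * rho <= W -> exists2 D, 0 <= D &
  forall s t, good s -> `|t| <= B ->
  emp (size_of s) (obsv s) (fun y => (`|y - t| <= rho * hh2 s)%R%:R) <= D * hh2 s.
Proof.
move=> rho0 rhoW; have [D D0 devD] := good_dev_lip K G C B A00 W0.
exists (D / rho + `|C| * (4 * rho)).
  have r0 := ltW rho0; apply: addr_ge0; first exact: divr_ge0.
  by rewrite mulr_ge0// mulr_ge0.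
move=> s t gs tB; have h0 := good_h0 gs; have rh0 : 0 < rho * hh2 s by rewrite mulr_gt0.
have lt_ := tent_lip t rh0.
have ct := lip_continuous lt_.
have out y : 2 * (rho * hh2 s) <= `|y - t| -> tent (rho * hh2 s) t y = 0 by exact: tent_out.
have d1 := devD s t _ _ gs tB lt_.
have Wout y : W * hh2 s <= `|y - t| -> tent (rho * hh2 s) t y = 0.
  move=> hy; apply: out; apply: le_trans hy; rewrite mulrA ler_wpM2r// ltW//.
have {}d1 := d1 Wout.
have e1 : \int[law (prob s)]_y tent (rho * hh2 s) t y <= `|C| * (4 * rho) * hh2 s.
  rewrite (@law_segint R _ _ (good_law gs) (sd_density (good_dens gs)) _
    (t - 2 * (rho * hh2 s)) (t + 2 * (rho * hh2 s)))//; last 2 first.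
  - exact: good_f_cont gs.
  - move=> x hx; apply: out; rewrite leNgt; apply: contra hx => hx.
    by move: hx; rewrite ltr_norml => /andP[? ?]; apply/andP; split; lra.
  apply: (le_trans (ler_norm _)).
  apply: (@le_trans _ _ (C * (t + 2 * (rho * hh2 s) - (t - 2 * (rho * hh2 s))))).
    apply: segint_bound; [lra| |move=> x _].
      by apply: continuousM_fun => //; exact: good_f_cont gs.
    rewrite normrM -[leRHS]mul1r ler_pM ?(good_f_bound x gs)//.
      by have /andP[p q] := tent_le1 (rho * hh2 s) t x; rewrite ger0_norm.
  have -> : t + 2 * (rho * hh2 s) - (t - 2 * (rho * hh2 s)) = 4 * rho * hh2 s by ring.
  by rewrite mulrA ler_wpM2r ?(ltW h0)// ler_wpM2r ?ler_norm// mulr_ge0// ltW.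
apply: (@le_trans _ _ (emp (size_of s) (obsv s) (tent (rho * hh2 s) t))).
  by apply: emp_le => j _; exact: tent_ge.
have -> : emp (size_of s) (obsv s) (tent (rho * hh2 s) t) =
    dev (prob s) (size_of s) (obsv s) (tent (rho * hh2 s) t) +
    \int[law (prob s)]_y tent (rho * hh2 s) t y by rewrite /dev subrK.
rewrite mulrDl lerD//; apply: (le_trans (ler_norm _)); apply: (le_trans d1).
rewrite invfM.
have -> : D * (rho^-1 / hh2 s) * hh2 s ^+ 8 = D / rho * ((hh2 s)^-1 * hh2 s ^+ 8) by ring.
rewrite ler_wpM2l ?divr_ge0 ?(ltW rho0)// exprS mulKf ?gt_eqF//; exact: (good_hX gs (isT : (1 <= 7)%N)).
Qed.

Definition smooth_bias s x := (hh1 s)^-1 * kernel_mean (prob s) K (hh1 s) x - dens s x.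

Definition kernel_fluct s x :=
  (hh1 s)^-1 * dev (prob s) (size_of s) (obsv s) (fun y => K ((x - y) / hh1 s)).

Definition fhat_err s x := fhat K (hh1 s) (sample (size_of s) (obsv s)) x - dens s x.

Lemma fhat_errE s x : fhat_err s x = kernel_fluct s x + smooth_bias s x.
Proof.
rewrite /fhat_err /kernel_fluct /smooth_bias /fhat kernel_sumE expr1 /dev /kernel_mean.
ring.
Qed.

Lemma smooth_biasE s x : good s ->
  smooth_bias s x = segint (- A) A (fun z => K z * dens s (x - hh1 s * z)) - dens s x.
Proof.
move=> gs; rewrite /smooth_bias (kernel_meanE x gs (lip_continuous (kb_lip kb)) (kb_vanishes kb))//.
  by rewrite mulKf// gt_eqF// (good_h1_gt0 gs).
exact: good_h1_gt0 gs.
Qed.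

(* Lipschitz bound: apply the smoothing estimate to [f (. + x - y) - f]. *)
Lemma smooth_bias_bounds s : good s ->
  (forall x, `|smooth_bias s x| <= C * A ^+ 2 * hh2 s ^+ 5) /\
  lip (C * A ^+ 2 * hh2 s ^+ 5) (smooth_bias s).
Proof.
move=> gs; have C0 := good_C gs; have cf := good_f_cont gs.
have cK := lip_continuous (kb_lip kb).
have up c x : 0 <= c -> x <= C * c * A ^+ 2 * hh1 s ^+ 2 -> x <= C * A ^+ 2 * hh2 s ^+ 5 * c.
  move=> c0 /le_trans; apply.
  have -> : C * A ^+ 2 * hh2 s ^+ 5 * c = C * c * A ^+ 2 * hh2 s ^+ 5 by ring.
  by rewrite ler_wpM2l ?mulr_ge0 ?sqr_ge0//; exact: (good_h1sq gs).
split=> [x|x y].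
  rewrite -[leRHS]mulr1; apply: up => //; rewrite smooth_biasE// mulr1.
  have := @kernel_smoothing R K K1 L A M (fun j => derive1n j (dens s)) C x (hh1 s) kb
    (fun j j2 => sd_derive (good_dens gs) (leq_trans j2 (isT : (2 <= 6)%N)))
    (sd_bound (good_dens gs) (isT : (2 <= 6)%N)).
  by rewrite !derive1n0.
apply: up => //; rewrite !smooth_biasE//.
pose phi j z := derive1n j (dens s) (z + (x - y)) - derive1n j (dens s) z.
have dphi j : (j < 2)%N -> forall z : R, is_derive z 1 (phi j) (phi j.+1 z).
  move=> j2 z; have j6 : (j < 6)%N := leq_trans j2 (isT : (2 <= 6)%N).
  have d1 := sd_derive (good_dens gs) j6 (z + (x - y)).
  have d2 : is_derive z 1 (fun z : R => z + (x - y)) 1.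
    by apply: (isd_eq (isdD (isd_id z) (isd_cst (x - y) z))); rewrite addr0.
  have d3 := @isd_comp R (derive1n j (dens s)) (fun z => z + (x - y)) _ _ z d1 d2; rewrite mulr1 in d3.
  exact: (isdB d3 (sd_derive (good_dens gs) j6 z)).
have bphi z : `|phi 2%N z| <= C * `|x - y|.
  rewrite /phi; apply: (le_trans (good_dens_lip gs (isT : (2 < 6)%N) _ _)).
  by rewrite addrAC subrr add0r.
have := @kernel_smoothing R K K1 L A M phi (C * `|x - y|) y (hh1 s) kb dphi bphi.
rewrite /phi !derive1n0; set lhs := (X in `|X| <= _); set rhs := (X in _ -> `|X| <= _).
suff -> : lhs = rhs by [].
rewrite /lhs /rhs.
under eq_segint => z _.
  rewrite (_ : y - hh1 s * z + (x - y) = x - hh1 s * z); last by ring.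
  rewrite mulrBr; over.
rewrite segintB; last 2 first.
- by apply: continuousM_fun => //; exact: continuous_subst.
- by apply: continuousM_fun => //; exact: continuous_subst.
have -> : y + (x - y) = x by ring.
ring.
Qed.

(** Weaker than the bounds at the observations, but valid throughout the window. The function y ->
    K((x - y) / h1) has Lipschitz constant M / h1, whence h^8 / h1^2 <= h^2; a difference of two
    such functions has constant M |x - x'| / h1^2, whence h^8 / h1^3 <= 1 / h. The latter is what
    the product with the weight, itself O(1/h), can afford. *)
Lemma kernel_fluct_bounds rho : 0 <= rho -> rho + A <= W -> exists2 D, 0 <= D &
  forall s t x y, good s -> `|t| <= B -> `|x - t| <= rho * hh2 s -> `|y - t| <= rho * hh2 s ->
  `|kernel_fluct s x| <= D * hh2 s ^+ 2 /\
  `|kernel_fluct s x - kernel_fluct s y| <= D / hh2 s * `|x - y|.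
Proof.
move=> rho0 rhoW; have [D D0 devD] := good_dev_lip K G C B A00 W0.
exists (D * M); first exact: mulr_ge0.
move=> s t x y gs tB xt yt.
have h0 := good_h0 gs; have k0 := good_h1_gt0 gs; have kh := good_h1_le gs.
have k3 := good_h1 gs.
have out u : `|u - t| <= rho * hh2 s -> forall z, W * hh2 s <= `|z - t| -> K ((u - z) / hh1 s) = 0.
  move=> ut z zt; apply: (kb_vanishes kb); rewrite normrM normfV (gtr0_norm k0) ler_pdivlMr//.
  apply: (@le_trans _ _ (A * hh2 s)); first by rewrite ler_wpM2l.
  have : `|z - t| <= `|u - t| + `|u - z|.
    by rewrite [X in _ <= _ + X]distrC (_ : z - t = (u - t) + (z - u)) ?ler_normD//; ring.
  have : (rho + A) * hh2 s <= W * hh2 s by rewrite ler_wpM2r// ltW.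
  by rewrite mulrDl; lra.
have dK u (z : R) : is_derive z 1 (fun z : R => K ((u - z) / hh1 s)) (- ((hh1 s)^-1 * K1 ((u - z) / hh1 s))).
  have d1 := kb_derive kb ((u - z) / hh1 s).
  have d2 : is_derive z 1 (fun z : R => (u - z) / hh1 s) (- (hh1 s)^-1).
    apply: (isd_eq (isdM (isdB (isd_cst u z) (isd_id z)) (isd_cst (hh1 s)^-1 z))).
    by rewrite mulr0 addr0 sub0r mulN1r.
  by apply: (isd_eq (@isd_comp R K (fun z => (u - z) / hh1 s) _ _ z d1 d2)); rewrite mulrN mulrC.
have cK := lip_continuous (kb_lip kb).
have bmK u : bounded_measurable (fun z : R => K ((u - z) / hh1 s)).
  exact: bm_scaled cK (kb_bound kb).
have lK u : lip (M / hh1 s) (fun z => K ((u - z) / hh1 s)).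
  move=> z z'; apply: (le_trans (kb_lip kb _ _)); rewrite -mulrA ler_wpM2l//.
  rewrite -mulrBl (_ : u - z - (u - z') = z' - z); last by ring.
  by rewrite normrM distrC mulrC normfV (gtr0_norm k0).
split.
  rewrite /kernel_fluct normrM gtr0_norm ?invr_gt0//.
  have := devD s t _ _ gs tB (lK x) (out x xt).
  move=> /(ler_wpM2l (ltW (_ : 0 < (hh1 s)^-1))) h1; apply: (le_trans (h1 _)); first by rewrite invr_gt0.
  have -> : (hh1 s)^-1 * (D * (M / hh1 s) * hh2 s ^+ 8) = (D * M) * (hh2 s ^+ 8 / hh1 s ^+ 2).
    by rewrite expr2 invfM; ring.
  rewrite ler_wpM2l ?mulr_ge0// ler_pdivrMr ?exprn_gt0//.
  rewrite (_ : 8%N = (2 + 3 * 2)%N)// exprD exprM ler_wpM2l ?exprn_ge0 ?(ltW h0)//.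
  by rewrite lerXn2r ?nnegrE ?exprn_ge0 ?(ltW h0) ?(ltW k0).
rewrite /kernel_fluct -mulrBr -devB// normrM gtr0_norm ?invr_gt0//.
have ld : lip (M / hh1 s ^+ 2 * `|x - y|) (fun z => K ((x - z) / hh1 s) - K ((y - z) / hh1 s)).
  apply: (lip_deriv (fun z => isdB (dK x z) (dK y z))) => z.
  rewrite -opprD normrN -mulrBr normrM gtr0_norm ?invr_gt0//.
  apply: (@le_trans _ _ ((hh1 s)^-1 * (M * `|(x - z) / hh1 s - (y - z) / hh1 s|))).
    by rewrite ler_wpM2l ?invr_ge0 ?(ltW k0)//; exact: (kb_lip1 kb).
  rewrite -mulrBl (_ : x - z - (y - z) = x - y); last by ring.
  rewrite normrM normfV (gtr0_norm k0) expr2 invfM.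
  by have -> : (hh1 s)^-1 * (M * (`|x - y| / hh1 s)) = M * ((hh1 s)^-1 / hh1 s) * `|x - y| by ring.
have od z : W * hh2 s <= `|z - t| -> K ((x - z) / hh1 s) - K ((y - z) / hh1 s) = 0.
  by move=> zt; rewrite (out x xt)// (out y yt)// subrr.
have := devD s t _ _ gs tB ld od.
move=> /(ler_wpM2l (ltW (_ : 0 < (hh1 s)^-1))) h1; apply: (le_trans (h1 _)); first by rewrite invr_gt0.
have -> : (hh1 s)^-1 * (D * (M / hh1 s ^+ 2 * `|x - y|) * hh2 s ^+ 8) =
    (D * M) * ((hh2 s ^+ 8 / hh1 s ^+ 3) * `|x - y|).
  by field; rewrite gt_eqF.
rewrite -[leRHS]mulrA ler_wpM2l ?mulr_ge0// ler_wpM2r// ler_pdivrMr ?exprn_gt0//.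
rewrite mulrC ler_pdivlMr// -exprSr (_ : 9%N = (3 * 3)%N)// exprM.
by rewrite lerXn2r ?nnegrE ?exprn_ge0 ?(ltW h0) ?(ltW k0).
Qed.

Lemma fhat_err_bounds rho : 0 <= rho -> rho + A <= W -> exists2 D, 0 <= D &
  forall s t x y, good s -> `|t| <= B -> `|x - t| <= rho * hh2 s -> `|y - t| <= rho * hh2 s ->
  `|fhat_err s x| <= D * hh2 s ^+ 2 /\ `|fhat_err s x - fhat_err s y| <= D / hh2 s * `|x - y|.
Proof.
move=> rho0 rhoW; have [D D0 h] := kernel_fluct_bounds rho0 rhoW.
exists (D + `|C| * A ^+ 2); first by rewrite addr_ge0// mulr_ge0// sqr_ge0.
move=> s t x y gs tB xt yt; have [h1 h2] := h s t x y gs tB xt yt.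
have [b1 b2] := smooth_bias_bounds gs.
have C0 := good_C gs; have hp := good_h0 gs.
have CA : 0 <= C * A ^+ 2 by rewrite mulr_ge0// sqr_ge0.
split.
  rewrite fhat_errE (ger0_norm C0) mulrDl (le_trans (ler_normD _ _))// lerD//.
  by apply: (le_trans (b1 x)); rewrite ler_wpM2l//; exact: (good_hX gs (isT : (2 <= 5)%N)).
rewrite !fhat_errE opprD addrACA (le_trans (ler_normD _ _))// (ger0_norm C0).
rewrite [(D + _) / _]mulrDl mulrDl lerD//; apply: (le_trans (b2 x y)).
rewrite ler_wpM2r// ler_wpM2l//; apply: (le_trans (good_hX1 5 gs)).
by rewrite -[leLHS]invr1 lef_pV2 ?posrE//; have /andP[] := good_h gs.
Qed.

End good_windows.

Lemma Oh_inv (R : realType) (T : Type) (D : T -> Prop) (h u : T -> R) (c : R) : 0 < c ->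
  (forall q, D q -> c <= u q) -> bigOh D h 0 (fun q => (u q)^-1).
Proof.
move=> c0 cu; exists c^-1; first by rewrite invr_ge0 ltW.
move=> q Dq; have u0 : 0 < u q := lt_le_trans c0 (cu q Dq).
by rewrite expr0 mulr1 gtr0_norm ?invr_gt0// lef_pV2 ?posrE//; exact: cu.
Qed.

Lemma kernel_L (R : realType) (K K1 L : R -> R) A M : kernel_bounds K K1 L A M ->
  forall y, L y = K y + y * K1 y.
Proof.
move=> kb y; have [_ <-] := kb_Lderive kb y.
have d := isdM (isd_id y) (kb_derive kb y); rewrite mul1r in d.
by have [_ ->] := d.
Qed.

Lemma tau_segint (R : realType) (K K1 L : R -> R) A M j : kernel_bounds K K1 L A M ->
  ~~ odd j -> tau K j%:R = segint (- A) A (fun z => z ^+ j * K z).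
Proof.
move=> kb oj; rewrite /tau /Rintegral.
have e x : K x * `|x| `^ j%:R = x ^+ j * K x.
  by rewrite powR_mulrn// -normrX ger0_norm 1?mulrC//; exact: exprn_even_ge0.
under eq_integral do rewrite e.
rewrite (@integral_segint R (- A) A (fun z : R => z ^+ j * K z))//.
  by apply: continuousM_fun; [exact: continuous_pow|exact: lip_continuous (kb_lip kb)].
by move=> x hx; rewrite (vanishes_out (kb_vanishes kb) hx) mulr0.
Qed.

(** * The estimated bandwidth function at the observations *)

Section pilot_bandwidths.
Context (R : realType) (K K1 L G : R -> R) (A M AG MG : R).
Context (kb : kernel_bounds K K1 L A M) (gb : kernel4_bounds G AG MG).
Context (C A0 B W : R) (A00 : 0 <= A0) (W0 : 0 <= W).
Context (c t0 : R) (p : R -> R) (c0 : 0 < c).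
Context (pmono : {homo p : x y / x <= y}) (p1 : forall x, 1 <= p x).
Context (pid : forall x, t0 <= x -> p x = x).
Local Notation good := (good K G C A0 B W).
Implicit Types (s : config R) (t x y rho : R).

Let kap : R := tau K 4 / (24 * tau K 2).

Definition sampled s := sample (size_of s) (obsv s).

Definition fh s x := fhat K (hh1 s) (sampled s) x.
Definition ah s x := alpha_hat K c p (hh1 s) (sampled s) x.
Definition bh s x := beta_hat K G c p (hh1 s) (hh3 s) (hh2 s) (sampled s) x.
Definition gh s x := gamma_hat K G c p (hh1 s) (hh2 s) (hh3 s) (hh2 s) (sampled s) x.

Lemma alpha_ge x : c <= alpha c p x.
Proof.
rewrite /alpha -[leLHS]mulr1 ler_wpM2l ?(ltW c0)// -[leLHS]sqrtr1 ler_wsqrtr//.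
Qed.

Lemma alpha_le x y : x <= y -> alpha c p x <= alpha c p y.
Proof.
move=> xy; rewrite /alpha ler_wpM2l ?(ltW c0)// ler_wsqrtr// pmono// ler_wpM2l//.
by rewrite invr_ge0 exprn_ge0// ltW.
Qed.

Lemma alpha_sqrt x : t0 * c ^+ 2 <= x -> alpha c p x = Num.sqrt x.
Proof.
move=> h; have c2 : 0 < c ^+ 2 by rewrite exprn_gt0.
rewrite /alpha pid; last by rewrite mulrC ler_pdivlMr.
by rewrite sqrtrM ?invr_ge0 ?(ltW c2)// sqrtrV ?(ltW c2)// sqrtr_sqr gtr0_norm// mulrA divff ?gt_eqF// mul1r.
Qed.

Lemma bhE s x : bh s x = kap * (fG2 G (hh2 s) (sampled s) x * fh s x
   - 2 * fG1 G (hh3 s) (sampled s) x ^+ 2) / ah s x ^+ 6.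
Proof. by rewrite /bh /beta_hat -/(ah s x) -/(fh s x) /kap invfM; ring. Qed.

(** These hold at every observation, near the point of interest or not: alpha_hat >= c follows from
    p >= 1, and the other pilots are bounded because their errors at observations are. The lower
    bound c / 2 is what confines the support of each summand of the estimator to a window. *)
Lemma pilot_bounds : exists h0 Gam, [/\ 0 < h0, 0 <= Gam & forall s i, good s -> hh2 s <= h0 ->
  (i < size_of s)%N ->
  [/\ c / 2 <= gh s (obs i (obsv s)) <= Gam, 2^-1 <= 1 + hh2 s ^+ 2 * bh s (obs i (obsv s)) &
      `|bh s (obs i (obsv s))| <= Gam]].
Proof.
have [D D0 dh] := observation_density G kb C B W A00.
have [D1 D10 dh1] := observation_derive1 K gb C B W A00.
have [D2 D20 dh2] := observation_derive2 K gb C B W A00.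
pose F := `|C| + D; pose F1 := `|C| + D1; pose F2 := `|C| + D2.
have F0 : 0 <= F by rewrite addr_ge0.
have F10 : 0 <= F1 by rewrite addr_ge0.
have F20 : 0 <= F2 by rewrite addr_ge0.
pose Bb := `|kap| * (F2 * F + 2 * F1 ^+ 2) / c ^+ 6.
have Bb0 : 0 <= Bb by rewrite divr_ge0 ?exprn_ge0 ?(ltW c0)// mulr_ge0// addr_ge0 ?mulr_ge0// ?exprn_ge0.
(* Makes h^2 |beta_hat| at most 1/2. *)
pose h0 := Num.min 1 (2 * (Bb + 1))^-1.
have h00 : 0 < h0 by rewrite lt_min ltr01 invr_gt0 mulr_gt0// ltr_pwDr.
have aF : 0 < alpha c p F by apply: lt_le_trans c0 (alpha_ge F).
exists h0, (2 * alpha c p F + Bb); split=> //.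
  by rewrite addr_ge0// mulr_ge0// ltW.
move=> s i gs hs ilt; set x := obs i (obsv s).
have hp := good_h0 gs; have hle1 : hh2 s <= 1 by have /andP[] := good_h gs.
have C0 := good_C gs.
have add_bound (a b m d : R) k : 0 <= d -> `|a - b| <= d * hh2 s ^+ k -> `|b| <= m -> `|a| <= `|m| + d.
  move=> d0 ab bm; have -> : a = b + (a - b) by ring.
  rewrite (le_trans (ler_normD _ _))// lerD//; first exact: le_trans bm (ler_norm m).
  by apply: (le_trans ab); rewrite ler_piMr// (good_hX1 k gs).
have e0 : `|fh s x| <= F by exact: add_bound D0 (dh s i gs ilt) (good_f_bound x gs).
have e1 : `|fG1 G (hh3 s) (sampled s) x| <= F1.
  exact: add_bound D10 (dh1 s i gs ilt) (sd_bound (good_dens gs) (isT : (1 <= 6)%N) x).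
have e2 : `|fG2 G (hh2 s) (sampled s) x| <= F2.
  exact: add_bound D20 (dh2 s i gs ilt) (sd_bound (good_dens gs) (isT : (2 <= 6)%N) x).
have ac : c <= ah s x by exact: alpha_ge.
have a0 : 0 < ah s x by exact: lt_le_trans ac.
have aFx : ah s x <= alpha c p F by apply: alpha_le; exact: le_trans (ler_norm _) e0.
have bb : `|bh s x| <= Bb.
  rewrite bhE /Bb normrM ler_pM//.
    rewrite normrM ler_wpM2l// (le_trans (ler_normB _ _))// lerD//.
      by rewrite normrM ler_pM.
    by rewrite normrM normrX ger0_norm// ler_wpM2l// lerXn2r ?nnegrE.
  rewrite gtr0_norm ?invr_gt0 ?exprn_gt0// lef_pV2 ?posrE ?exprn_gt0//.
  by rewrite lerXn2r ?nnegrE ?(ltW c0) ?(ltW a0).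
have h2b : `|hh2 s ^+ 2 * bh s x| <= 2^-1.
  rewrite normrM ger0_norm ?exprn_ge0 ?(ltW hp)//.
  apply: (@le_trans _ _ (hh2 s * (Bb + 1))).
    rewrite expr2 -mulrA ler_wpM2l ?(ltW hp)//.
    by rewrite -[leRHS]mul1r ler_pM ?(ltW hp)// (le_trans bb)// lerDl.
  rewrite -ler_pdivlMr; last by rewrite ltr_pwDr.
  apply: (le_trans hs); rewrite /h0 ge_min; apply/orP; right.
  by rewrite invfM.
move: h2b; rewrite ler_norml => /andP[l1 l2].
have den : 2^-1 <= 1 + hh2 s ^+ 2 * bh s x by lra.
have den2 : 1 + hh2 s ^+ 2 * bh s x <= 2 by lra.
have den0 : 0 < 1 + hh2 s ^+ 2 * bh s x by lra.
split => //; last by rewrite (le_trans bb)// lerDr mulr_ge0// ltW.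
have -> : gh s x = ah s x / (1 + hh2 s ^+ 2 * bh s x) by [].
apply/andP; split.
  by rewrite ler_pM ?invr_ge0 ?(ltW c0)// lef_pV2 ?posrE.
rewrite (@le_trans _ _ (2 * alpha c p F))//; last by rewrite lerDl.
rewrite mulrC ler_pM ?invr_ge0 ?(ltW a0) ?(ltW den0)//.
by rewrite -[leRHS]invrK lef_pV2 ?posrE ?invr_gt0.
Qed.

Section window.
Context (rho r0 r1 : R) (rho0 : 0 <= rho) (r10 : 0 < r1) (r1t0 : t0 * c ^+ 2 <= r1) (r01 : r1 < r0).

Let T : Type := (config R * R * nat)%type.
Let cs (q : T) : config R := q.1.1.
Let ct (q : T) : R := q.1.2.
Let cx (q : T) : R := obs q.2 (obsv q.1.1).

Definition in_window h0 (q : T) : Prop :=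
  [/\ good (cs q), hh2 (cs q) <= h0, `|ct q| <= B & r0 <= dens (cs q) (ct q)] /\
  (q.2 < size_of (cs q))%N /\ `|cx q - ct q| <= rho * hh2 (cs q).

Let gam s x := gamma_cut kap r1 (hh2 s) (dens s) x.

(** gamma_hat - gamma is sqrt(f_hat) - sqrt(f) up to h^2 times a term O(h^4). The difference of
    roots is (f_hat - f) / (sqrt(f_hat) + sqrt(f)), where f_hat - f = O(h^5), and replacing the
    denominator by 2 sqrt(f t) costs a relative error O(h). *)
Lemma gamma_hat_expansion : exists h0 D, [/\ 0 < h0, 0 <= D & forall q, in_window h0 q ->
  let s := cs q in let x := cx q in let sg := Num.sqrt (dens s (ct q)) in
  [/\ `|gh s x - gam s x - fhat_err K s x / (2 * sg)| <= D * hh2 s ^+ 6,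
      `|gh s x - gam s x| <= D * hh2 s ^+ 5,
      `|gh s x - sg| <= D * hh2 s & `|gam s x - sg| <= D * hh2 s]].
Proof.
have [D D0 dh] := observation_density G kb C B W A00.
have [D1 D10 dh1] := observation_derive1 K gb C B W A00.
have [D2 D20 dh2] := observation_derive2 K gb C B W A00.
have [hp0 [Gam [hp00 Gam0 pb]]] := pilot_bounds.
have [hg [g0 [Gg [/andP[hg0 hg1] g00 Gg0 gc]]]] := gamma_cut_bounds C kap r10.
pose d := (r0 - r1) / 2; have d0 : 0 < d by rewrite divr_gt0// subr_gt0.
(* With h E at most (r0 - r1) / 2, neither the move from t to the observation, which changes f by at
   most C rho h, nor the pilot error D h^5 brings f or f_hat below r1: no clipping acts. *)
pose E := `|C| * rho + D + 1.
have E0 : 0 < E by rewrite ltr_pwDr// addr_ge0// mulr_ge0.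
pose h0 := Num.min (Num.min hp0 hg) (Num.min 1 (d / E)).
have h00 : 0 < h0 by rewrite !lt_min hp00 hg0 ltr01 divr_gt0.
pose D' := in_window h0; pose h q := hh2 (cs q).
have base q : D' q -> [/\ good (cs q), h q <= hp0, h q <= hg & h q * E <= d].
  move=> [[gs hs _ _] _]; move: hs; rewrite !le_min => /andP[/andP[? ?] /andP[? hE]].
  by split => //; rewrite -ler_pdivlMr.
have h01 q : D' q -> 0 <= h q <= 1.
  by move=> [[gs _ _ _] _]; have /andP[a b] := good_h gs; rewrite /h (ltW a).
have hpos q : D' q -> 0 < h q by move=> [[gs _ _ _] _]; exact: good_h0 gs.
have C0 q : D' q -> 0 <= C by move=> [[gs _ _ _] _]; exact: good_C gs.
pose F q := dens (cs q) (cx q); pose F1 q := derive1n 1 (dens (cs q)) (cx q).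
pose F2 q := derive1n 2 (dens (cs q)) (cx q).
pose Fh q := fh (cs q) (cx q); pose Gh1 q := fG1 G (hh3 (cs q)) (sampled (cs q)) (cx q).
pose Gh2 q := fG2 G (hh2 (cs q)) (sampled (cs q)) (cx q).
pose f0 q := dens (cs q) (ct q).
have OF : bigOh D' h 0 F.
  exists `|C| => // q [[gs _ _ _] _]; rewrite expr0 mulr1.
  exact: le_trans (good_f_bound _ gs) (ler_norm C).
have OF1 : bigOh D' h 0 F1.
  exists `|C| => // q [[gs _ _ _] _]; rewrite expr0 mulr1.
  exact: le_trans (sd_bound (good_dens gs) (isT : (1 <= 6)%N) _) (ler_norm C).
have OF2 : bigOh D' h 0 F2.
  exists `|C| => // q [[gs _ _ _] _]; rewrite expr0 mulr1.
  exact: le_trans (sd_bound (good_dens gs) (isT : (2 <= 6)%N) _) (ler_norm C).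
have Od : bigOh D' h 5 (fun q => Fh q - F q).
  by exists D => // q [[gs _ _ _] [ilt _]]; exact: dh.
have Od1 : bigOh D' h 4 (fun q => Gh1 q - F1 q).
  by exists D1 => // q [[gs _ _ _] [ilt _]]; exact: dh1.
have Od2 : bigOh D' h 4 (fun q => Gh2 q - F2 q).
  by exists D2 => // q [[gs _ _ _] [ilt _]]; exact: dh2.
have Oft : bigOh D' h 1 (fun q => F q - f0 q).
  exists (`|C| * rho); first by rewrite mulr_ge0.
  move=> q Dq; have cp := C0 q Dq; case: (Dq) => [[gs _ _ _] [_ xt]].
  apply: (le_trans (good_f_lip gs _ _)); rewrite expr1 (ger0_norm cp) -mulrA.
  by rewrite ler_wpM2l.
have OFh : bigOh D' h 0 Fh.
  by apply: Oh_ext (OhD OF (Oh_le h01 (leq0n 5) Od)) => q _; rewrite addrC subrK.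
have OGh1 : bigOh D' h 0 Gh1.
  by apply: Oh_ext (OhD OF1 (Oh_le h01 (leq0n 4) Od1)) => q _; rewrite addrC subrK.
have OGh2 : bigOh D' h 0 Gh2.
  by apply: Oh_ext (OhD OF2 (Oh_le h01 (leq0n 4) Od2)) => q _; rewrite addrC subrK.
have f0ge q : D' q -> r0 <= f0 q by move=> [[_ _ _ ?] _].
have Fge q : D' q -> r1 + (D + 1) * h q <= F q.
  move=> Dq; have [gs _ _ hE] := base q Dq; have cp := C0 q Dq.
  case: (Dq) => [[_ _ _ fr] [_ xt]].
  have := good_f_lip gs (cx q) (ct q); rewrite ler_norml => /andP[lo _].
  have : C * `|cx q - ct q| <= `|C| * rho * h q.
    by rewrite (ger0_norm cp) -mulrA ler_wpM2l.
  have : r1 < r0 by [].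
  move: hE lo fr; rewrite /E /d /F; set k := `|C| * rho.
  have hq := hpos q Dq.
  by nra.
have Fhge q : D' q -> r1 <= Fh q.
  move=> Dq; have := Fge q Dq; case: (Dq) => [[gs _ _ _] [ilt _]].
  have := dh _ _ gs ilt; rewrite ler_norml => /andP[lo _].
  have {}lo : - (D * h q ^+ 5) <= Fh q - F q by [].
  have hk : D * h q ^+ 5 <= D * h q by rewrite ler_wpM2l//; exact: (good_hX gs (isT : (1 <= 5)%N)).
  by have hq := hpos q Dq; move: lo hk; set u := D * _ ^+ 5; lra.
have {}Fge q : D' q -> r1 <= F q.
  move=> Dq; have := Fge q Dq; have hq := hpos q Dq; move=> h1; apply: le_trans h1.
  by rewrite lerDl mulr_ge0 ?(ltW hq)// addr_ge0.
have srt (u : T -> R) : (forall q, D' q -> r1 <= u q) ->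
  (forall q, D' q -> Num.sqrt r1 <= Num.sqrt (u q)) /\ (forall q, D' q -> Num.sqrt (u q) ^+ 2 = u q).
  move=> hu; split=> q Dq; first by rewrite ler_wsqrtr// hu.
  by rewrite sqr_sqrtr// (le_trans (ltW r10))// hu.
have sr0 : 0 < Num.sqrt r1 by rewrite sqrtr_gt0.
have sr00 : 0 < Num.sqrt r1 + Num.sqrt r1 by rewrite addr_gt0.
have [s1 s1q] := srt F Fge; have [s2 s2q] := srt Fh Fhge.
have [s3 s3q] := srt f0 (fun q Dq => le_trans (ltW r01) (f0ge q Dq)).
pose S1 q := Num.sqrt (F q); pose S2 q := Num.sqrt (Fh q); pose S3 q := Num.sqrt (f0 q).
have sq_pos (u : T -> R) : (forall q, D' q -> Num.sqrt r1 <= u q) -> forall q, D' q -> 0 < u q.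
  by move=> hu q Dq; exact: lt_le_trans sr0 (hu q Dq).
have p1q := sq_pos S1 s1; have p2q := sq_pos S2 s2; have p3q := sq_pos S3 s3.
have OV12 : bigOh D' h 0 (fun q => (S2 q + S1 q)^-1).
  by apply: (@Oh_inv _ _ D' h (fun q => S2 q + S1 q) _ sr00) => q Dq; exact: lerD (s2 q Dq) (s1 q Dq).
have OV13 : bigOh D' h 0 (fun q => (S3 q + S1 q)^-1).
  by apply: (@Oh_inv _ _ D' h (fun q => S3 q + S1 q) _ sr00) => q Dq; exact: lerD (s3 q Dq) (s1 q Dq).
have OV3 : bigOh D' h 0 (fun q => (S3 q)^-1) by exact: (@Oh_inv _ _ D' h S3 _ sr0).
have O21 : bigOh D' h 5 (fun q => S2 q - S1 q).
  apply: Oh_ext (OhMr Od OV12) => q Dq; rewrite -(s1q q Dq) -(s2q q Dq) -/(S1 q) -/(S2 q).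
  by have a := p1q q Dq; have b := p2q q Dq; field; rewrite gt_eqF// addr_gt0.
have O13 : bigOh D' h 1 (fun q => S1 q - S3 q).
  apply: Oh_ext (OhMr Oft OV13) => q Dq; rewrite -(s1q q Dq) -(s3q q Dq) -/(S1 q) -/(S3 q).
  by have a := p1q q Dq; have b := p3q q Dq; field; rewrite gt_eqF// addr_gt0.
have O23 : bigOh D' h 1 (fun q => S2 q - S3 q).
  by apply: Oh_ext (OhD (Oh_le h01 (isT : (1 <= 5)%N) O21) O13) => q _; ring.
have OS1 : bigOh D' h 0 S1.
  exists (Num.sqrt `|C|); first exact: sqrtr_ge0.
  move=> q [[gs _ _ _] _]; rewrite expr0 mulr1 ger0_norm ?sqrtr_ge0// ler_wsqrtr//.
  exact: le_trans (ler_norm _) (le_trans (good_f_bound _ gs) (ler_norm C)).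
have OS2 : bigOh D' h 0 S2.
  by apply: Oh_ext (OhD OS1 (Oh_le h01 (leq0n 5) O21)) => q _; ring.
pose Bt q := beta_cut kap r1 (dens (cs q)) (cx q); pose Bh q := bh (cs q) (cx q).
have BtE q : D' q -> Bt q = kap * (F2 q * F q - 2 * F1 q ^+ 2) / F q ^+ 3.
  by move=> Dq; rewrite /Bt /beta_cut flrE//; exact: Fge.
have ahE q : D' q -> ah (cs q) (cx q) = S2 q.
  by move=> Dq; rewrite /ah /alpha_hat alpha_sqrt// (le_trans r1t0)//; exact: Fhge.
have BhE q : D' q -> Bh q = kap * (Gh2 q * Fh q - 2 * Gh1 q ^+ 2) / Fh q ^+ 3.
  by move=> Dq; rewrite /Bh bhE ahE// (exprM _ 2 3) s2q.
have OVF : bigOh D' h 0 (fun q => (F q)^-1) by exact: (@Oh_inv _ _ D' h F _ r10).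
have OVFh : bigOh D' h 0 (fun q => (Fh q)^-1) by exact: (@Oh_inv _ _ D' h Fh _ r10).
have OBdiff : bigOh D' h 4 (fun q => Bh q - Bt q).
  pose N1 q := F2 q * F q - 2 * F1 q ^+ 2.
  have OFd4 := Oh_le h01 (isT : (4 <= 5)%N) Od.
  have ON : bigOh D' h 4 (fun q => (Gh2 q - F2 q) * Fh q + F2 q * (Fh q - F q)
      - 2 * ((Gh1 q - F1 q) * (Gh1 q + F1 q))).
    apply: OhB; last by apply: OhMl; [exact: Oh_cst|apply: OhMr => //; exact: OhD].
    by apply: OhD; [exact: OhMr|exact: OhMl].
  have ON1 : bigOh D' h 0 N1 by rewrite /N1; Ohbounded.
  have OV3h : bigOh D' h 0 (fun q => (Fh q)^-1 ^+ 3) by exact: OhX0.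
  have OD3 : bigOh D' h 4 (fun q => - (Fh q - F q) *
     ((Fh q ^+ 2 + Fh q * F q + F q ^+ 2) * ((Fh q)^-1 ^+ 3 * (F q)^-1 ^+ 3))).
    by apply: OhMr; [exact: OhN|Ohbounded].
  have Ofin := OhMl (Oh_cst D' h kap) (OhD (OhMr ON OV3h) (OhMl ON1 OD3)).
  apply: Oh_ext Ofin => q Dq; rewrite BtE// BhE// /N1.
  have a := lt_le_trans r10 (Fge q Dq); have b := lt_le_trans r10 (Fhge q Dq).
  by field; rewrite !gt_eqF.
pose d1 q := (1 + h q ^+ 2 * Bt q)^-1; pose d2 q := (1 + h q ^+ 2 * Bh q)^-1.
have hf : 0 < 2^-1 :> R by [].
have dlow1 q : D' q -> 2^-1 <= 1 + h q ^+ 2 * Bt q.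
  move=> Dq; have [gs _ hgq _] := base q Dq.
  have hq : 0 <= h q <= hg by rewrite hgq (ltW (hpos q Dq)).
  by have [_ b _ _] := gc _ _ (good_dens gs) hq; exact: b.
have dlow2 q : D' q -> 2^-1 <= 1 + h q ^+ 2 * Bh q.
  by move=> Dq; have [gs hq _ _] := base q Dq; case: (Dq) => [_ [ilt _]]; have [] := pb _ _ gs hq ilt.
have Od1i : bigOh D' h 0 d1 by exact: (@Oh_inv _ _ D' h (fun q => 1 + h q ^+ 2 * Bt q) _ hf).
have Od2i : bigOh D' h 0 d2 by exact: (@Oh_inv _ _ D' h (fun q => 1 + h q ^+ 2 * Bh q) _ hf).
have OBh : bigOh D' h 0 Bh.
  exists Gam => // q Dq; have [gs hq _ _] := base q Dq; case: (Dq) => [_ [ilt _]].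
  by rewrite expr0 mulr1; have [] := pb _ _ gs hq ilt.
have OBt : bigOh D' h 0 Bt.
  by apply: Oh_ext (OhB OBh (Oh_le h01 (leq0n 4) OBdiff)) => q _; ring.
have Oh2 := Oh_h h01 2.
have Odd : bigOh D' h 4 (fun q => d2 q - d1 q).
  have := OhM Oh2 (OhMr (OhN OBdiff) (OhMl Od2i Od1i)).
  move=> /(Oh_le h01 (isT : (4 <= 2 + (4 + 0))%N)); apply: Oh_ext => q Dq.
  have a := lt_le_trans hf (dlow1 q Dq); have b := lt_le_trans hf (dlow2 q Dq).
  by rewrite /d1 /d2; field; rewrite !gt_eqF.
have Ores : bigOh D' h 6 (fun q => h q ^+ 2 * (S2 q * Bh q * d2 q - S1 q * Bt q * d1 q)).
  apply: (OhM Oh2).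
  have O21' := Oh_le h01 (isT : (4 <= 5)%N) O21.
  apply: Oh_ext (OhD (OhD (OhMr O21' (OhMl OBh Od2i)) (OhMl OS1 (OhMr OBdiff Od2i)))
     (OhMl OS1 (OhMl OBt Odd))) => q _; ring.
(* Both quotients are expanded by 1 / (1 + v) = 1 - v / (1 + v). *)
have gE q : D' q -> gh (cs q) (cx q) - gam (cs q) (cx q) = (S2 q - S1 q) -
    h q ^+ 2 * (S2 q * Bh q * d2 q - S1 q * Bt q * d1 q).
  move=> Dq; have -> : gh (cs q) (cx q) = ah (cs q) (cx q) * d2 q by [].
  have -> : gam (cs q) (cx q) = S1 q * d1 q by rewrite /gam /gamma_cut flrE//; exact: Fge.
  rewrite ahE// /d1 /d2.
  have a := lt_le_trans hf (dlow1 q Dq); have b := lt_le_trans hf (dlow2 q Dq).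
  by field; rewrite !gt_eqF.
have Osq : bigOh D' h 6 (fun q => (S2 q - S1 q) - (Fh q - F q) / (2 * S3 q)).
  have Oin : bigOh D' h 1 (fun q => - ((S2 q - S3 q) + (S1 q - S3 q)) * ((S2 q + S1 q)^-1 * (2^-1 * (S3 q)^-1))).
    apply: OhMr; first by apply: OhN; exact: OhD.
    by Ohbounded.
  apply: Oh_ext (OhM Od Oin) => q Dq; rewrite -(s1q q Dq) -(s2q q Dq) -/(S1 q) -/(S2 q).
  have a := p1q q Dq; have b := p2q q Dq; have e := p3q q Dq.
  by field; rewrite !gt_eqF// addr_gt0.
have Ofin : bigOh D' h 6 (fun q => gh (cs q) (cx q) - gam (cs q) (cx q) - (Fh q - F q) / (2 * S3 q)).
  by apply: Oh_ext (OhB Osq Ores) => q Dq; rewrite gE//; ring.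
have Ogg : bigOh D' h 5 (fun q => gh (cs q) (cx q) - gam (cs q) (cx q)).
  by apply: Oh_ext (OhB O21 (Oh_le h01 (isT : (5 <= 6)%N) Ores)) => q Dq; rewrite gE.
have OgS : bigOh D' h 1 (fun q => gam (cs q) (cx q) - S3 q).
  have h1 : bigOh D' h 2 (fun q => gam (cs q) (cx q) - S1 q).
    exists Gg; first exact: ltW.
    move=> q Dq; have [gs _ hgq _] := base q Dq.
    have hq : 0 <= h q <= hg by rewrite hgq (ltW (hpos q Dq)).
    have [_ _ b _] := gc _ _ (good_dens gs) hq; have := b (cx q).
    by rewrite flrE//; exact: Fge.
  by apply: Oh_ext (OhD (Oh_le h01 (isT : (1 <= 2)%N) h1) O13) => q _; ring.
have OhS : bigOh D' h 1 (fun q => gh (cs q) (cx q) - S3 q).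
  by apply: Oh_ext (OhD (Oh_le h01 (isT : (1 <= 5)%N) Ogg) OgS) => q _; ring.
case: Ofin => N6 N60 b6; case: Ogg => N5 N50 b5; case: OgS => Na Na0 ba; case: OhS => Nb Nb0 bb.
exists h0, (N6 + N5 + Na + Nb); split=> //; first by rewrite !addr_ge0.
move=> q Dq /=; have hq := ltW (hpos q Dq).
have up k (a b : R) : 0 <= b -> a <= b -> a * h q ^+ k <= b * h q ^+ k.
  by move=> _ ab; rewrite ler_wpM2r// exprn_ge0.
have NN : 0 <= N6 + N5 + Na + Nb by rewrite !addr_ge0.
split.
- by apply: (le_trans (b6 q Dq)); apply: (up 6%N) => //; lra.
- by apply: (le_trans (b5 q Dq)); apply: (up 5%N) => //; lra.
- by apply: (le_trans (bb q Dq)); apply: (up 1%N) => //; lra.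
- by apply: (le_trans (ba q Dq)); apply: (up 1%N) => //; lra.
Qed.

End window.
End pilot_bandwidths.

(** * Linearization *)

Section linearization_step.
Context (R : realType) (K K1 L : R -> R) (A M : R) (kb : kernel_bounds K K1 L A M).

(** The function g -> K(z g) g has derivative L(z g). The mean value theorem evaluates it between g1
    and g2, and the Lipschitz bound of [L] moves that point to [sg]. *)
Lemma kernel_product_step (z g1 g2 sg e d : R) : `|g1 - sg| <= d -> `|g2 - sg| <= d ->
  `|K (z * g1) * g1 - K (z * g2) * g2 - L (z * sg) * e| <=
  M * (`|z| * d) * `|g1 - g2| + M * `|g1 - g2 - e|.
Proof.
move=> h1 h2.
have dF (x : R) : is_derive x 1 (fun x : R => K (z * x) * x) (L (z * x)).
  have d1 := kb_derive kb (z * x).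
  have d2 := isdM (isd_cst z x) (isd_id x).
  have d3 := isdM (@isd_comp R K (fun x => z * x) _ _ x d1 d2) (isd_id x).
  by apply: (isd_eq d3); rewrite (kernel_L kb); ring.
have [xi /andP[x1 x2] e1] := mvt g2 g1 dF.
have xid : `|xi - sg| <= d.
  move: h1 h2; rewrite !ler_norml => /andP[a1 a2] /andP[b1 b2].
  move: x1 x2; rewrite ge_min le_max => /orP[x1|x1] /orP[x2|x2]; apply/andP; split; lra.
rewrite e1.
have -> : L (z * xi) * (g1 - g2) - L (z * sg) * e =
  (L (z * xi) - L (z * sg)) * (g1 - g2) + L (z * sg) * (g1 - g2 - e) by ring.
have M0 := kb_M kb.
rewrite (le_trans (ler_normD _ _))// lerD// normrM.
  rewrite ler_wpM2r//; apply: (le_trans (kb_Llip kb _ _)).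
  by rewrite -mulrBr normrM ler_wpM2l// ler_wpM2l.
by rewrite ler_wpM2r//; exact: (kb_Lbound kb).
Qed.

(** [v] is controlled on [S] only, off which [w] vanishes; when just one of the two points is in
    [S], the increment is that of [w] times the value of [v] there. *)
Lemma lip_product_window (w v : R -> R) (S : R -> Prop) (Lw Mw Lv Mv : R) :
  lip Lw w -> (forall x, `|w x| <= Mw) -> (forall x, ~ S x -> w x = 0) ->
  (forall x, S x -> `|v x| <= Mv) ->
  (forall x y, S x -> S y -> `|v x - v y| <= Lv * `|x - y|) -> 0 <= Mv -> 0 <= Lv ->
  lip (Lw * Mv + Mw * Lv) (fun x => w x * v x).
Proof.
move=> lw bw ow bv lv Mv0 Lv0 x y.
have Lw0 := lip_ge0 lw.
have Mw0 : 0 <= Mw by exact: le_trans (bw 0).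
have one a b : S b -> ~ S a -> `|w a * v a - w b * v b| <= (Lw * Mv + Mw * Lv) * `|a - b|.
  move=> Sb nSa; rewrite (ow a nSa) mul0r.
  have -> : 0 - w b * v b = (w a - w b) * v b by rewrite (ow a nSa); ring.
  rewrite normrM; apply: (@le_trans _ _ ((Lw * `|a - b|) * Mv)).
    by rewrite ler_pM// ?lw// bv.
  by rewrite mulrDl mulrAC lerDl mulr_ge0// mulr_ge0.
have [Sx|nSx] := pselect (S x); have [Sy|nSy] := pselect (S y).
- have -> : w x * v x - w y * v y = (w x - w y) * v y + w x * (v x - v y) by ring.
  rewrite (le_trans (ler_normD _ _))// [leRHS]mulrDl lerD// normrM.
    by rewrite mulrAC ler_pM// ?lw// bv.
  by rewrite -mulrA ler_pM// lv.
- by rewrite distrC [`|x - y|]distrC; exact: one.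
- exact: one.
- by rewrite (ow x nSx) (ow y nSy) !mul0r subrr normr0 mulr_ge0// addr_ge0// mulr_ge0.
Qed.

End linearization_step.

Section linearization.
Context (R : realType) (K K1 L G : R -> R) (A M AG MG : R).
Context (kb : kernel_bounds K K1 L A M) (gb : kernel4_bounds G AG MG).
Context (C A0 B W : R) (A00 : 0 <= A0) (W0 : 0 <= W).
Context (c t0 : R) (p : R -> R) (c0 : 0 < c).
Context (pmono : {homo p : x y / x <= y}) (p1 : forall x, 1 <= p x).
Context (pid : forall x, t0 <= x -> p x = x).
Local Notation good := (good K G C A0 B W).
Implicit Types (s : config R) (t x y : R).

Let kap : R := tau K 4 / (24 * tau K 2).

Context (r0 r1 : R) (r10 : 0 < r1) (r1t0 : t0 * c ^+ 2 <= r1) (r01 : r1 < r0).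
Context (rho gl Gg hg : R) (rho0 : 0 < rho) (rhoW : 2 * rho + A <= W).
Context (gl0 : 0 < gl) (Gg0 : 0 < Gg) (hg0 : 0 < hg).
Context (gcut : forall f h, smooth_densities C 6 f -> 0 <= h <= hg ->
  (forall x, gl <= gamma_cut kap r1 h f x <= Gg) /\ lip Gg (gamma_cut kap r1 h f)).
Context (rho_gl : A <= rho * gl) (rho_c : A <= rho * (c / 2)) (rho_r0 : A <= rho * Num.sqrt r0).

Let Age0 : 0 <= A. Proof. exact: le_trans ler01 (kb_A kb). Qed.
Let M0 := kb_M kb.

Definition gamma_at s x := gamma_cut kap r1 (hh2 s) (dens s) x.
Definition root_dens s t := Num.sqrt (dens s t).
Definition clean_summand s t y := (hh2 s)^-1 * (K ((t - y) / hh2 s * gamma_at s y) * gamma_at s y).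
Definition weight s t y := (hh2 s)^-1 * L ((t - y) / hh2 s * root_dens s t).

(** The three hypotheses on [rho] make rho h a common window: outside it the kernels scaled by gamma
    (at least [gl]), by gamma_hat (at least c / 2) and by sqrt(f t) (at least sqrt r0) all
    vanish. *)
Lemma vanish_scaled (Q : R -> R) s t y (g l : R) : vanishes A Q -> 0 < hh2 s -> 0 <= l ->
  A <= rho * l -> l <= g -> rho * hh2 s <= `|y - t| -> Q ((t - y) / hh2 s * g) = 0.
Proof.
move=> vQ h0 l0 Al lg hy; apply: vQ; apply: (le_trans Al).
rewrite normrM (ger0_norm (le_trans l0 lg)) ler_pM ?(ltW rho0)//.
by rewrite normrM normfV (gtr0_norm h0) ler_pdivlMr// distrC.
Qed.

Lemma gamma_at_bounds s x : good s -> hh2 s <= hg -> gl <= gamma_at s x <= Gg.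
Proof.
move=> gs hs; have h0 : 0 <= hh2 s <= hg by rewrite hs ltW// (good_h0 gs).
by have [b _] := gcut (good_dens gs) h0; exact: b.
Qed.

Lemma gamma_at_lip s : good s -> hh2 s <= hg -> lip Gg (gamma_at s).
Proof.
move=> gs hs; have h0 : 0 <= hh2 s <= hg by rewrite hs ltW// (good_h0 gs).
by have [_ b] := gcut (good_dens gs) h0; exact: b.
Qed.

Lemma clean_summand_out s t y : good s -> hh2 s <= hg -> rho * hh2 s <= `|y - t| ->
  K ((t - y) / hh2 s * gamma_at s y) = 0.
Proof.
move=> gs hs hy; have /andP[a b] := gamma_at_bounds y gs hs.
exact: vanish_scaled (kb_vanishes kb) (good_h0 gs) (ltW gl0) rho_gl a hy.
Qed.

Lemma root_dens_ge s t : r0 <= dens s t -> Num.sqrt r0 <= root_dens s t.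
Proof. by move=> h; rewrite /root_dens ler_wsqrtr. Qed.

Let sr0 : 0 < Num.sqrt r0. Proof. by rewrite sqrtr_gt0; exact: lt_trans r10 r01. Qed.

Lemma weight_out s t y : good s -> r0 <= dens s t -> rho * hh2 s <= `|y - t| ->
  L ((t - y) / hh2 s * root_dens s t) = 0.
Proof.
move=> gs ft hy.
exact: vanish_scaled (kb_Lvanishes kb) (good_h0 gs) (ltW sr0) rho_r0 (root_dens_ge ft) hy.
Qed.

Lemma fhat_varE s t : fhat_var K G c p (hh1 s) (hh2 s) (hh3 s) (hh2 s) (sampled s) t =
  emp (size_of s) (obsv s) (fun y => (hh2 s)^-1 *
    (K ((t - y) / hh2 s * gh K G c p s y) * gh K G c p s y)).
Proof.
rewrite /fhat_var empZ /emp mulrA -invfM [_ * hh2 s]mulrC; congr (_ * _).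
by apply: eq_bigr => i _; rewrite tnth_mktuple.
Qed.

Lemma linearization : exists h0 D, [/\ 0 < h0, 0 <= D & forall s t, good s -> hh2 s <= h0 ->
  `|t| <= B -> r0 <= dens s t ->
  `|fhat_var K G c p (hh1 s) (hh2 s) (hh3 s) (hh2 s) (sampled s) t -
    emp (size_of s) (obsv s) (clean_summand s t) -
    (2 * root_dens s t)^-1 * emp (size_of s) (obsv s) (fun y => weight s t y * fhat_err K s y)|
  <= D * hh2 s ^+ 6].
Proof.
have [hp0 [Gam [hp00 Gam0 pb]]] := pilot_bounds kb gb C B W A00 c0 pmono p1.
have [he [D [he0 D0 ge]]] :=
  gamma_hat_expansion kb gb C B W A00 c0 pmono p1 pid (ltW rho0) r10 r1t0 r01.
have rW : 2 * rho <= W by apply: le_trans rhoW; rewrite lerDl.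
have [N N0 cnt] := window_count K G C B A00 W0 rho0 rW.
pose h0 := Num.min hg (Num.min hp0 he).
have h00 : 0 < h0 by rewrite !lt_min hg0 hp00.
pose E := M * (rho * D) * D + M * D.
have E0 : 0 <= E by rewrite !(addr_ge0, mulr_ge0)// ltW.
exists h0, (E * N); split => //; first exact: mulr_ge0.
move=> s t gs hs tB ft.
move: hs; rewrite !le_min => /andP[hsg /andP[hsp hse]].
have hp := good_h0 gs; set h := hh2 s in hsg hsp hse hp *.
set n := size_of s; set X := obsv s.
(* Off the window all parts of the term vanish. Inside, [kernel_product_step] leaves O(h) O(h^5) +
   O(h^6), divided by h; the mean of the indicator, which is O(h), restores h^6. *)
have term i : (i < n)%N ->
   `|h^-1 * (K ((t - obs i X) / h * gh K G c p s (obs i X)) * gh K G c p s (obs i X)) -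
     clean_summand s t (obs i X) - (2 * root_dens s t)^-1 * (weight s t (obs i X) * fhat_err K s (obs i X))| <=
   E * h ^+ 5 * (`|obs i X - t| <= rho * h)%R%:R.
  move=> ilt; set x := obs i X.
  have -> : h^-1 * (K ((t - x) / h * gh K G c p s x) * gh K G c p s x) -
     clean_summand s t x - (2 * root_dens s t)^-1 * (weight s t x * fhat_err K s x) =
     h^-1 * (K ((t - x) / h * gh K G c p s x) * gh K G c p s x -
      K ((t - x) / h * gamma_at s x) * gamma_at s x -
      L ((t - x) / h * root_dens s t) * (fhat_err K s x / (2 * root_dens s t))).
    by rewrite /clean_summand /weight -/h; ring.
  have [/= xt|/ltW/= xt] := leP `|x - t| (rho * h); last first.
    have [/andP[gh1 _] _ _] := pb s i gs hsp ilt.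
    rewrite (clean_summand_out gs hsg xt) (weight_out gs ft xt).
    rewrite (@vanish_scaled K s t x (gh K G c p s x) (c / 2))//; first last.
    - by rewrite ltW// divr_gt0.
    - exact: kb_vanishes kb.
    by rewrite !mul0r !subr0 mulr0 normr0 mulr_ge0// mulr_ge0// exprn_ge0// ltW.
  rewrite mulr1.
  have win : in_window K G C A0 B W rho r0 he (s, t, i) by split.
  have [g1 g2 g3 g4] : [/\ `|gh K G c p s x - gamma_at s x - fhat_err K s x / (2 * root_dens s t)| <= D * h ^+ 6,
      `|gh K G c p s x - gamma_at s x| <= D * h ^+ 5,
      `|gh K G c p s x - root_dens s t| <= D * h & `|gamma_at s x - root_dens s t| <= D * h] := ge _ win.
  rewrite normrM gtr0_norm ?invr_gt0// mulrC ler_pdivrMr// -[leRHS]mulrA -exprSr.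
  have step := @kernel_product_step R K K1 L A M kb ((t - x) / h) (gh K G c p s x) (gamma_at s x) (root_dens s t)
    (fhat_err K s x / (2 * root_dens s t)) (D * h) g3 g4.
  apply: (le_trans step); rewrite /E [leRHS]mulrDl lerD//; last first.
    by rewrite -[leRHS]mulrA ler_wpM2l.
  have zr : `|(t - x) / h| <= rho.
    by rewrite normrM normfV (gtr0_norm hp) ler_pdivrMr// distrC.
  have -> : M * (rho * D) * D * h ^+ 6 = M * (rho * (D * h)) * (D * h ^+ 5) by ring.
  rewrite ler_pM ?mulr_ge0 ?(ltW hp)//.
  by rewrite ler_wpM2l// ler_wpM2r// mulr_ge0// ltW.
rewrite fhat_varE -/h -/n -/X -empZ -!empB.
apply: (le_trans (emp_norm _ _ _)).
apply: (@le_trans _ _ (emp n X (fun y => E * h ^+ 5 * (`|y - t| <= rho * h)%R%:R))).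
  by apply: emp_le => j jn; exact: term.
rewrite empZ.
have := cnt s t gs tB; rewrite -/h -/n -/X => cn.
have -> : E * N * h ^+ 6 = E * h ^+ 5 * (N * h) by ring.
by rewrite ler_wpM2l// mulr_ge0// exprn_ge0// ltW.
Qed.

(** The summand of the ideal estimator has Lipschitz constant O(h^-2), hence deviation O(h^6); its
    expectation is handled by [bias_bound]. *)
Lemma leading_term (m2 : tau K 2 != 0) : exists h0 D, [/\ 0 < h0, 0 <= D &
  forall s t, good s -> hh2 s <= h0 -> `|t| <= B -> r0 <= dens s t ->
  `|emp (size_of s) (obsv s) (clean_summand s t) - dens s t| <= D * hh2 s ^+ 6].
Proof.
have t2 : tau K 2 = segint (- A) A (fun z => z ^+ 2 * K z) by exact: (tau_segint kb).
have t4 : tau K 4 = segint (- A) A (fun z => z ^+ 4 * K z) by exact: (tau_segint kb).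
have m2' := m2; rewrite t2 in m2'.
have [hb /andP[hb0 hb1] [Bb Bb0 bias]] := bias_bound kb C r10 r01 rho0 m2'.
have [D D0 devD] := good_dev_lip K G C B A00 W0.
pose h0 := Num.min hg hb.
have h00 : 0 < h0 by rewrite lt_min hg0.
pose Lam := M * (Gg + rho * Gg) * Gg + M * Gg.
have Lam0 : 0 <= Lam by rewrite !(addr_ge0, mulr_ge0)// ltW.
exists h0, (D * Lam + Bb); split => //; first by rewrite addr_ge0// mulr_ge0.
move=> s t gs hs tB ft.
move: hs; rewrite !le_min => /andP[hsg hsb].
have hp := good_h0 gs; have hle1 : hh2 s <= 1 by have /andP[] := good_h gs.
set h := hh2 s in hsg hsb hp hle1 *.
have out y : rho * h <= `|y - t| -> clean_summand s t y = 0.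
  by move=> hy; rewrite /clean_summand (clean_summand_out gs hsg hy) mul0r mulr0.
have gb_ y : `|gamma_at s y| <= Gg.
  by have /andP[a b] := gamma_at_bounds y gs hsg; rewrite ger0_norm// (le_trans _ a)// ltW.
have one a b : `|a - t| <= rho * h -> `|clean_summand s t b - clean_summand s t a| <= Lam / h ^+ 2 * `|b - a|.
  move=> ha; rewrite /clean_summand -/h -mulrBr normrM gtr0_norm ?invr_gt0// mulrC ler_pdivrMr//.
  have -> : Lam / h ^+ 2 * `|b - a| * h = Lam / h * `|b - a| by field; rewrite gt_eqF.
  have -> : K ((t - b) / h * gamma_at s b) * gamma_at s b - K ((t - a) / h * gamma_at s a) * gamma_at s a =
    (K ((t - b) / h * gamma_at s b) - K ((t - a) / h * gamma_at s a)) * gamma_at s b +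
    K ((t - a) / h * gamma_at s a) * (gamma_at s b - gamma_at s a) by ring.
  have hV : 1 <= h^-1 by rewrite -[leLHS]invr1 lef_pV2 ?posrE.
  have gl_ : `|gamma_at s b - gamma_at s a| <= Gg * `|b - a| by exact: gamma_at_lip gs hsg _ _.
  have inner : `|(t - b) / h * gamma_at s b - (t - a) / h * gamma_at s a| <=
      (Gg + rho * Gg) * h^-1 * `|b - a|.
    have -> : (t - b) / h * gamma_at s b - (t - a) / h * gamma_at s a =
      (a - b) / h * gamma_at s b + (t - a) / h * (gamma_at s b - gamma_at s a) by ring.
    have -> : (Gg + rho * Gg) * h^-1 * `|b - a| =
      `|b - a| / h * Gg + rho * (h^-1 * (Gg * `|b - a|)) by ring.
    apply: (le_trans (ler_normD _ _)); apply: lerD; rewrite 2!normrM normfV (gtr0_norm hp).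
      by rewrite [`|a - b|]distrC ler_wpM2l// divr_ge0// ltW.
    rewrite ler_pM//; first by rewrite divr_ge0// ltW.
      by rewrite ler_pdivrMr// distrC.
    by apply: (le_trans gl_); rewrite ler_peMl// mulr_ge0// ltW.
  have -> : Lam / h * `|b - a| = (M * ((Gg + rho * Gg) * h^-1 * `|b - a|)) * Gg +
     M * (h^-1 * (Gg * `|b - a|)) by rewrite /Lam; ring.
  apply: (le_trans (ler_normD _ _)); apply: lerD; rewrite normrM.
    by rewrite ler_pM//; apply: (le_trans (kb_lip kb _ _)); rewrite ler_wpM2l.
  rewrite ler_pM ?(kb_bound kb)//.
  by apply: (le_trans gl_); rewrite ler_peMl// mulr_ge0// ltW.
have lgt : lip (Lam / h ^+ 2) (clean_summand s t).
  move=> x y; have [hx|/ltW hx] := leP `|x - t| (rho * h).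
    by rewrite distrC [`|x - y|]distrC; exact: one.
  have [hy|/ltW hy] := leP `|y - t| (rho * h); first exact: one.
  by rewrite out// out// subrr normr0 mulr_ge0// divr_ge0// exprn_ge0// ltW.
have cgt := lip_continuous lgt.
have rW : rho <= W.
  apply: le_trans rhoW; have -> : 2 * rho + A = rho + (rho + A) by ring.
  by rewrite lerDl addr_ge0// ltW.
have d1 : `|dev (prob s) (size_of s) (obsv s) (clean_summand s t)| <= D * (Lam / h ^+ 2) * h ^+ 8.
  apply: devD gs tB lgt _ => y hy; apply: out; apply: le_trans hy.
  by rewrite ler_wpM2r// ltW.
have oseg x : ~~ (t - rho * h <= x <= t + rho * h) -> clean_summand s t x = 0.
  move=> hx; apply: out; rewrite leNgt; apply: contra hx.
  by rewrite ltr_norml => /andP[? ?]; apply/andP; split; lra.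
have e1 : \int[law (prob s)]_y clean_summand s t y = h^-1 * segint (t - rho * h) (t + rho * h) (fun x =>
    K ((t - x) / h * gamma_at s x) * gamma_at s x * dens s x).
  rewrite (law_segint (good_law gs) (sd_density (good_dens gs)) cgt (good_f_cont gs) oseg).
  have cg := lip_continuous (gamma_at_lip gs hsg).
  have cu : continuous (fun x => K ((t - x) / h * gamma_at s x) * gamma_at s x * dens s x).
    apply: continuousM_fun; last exact: good_f_cont gs.
    apply: continuousM_fun => //; apply: continuous_compose (lip_continuous (kb_lip kb)) _.
    by apply: continuousM_fun => //; apply: continuousM_fun; cont.
  by rewrite -segintZ//; apply: eq_segint => x _; rewrite /clean_summand -/h -!mulrA.
have -> : emp (size_of s) (obsv s) (clean_summand s t) - dens s t =
    dev (prob s) (size_of s) (obsv s) (clean_summand s t) +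
    (\int[law (prob s)]_y clean_summand s t y - dens s t) by rewrite /dev; ring.
rewrite [leRHS]mulrDl (le_trans (ler_normD _ _))// lerD//.
  apply: (le_trans d1); have -> : D * (Lam / h ^+ 2) * h ^+ 8 = D * Lam * h ^+ 6 by field; rewrite gt_eqF.
  by [].
have hh : 0 < h <= hb by rewrite hp.
have := bias (dens s) t h (good_dens gs) ft hh.
rewrite e1 /gamma_at /kap t2 t4 -/h; apply.
by move=> x hx; have := clean_summand_out gs hsg hx; rewrite /gamma_at /kap t2 t4.
Qed.

End linearization.

Lemma expect_exchange (R : realType) (mu : probability R R) (u : R -> R -> R) (M : R) :
  measurable_fun setT (fun z : R * R => u z.1 z.2) -> (forall x y, `|u x y| <= M) ->
  \int[mu]_x \int[mu]_y u x y = \int[mu]_y \int[mu]_x u x y.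
Proof.
move=> mu_ uM.
have i12 : (mu \x mu)%E.-integrable setT (fun z : R * R => (u z.1 z.2)%:E).
  apply: measurable_bounded_integrable => //.
    rewrite -setXTT [ltLHS](@product_measure1E _ _ _ _ R mu mu)//.
    by rewrite [X in (X * _)%E](@probability_setT _ _ _ mu) mul1e (le_lt_trans (probability_le1 _ _))// ltry.
  by exists M; split; rewrite ?num_real // => y My x _; exact: le_trans (uM _ _) (ltW My).
have m1 x : bounded_measurable (fun y => u x y).
  split; last by exists M.
  exact: (measurableT_comp mu_ (pair1_measurable x)).
have m2 y : bounded_measurable (fun x => u x y).
  split; last by exists M.
  exact: (measurableT_comp mu_ (pair2_measurable y)).
have := @Fubini _ _ _ _ R mu mu _ i12.
under eq_integral do rewrite /fubini_F /= expect_EFin//.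
under [in RHS]eq_integral do rewrite /fubini_G /= expect_EFin//.
by rewrite /Rintegral => ->.
Qed.

(** * The linear term *)

Section error_bound.
Context (R : realType) (K K1 L G : R -> R) (A M : R).
Context (kb : kernel_bounds K K1 L A M).
Context (C A0 B W : R) (A00 : 0 <= A0) (W0 : 0 <= W).
Local Notation good := (good K G C A0 B W).
Implicit Types (s : config R) (t x y : R).

Context (r0 rho : R) (r00 : 0 < r0).
Context (rho0 : 0 < rho) (rhoW : 2 * rho + A <= W).
Context (rho_r0 : A <= rho * Num.sqrt r0).

Let A1 := kb_A kb.
Let M0 := kb_M kb.
Let Age0 : 0 <= A. Proof. exact: le_trans ler01 A1. Qed.
Let AA : 0 <= A - - A. Proof. by rewrite opprK addr_ge0. Qed.
Let sr0 : 0 < Num.sqrt r0. Proof. by rewrite sqrtr_gt0. Qed.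
Let rho_W : rho <= W.
Proof.
apply: le_trans rhoW; have -> : 2 * rho + A = rho + (rho + A) by ring.
by rewrite lerDl addr_ge0// ltW.
Qed.
Let rhoA_W : rho + A <= W.
Proof. by apply: le_trans rhoW; rewrite lerD2r ler_peMl ?(ltW rho0)// ler1n. Qed.

Local Notation weight := (weight L).

Let smax := Num.sqrt `|C|.

Lemma root_dens_bounds s t : good s -> r0 <= dens s t -> Num.sqrt r0 <= root_dens s t <= smax.
Proof.
move=> gs ft; rewrite root_dens_ge//= /root_dens /smax ler_wsqrtr//.
exact: le_trans (ler_norm _) (le_trans (good_f_bound t gs) (ler_norm C)).
Qed.

Lemma weight_zero s t y : good s -> r0 <= dens s t -> rho * hh2 s <= `|y - t| -> weight s t y = 0.
Proof.
move=> gs ft hy; have h0 := good_h0 gs; have /andP[s1 _] := root_dens_bounds gs ft.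
rewrite /weight (kb_Lvanishes kb) ?mulr0//.
rewrite normrM (ger0_norm (le_trans (ltW sr0) s1)) (le_trans rho_r0)//.
rewrite ler_pM ?(ltW rho0) ?(ltW sr0)//.
by rewrite normrM normfV (gtr0_norm h0) ler_pdivlMr// distrC.
Qed.

Lemma weight_bound s t y : good s -> `|weight s t y| <= M / hh2 s.
Proof.
move=> gs; have h0 := good_h0 gs.
rewrite /weight normrM gtr0_norm ?invr_gt0// mulrC ler_wpM2r ?invr_ge0 ?(ltW h0)//.
exact: (kb_Lbound kb).
Qed.

Lemma weight_lip s t : good s -> r0 <= dens s t -> lip (M * smax / hh2 s ^+ 2) (weight s t).
Proof.
move=> gs ft x y; have h0 := good_h0 gs; have /andP[s1 s2] := root_dens_bounds gs ft.
have sp := le_trans (ltW sr0) s1.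
rewrite /weight -mulrBr normrM gtr0_norm ?invr_gt0//.
have -> : M * smax / hh2 s ^+ 2 * `|x - y| = (hh2 s)^-1 * (M * (`|x - y| / hh2 s * smax)).
  by field; rewrite gt_eqF.
rewrite ler_wpM2l ?invr_ge0 ?(ltW h0)//; apply: (le_trans (kb_Llip kb _ _)).
rewrite ler_wpM2l// -mulrBl normrM (ger0_norm sp) ler_pM//.
have -> : (t - x) / hh2 s - (t - y) / hh2 s = (y - x) / hh2 s by ring.
by rewrite normrM normfV (gtr0_norm h0) distrC.
Qed.

(** In the window the weight is O(1/h) with Lipschitz constant O(h^-2), and the pilot error is O(1)
    with Lipschitz constant O(1/h): the product has Lipschitz constant O(h^-2). *)
Lemma weighted_deviation : exists2 D, 0 <= D & forall s t, good s -> `|t| <= B ->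
  r0 <= dens s t ->
  `|dev (prob s) (size_of s) (obsv s) (fun y => weight s t y * fhat_err K s y)| <= D * hh2 s ^+ 6 /\
  continuous (fun y => weight s t y * fhat_err K s y).
Proof.
have [D D0 devD] := good_dev_lip K G C B A00 W0.
have [N N0 eb] := fhat_err_bounds G kb C B A00 W0 (ltW rho0) rhoA_W.
exists (D * (M * smax * N + M * N)).
  by rewrite mulr_ge0// addr_ge0 ?mulr_ge0// sqrtr_ge0.
move=> s t gs tB ft; have h0 := good_h0 gs.
have hle1 : hh2 s <= 1 by have /andP[] := good_h gs.
pose S y := `|y - t| <= rho * hh2 s.
have ow y : ~ S y -> weight s t y = 0.
  by move=> /negP; rewrite -ltNge => /ltW; exact: weight_zero.
have bv x : S x -> `|fhat_err K s x| <= N.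
  move=> Sx; have [b _] := eb s t x x gs tB Sx Sx; apply: (le_trans b).
  by rewrite ler_piMr// (good_hX1 2 gs).
have lv x y : S x -> S y -> `|fhat_err K s x - fhat_err K s y| <= N / hh2 s * `|x - y|.
  by move=> Sx Sy; have [_ b] := eb s t x y gs tB Sx Sy.
have lwv := lip_product_window (weight_lip gs ft) (fun x => weight_bound t x gs) ow bv lv N0
  (divr_ge0 N0 (ltW h0)).
split; last exact: lip_continuous lwv.
apply: le_trans (devD s t _ _ gs tB lwv _) _.
  move=> y hy; rewrite weight_zero ?mul0r//; apply: le_trans hy.
  by rewrite ler_wpM2r// ltW.
rewrite le_eqVlt; apply/orP; left; apply/eqP; field; rewrite gt_eqF//.
Qed.

(** Subtracting the value at t, which [L] integrates to 0, leaves the increment over a distance O(h)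
    of a function with Lipschitz constant O(h^5). *)
Lemma weighted_bias : exists2 D, 0 <= D & forall s t, good s -> `|t| <= B ->
  r0 <= dens s t ->
  `|\int[law (prob s)]_y (weight s t y * smooth_bias K s y)| <= D * hh2 s ^+ 6.
Proof.
pose N := `|C| * A ^+ 2.
have N0 : 0 <= N by rewrite mulr_ge0// sqr_ge0.
exists ((Num.sqrt r0)^-1 * (M * (2 * N * `|C| * (A / Num.sqrt r0)) * (A - - A))).
  by rewrite !(mulr_ge0, divr_ge0, invr_ge0, sqrtr_ge0).
move=> s t gs tB ft; have h0 := good_h0 gs; have /andP[s1 s2] := root_dens_bounds gs ft.
have C0 := good_C gs; have NE : N = C * A ^+ 2 by rewrite /N ger0_norm.
have sp := lt_le_trans sr0 s1.
have [bb lb] := smooth_bias_bounds kb gs.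
rewrite -NE in bb lb.
have cf := good_f_cont gs; have cb := lip_continuous lb.
have cw := lip_continuous (weight_lip gs ft).
pose phi y := smooth_bias K s y * dens s y.
have cphi : continuous phi by exact: continuousM_fun.
have lphi : lip (2 * N * `|C| * hh2 s ^+ 5) phi.
  move=> x y; rewrite /phi.
  have -> : smooth_bias K s x * dens s x - smooth_bias K s y * dens s y =
    (smooth_bias K s x - smooth_bias K s y) * dens s x + smooth_bias K s y * (dens s x - dens s y) by ring.
  have -> : 2 * N * `|C| * hh2 s ^+ 5 * `|x - y| = (N * hh2 s ^+ 5 * `|x - y|) * `|C| +
    (N * hh2 s ^+ 5) * (`|C| * `|x - y|) by ring.
  rewrite (ger0_norm C0).
  apply: (le_trans (ler_normD _ _)); apply: lerD; rewrite normrM.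
    by rewrite ler_pM ?lb// (good_f_bound x gs).
  by rewrite ler_pM ?bb// (good_f_lip gs).
pose h' := hh2 s / root_dens s t.
have h'0 : 0 < h' by rewrite divr_gt0.
have cL := lip_continuous (kb_Llip kb).
have wE y : weight s t y = (hh2 s)^-1 * L ((t - y) / h').
  by rewrite /weight /h' invfM invrK mulrA.
have oL y : ~~ (t - h' * A <= y <= t + h' * A) -> weight s t y * smooth_bias K s y = 0.
  by move=> hy; rewrite wE (scaled_vanishes (kb_Lvanishes kb) h'0 hy) mulr0 mul0r.
rewrite (law_segint (good_law gs) (sd_density (good_dens gs)) (continuousM_fun cw cb) cf oL).
have -> : segint (t - h' * A) (t + h' * A) (fun y => weight s t y * smooth_bias K s y * dens s y) =
    (root_dens s t)^-1 * segint (- A) A (fun z => L z * phi (t - h' * z)).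
  transitivity ((hh2 s)^-1 * segint (t - h' * A) (t + h' * A) (fun y => L ((t - y) / h') * phi y)).
    rewrite -segintZ; last by apply: continuousM_fun => //; exact: continuous_scaled.
    by apply: eq_segint => y _; rewrite wE /phi -!mulrA.
  rewrite segint_kernel_subst// mulrA /h'; congr (_ * _).
  by field; rewrite !gt_eqF.
have -> : segint (- A) A (fun z => L z * phi (t - h' * z)) =
    segint (- A) A (fun z => L z * (phi (t - h' * z) - phi t)).
  have -> : segint (- A) A (fun z => L z * (phi (t - h' * z) - phi t)) =
    segint (- A) A (fun z => L z * phi (t - h' * z)) - segint (- A) A (fun z => phi t * L z).
    rewrite -segintB; last 2 first.
    - by apply: continuousM_fun => //; exact: continuous_subst.
    - by apply: continuousM_fun => //; exact: continuous_cst.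
    by apply: eq_segint => z _; ring.
  by rewrite segintZ// (kb_Lmass kb) mulr0 subr0.
rewrite normrM gtr0_norm ?invr_gt0//.
rewrite -[leRHS]mulrA ler_pM ?invr_ge0 ?(ltW sp)//.
  by rewrite lef_pV2 ?posrE.
have e6 : M * (2 * N * `|C| * (A / Num.sqrt r0)) * (A - - A) * hh2 s ^+ 6 =
  M * (2 * N * `|C| * hh2 s ^+ 5 * (hh2 s / Num.sqrt r0 * A)) * (A - - A).
  by field; rewrite gt_eqF.
rewrite e6; apply: segint_bound; [by rewrite -subr_ge0| |].
  by apply: continuousM_fun => //; apply: continuousB_fun; [exact: continuous_subst|exact: continuous_cst].
move=> z /andP[z1 z2]; rewrite normrM ler_pM ?(kb_Lbound kb)//.
apply: (le_trans (lphi _ _)); rewrite ler_wpM2l ?mulr_ge0 ?exprn_ge0 ?(ltW h0)//.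
rewrite (_ : t - h' * z - t = - (h' * z)); last by ring.
rewrite normrN normrM (gtr0_norm h'0) ler_pM ?(ltW h'0)//.
  by rewrite /h' ler_wpM2l ?(ltW h0)// lef_pV2 ?posrE.
by rewrite ler_norml; apply/andP; split.
Qed.

(* By Fubini the integral is the deviation of
   [y |-> \int w(x) K((x - y) / h1) / h1 dlaw(x)]. *)
Lemma weighted_fluctuation : exists2 D, 0 <= D & forall s t, good s -> `|t| <= B ->
  r0 <= dens s t ->
  `|\int[law (prob s)]_y (weight s t y * kernel_fluct K s y)| <= D * hh2 s ^+ 6 /\
  bounded_measurable (fun y => weight s t y * kernel_fluct K s y).
Proof.
have [D D0 devD] := good_dev_lip K G C B A00 W0.
pose Lp := M * smax * `|C| + M * `|C|.
have sm0 : 0 <= smax by exact: sqrtr_ge0.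
have Lp0 : 0 <= Lp by rewrite !(addr_ge0, mulr_ge0).
exists (D * (M * Lp * (A - - A))).
  by rewrite !mulr_ge0.
move=> s t gs tB ft; have h0 := good_h0 gs; have k0 := good_h1_gt0 gs.
have hle1 : hh2 s <= 1 by have /andP[] := good_h gs.
have C0 := good_C gs.
have cK := lip_continuous (kb_lip kb).
have cw := lip_continuous (weight_lip gs ft).
have cf := good_f_cont gs.
have ow := weight_zero gs ft.
have bmw : bounded_measurable (weight s t).
  split; first exact: continuous_measurable.
  by exists (M / hh2 s) => y; exact: weight_bound.
have bmK y : bounded_measurable (fun x : R => K ((x - y) / hh1 s)).
  split; last by exists M => x; exact: (kb_bound kb).
  apply: continuous_measurable; apply: continuous_compose => //.
  by apply: continuousM_fun; cont.
have bmK' x : bounded_measurable (fun y : R => K ((x - y) / hh1 s)).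
  exact: bm_scaled cK (kb_bound kb).
pose mu := law (prob s).
pose m y := (hh1 s)^-1 * \int[mu]_x (weight s t x * K ((x - y) / hh1 s)).
pose phi x := weight s t x * dens s x.
have lphi : lip (Lp / hh2 s ^+ 2) phi.
  move=> x y; have h2 := lip_product_window (S := fun _ => True) (weight_lip gs ft)
    (fun x => weight_bound t x gs) (fun x (h : ~ True) => False_ind _ (h I))
    (fun x _ => good_f_bound x gs) (fun x y _ _ => good_f_lip gs x y) C0 C0.
  apply: (le_trans (h2 x y)); rewrite ler_wpM2r// /Lp (ger0_norm C0).
  have -> : (M * smax * C + M * C) / hh2 s ^+ 2 =
    M * smax / hh2 s ^+ 2 * C + M / hh2 s / hh2 s * C by field; rewrite gt_eqF.
  rewrite lerD2l ler_wpM2r// ler_peMr ?divr_ge0 ?(ltW h0)//.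
  by rewrite -[leLHS]invr1 lef_pV2 ?posrE.
have cphi := lip_continuous lphi.
(* By evenness of [K], [m] is the smoothing of [phi] at scale h1. It thus inherits the Lipschitz
   constant O(h^-2) of [phi], free of the powers of 1 / h1 that differentiating the kernel would
   bring. *)
have mE : m = fun y => segint (- A) A (fun z => K z * phi (y - hh1 s * z)).
  apply/funext => y; rewrite /m.
  have oK x : ~~ (y - hh1 s * A <= x <= y + hh1 s * A) -> weight s t x * K ((x - y) / hh1 s) = 0.
    move=> hx; rewrite -(kb_even kb) -mulNr opprB.
    by rewrite (scaled_vanishes (kb_vanishes kb) k0 hx) mulr0.
  have cwK : continuous (fun x => weight s t x * K ((x - y) / hh1 s)).
    apply: continuousM_fun => //; apply: continuous_compose => //.
    by apply: continuousM_fun; cont.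
  rewrite (law_segint (good_law gs) (sd_density (good_dens gs)) cwK cf oK).
  have -> : segint (y - hh1 s * A) (y + hh1 s * A)
      (fun x => weight s t x * K ((x - y) / hh1 s) * dens s x) =
    segint (y - hh1 s * A) (y + hh1 s * A) (fun x => K ((y - x) / hh1 s) * phi x).
    apply: eq_segint => x _; rewrite -(kb_even kb ((y - x) / _)) -mulNr opprB /phi; ring.
  by rewrite segint_kernel_subst// mulKf// gt_eqF.
have lm : lip (M * (Lp / hh2 s ^+ 2) * (A - - A)) m.
  by rewrite mE; exact: lip_smoothing (hh1 s) cK lphi (kb_bound kb) Age0.
have om y : W * hh2 s <= `|y - t| -> m y = 0.
  move=> hy; rewrite /m; apply/eqP; rewrite mulf_eq0; apply/orP; right; apply/eqP.
  rewrite [X in Rintegral _ _ X](_ : _ = cst 0); first by rewrite expect_cst.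
  apply/funext => x /=; have [xt|/ltW xt] := leP (rho * hh2 s) `|x - t|; first by rewrite ow// mul0r.
  rewrite (kb_vanishes kb) ?mulr0// normrM normfV (gtr0_norm k0) ler_pdivlMr//.
  apply: (@le_trans _ _ (A * hh2 s)); first by rewrite ler_wpM2l// (good_h1_le gs).
  have : `|y - t| <= `|x - t| + `|x - y|.
    by rewrite [X in _ <= _ + X]distrC (_ : y - t = (x - t) + (y - x)) ?ler_normD//; ring.
  have : (rho + A) * hh2 s <= W * hh2 s by rewrite ler_wpM2r// ltW.
  by rewrite mulrDl; lra.
have dm := devD s t _ _ gs tB lm om.
pose n := size_of s; pose X := obsv s.
have bmE : bounded_measurable (fun x => emp n X (fun y => K ((x - y) / hh1 s))).
  rewrite /emp; apply: bmZ; apply: bm_sum => j; exact: bmK.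
have ckm := kernel_mean_lip (good_dens gs) (good_law gs) cK (kb_vanishes kb) (kb_bound kb) Age0 k0.
have bmkm : bounded_measurable (kernel_mean (prob s) K (hh1 s)).
  split; first exact: continuous_measurable.
  by exists M => x; exact: kernel_mean_bound cK (kb_bound kb).
have flE x : weight s t x * kernel_fluct K s x =
   (hh1 s)^-1 * (weight s t x * emp n X (fun y => K ((x - y) / hh1 s))
     - weight s t x * kernel_mean (prob s) K (hh1 s) x).
  by rewrite /kernel_fluct /dev -/(kernel_mean (prob s) K (hh1 s) x) -/n -/X; ring.
have -> : (fun y => weight s t y * kernel_fluct K s y) = fun x => (hh1 s)^-1 *
   (weight s t x * emp n X (fun y => K ((x - y) / hh1 s))
     - weight s t x * kernel_mean (prob s) K (hh1 s) x) by apply/funext => x; exact: flE.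
have b1 : bounded_measurable (fun x => weight s t x * emp n X (fun y => K ((x - y) / hh1 s))).
  exact: bmM bmw bmE.
have b2 : bounded_measurable (fun x => weight s t x * kernel_mean (prob s) K (hh1 s) x).
  exact: bmM bmw bmkm.
split; last by apply: bmZ; exact: bmB.
suff -> : \int[mu]_x ((hh1 s)^-1 * (weight s t x * emp n X (fun y => K ((x - y) / hh1 s))
     - weight s t x * kernel_mean (prob s) K (hh1 s) x)) = dev (prob s) n X m.
  apply: (le_trans dm); rewrite le_eqVlt; apply/orP; left; apply/eqP.
  by field; rewrite gt_eqF.
rewrite expectZ ?expectB//; last exact: bmB.
rewrite mulrBr /dev; congr (_ - _).
  under eq_Rintegral do rewrite /emp mulrCA mulr_sumr.
  rewrite expectZ; last by apply: bm_sum => j; exact: bmM bmw (bmK _).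
  rewrite expect_sum; last by move=> j; exact: bmM bmw (bmK _).
  by rewrite /emp /m -mulr_sumr mulrCA.
have -> : \int[mu]_x (weight s t x * kernel_mean (prob s) K (hh1 s) x) =
    \int[mu]_x \int[mu]_y (weight s t x * K ((x - y) / hh1 s)).
  by apply: eq_Rintegral => x _; rewrite expectZ.
rewrite (@expect_exchange R mu (fun x y => weight s t x * K ((x - y) / hh1 s)) (M / hh2 s * M)).
- have -> : \int[mu]_y \int[mu]_x (weight s t x * K ((x - y) / hh1 s)) = \int[mu]_y (hh1 s * m y).
    by apply: eq_Rintegral => y _; rewrite /m mulVKf// gt_eqF.
  rewrite expectZ ?mulKf ?gt_eqF//.
  split; first exact: continuous_measurable (lip_continuous lm).
  exists ((hh1 s)^-1 * (M / hh2 s * M)) => y.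
  rewrite /m normrM gtr0_norm ?invr_gt0// ler_wpM2l ?invr_ge0 ?(ltW k0)//.
  apply: expect_bound; first exact: bmM bmw (bmK y).
  by move=> x; rewrite normrM ler_pM// ?(weight_bound t x gs)// (kb_bound kb).
- apply: measurable_funM; first exact: (measurableT_comp (continuous_measurable cw)).
  apply: (measurableT_comp (continuous_measurable cK)).
  by apply: measurable_funM => //; apply: measurable_funB.
- by move=> x y; rewrite normrM ler_pM// ?(weight_bound t x gs)// (kb_bound kb).
Qed.

Lemma weighted_error : exists2 D, 0 <= D & forall s t, good s -> `|t| <= B ->
  r0 <= dens s t ->
  `|emp (size_of s) (obsv s) (fun y => weight s t y * fhat_err K s y)| <= D * hh2 s ^+ 6.
Proof.
have [D1 D10 h1] := weighted_deviation.
have [D2 D20 h2] := weighted_bias.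
have [D3 D30 h3] := weighted_fluctuation.
exists (D1 + (D3 + D2)); first by rewrite !addr_ge0.
move=> s t gs tB ft.
have [d1 cwe] := h1 s t gs tB ft; have [d3 b3] := h3 s t gs tB ft.
have d2 := h2 s t gs tB ft.
have -> : emp (size_of s) (obsv s) (fun y => weight s t y * fhat_err K s y) =
  dev (prob s) (size_of s) (obsv s) (fun y => weight s t y * fhat_err K s y) +
  \int[law (prob s)]_y (weight s t y * fhat_err K s y) by rewrite /dev subrK.
rewrite !mulrDl (le_trans (ler_normD _ _))// lerD//.
have [bb lb] := smooth_bias_bounds kb gs.
have b2 : bounded_measurable (fun y => weight s t y * smooth_bias K s y).
  apply: bmM.
    split; first exact: continuous_measurable (lip_continuous (weight_lip gs ft)).
    by exists (M / hh2 s) => y; exact: weight_bound.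
  split; first exact: continuous_measurable (lip_continuous lb).
  by exists (C * A ^+ 2 * hh2 s ^+ 5) => y; exact: bb.
under eq_Rintegral do rewrite fhat_errE mulrDr.
by rewrite expectD// (le_trans (ler_normD _ _))// lerD.
Qed.

End error_bound.

(** * The deterministic error bound *)

Section deterministic.
Context (R : realType) (K K1 L G : R -> R) (A M AG MG : R).
Context (kb : kernel_bounds K K1 L A M) (gb : kernel4_bounds G AG MG).

(** A bounded kernel is not concentrated at 0: [K] is at most z^2 K / r^2 plus [M] times the tent of
    radius r, so that a zero second moment would give 1 <= 4 M r <= 1/2. *)
Lemma tau2_neq0 : tau K 2 != 0.
Proof.
have A1 := kb_A kb; have M0 := kb_M kb.
have A0 : 0 <= A by exact: le_trans ler01 A1.
have -> : tau K 2 = segint (- A) A (fun z => z ^+ 2 * K z) by exact: (tau_segint kb).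
apply/eqP => m0.
pose r : R := (8 * (M + 1))^-1.
have M1 : 0 < M + 1 by rewrite ltr_pwDr.
have r0 : 0 < r by rewrite invr_gt0 mulr_gt0.
have r1 : 2 * r <= 1.
  rewrite /r invfM mulrA ler_pdivrMr// mul1r; apply: (@le_trans _ _ 1); first lra.
  by rewrite lerDr.
have cK := lip_continuous (kb_lip kb).
have ct := lip_continuous (tent_lip 0 r0).
have c2 : continuous (fun z : R => z ^+ 2 * K z).
  by apply: continuousM_fun => //; exact: continuous_pow.
have h1 : segint (- A) A K <=
    segint (- A) A (fun z => r ^- 2 * (z ^+ 2 * K z) + M * tent r 0 z).
  apply: segint_le => //.
    by apply: continuousD_fun; apply: continuousM_fun => //; exact: continuous_cst.
  move=> z _; have K0 := kb_ge0 kb z.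
  have [zr|zr] := leP `|z| r.
    apply: (@le_trans _ _ (M * tent r 0 z)); last first.
      rewrite lerDr; apply: mulr_ge0; first by rewrite invr_ge0 exprn_ge0// ltW.
      by apply: mulr_ge0 => //; exact: sqr_ge0.
    have := tent_ge 0 z r0; rewrite subr0 zr => t1.
    apply: (le_trans (ler_norm _)); apply: (le_trans (kb_bound kb z)).
    by rewrite -[leLHS]mulr1 ler_wpM2l.
  apply: (@le_trans _ _ (r ^- 2 * (z ^+ 2 * K z))); last first.
    by rewrite lerDl mulr_ge0//; have /andP[] := tent_le1 r 0 z.
  rewrite mulrA ler_peMl// mulrC ler_pdivlMr ?exprn_gt0// mul1r.
  by rewrite -[leRHS]real_normK ?num_real// lerXn2r ?nnegrE ?(ltW r0)// ltW.
rewrite (kb_mass kb) in h1.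
have h2 : segint (- A) A (tent r 0) <= 1 * (2 * r - - (2 * r)).
  rewrite (@segint_widen _ (- (2 * r)) (2 * r)).
  - apply: (le_trans (ler_norm _)); apply: segint_bound => //.
      by rewrite -subr_ge0 opprK addr_ge0// mulr_ge0// ltW.
    by move=> z _; have /andP[a b] := tent_le1 r 0 z; rewrite ger0_norm.
  - by rewrite lerN2 (le_trans r1).
  - exact: le_trans r1 A1.
  - move=> z hz; apply: tent_out => //; rewrite subr0 leNgt; apply: contra hz.
    by rewrite ltr_norml => /andP[/ltW -> /ltW ->].
have : segint (- A) A (fun z => r ^- 2 * (z ^+ 2 * K z) + M * tent r 0 z) =
    r ^- 2 * 0 + M * segint (- A) A (tent r 0).
  rewrite segintD; last 2 first.
  - by apply: continuousM_fun => //; exact: continuous_cst.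
  - by apply: continuousM_fun => //; exact: continuous_cst.
  by rewrite !segintZ// m0.
move=> e; move: h1; rewrite e mulr0 add0r => h1.
have h3 : M * segint (- A) A (tent r 0) <= M * (1 * (2 * r - - (2 * r))) by rewrite ler_wpM2l.
have h4 : (M + 1) * r = 8^-1 by rewrite /r invfM mulrCA divff ?gt_eqF// mulr1.
have h5 : M * r <= 8^-1 by rewrite -h4 ler_wpM2r ?(ltW r0)// lerDl.
have : M * (1 * (2 * r - - (2 * r))) = 4 * (M * r) by ring.
by move: h1 h3 h5; set u := M * segint _ _ _; set v := M * (1 * _); set w := M * r; lra.
Qed.

Context (C B c t0 r0 : R) (p : R -> R) (c0 : 0 < c) (t01 : 1 <= t0).
Context (pmono : {homo p : x y / x <= y}) (p1 : forall x, 1 <= p x).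
Context (pid : forall x, t0 <= x -> p x = x).
Context (r0t0 : t0 * c ^+ 2 < r0).

(** [W] is chosen before [A0], because the constant of the bad events depends on the width of the
    window; [h0] and [D] come last. *)
Lemma deterministic_error : exists2 W, A <= W & forall A0, 0 <= A0 ->
  exists h0 D, [/\ 0 < h0, 0 <= D & forall (s : config R) t, good K G C A0 B W s ->
  hh2 s <= h0 -> `|t| <= B -> r0 <= dens s t ->
  `|fhat_var K G c p (hh1 s) (hh2 s) (hh3 s) (hh2 s) (sampled s) t - dens s t|
    <= D * hh2 s ^+ 6].
Proof.
have A1 := kb_A kb; have Age0 : 0 <= A by exact: le_trans ler01 A1.
(* The midpoint leaves room on both sides: above it alpha is the square root, and for small h the
   density stays above it in the window of any t with f(t) >= r0. *)
pose r1 := (t0 * c ^+ 2 + r0) / 2.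
have tc : 0 < t0 * c ^+ 2 by rewrite mulr_gt0 ?exprn_gt0// (lt_le_trans ltr01).
have r0t := r0t0.
have r1t0 : t0 * c ^+ 2 <= r1 by rewrite /r1; lra.
have r01 : r1 < r0 by rewrite /r1; lra.
have r10 : 0 < r1 by exact: lt_le_trans tc r1t0.
have r00 : 0 < r0 by exact: lt_trans r10 r01.
have sr0 : 0 < Num.sqrt r0 by rewrite sqrtr_gt0.
have [hg [gl [Gg [/andP[hg0 hg1] gl0 Gg0 gc]]]] :=
  gamma_cut_bounds C (tau K 4 / (24 * tau K 2)) r10.
have gcut f h : smooth_densities C 6 f -> 0 <= h <= hg ->
   (forall x, gl <= gamma_cut (tau K 4 / (24 * tau K 2)) r1 h f x <= Gg) /\
   lip Gg (gamma_cut (tau K 4 / (24 * tau K 2)) r1 h f).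
  by move=> sf hh; have [a _ _ b] := gc f h sf hh.
have c20 : 0 < c / 2 by rewrite divr_gt0.
(* The sum of the three reciprocals dominates each of them, which gives the three inequalities A <=
   rho x below. *)
pose rho := A * (gl^-1 + (c / 2)^-1 + (Num.sqrt r0)^-1).
have i1 : 0 < gl^-1 by rewrite invr_gt0.
have i2 : 0 < (c / 2)^-1 by rewrite invr_gt0.
have i3 : 0 < (Num.sqrt r0)^-1 by rewrite invr_gt0.
have rho0 : 0 < rho by apply: mulr_gt0; [exact: lt_le_trans ltr01 A1|by rewrite !addr_gt0].
have rho_of x : 0 < x -> x^-1 <= gl^-1 + (c / 2)^-1 + (Num.sqrt r0)^-1 -> A <= rho * x.
  move=> x0 hx; rewrite /rho -mulrA ler_peMr// -(@ler_pM2r _ x^-1) ?invr_gt0//.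
  by rewrite mul1r mulfK ?gt_eqF.
have rho_gl : A <= rho * gl by apply: rho_of => //; rewrite -addrA lerDl addr_ge0// ltW.
have rho_c : A <= rho * (c / 2).
  by apply: rho_of => //; rewrite addrAC lerDr addr_ge0// ltW.
have rho_r0 : A <= rho * Num.sqrt r0 by apply: rho_of => //; rewrite lerDr addr_ge0// ltW.
pose W := 2 * rho + A.
have AW : A <= W by rewrite lerDr mulr_ge0// ltW.
have W0 : 0 <= W by exact: le_trans AW.
exists W => // A0 A00.
have [h1 [D1 [h10 D10 b1]]] := linearization kb gb B A00 W0 c0 pmono p1 pid r10 r1t0 r01
  rho0 (lexx W) gl0 hg0 gcut rho_gl rho_c rho_r0.
have [h2 [D2 [h20 D20 b2]]] := leading_term G kb B A00 W0 r10 r01 rho0 (lexx W) gl0 Gg0 hg0 gcut rho_gl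
  tau2_neq0.
have [D3 D30 b3] := weighted_error G kb C B A00 W0 r00 rho0 (lexx W) rho_r0.
exists (Num.min h1 h2), (D1 + (D2 + (Num.sqrt r0)^-1 * D3)); split.
- by rewrite lt_min h10.
- by rewrite !addr_ge0// mulr_ge0// ltW.
move=> s t gs hs tB ft; move: hs; rewrite le_min => /andP[hs1 hs2].
have e1 := b1 s t gs hs1 tB ft; have e2 := b2 s t gs hs2 tB ft; have e3 := b3 s t gs tB ft.
set fv := fhat_var _ _ _ _ _ _ _ _ _ _ in e1 *.
set lead := emp _ _ _ in e1 e2.
set we := emp _ _ _ in e1 e3.
have -> : fv - dens s t = (fv - lead - (2 * root_dens s t)^-1 * we) +
  ((lead - dens s t) + (2 * root_dens s t)^-1 * we) by ring.
rewrite [leRHS]mulrDl (le_trans (ler_normD _ _))//; apply: lerD => //.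
rewrite [leRHS]mulrDl (le_trans (ler_normD _ _))//; apply: lerD => //.
have s1 := root_dens_ge ft; have sp := lt_le_trans sr0 s1.
rewrite normrM gtr0_norm ?invr_gt0 ?mulr_gt0// -mulrA ler_pM ?invr_ge0 ?mulr_ge0 ?(ltW sp)//.
rewrite lef_pV2 ?posrE ?mulr_gt0// (le_trans s1)// ler_peMl ?(ltW sp)//.
exact: (ler1n R 2).
Qed.

(** Valid at every t, not just at observations: it converts the lower bound on f_hat that defines
    the second region into one on f. *)
Lemma pilot_error A0 W : 0 <= A0 -> A <= W ->
  exists2 D, 0 <= D & forall (s : config R) t, good K G C A0 B W s -> `|t| <= B ->
  `|fhat_err K s t| <= D * hh2 s ^+ 2.
Proof.
move=> A00 AW; have Age0 : 0 <= A by exact: le_trans ler01 (kb_A kb).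
have aw : 0 + A <= W by rewrite add0r.
have [D D0 h] := fhat_err_bounds G kb C B A00 (le_trans Age0 AW) (lexx 0) aw.
exists D => // s t gs tB.
have tt : `|t - t| <= 0 * hh2 s by rewrite subrr normr0 mul0r.
by have [] := h s t t t gs tB tt tt.
Qed.

End deterministic.

(** * Rates and probabilities *)

Section bandwidth_rates.
Context (R : realType).

Definition bandwidths n (f : R -> R) (P : probability (sampleSpace R) R) X : config R :=
  Config n f P X (log_rate (1 / 13) n) (log_rate (1 / 5) n) (log_rate (1 / 11) n).

Lemma log_rate_exp (a : R) k n : 0 <= eps R n -> log_rate a n ^+ k = log_rate (a * k%:R) n.
Proof.
by move=> e0; rewrite !log_rate_eps powRrM powR_mulrn// powR_ge0.
Qed.

Lemma log_rate_le (a b : R) n : 0 < eps R n <= 1 -> a <= b -> log_rate b n <= log_rate a n.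
Proof. by move=> e1 ab; rewrite !log_rate_eps; exact: ger_powR. Qed.

Lemma log_rate_small (a d : R) : 0 < a -> 0 < d ->
  exists n0 : nat, forall n, (n0 <= n)%N -> log_rate a n <= d.
Proof.
move=> a0 d0; have [n0 h] := eps_small (powR_gt0 a^-1 d0).
have [n1 [n10 hln]] := ln_ge1 R.
exists (maxn n0 n1) => n; rewrite geq_max => /andP[hn hn1].
have e0 : 0 <= eps R n by rewrite divr_ge0// (le_trans _ (hln n hn1)).
have av : a^-1 * a = 1 by rewrite mulVf// gt_eqF.
rewrite log_rate_eps -[leRHS](powRr1 (ltW d0)) -av.
rewrite powRrM; apply: ge0_ler_powR; rewrite ?nnegrE ?powR_ge0 ?(ltW a0)//.
exact: h.
Qed.

Lemma eps_evt : exists n0 : nat, forall n, (n0 <= n)%N ->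
  [/\ (0 < n)%N, 1 <= ln (n%:R : R), 0 < eps R n <= 1 & n%:R^-1 <= eps R n].
Proof.
have [n0 h] := @eps_small R 1 ltr01.
have [n1 [n10 hln]] := ln_ge1 R.
exists (maxn n0 n1) => n; rewrite geq_max => /andP[hn hn1].
have npos : (0 < n)%N by exact: leq_trans hn1.
split => //; first exact: hln.
  by rewrite h// andbT divr_gt0 ?ltr0n// (lt_le_trans ltr01)// hln.
by apply: eps_ge_inv; exact: hln.
Qed.

End bandwidth_rates.

Section bad_event.
Context (R : realType) (K K1 L G : R -> R) (A M AG MG : R).
Context (kb : kernel_bounds K K1 L A M) (gb : kernel4_bounds G AG MG).
Context (C B W : R) (W0 : 0 <= W) (B0 : 0 <= B).

Definition bad_event (A0 : R) (P : probability (sampleSpace R) R) n :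
    set (sampleSpace R) :=
  bad_itv P A0 (B + W) (2 * W + 2) n
      (Num.truncn (2 * (B + W) * n%:R)).+4 (log_rate (1 / 13) n) `|`
  (bad_kernel P A0 n K (log_rate (1 / 5) n) `|`
  (bad_kernel P A0 n (derive1n 1 G) (log_rate (1 / 11) n) `|`
   bad_kernel P A0 n (derive1n 2 G) (log_rate (1 / 13) n))).

(** As eps <= 1, the inequalities between bandwidths compare exponents: 1/5 <= 3/13, 5/13 <= 2/5,
    1/13 <= 1/11 and 3/11 <= 5/13. *)
Lemma good_bandwidths A0 : exists n0 : nat, forall n f P X, (n0 <= n)%N ->
  smooth_densities C 6 f -> is_product_law f P -> ~ bad_event A0 P n X ->
  good K G C A0 B W (bandwidths n f P X).
Proof.
have [n0 hn0] := eps_evt R.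
exists n0 => n f P X nn sf fP nbad.
have [npos ln1 e01 einv] := hn0 n nn; have /andP[e0 e1] := e01.
have e00 := ltW e0.
have rate0 a : 0 < log_rate (a : R) n by rewrite log_rate_eps powR_gt0.
have r13 : log_rate (1 / 13 : R) n ^+ 13 = eps R n.
  by rewrite log_rate_exp// mulfVK// log_rate_eps powRr1.
have le (a b : R) : a <= b -> log_rate b n <= log_rate a n by exact: log_rate_le.
split => //=.
- rewrite rate0/=; apply: le_trans (le 0 _ _) _; first by rewrite divr_ge0.
  by rewrite log_rate_eps powRr0.
- by rewrite r13.
- by rewrite log_rate_exp//; apply: le; lra.
- by rewrite !log_rate_exp//; apply: le; lra.
- by rewrite rate0/=; apply: le; lra.
- by rewrite !log_rate_exp//; apply: le; lra.
- by move=> h; apply: nbad; left.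
- by move=> h; apply: nbad; right; left.
- by move=> h; apply: nbad; right; right; left.
- by move=> h; apply: nbad; right; right; right.
Qed.

Lemma bad_event_prob : exists2 A0, 0 <= A0 & exists2 c, 0 <= c & exists n0 : nat,
  forall n f P, smooth_densities C 6 f -> is_product_law f P -> (n0 <= n)%N ->
  measurable (bad_event A0 P n) /\ (P (bad_event A0 P n) <= (c / n%:R ^+ 2)%:E)%E.
Proof.
have A1 := kb_A kb; have Age0 : 0 <= A by exact: le_trans ler01 A1.
have AG1 := gb_A gb; have AGge0 : 0 <= AG by exact: le_trans ler01 AG1.
have M0 := kb_M kb; have MG0 := gb_M gb.
have AA : 0 <= A - - A by rewrite opprK addr_ge0.
have AGAG : 0 <= AG - - AG by rewrite opprK addr_ge0.
pose V1 := M ^+ 2 * `|C| * (A - - A); pose V2 := MG ^+ 2 * `|C| * (AG - - AG).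
pose V3 := `|C| * (2 * W + 2).
have V10 : 0 <= V1 by rewrite !mulr_ge0// sqr_ge0.
have V20 : 0 <= V2 by rewrite !mulr_ge0// sqr_ge0.
have V30 : 0 <= V3 by rewrite mulr_ge0// addr_ge0// mulr_ge0.
(* At least 2 V + 4 for each of the three variance constants, as [exp_bound] requires. *)
pose A0 := 2 * (V1 + V2 + V3) + 4.
have A00 : 0 <= A0 by rewrite addr_ge0// mulr_ge0// !addr_ge0.
pose q := 2 * (B + W) + 4.
have q0 : 0 <= q by rewrite addr_ge0// mulr_ge0// addr_ge0.
(* N^2 pairs of grid points with N <= q n give 2 q^2 / n^2, and each of the three kernel events
   gives at most 2 / n^2. *)
exists A0 => //; exists (2 * q ^+ 2 + 6); first by rewrite addr_ge0// mulr_ge0// sqr_ge0.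
have [n0 hn0] := eps_evt R.
(* Bounds eps / hh so that lam = sqrt(eps / hh) times the sup bound of any of the summands is at
   most 1/2, the condition in Bernstein's inequality. *)
pose d := (4 * (M + M + (MG + MG) + 2)) ^- 2.
have d0 : 0 < d.
  by rewrite invr_gt0 exprn_gt0// mulr_gt0// ltr_wpDl// !addr_ge0.
(* For hh = eps^a the quotient eps / hh is eps^(1 - a); among the three bandwidths it is largest for
   a = 1/5. *)
have a1 : 0 < 1 - 1 / 5 :> R by lra.
have [n1 hn1] := log_rate_small a1 d0.
exists (maxn n0 n1) => n f P sf fP; rewrite geq_max => /andP[nn0 nn1].
have [npos ln1 e01 einv] := hn0 n nn0; have /andP[e0 e1] := e01.
have nR : 0 < n%:R :> R by rewrite ltr0n.
have C0 : 0 <= C by apply: le_trans (normr_ge0 _) (sd_bound sf (leq0n 6) 0).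
have hsmall (a m : R) : log_rate (1 - a) n <= d -> 0 <= m -> m <= M + M + (MG + MG) + 2 ->
    Num.sqrt (eps R n / log_rate a n) * m <= 2^-1.
  move=> hd m0 mle.
  have ee : eps R n / log_rate a n = log_rate (1 - a) n.
    have h := @powRB R (eps R n) 1 a; rewrite [_ == 0]gt_eqF// implybT in h.
    by rewrite !log_rate_eps h// powRr1// ltW.
  rewrite ee; set v := M + M + (MG + MG) + 2 in mle.
  have v0 : 0 < v by rewrite ltr_wpDl// !addr_ge0.
  have s1 : Num.sqrt (log_rate (1 - a) n) <= (4 * v)^-1.
    apply: sqrt_le_sq; first by rewrite invr_ge0 mulr_ge0// ltW.
    by rewrite exprVn.
  apply: (@le_trans _ _ ((4 * v)^-1 * v)).
    by apply: ler_pM => //; exact: sqrtr_ge0.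
  by rewrite invfM -mulrA mulVf ?gt_eqF// mulr1 lef_pV2 ?posrE// ler_nat.
have rate0 a : 0 < log_rate (a : R) n by rewrite log_rate_eps powR_gt0.
have hd a : a <= 1 / 5 -> log_rate (1 - a) n <= d.
  move=> a5; apply: le_trans (hn1 n nn1); apply: log_rate_le => //; lra.
have VA1 : 2 * (M ^+ 2 * C * (A - - A)) + 4 <= A0.
  rewrite /A0 lerD2r ler_wpM2l//.
  apply: (@le_trans _ _ V1); last by rewrite -addrA lerDl addr_ge0.
  by rewrite /V1 (ger0_norm C0).
have VA2 : 2 * (MG ^+ 2 * C * (AG - - AG)) + 4 <= A0.
  rewrite /A0 lerD2r ler_wpM2l//.
  apply: (@le_trans _ _ V2); last by rewrite addrAC lerDr addr_ge0.
  by rewrite /V2 (ger0_norm C0).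
have VA3 : 2 * (C * (2 * W + 2)) + 4 <= A0.
  rewrite /A0 lerD2r ler_wpM2l//.
  apply: (@le_trans _ _ V3); last by rewrite lerDr addr_ge0.
  by rewrite /V3 (ger0_norm C0).
have M2 : 0 <= M + M by rewrite addr_ge0.
have MG2 : 0 <= MG + MG by rewrite addr_ge0.
have mk : M + M <= M + M + (MG + MG) + 2 by rewrite -addrA lerDl addr_ge0.
have mg : MG + MG <= M + M + (MG + MG) + 2 by rewrite addrAC lerDr addr_ge0.
have m2 : 2 <= M + M + (MG + MG) + 2 by rewrite lerDr addr_ge0.
have le135 : 1 / 13 <= 1 / 5 :> R by lra.
have le115 : 1 / 11 <= 1 / 5 :> R by lra.
have [k1 p1] := bad_kernel_prob sf fP (lip_continuous (kb_lip kb)) (kb_vanishes kb) (kb_bound kb)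
  Age0 (rate0 (1 / 5)) M0 ln1 npos (hsmall _ _ (hd _ (lexx _)) M2 mk) VA1.
have [k2 p2] := bad_kernel_prob sf fP (gb_continuous gb (isT : (1 <= 2)%N))
  (gb_vanishes gb (isT : (1 <= 2)%N)) (gb_bound gb (isT : (1 <= 2)%N))
  AGge0 (rate0 (1 / 11)) MG0 ln1 npos (hsmall _ _ (hd _ le115) MG2 mg) VA2.
have [k3 p3] := bad_kernel_prob sf fP (gb_continuous gb (isT : (2 <= 2)%N))
  (gb_vanishes gb (isT : (2 <= 2)%N)) (gb_bound gb (isT : (2 <= 2)%N))
  AGge0 (rate0 (1 / 13)) MG0 ln1 npos (hsmall _ _ (hd _ le135) MG2 mg) VA2.
have w0 : 0 <= 2 * W + 2 by rewrite addr_ge0// mulr_ge0.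
have t2 : 0 <= 2 :> R by [].
set N := (Num.truncn (2 * (B + W) * n%:R)).+4.
have [k4 p4] := bad_itv_prob sf fP (B + W) N (rate0 (1 / 13)) w0 ln1 npos
  (hsmall _ _ (hd _ le135) t2 m2) VA3.
have n1' : 1 <= n%:R :> R by rewrite ler1n.
have Nq : N%:R <= q * n%:R.
  have t0 : 0 <= 2 * (B + W) * n%:R by rewrite !mulr_ge0// addr_ge0.
  have h : (Num.truncn (2 * (B + W) * n%:R))%:R <= 2 * (B + W) * n%:R by rewrite truncn_le.
  have -> : N%:R = (Num.truncn (2 * (B + W) * n%:R))%:R + 4 :> R.
    by rewrite -natrD addnC.
  by rewrite /q [leRHS]mulrDl; apply: lerD => //; rewrite ler_peMr.
have p4' : N%:R * (N%:R * (2 / n%:R ^+ 4)) <= 2 * q ^+ 2 / n%:R ^+ 2.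
  have -> : 2 * q ^+ 2 / n%:R ^+ 2 = (q * n%:R) * ((q * n%:R) * (2 / n%:R ^+ 4)).
    by field; rewrite gt_eqF.
  have z0 : 0 <= 2 / n%:R ^+ 4 :> R by rewrite divr_ge0// exprn_ge0.
  by rewrite ler_pM// ?mulr_ge0// ler_wpM2r.
have pk : n%:R * (2 / n%:R ^+ 4) <= 2 / n%:R ^+ 2 :> R.
  have -> : n%:R * (2 / n%:R ^+ 4) = 2 / n%:R ^+ 2 * n%:R^-1 :> R by field; rewrite gt_eqF.
  rewrite ler_piMr ?divr_ge0 ?exprn_ge0//.
  by rewrite -[leRHS]invr1 lef_pV2 ?posrE.
have k23 := measurableU _ _ k2 k3; have k123 := measurableU _ _ k1 k23.
split; first exact: measurableU.
have -> : (2 * q ^+ 2 + 6) / n%:R ^+ 2 =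
  2 * q ^+ 2 / n%:R ^+ 2 + (2 / n%:R ^+ 2 + (2 / n%:R ^+ 2 + 2 / n%:R ^+ 2)) by ring.
have up (x : \bar R) (a b : R) : (x <= a%:E)%E -> a <= b -> (x <= b%:E)%E.
  by move=> xa ab; apply: le_trans xa _; rewrite lee_fin.
rewrite /bad_event !EFinD.
apply: le_trans (measureU2 _ k4 k123) _; apply: leeD; first exact: up p4 p4'.
apply: le_trans (measureU2 _ k1 k23) _; apply: leeD; first exact: up p1 pk.
apply: le_trans (measureU2 _ k2 k3) _; apply: leeD; first exact: up p2 pk.
exact: up p3 pk.
Qed.

End bad_event.

(** * Measurability *)

Section measurable_supremum.
Context (R : realType).

Definition rational_point (n : nat) : R :=
  if @unpickle rat n is Some q then ratr q else 0.

Lemma near_rational_point (t : R) (U : set R) : nbhs t U -> exists n, U (rational_point n).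
Proof.
move=> /nbhs_ballP[d /= d0 dU].
have td : t < t + d by rewrite ltrDl.
have [q] := rat_in_itvoo td; rewrite in_itv/= => /andP[q1 q2].
exists (pickle q); rewrite /rational_point pickleK; apply: dU.
by rewrite /ball/= distrC ger0_norm ?subr_ge0 ?(ltW q1)// ltrBlDl.
Qed.

(** Because the index set is open and [g x] continuous, rational points suffice. They can be kept
    fixed although the index set depends on [x]: outside it the value is replaced by 0, which is
    harmless for a non-negative [g]. *)
Lemma measurable_sup_open d (T : measurableType d) (U : T -> R -> bool) (g : T -> R -> R) :
  (forall x, open [set t | U x t]) -> (forall x, continuous (g x)) ->
  (forall x t, 0 <= g x t) -> (forall t, measurable_fun setT (fun x => U x t)) ->
  (forall t, measurable_fun setT (fun x => g x t)) ->
  measurable_fun setT (fun x => esup0 [set (g x t)%:E | t in [set t | U x t]]).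
Proof.
move=> oU cg g0 mU mg.
pose Y n x := (if U x (rational_point n) then g x (rational_point n) else 0)%:E.
have Y0 n x : (0 <= Y n x)%E by rewrite lee_fin; case: ifP.
have mY n : measurable_fun setT (Y n).
  apply/measurable_EFinP; apply: measurable_fun_ifT; [exact: mU|exact: mg|exact: measurable_cst].
have -> : (fun x => esup0 [set (g x t)%:E | t in [set t | U x t]]) =
    fun x => esup0 [set Y n x | n in setT].
  apply/funext => x; apply/eqP; rewrite eq_le; apply/andP; split.
    apply: esup0_le; first by apply: esup0_ge0 => _ [n _ <-].
    move=> _ [t /= Ut <-]; apply/lee_addgt0Pr => e e0.
    have near_g : \forall u \near t, `|g x t - g x u| < e.
      by have /cvgrPdist_lt := cg x t; apply.
    have near_U : \forall u \near t, U x u by exact: (open_nbhs_nbhs (conj (oU x) Ut)).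
    have [n [/ltW gn Un]] := near_rational_point (filterI near_g near_U).
    apply: (@le_trans _ _ (Y n x + e%:E)%E); last first.
      by rewrite leeD2r//; apply: esup0_ub; exists n.
    rewrite /Y Un -EFinD lee_fin -lerBlDl.
    exact: le_trans (ler_norm _) gn.
  apply: esup0_le.
    by apply: esup0_ge0 => _ [t _ <-]; rewrite lee_fin.
  move=> _ [n _ <-]; rewrite /Y; case: ifPn => Un.
    by apply: esup0_ub; exists (rational_point n).
  by apply: esup0_ge0 => _ [t _ <-]; rewrite lee_fin.
exact: measurable_esup0.
Qed.

End measurable_supremum.

Section measurable_estimators.
Context (R : realType).

(** The inverse is continuous off 0, and the remaining point is a measurable set. *)
Lemma measurable_invr : measurable_fun setT (@GRing.inv R).
Proof.
have o : open [set x : R | x != 0].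
  rewrite (_ : [set x | _] = [set x | x < 0] `|` [set x | 0 < x]).
    by apply: openU; [exact: open_lt|exact: open_gt].
  apply/seteqP; split => x /=; first by rewrite neq_lt => /orP.
  by move=> h; rewrite neq_lt; apply/orP.
rewrite (_ : setT = [set 0] `|` [set x : R | x != 0]); last first.
  apply/seteqP; split => x //= _; have [->|xN0] := eqVneq x 0; [by left|by right].
apply/measurable_funU => //; first exact: open_measurable.
split; first exact: measurable_fun_set1.
apply: open_continuous_measurable_fun => // x; rewrite inE/=.
exact: inv_continuous.
Qed.

Context (n : nat).
Local Notation T := (n.-tuple R).
Implicit Types (xi g : T -> R).

Lemma measurable_tnth_fun (i : 'I_n) : measurable_fun setT (fun X : T => tnth X i).
Proof. exact: measurable_tnth. Qed.

Lemma measurable_inv_fun g : measurable_fun setT g -> measurable_fun setT (fun X => (g X)^-1).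
Proof. by move=> mg; exact: (measurableT_comp measurable_invr mg). Qed.

Lemma measurable_kernel_sum (Q : R -> R) m h xi : measurable_fun setT Q ->
  measurable_fun setT xi -> measurable_fun setT (fun X : T => kernel_sum Q m h X (xi X)).
Proof.
move=> mQ mxi; apply: measurable_funM => //.
apply: measurable_sum => i; apply: (measurableT_comp mQ).
apply: measurable_funM => //; apply: measurable_funB => //; exact: measurable_tnth_fun.
Qed.

Context (K G p : R -> R) (c : R).
Context (cK : continuous K) (cG1 : continuous (derive1n 1 G)) (cG2 : continuous (derive1n 2 G)).
Context (cp : continuous p).

Lemma measurable_alpha_hat h1 xi : measurable_fun setT xi ->
  measurable_fun setT (fun X : T => alpha_hat K c p h1 X (xi X)).
Proof.
move=> mxi; rewrite /alpha_hat /alpha; apply: measurable_funM => //.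
apply: (measurableT_comp (continuous_measurable (@sqrt_continuous R))).
apply: (measurableT_comp (continuous_measurable cp)).
by apply: measurable_funM => //; apply: measurable_kernel_sum => //; exact: continuous_measurable.
Qed.

Lemma measurable_gamma_hat h1 h2 h3 h4 xi : measurable_fun setT xi ->
  measurable_fun setT (fun X : T => gamma_hat K G c p h1 h2 h3 h4 X (xi X)).
Proof.
move=> mxi; have ma := measurable_alpha_hat h1 mxi.
have mf : measurable_fun setT (fun X : T => fhat K h1 X (xi X)).
  by apply: measurable_kernel_sum => //; exact: continuous_measurable.
have m1 : measurable_fun setT (fun X : T => fG1 G h3 X (xi X)).
  by apply: measurable_kernel_sum => //; exact: continuous_measurable.
have m2 : measurable_fun setT (fun X : T => fG2 G h4 X (xi X)).
  by apply: measurable_kernel_sum => //; exact: continuous_measurable.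
apply: measurable_funM => //; apply: measurable_inv_fun.
apply: measurable_funD => //; apply: measurable_funM => //.
apply: measurable_funM.
  apply: measurable_funM => //; apply: measurable_funB; first exact: measurable_funM.
  by apply: measurable_funM => //; exact: measurable_funX.
by apply: measurable_inv_fun; apply: measurable_funM => //; exact: measurable_funX.
Qed.

Lemma measurable_fhat_var h1 h2 h3 h4 t :
  measurable_fun setT (fun X : T => fhat_var K G c p h1 h2 h3 h4 X t).
Proof.
have mg i := measurable_gamma_hat h1 h2 h3 h4 (measurable_tnth_fun i).
apply: measurable_funM => //; apply: measurable_sum => i; apply: measurable_funM => //.
apply: (measurableT_comp (continuous_measurable cK)); apply: measurable_funM => //.
apply: measurable_funM => //; apply: measurable_funB => //; exact: measurable_tnth_fun.
Qed.

Lemma continuous_sum_fun (I : Type) (r : seq I) (F : I -> R -> R) :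
  (forall i, continuous (F i)) -> continuous (fun t => \sum_(i <- r) F i t).
Proof.
move=> cF; elim: r => [|i r ih].
  by under eq_fun do rewrite big_nil; exact: continuous_cst.
by under eq_fun do rewrite big_cons; exact: continuousD_fun.
Qed.

Lemma continuous_kernel_sum (Q : R -> R) m h (X : T) : continuous Q ->
  continuous (kernel_sum Q m h X).
Proof.
move=> cQ; apply: continuousM_fun; first exact: continuous_cst.
apply: continuous_sum_fun => i; apply: continuous_compose => //.
by apply: continuousM_fun; cont.
Qed.

Lemma continuous_fhat_var h1 h2 h3 h4 (X : T) :
  continuous (fhat_var K G c p h1 h2 h3 h4 X).
Proof.
apply: continuousM_fun; first exact: continuous_cst.
apply: continuous_sum_fun => i; apply: continuousM_fun; last exact: continuous_cst.
apply: continuous_compose => //; apply: continuousM_fun; last exact: continuous_cst.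
by apply: continuousM_fun; cont.
Qed.

Context (f : R -> R) (cf : continuous f) (t0 r : R) (h1 h2 h3 h4 : R).

Lemma open_gt_fun (g : R -> R) (a : R) : continuous g -> open [set t | a < g t].
Proof. by move=> cg; apply: (@open_comp _ _ g [set y | a < y]) => [x _|]; [exact: cg|exact: open_gt]. Qed.

Lemma open_centered (a : R) : open [set t : R | `|t| < a].
Proof.
by apply: (@open_comp _ _ (@Num.norm _ R) [set y | y < a]) => [x _|]; [exact: norm_continuous|exact: open_lt].
Qed.

Lemma open_and (a b : R -> bool) : open [set t | a t] -> open [set t | b t] ->
  open [set t | a t && b t].
Proof.
move=> oa ob; rewrite (_ : [set t | _] = [set t | a t] `&` [set t | b t]); first exact: openI.
by apply/seteqP; split => t /andP.
Qed.

Lemma open_bool (b : bool) : open [set t : R | b].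
Proof.
case: b.
  by have -> : [set t : R | true] = setT; [apply/seteqP; split|exact: openT].
by have -> : [set t : R | false] = set0; [apply/seteqP; split|exact: open0].
Qed.

Let err (X : T) t : R := `|fhat_var K G c p h1 h2 h3 h4 X t - f t|.

Let cerr X : continuous (err X).
Proof.
have cn : continuous (fun y : R => `|y|) by exact: norm_continuous.
apply: (@continuous_compose R (fun y => `|y|)) cn _.
by apply: continuousB_fun => //; exact: continuous_fhat_var.
Qed.

Let merr t : measurable_fun setT (fun X => err X t).
Proof.
apply: (measurableT_comp (@normr_measurable R setT)).
by apply: measurable_funB => //; exact: measurable_fhat_var.
Qed.

Lemma measurable_region_sup : measurable_fun setT (fun X : T =>
  esup0 [set (`|fhat_var K G c p h1 h2 h3 h4 X t - f t|)%:E | t in region t0 c r f]).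
Proof.
pose U (X : T) t := (r < f t) && ((t0 * c ^+ 2 < r) && (`|t| < r^-1)).
have -> : region t0 c r f = [set t | U (point : T) t].
  by apply/seteqP; split => t; [move=> [a b d]; apply/and3P|move=> /and3P[a b d]].
apply: (@measurable_sup_open R _ _ U err) => //.
  move=> X; apply: open_and; first exact: open_gt_fun.
  by apply: open_and; [exact: open_bool|exact: open_centered].
by move=> X t; exact: normr_ge0.
Qed.

Lemma measurable_region_hat_sup : measurable_fun setT (fun X : T =>
  esup0 [set (`|fhat_var K G c p h1 h2 h3 h4 X t - f t|)%:E | t in region_hat K t0 c r h1 X]).
Proof.
pose U (X : T) t := (2 * r < fhat K h1 X t) && ((t0 * c ^+ 2 < 2 * r) && (`|t| < r^-1)).
have e X : region_hat K t0 c r h1 X = [set t | U X t].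
  by apply/seteqP; split => t; [move=> [a b d]; apply/and3P|move=> /and3P[a b d]].
under eq_fun do rewrite e.
apply: (@measurable_sup_open R _ _ U err) => //.
  move=> X; apply: open_and.
    by apply: open_gt_fun; exact: continuous_kernel_sum.
  by apply: open_and; [exact: open_bool|exact: open_centered].
  by move=> X t; exact: normr_ge0.
move=> t; apply: measurable_and => //; apply: measurable_fun_ltr => //.
by apply: measurable_kernel_sum => //; exact: continuous_measurable.
Qed.

End measurable_estimators.

(** * From the deterministic bound to the uniform rates *)

Section uniform_rate.
Context (R : realType) (Pr : (R -> R) -> probability (sampleSpace R) R).
Context (hPr : forall f, is_density f -> is_product_law f (Pr f)).
Context (K K1 L G : R -> R) (A M AG MG : R).
Context (kb : kernel_bounds K K1 L A M) (gb : kernel4_bounds G AG MG).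
Context (C B c t0 r0 : R) (p : R -> R) (c0 : 0 < c) (t01 : 1 <= t0) (B0 : 0 <= B).
Context (pmono : {homo p : x y / x <= y}) (p1 : forall x, 1 <= p x).
Context (pid : forall x, t0 <= x -> p x = x).
Context (r0t0 : t0 * c ^+ 2 < r0).

Let Age0 : 0 <= A. Proof. exact: le_trans ler01 (kb_A kb). Qed.

(** Common to both regions: it remains to show, for a good configuration, that a bound [D] at all
    points with |t| <= B and f(t) >= r0 carries over to the supremum in question. *)
Lemma uniform_Oas_of_good (Z : forall n, (R -> R) -> n.-tuple R -> \bar R) :
  (forall n f, smooth_densities C 6 f -> measurable_fun setT (Z n f)) ->
  (forall A0 W, 0 <= A0 -> A <= W -> exists2 h0, 0 < h0 &
    forall n f X (D : R), smooth_densities C 6 f ->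
    good K G C A0 B W (bandwidths n f (Pr f) X) -> log_rate (1 / 13 : R) n <= h0 -> 0 <= D ->
    (forall t, `|t| <= B -> r0 <= f t ->
      `|fhat_var K G c p (log_rate (1 / 5 : R) n) (log_rate (1 / 13 : R) n) (log_rate (1 / 11 : R) n)
         (log_rate (1 / 13 : R) n) (sample n X) t - f t| <= D) ->
    (`|Z n f (sample n X)| <= D%:E)%E) ->
  uniform_Oas Pr (smooth_densities C 6) Z (log_rate (6 / 13 : R)).
Proof.
move=> mZ hZ.
have [W AW det] := deterministic_error kb gb C B c0 t01 pmono p1 pid r0t0.
have W0 : 0 <= W by exact: le_trans AW.
have [A0 A00 [cc cc0 [n0 bad]]] := bad_event_prob kb gb C W0 B0.
have [h0 [D [h00 D0 herr]]] := det A0 A00.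
have [h1 h10 hz] := hZ A0 W A00 AW.
have [n1 hgood] := good_bandwidths K G C B W A0.
have hm : 0 < Num.min h0 h1 by rewrite lt_min h00.
have a13 : 0 < 1 / 13 :> R by rewrite divr_gt0.
have [n2 hsmall] := log_rate_small a13 hm.
have [n3 heps] := eps_evt R.
pose m := maxn (maxn n0 n1) (maxn n2 n3).
(* [bad_event] is known to be measurable for large n only, hence the empty set before [m]. *)
apply: (@uniform_Oas_intro R Pr _ Z _ (fun f n => if (m <= n)%N then bad_event K G B W A0 (Pr f) n else set0)
  cc D m) => //.
- move=> f n sf; case: ifPn => // mn; have n0n : (n0 <= n)%N.
    by move: mn; rewrite !geq_max => /andP[/andP[]].
  by have [] := bad n f (Pr f) sf (hPr (sd_density sf)) n0n.
- move=> f n sf mn; rewrite mn; have n0n : (n0 <= n)%N.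
    by move: mn; rewrite !geq_max => /andP[/andP[]].
  by have [] := bad n f (Pr f) sf (hPr (sd_density sf)) n0n.
- by move=> n; exact: powR_ge0.
move=> f n X sf mn; rewrite mn => nbad.
move: mn; rewrite !geq_max => /andP[/andP[mn0 mn1] /andP[mn2 mn3]].
have gs := hgood n f (Pr f) X mn1 sf (hPr (sd_density sf)) nbad.
have := hsmall n mn2; rewrite le_min => /andP[hs0 hs1].
have [_ _ /andP[e0 _] _] := heps n mn3.
have e6 : log_rate (1 / 13 : R) n ^+ 6 = log_rate (6 / 13 : R) n.
  by rewrite log_rate_exp ?(ltW e0)//; congr (log_rate _ n); ring.
apply: (hz n f X _ sf gs hs1); first by rewrite mulr_ge0// powR_ge0.
move=> t tB ft; rewrite -e6.
exact: (herr (bandwidths n f (Pr f) X) t gs hs0 tB ft).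
Qed.

End uniform_rate.

Theorem theorem2 (R : realType)
    (Pr : (R -> R) -> probability (sampleSpace R) R)
    (hPr : forall f, is_density f -> is_product_law f (Pr f))
    (K Phi : R -> R) (T : R) (hK : is_K_kernel K Phi T)
    (G : R -> R) (TG : R) (hG : is_G_kernel G TG)
    (c t0 : R) (hc : 0 < c) (ht0 : 1 <= t0)
    (p : R -> R) (hp : is_clipping t0 p) :
  let h1 := log_rate (1 / 5 : R) in
  let h2 := log_rate (1 / 13 : R) in
  let h3 := log_rate (1 / 11 : R) in
  let h4 := log_rate (1 / 13 : R) in
  let err n (X : n.-tuple R) (f : R -> R) (t : R) : \bar R :=
    (`|fhat_var K G c p (h1 n) (h2 n) (h3 n) (h4 n) X t - f t|)%:E in
  forall (r C : R), 0 < r ->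
    uniform_Oas Pr (smooth_densities C 6)
      (fun n f X => esup0 [set err n X f t | t in region t0 c r f])
      (log_rate (6 / 13 : R)) /\
    uniform_Oas Pr (smooth_densities C 6)
      (fun n f X => esup0 [set err n X f t | t in region_hat K t0 c r (h1 n) X])
      (log_rate (6 / 13 : R)).
Proof.
move=> h1 h2 h3 h4 err r C r0.
have [K1 [L [A [M kb]]]] := kernel_boundsP hK.
have [AG [MG gb]] := kernel4_boundsP hG.
have [pmono p1 pid dp _] := hp.
have cp : continuous p.
  by have := is_derive_continuous (is_derive_derive1n dp (isT : (0 < 7)%N)); rewrite derive1n0.
have cK := lip_continuous (kb_lip kb).
have cG1 := gb_continuous gb (isT : (1 <= 2)%N).
have cG2 := gb_continuous gb (isT : (2 <= 2)%N).
have B0 : 0 <= r^-1 by rewrite invr_ge0 ltW.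
have pos n (X : n.-tuple R) f (U : set R) :
    (0 <= esup0 [set err n X f t | t in U])%E.
  by apply: esup0_ge0 => _ [t _ <-]; rewrite lee_fin.
have m1 n f : smooth_densities C 6 f ->
    measurable_fun setT (fun X : n.-tuple R => esup0 [set err n X f t | t in region t0 c r f]).
  by move=> sf; apply: measurable_region_sup => //; exact: (sd_continuous sf).
have m2 n f : smooth_densities C 6 f ->
    measurable_fun setT (fun X : n.-tuple R =>
      esup0 [set err n X f t | t in region_hat K t0 c r (h1 n) X]).
  by move=> sf; apply: measurable_region_hat_sup => //; exact: (sd_continuous sf).
split.
  (* If r <= t0 c^2 the region is empty, and [r'] is just an admissible level above t0 c^2. *)
  pose r' := Num.max r (t0 * c ^+ 2 + 1).
  have r't0 : t0 * c ^+ 2 < r' by rewrite lt_max ltrDl ltr01 orbT.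
  have [lt|ge] := ltP (t0 * c ^+ 2) r.
    apply: (uniform_Oas_of_good hPr kb gb hc ht0 B0 pmono p1 pid lt m1) => A0 W A00 AW.
    exists 1 => // n f X D sf gs _ D0 hD; rewrite gee0_abs//.
    apply: esup0_le => // _ [t [rf _ tB] <-]; rewrite lee_fin.
    by apply: hD; exact: ltW.
  apply: (uniform_Oas_of_good hPr kb gb hc ht0 B0 pmono p1 pid r't0 m1) => A0 W A00 AW.
  exists 1 => // n f X D sf gs _ D0 _; rewrite gee0_abs//.
  by apply: esup0_le => // _ [t [_ lt _] <-]; have := lt_le_trans lt ge; rewrite ltxx.
have [lt|ge] := ltP (t0 * c ^+ 2) (2 * r); last first.
  have tc1 : t0 * c ^+ 2 < t0 * c ^+ 2 + 1 by rewrite ltrDl.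
  apply: (uniform_Oas_of_good hPr kb gb hc ht0 B0 pmono p1 pid tc1 m2) => A0 W A00 AW.
  exists 1 => // n f X D sf gs _ D0 _; rewrite gee0_abs//.
  by apply: esup0_le => // _ [t [_ lt _] <-]; have := lt_le_trans lt ge; rewrite ltxx.
(* Half-way between t0 c^2 and 2 r: once the pilot error is at most d = 2 r - r', f_hat > 2 r forces
   f >= r'. *)
pose r' := (2 * r + t0 * c ^+ 2) / 2.
have r't0 : t0 * c ^+ 2 < r' by rewrite /r'; lra.
apply: (uniform_Oas_of_good hPr kb gb hc ht0 B0 pmono p1 pid r't0 m2) => A0 W A00 AW.
have [D D0 pil] := pilot_error G kb C r^-1 A00 AW.
pose d := (2 * r - t0 * c ^+ 2) / 2.
have d0 : 0 < d by rewrite /d; lra.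
have D1 : 0 < D + 1 by rewrite ltr_pwDr.
exists (d / (D + 1)); first by rewrite divr_gt0.
move=> n f X D' sf gs hs D'0 hD; rewrite gee0_abs//.
apply: esup0_le => // _ [t [rf _ tB] <-]; rewrite lee_fin.
apply: hD; first exact: ltW.
have := pil _ t gs (ltW tB); rewrite /fhat_err /= => e1.
have h0 := good_h0 gs; have h01 := good_hX gs (isT : (1 <= 2)%N).
have e2 : D * log_rate (1 / 13 : R) n ^+ 2 <= d.
  apply: (@le_trans _ _ ((D + 1) * log_rate (1 / 13 : R) n)).
    by rewrite ler_pM// ?exprn_ge0 ?(ltW h0)// lerDl.
  by rewrite mulrC -ler_pdivlMr.
have := le_trans (ler_norm _) (le_trans e1 e2).
move: rf; rewrite /r' /d => rf e3.
by move: rf e3; rewrite /h1; set u := fhat _ _ _ _; set v := f t; lra.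
Qed.
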